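(* Let $(M^n,g)$ be a connected, time- and space-oriented Lorentzian spin manifold of dimension $n\geq 3$ with spinor bundle $\mathcal{S}$, and let $\phi\in\Gamma(\mathcal{S})$ be a non-trivial conformal Killing spinor with $\mathrm{zero}(\phi)\neq\varnothing$ and Dirac current $V_\phi$. 1. If $V_\phi$ is null on $M\setminus\mathrm{zero}(\phi)$, then $\mathrm{sing}(\phi)=\mathrm{zero}(\phi)$ is a countable union of isolated images of smooth maximal null geodesics. 2. If $V_\phi$ is timelike at some point of $M$, then $\mathrm{zero}(\phi)$ is a countable union of isolated points. The singular set $\mathrm{sing}(\phi)$ contains all geodesic null cones $L_p$ with origin $p\in\mathrm{zero}(\phi)$. In some neighbourhood $U_p\subset M$ of any $p\in\mathrm{zero}(\phi)$, the singular set equals the null cone, i.e. $\mathrm{sing}(\phi)\cap U_p=U_p\cap L_p$.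
   Context: Conventions. Lorentzian metrics have signature $(1,n-1)$, i.e. $(-,+,\dots,+)$; manifolds have a countable basis. $(M,g)$ carries a fixed spin structure for the group $\mathrm{Spin}_o(1,n-1)$; $\mathcal{S}$ is the associated complex spinor bundle, with $\mathrm{Spin}_o(1,n-1)$-invariant indefinite Hermitian product $\langle\cdot,\cdot\rangle_{\mathcal{S}}$, spinor derivative $\nabla^{\mathcal{S}}$ (lift of the Levi-Civita connection), and Clifford multiplication with $X\cdot X\cdot\phi=-g(X,X)\phi$. The Dirac operator is $\mathcal{D}\phi=\sum_i\varepsilon_i e_i\cdot\nabla^{\mathcal{S}}_{e_i}\phi$ for a local orthonormal frame $(e_i)$, $\varepsilon_i=g(e_i,e_i)$. The Hermitian product is normalised (its sign) so that the Dirac current defined below is future-directed. A conformal Killing spinor (twistor spinor) is $\phi\in\Gamma(\mathcal{S})$ satisfying $\nabla^{\mathcal{S}}_X\phi+\frac1n X\cdot\mathcal{D}\phi=0$ for all $X\in TM$. $\mathrm{zero}(\phi)=\{p\in M:\phi(p)=0\}$. The Dirac current of $\phi$ is the vector field $V_\phi$ determined by $g(V_\phi,X)=-\langle X\cdot\phi,\phi\rangle_{\mathcal{S}}$ for all $X\in TM$; it is future-directed causal (null, $g(V_\phi,V_\phi)=0$, or timelike, $g(V_\phi,V_\phi)<0$) wherever $\phi\ne0$, and vanishes exactly on $\mathrm{zero}(\phi)$. The singular set: if $V_\phi$ is nowhere timelike on $M$, $\mathrm{sing}(\phi):=\mathrm{zero}(\phi)$; if $V_\phi$ is timelike in at least one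 point of $M$, $\mathrm{sing}(\phi):=\{p\in M: g(V_\phi,V_\phi)(p)=0\}$. A geodesic $\gamma_p:I=(a,b)\to M$, $a<0<b$, $\gamma_p(0)=p$, is maximal if $I$ is its maximal domain of definition. The geodesic null cone $L_p$ with origin $p\in M$ is the set of those points of $M$ which can be joined with $p$ by a smooth null geodesic (with $p\in L_p$). ''Isolated'' images of maximal null geodesics means: every point $p$ of the union has a neighbourhood $U_p$ in which the union coincides with the image, intersected with $U_p$, of a single maximal null geodesic through $p$. *)

(* Defs.v *)
From HB Require Import structures.
From mathcomp Require Import all_boot all_order all_algebra.
From mathcomp Require Export all_classical all_reals all_analysis.
From mathcomp Require Import complex.

Set Implicit Arguments.
Unset Strict Implicit.
Unset Printing Implicit Defensive.

Import Order.TTheory GRing.Theory Num.Theory.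
Import numFieldNormedType.Exports.

Local Open Scope classical_set_scope.
Local Open Scope ring_scope.
Local Open Scope complex_scope.

Section Smooth.
Context {R : realType} {V W : normedModType R}.

(* Only used for open A, where it is the usual notion: all iterated
   directional derivatives of order <= k exist and are continuous. *)
Fixpoint Ck (k : nat) (A : set V) (f : V -> W) : Prop :=
  (forall x, A x -> {for x, continuous f}) /\
  if k is k'.+1 then
    forall v, (forall x, A x -> derivable f x v) /\ Ck k' A (fun x => 'D_v f x)
  else True.

Definition smooth_on (A : set V) (f : V -> W) := forall k, Ck k A f.

End Smooth.

Section ComplexValued.
Context {R : realType} {V : normedModType R} {m l : nat}.
Implicit Type f : V -> 'M[R[i]]_(m, l).

Definition remx f (x : V) : 'M[R]_(m, l) := map_mx (@complex.Re R) (f x).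
Definition immx f (x : V) : 'M[R]_(m, l) := map_mx (@complex.Im R) (f x).

Definition csmooth_on (A : set V) f :=
  smooth_on A (remx f) /\ smooth_on A (immx f).

Definition cderive (v : V) f (x : V) : 'M[R[i]]_(m, l) :=
  map2_mx (@Complex R) ('D_v (remx f) x) ('D_v (immx f) x).

End ComplexValued.

(* A (not necessarily maximal) smooth atlas.  The chart of index i is defined
   on [dom i] and [param i] is its inverse; their values elsewhere are
   irrelevant. *)
Record smooth_manifold (R : realType) (n : nat) := SmoothManifold {
  point :> topologicalType;
  manifold_hausdorff : hausdorff_space point;
  manifold_second_countable : @second_countable point;
  chart_idx : Type;
  dom : chart_idx -> set point;
  chart : chart_idx -> point -> 'rV[R]_n;
  param : chart_idx -> 'rV[R]_n -> point;
  dom_open : forall i, open (dom i);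
  dom_cover : forall p, exists i, dom i p;
  codom_open : forall i, open (chart i @` dom i);
  chartK : forall i p, dom i p -> param i (chart i p) = p;
  chart_continuous : forall i p, dom i p -> {for p, continuous (chart i)};
  param_continuous : forall i x,
    (chart i @` dom i) x -> {for x, continuous (param i)};
  transition_smooth : forall i j,
    smooth_on (chart i @` (dom i `&` dom j)) (chart j \o param i)
}.

Section Manifold.
Context {R : realType} {n : nat} (M : smooth_manifold R n).

(* Tangent vectors are row vectors of components, so that components change by
   v_j = v_i *m chart_jac i j p. *)
Definition chart_jac (i j : chart_idx M) (p : M) : 'M[R]_n :=
  jacobian (chart j \o param i) (chart i p).

(* Tensorial objects are given by their components in every chart; the value
   at (i, p) is meaningful only when p is in [dom i]. *)
Record tangent_field := TangentField {
  tcomp :> chart_idx M -> M -> 'rV[R]_n;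
  tcomp_compat : forall i j p, dom i p -> dom j p ->
    tcomp j p = tcomp i p *m chart_jac i j p
}.

(* Signature (1, n-1): index 0 is the timelike direction. *)
Definition eps (k : 'I_n) : R := if (k == 0 :> nat)%N then -1 else 1.

Definition eta : 'M[R]_n := diag_mx (\row_k eps k).

(* Gram matrices of the coordinate fields: g(v, w) = v G w^T. *)
Record lorentz_metric := LorentzMetric {
  metric : chart_idx M -> M -> 'M[R]_n;
  metric_smooth : forall i,
    smooth_on (chart i @` dom i) (metric i \o param i);
  metric_compat : forall i j p, dom i p -> dom j p ->
    metric i p = chart_jac i j p *m metric j p *m (chart_jac i j p)^T;
  metric_sym : forall i p, dom i p -> (metric i p)^T = metric i p;
  metric_signature : forall i p, dom i p ->
    exists2 P : 'M[R]_n, P \in unitmx & P *m metric i p *m P^T = eta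
}.

(* SO_o(1, n-1), the identity component of O(1, n-1). *)
Definition SOo : set 'M[R]_n :=
  [set L | [/\ L *m eta *m L^T = eta, \det L = 1 &
              forall k : 'I_n, (k = 0 :> nat)%N -> 0 < L k k]].

(* A time- and space-orientation is a reduction of the bundle of orthonormal
   frames to SO_o(1, n-1), given by a covering family of smooth local sections.
   The rows of [frame b i p] are the components in the chart i of the frame
   vectors e_0, ..., e_(n-1); e_0 is timelike and future-directed. *)
Record orientation (g : lorentz_metric) := Orientation {
  frame_idx : Type;
  fdom : frame_idx -> set M;
  frame : frame_idx -> chart_idx M -> M -> 'M[R]_n;
  frame_trans : frame_idx -> frame_idx -> M -> 'M[R]_n;
  fdom_open : forall b, open (fdom b);
  fdom_cover : forall p, exists b, fdom b p;
  frame_smooth : forall b i,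
    smooth_on (chart i @` (dom i `&` fdom b)) (frame b i \o param i);
  frame_compat : forall b i j p, fdom b p -> dom i p -> dom j p ->
    frame b j p = frame b i p *m chart_jac i j p;
  frame_orthonormal : forall b i p, fdom b p -> dom i p ->
    frame b i p *m metric g i p *m (frame b i p)^T = eta;
  frame_transP : forall b c i p, fdom b p -> fdom c p -> dom i p ->
    frame c i p = frame_trans b c p *m frame b i p;
  frame_trans_SOo : forall b c p, fdom b p -> fdom c p ->
    SOo (frame_trans b c p)
}.

End Manifold.

Section LeviCivita.
Context {R : realType} {n : nat} {M : smooth_manifold R n}.
Variable g : lorentz_metric M.

Definition ip (i : chart_idx M) (p : M) (v w : 'rV[R]_n) : R :=
  (v *m metric g i p *m w^T) 0 0.

(* The derivative at p, in the direction v, of the components of g. *)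
Definition dmetric (i : chart_idx M) (p : M) (v : 'rV[R]_n) : 'M[R]_n :=
  'D_v (metric g i \o param i) (chart i p).

(* Christoffel map: Koszul's formula for coordinate vector fields,
   2 g(Gamma(u,v), d_k) = (D_u g)(v, d_k) + (D_v g)(u, d_k) - (D_k g)(u, v). *)
Definition christoffel (i : chart_idx M) (p : M) (u v : 'rV[R]_n) : 'rV[R]_n :=
  2^-1 *: (v *m dmetric i p u + u *m dmetric i p v
           - \row_k (u *m dmetric i p (delta_mx 0 k) *m v^T) 0 0)
  *m invmx (metric g i p).

(* Levi-Civita derivative at p, in the direction v, of a vector field with
   components Y in the chart i. *)
Definition nabla (i : chart_idx M) (p : M) (v : 'rV[R]_n)
    (Y : M -> 'rV[R]_n) : 'rV[R]_n :=
  'D_v (Y \o param i) (chart i p) + christoffel i p v (Y p).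

Definition oitv (a b : \bar R) : set R := [set t | (a < t%:E < b)%E].

Definition geodesic (a b : \bar R) (c : R -> M) :=
  (forall t, oitv a b t -> {for t, continuous c}) /\
  forall i : chart_idx M,
    let J := [set t | oitv a b t /\ dom i (c t)] in
    let x : R -> 'rV[R]_n := chart i \o c in
    smooth_on (J : set R^o) x /\
    forall t, J t -> derive1n 2 x t + christoffel i (c t) (derive1 x t) (derive1 x t) = 0.

(* The velocity of a null geodesic is a non-zero null vector: constant curves
   are excluded. *)
Definition null_geodesic (a b : \bar R) (c : R -> M) :=
  geodesic a b c /\
  forall (i : chart_idx M) t, oitv a b t -> dom i (c t) ->
    derive1 (chart i \o c) t != 0 /\
    ip i (c t) (derive1 (chart i \o c) t) (derive1 (chart i \o c) t) = 0.

Definition maximal_null_geodesic (a b : \bar R) (c : R -> M) :=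
  [/\ (a < 0 < b)%E, null_geodesic a b c &
      forall (a' b' : \bar R) (c' : R -> M), (a' <= a)%E -> (b <= b')%E ->
        geodesic a' b' c' -> (forall t, oitv a b t -> c' t = c t) ->
        a' = a /\ b' = b].

Definition null_cone (p : M) : set M :=
  [set q | q = p \/
    exists a b c, [/\ (a < 0 < b)%E, null_geodesic a b c, c 0 = p &
                      exists2 t, oitv a b t & c t = q]].

Definition null_at (V : tangent_field M) (p : M) :=
  forall i, dom i p -> ip i p (V i p) (V i p) = 0.

Definition timelike_at (V : tangent_field M) (p : M) :=
  forall i, dom i p -> ip i p (V i p) (V i p) < 0.

End LeviCivita.

(* The complex spinor module of dimension 2^[n/2] with its Clifford action and
   invariant Hermitian form.  Relations and dimension force the representation
   of the complex Clifford algebra to be irreducible. *)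
Notation spdim n := (2 ^ (n./2))%N.

Section CliffordAction.
Context {R : realType} {n : nat}.
Variable gam : 'I_n -> 'M[R[i]]_(spdim n).

Definition clifford_mul (x : 'rV[R]_n) : 'M[R[i]]_(spdim n) :=
  \sum_k (x 0 k)%:C *: gam k.

Definition eta_norm (x : 'rV[R]_n) : R := (x *m eta *m x^T) 0 0.

(* Spin_o(1, n-1): products of an even number of unit vectors, evenly many of
   which are timelike.  It may be taken inside GL of the spinor module because
   the even part of the real Clifford algebra acts faithfully there. *)
Definition spin_o : set 'M[R[i]]_(spdim n) :=
  [set s | exists2 vs : seq 'rV[R]_n,
     [/\ all (fun x => `|eta_norm x| == 1) vs, ~~ odd (size vs) &
         ~~ odd (count (fun x => eta_norm x < 0) vs)] &
     s = \big[mulmx/1%:M]_(x <- vs) clifford_mul x].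

End CliffordAction.

Definition adjmx {R : realType} {m l : nat} (A : 'M[R[i]]_(m, l)) :
  'M[R[i]]_(l, m) := map_mx Num.conj A^T.

(* [spform_pos] is the normalisation of the form: at e_0 the Dirac current
   satisfies g(V, e_0) = - <e_0 psi, psi>, and a causal vector is
   future-directed iff this is negative. *)
Record spinor_module (R : realType) (n : nat) := SpinorModule {
  gam : 'I_n -> 'M[R[i]]_(spdim n);
  gam_clifford : forall k l,
    gam k *m gam l + gam l *m gam k = (- 2 * eta k l)%:C%:M;
  spform : 'M[R[i]]_(spdim n);
  spform_herm : adjmx spform = spform;
  spform_inv : forall s, spin_o gam s -> adjmx s *m spform *m s = spform;
  spform_pos : forall (k : 'I_n), (k = 0 :> nat)%N ->
    forall psi : 'cV[R[i]]_(spdim n), psi != 0 ->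
      0 < (adjmx psi *m spform *m (gam k *m psi)) 0 0
}.

Definition spprod {R : realType} {n : nat} (D : spinor_module R n)
  (psi chi : 'cV[R[i]]_(spdim n)) : R[i] := (adjmx chi *m spform D *m psi) 0 0.

(* A spin structure, given over the cover carrying the frames by the transition
   functions q_c = q_b . lift b c of local sections q_b lying over the frames.
   [lift_covers] says that the double covering s |-> (x |-> s x s^-1) maps
   lift b c to the transition between the frames. *)
Record spin_structure (R : realType) (n : nat) (M : smooth_manifold R n)
    (g : lorentz_metric M) (o : orientation g) (D : spinor_module R n) :=
  SpinStructure {
  lift : frame_idx o -> frame_idx o -> M -> 'M[R[i]]_(spdim n);
  lift_spin : forall b c p, fdom b p -> fdom c p ->
    spin_o (gam D) (lift b c p);
  lift_smooth : forall b c i,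
    csmooth_on (chart i @` (dom i `&` (fdom b `&` fdom c)))
               (lift b c \o param i);
  lift_cocycle : forall b c d p, fdom b p -> fdom c p -> fdom d p ->
    lift b d p = lift b c p *m lift c d p;
  lift_covers : forall b c p k, fdom b p -> fdom c p ->
    lift b c p *m gam D k =
    clifford_mul (gam D) (row k (frame_trans b c p)) *m lift b c p
}.

(* Smooth sections of the spinor bundle associated with the spin structure,
   through their components psi_b in the local trivialisations q_b. *)
Record spinor_field (R : realType) (n : nat) (M : smooth_manifold R n)
    (g : lorentz_metric M) (o : orientation g) (D : spinor_module R n)
    (S : spin_structure o D) := SpinorField {
  scomp :> frame_idx o -> M -> 'cV[R[i]]_(spdim n);
  scomp_smooth : forall b i,
    csmooth_on (chart i @` (dom i `&` fdom b)) (scomp b \o param i);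
  scomp_compat : forall b c p, fdom b p -> fdom c p ->
    scomp b p = lift S b c p *m scomp c p
}.

Section Spinors.
Context {R : realType} {n : nat} {M : smooth_manifold R n}.
Context {g : lorentz_metric M} {o : orientation g} {D : spinor_module R n}.
Context {S : spin_structure o D}.
Variable phi : spinor_field S.

(* Clifford multiplication by the tangent vector with components v in the
   chart i, written in the trivialisation b. *)
Definition clif (b : frame_idx o) (i : chart_idx M) (p : M) (v : 'rV[R]_n) :
  'M[R[i]]_(spdim n) := clifford_mul (gam D) (v *m invmx (frame b i p)).

Definition connection_form (b : frame_idx o) (i : chart_idx M) (p : M)
    (v : 'rV[R]_n) (k l : 'I_n) : R :=
  ip g i p (nabla g i p v (fun q => row k (frame b i q)))
     (row l (frame b i p)).

(* Lift of the Levi-Civita connection; with X.X = - g(X,X) it reads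
   X(psi) + 1/2 sum_(k < l) eps_k eps_l g(nabla_X e_k, e_l) e_k.e_l.psi . *)
Definition nablaS (b : frame_idx o) (i : chart_idx M) (p : M) (v : 'rV[R]_n) :
    'cV[R[i]]_(spdim n) :=
  cderive v (phi b \o param i) (chart i p) +
  2^-1 *: \sum_(k < n) \sum_(l < n | (k < l)%N)
    (eps k * eps l * connection_form b i p v k l)%:C *:
      (gam D k *m gam D l *m phi b p).

Definition dirac (b : frame_idx o) (i : chart_idx M) (p : M) :
    'cV[R[i]]_(spdim n) :=
  \sum_k (eps k)%:C *: (gam D k *m nablaS b i p (row k (frame b i p))).

Definition conformal_killing :=
  forall b i p (v : 'rV[R]_n), fdom b p -> dom i p ->
    nablaS b i p v + n%:R^-1 *: (clif b i p v *m dirac b i p) = 0.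

Definition zero_set : set M := [set p | forall b, fdom b p -> phi b p = 0].

Definition is_dirac_current (V : tangent_field M) :=
  forall b i p (v : 'rV[R]_n), fdom b p -> dom i p ->
    (ip g i p (V i p) v)%:C = - spprod D (clif b i p v *m phi b p) (phi b p).

(* The singular set of phi, V being its Dirac current. *)
Definition sing_set (V : tangent_field M) : set M :=
  if `[< exists q, timelike_at g V q >] then [set p | null_at g V p]
  else zero_set.

End Spinors.

(* Main.v *)
(** Together with chi, which is - 1/n times the Dirac image of phi, a conformal
    Killing spinor phi solves a linear system: the derivatives of phi and chi
    along v are v.chi and P(v).phi, where P is a multiple of the Schouten tensor.
    If phi is non-trivial, chi does not vanish at a zero p of phi.  Along the
    geodesic gamma with initial velocity u at p, phi = t u.chi(p) + O(t^2), and
    the pair (phi, gamma'.chi) solves a linear system, so the zeros near p lie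
    on geodesics with u.chi(p) = 0, and phi vanishes all along those.
    If the current of chi(p) is timelike, u.chi(p) = 0 only for u = 0 and p is
    isolated; moreover phi = gamma'.z for non-null u, where z is t chi(p) to
    first order, whence g(V,V) = g(u,u)^2 g(V_z,V_z) < 0 off the null cone, while
    along a null geodesic from p the spinor gamma'.phi is parallel, hence zero,
    so that V is proportional to gamma'.
    If the current of chi(p) is null, the solutions u form a null line.  Moreover
    the tractor spinor (phi, chi) is then annihilated at p by a totally null
    2-plane; this property is parallel, so that V is null on all of M.  The two
    cases of the theorem are thus distinguished by the current of chi at a zero. *)
Require Import Defs.
From HB Require Import structures.
From mathcomp Require Import all_boot all_order all_algebra.
From mathcomp Require Import complex ring lra.

Set Implicit Arguments.
Unset Strict Implicit.
Unset Printing Implicit Defensive.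

Import Order.TTheory GRing.Theory Num.Theory.
Import numFieldNormedType.Exports.

Local Open Scope classical_set_scope.
Local Open Scope ring_scope.

(** * Directional derivatives *)

(** The expansion of phi along geodesics must be uniform in the direction u, also for u close to the
    kernel of u -> u.chi(p). It is, because the initial value b = u.chi(p) of gamma'.chi controls
    the whole solution of the linear system: phi differs from t b by at most a constant times t^2
    |b|, so one small time serves for all u. All points near p are reached at such a fixed time by a
    contraction argument, so only the local surjectivity of the exponential map enters. The local
    pair (phi, chi) is built from a chart and a frame, and chi has to be compared between patches.
    The covering property of the transition functions determines the derivative of a spin lift up to
    endomorphisms that commute with Clifford multiplication. The effect of such an endomorphism on
    chi is shown to vanish where the current of phi is null. This suffices: the annihilation of
    (phi, chi) by a totally null 2-plane forces that current to be null, and the simultaneous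
    vanishing of phi and chi is carried from patch to patch as the vanishing of phi on an open
    set. *)

Section DerivativeAlongDirection.
Context {R : realType}.

Lemma is_derive_cvgP (V W : normedModType R) (f : V -> W) (x v : V) (df : W) :
  is_derive x v f df <->
  (fun h : R => h^-1 *: (f (h *: v + x) - f x)) @ 0^' --> df.
Proof.
split=> [[dfx <-]|H]; first exact: dfx.
by apply: DeriveDef; [apply/cvg_ex; exists df|apply: cvg_lim].
Qed.

Lemma is_derive_line (V W : normedModType R) (f : V -> W) (x v : V) (s : R)
    (df : W) :
  is_derive (x + s *: v) v f df ->
  is_derive s (1 : R) (fun t : R => f (x + t *: v)) df.
Proof.
move=> /is_derive_cvgP H; apply/is_derive_cvgP.
have -> : (fun h : R => h^-1 *: (f (x + (h *: (1 : R) + s) *: v) - f (x + s *: v)))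
  = (fun h : R => h^-1 *: (f (h *: v + (x + s *: v)) - f (x + s *: v))).
  by apply/funext => h; rewrite [h *: 1]mulr1 scalerDl addrCA.
exact: H.
Qed.

Lemma is_derive_ext (V W : normedModType R) (f g : V -> W) (x v : V) (df : W) :
  (\near x, f x = g x) -> is_derive x v f df -> is_derive x v g df.
Proof. exact: near_eq_is_derive. Qed.

Lemma is_derive_mxP (V : normedModType R) p q (f : V -> 'M[R]_(p, q)) (x v : V)
    (df : 'M[R]_(p, q)) :
  is_derive x v f df <->
  forall i j, is_derive x v (fun y => f y i j) (df i j).
Proof.
split=> [[dfx <-] i j|H].
  by apply: DeriveDef; [exact: (derivable_mxP f x v).1|rewrite derive_mx// mxE].
have dfx : derivable f x v by apply/derivable_mxP => i j; case: (H i j).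
apply: DeriveDef => //; rewrite derive_mx//; apply/matrixP => i j; rewrite mxE.
exact: derive_val.
Qed.

Lemma is_derive_bigsum (V W : normedModType R) (I : Type) (r : seq I) (P : pred I)
    (f : I -> V -> W) (df : I -> W) (x v : V) :
  (forall i, is_derive x v (f i) (df i)) ->
  is_derive x v (fun y => \sum_(i <- r | P i) f i y) (\sum_(i <- r | P i) df i).
Proof.
move=> H; elim: r => [|i r IH].
  rewrite big_nil.
  rewrite [X in is_derive _ _ X _](_ : _ = cst 0); first exact: is_derive_cst.
  by apply/funext => y; rewrite big_nil.
rewrite big_cons.
case: ifPn => Pi; last first.
  rewrite [X in is_derive _ _ X _](_ : _ = (fun y => \sum_(i <- r | P i) f i y))//.
  by apply/funext => y; rewrite big_cons (negbTE Pi).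
rewrite [X in is_derive _ _ X _]
  (_ : _ = f i + (fun y => \sum_(i <- r | P i) f i y)); last first.
  by apply/funext => y; rewrite big_cons Pi.
exact: is_deriveD.
Qed.

Lemma is_derive_mulr (V : normedModType R) (f g : V -> R) (x v : V) (df dg : R) :
  is_derive x v f df -> is_derive x v g dg ->
  is_derive x v (fun y => f y * g y) (df * g x + f x * dg).
Proof.
move=> Hf Hg; apply: (is_derive_eq (is_deriveM Hf Hg)).
by rewrite addrC [g x *: _]mulrC.
Qed.

Lemma is_derive_mulmx (V : normedModType R) p q r (f : V -> 'M[R]_(p, q))
    (g : V -> 'M[R]_(q, r)) (x v : V) df dg :
  is_derive x v f df -> is_derive x v g dg ->
  is_derive x v (fun y => f y *m g y) (df *m g x + f x *m dg).
Proof.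
move=> /is_derive_mxP Hf /is_derive_mxP Hg; apply/is_derive_mxP => i j.
rewrite [X in is_derive _ _ X _]
  (_ : _ = (fun y => \sum_k f y i k * g y k j)); last first.
  by apply/funext => y; rewrite mxE.
rewrite !mxE -big_split/=; apply: is_derive_bigsum => k.
exact: is_derive_mulr.
Qed.

Lemma is_derive_scaler (V : normedModType R) p q (k : V -> R)
    (f : V -> 'M[R]_(p, q)) (x v : V) dk df :
  is_derive x v k dk -> is_derive x v f df ->
  is_derive x v (fun y => k y *: f y) (dk *: f x + k x *: df).
Proof.
move=> Hk /is_derive_mxP Hf; apply/is_derive_mxP => i j.
rewrite [X in is_derive _ _ X _](_ : _ = (fun y => k y * f y i j)); last first.
  by apply/funext => y; rewrite mxE.
rewrite !mxE; exact: is_derive_mulr.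
Qed.

Lemma linear_mx_sum p q a b (L : {linear 'M[R]_(p, q) -> 'M[R]_(a, b)})
    (A : 'M[R]_(p, q)) :
  L A = \sum_i \sum_j A i j *: L (delta_mx i j).
Proof.
rewrite {1}[A]matrix_sum_delta linear_sum; apply: eq_bigr => i _.
by rewrite linear_sum; apply: eq_bigr => j _; rewrite linearZ.
Qed.

Lemma is_derive_linmx (V : normedModType R) p q a b
    (L : {linear 'M[R]_(p, q) -> 'M[R]_(a, b)}) (f : V -> 'M[R]_(p, q))
    (x v : V) df :
  is_derive x v f df -> is_derive x v (fun y => L (f y)) (L df).
Proof.
move=> Hf.
rewrite [X in is_derive _ _ X _]
  (_ : _ = (fun y => \sum_i \sum_j f y i j *: L (delta_mx i j))); last first.
  by apply/funext => y; rewrite linear_mx_sum.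
rewrite (linear_mx_sum _ df); apply: is_derive_bigsum => i.
apply: is_derive_bigsum => j.
have := is_derive_scaler ((is_derive_mxP _ _ _ _).1 Hf i j)
  (is_derive_cst (L (delta_mx i j)) x v).
by rewrite scaler0 addr0.
Qed.

Lemma is_derive_continuous (u : R -> R) (t du : R) :
  is_derive t (1 : R) u du -> {for t, continuous u}.
Proof.
by move=> [d _]; apply: differentiable_continuous; apply/derivable1_diffP.
Qed.

Lemma is_derive_mx_continuous p q (u : R -> 'M[R]_(p, q)) (t : R) du :
  is_derive t (1 : R) u du -> {for t, continuous u}.
Proof.
by move=> [d _]; apply: differentiable_continuous; apply/derivable1_diffP.
Qed.

End DerivativeAlongDirection.

(** * Mean values and matrix norms *)

Section MeanValue.
Context {R : realType}.

(** The interval is described by distances to [a], so that [b] may lie on either side; the later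
    estimates run over times of both signs. *)
Lemma mean_value (f df : R -> R) (a b : R) :
  (forall t, `|t - a| <= `|b - a| -> is_derive t (1 : R) f (df t)) ->
  exists2 c, `|c - a| <= `|b - a| & f b - f a = (b - a) * df c.
Proof.
have case1 (u v : R) : u < v ->
  (forall t, u <= t <= v -> is_derive t (1 : R) f (df t)) ->
  exists2 c, u <= c <= v & f v - f u = df c * (v - u).
  move=> uv H.
  have [||c Hc E] := @MVT R f df u v uv.
  - by move=> t; rewrite in_itv/= => /andP[a1 a2]; apply: H; rewrite !ltW.
  - apply: continuous_in_subspaceT => t /set_mem/=; rewrite in_itv/= => Ht.
    exact: is_derive_continuous (H _ Ht).
  - by exists c => //; move: Hc; rewrite in_itv/= => /andP[a1 a2]; rewrite !ltW.
move=> H; case: (ltgtP a b) => ab.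
- have [t /andP[t1 t2]|c /andP[c1 c2] E] := @case1 a b ab.
    by apply: H; rewrite !ger0_norm; lra.
  by exists c; [rewrite !ger0_norm; lra|rewrite E mulrC].
- have [t /andP[t1 t2]|c /andP[c1 c2] E] := @case1 b a ab.
    by apply: H; rewrite !ler0_norm; lra.
  by exists c; [rewrite !ler0_norm; lra|rewrite -[LHS]opprB E; ring].
- by exists a; rewrite ?subrr ?normr0// ab !subrr mul0r.
Qed.

Lemma mx_norm_le p q (A : 'M[R]_(p, q)) (c : R) :
  0 <= c -> (`|A| <= c) <-> (forall i j, `|A i j| <= c).
Proof.
move=> c0; split=> [H i j|H].
  apply: le_trans H; rewrite {2}/Num.norm/= mx_normrE.
  exact: (le_bigmax _ (fun ij => `|A ij.1 ij.2|) (i, j)).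
rewrite /Num.norm/= mx_normrE; apply: bigmax_le => // -[i j] _; exact: H.
Qed.

Lemma mx_entry_le p q (A : 'M[R]_(p, q)) i j : `|A i j| <= `|A|.
Proof. by have /mx_norm_le := lexx `|A|; apply. Qed.

Lemma mulmx_norm_le p q r (A : 'M[R]_(p, q)) (B : 'M[R]_(q, r)) :
  `|A *m B| <= q%:R * `|A| * `|B|.
Proof.
apply/mx_norm_le; first by rewrite !mulr_ge0.
move=> i j; rewrite mxE; apply: le_trans (ler_norm_sum _ _ _) _.
apply: (@le_trans _ _ (\sum_(k < q) `|A| * `|B|)).
  by apply: ler_sum => k _; rewrite normrM ler_pM// mx_entry_le.
by rewrite sumr_const card_ord -[leLHS]mulr_natl mulrA.
Qed.

(** The norm is the maximum of the entries, so the scalar theorem applies to each entry with its own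
    intermediate point and without loss in the constant. *)
Lemma mean_value_ineq p q (u du : R -> 'M[R]_(p, q)) (C a b : R) :
  (forall t, `|t - a| <= `|b - a| -> is_derive t (1 : R) u (du t)) ->
  (forall t, `|t - a| <= `|b - a| -> `|du t| <= C) ->
  `|u b - u a| <= C * `|b - a|.
Proof.
move=> H HC.
have C0 : 0 <= C by apply: le_trans (HC a _); rewrite ?subrr ?normr0.
apply/mx_norm_le; first by rewrite mulr_ge0.
move=> i j; rewrite !mxE.
have [t Ht|c Hc ->] := @mean_value (fun t => u t i j) (fun t => du t i j) a b.
  exact: ((is_derive_mxP _ _ _ _).1 (H t Ht)).
by rewrite normrM mulrC ler_wpM2r//; apply: le_trans (HC _ Hc); apply: mx_entry_le.
Qed.

End MeanValue.

Section EtaForms.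
Context {R : realType} {V W : normedModType R}.

Lemma is_derive_addf (f g : V -> W) (x v : V) (df dg : W) :
  is_derive x v f df -> is_derive x v g dg ->
  is_derive x v (fun y => f y + g y) (df + dg).
Proof. exact: is_deriveD. Qed.

Lemma is_derive_subf (f g : V -> W) (x v : V) (df dg : W) :
  is_derive x v f df -> is_derive x v g dg ->
  is_derive x v (fun y => f y - g y) (df - dg).
Proof. exact: is_deriveB. Qed.

Lemma is_derive_scalef (a : R) (f : V -> W) (x v : V) (df : W) :
  is_derive x v f df -> is_derive x v (fun y => a *: f y) (a *: df).
Proof. exact: is_deriveZ. Qed.

Lemma is_derive_oppf (f : V -> W) (x v : V) (df : W) :
  is_derive x v f df -> is_derive x v (fun y => - f y) (- df).
Proof. exact: is_deriveN. Qed.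

End EtaForms.

(** * Strict differentiability and the chain rule *)

Section StrictDifferentiability.
Context {R : realType} {n p q : nat}.
Implicit Types (A : set 'rV[R]_n) (f : 'rV[R]_n -> 'M[R]_(p, q)).

Definition dirder f (x h : 'rV[R]_n) : 'M[R]_(p, q) :=
  \sum_k h 0 k *: 'D_(delta_mx 0 k) f x.

Lemma dirder_sub f x h h' : dirder f x (h - h') = dirder f x h - dirder f x h'.
Proof.
rewrite /dirder -sumrB; apply: eq_bigr => k _.
by rewrite !mxE scalerBl.
Qed.

Lemma dirderZ f x (a : R) h : dirder f x (a *: h) = a *: dirder f x h.
Proof.
by rewrite /dirder scaler_sumr; apply: eq_bigr => k _; rewrite !mxE scalerA.
Qed.

Lemma dirder_bound f x : exists2 K : R, 0 <= K & forall h, `|dirder f x h| <= K * `|h|.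
Proof.
exists (\sum_k `|'D_(delta_mx 0 k) f x|); first by rewrite sumr_ge0.
move=> h; apply: le_trans (ler_norm_sum _ _ _) _; rewrite mulr_suml.
by apply: ler_sum => k _; rewrite normrZ mulrC ler_wpM2l// mx_entry_le.
Qed.

(** The passage from [h'] to [h] changes one coordinate at a time, through the points [P m]. On each
    step the mean value inequality applies to [f] minus its linear part at [x], whose derivative is
    small by continuity of the partial derivatives. *)
Lemma C1_strict A f x : open A -> Ck 1 A f -> A x -> forall e : R, 0 < e ->
  exists2 d : R, 0 < d & forall h h', `|h| < d -> `|h'| < d ->
    `|f (x + h) - f (x + h') - dirder f x (h - h')| <= e * `|h - h'|.
Proof.
move=> oA [_ fA] Ax e e0.
(* Each of the [n] coordinate steps costs [e'] times the norm of [h - h']. *)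
set e' := e / n.+1%:R.
have e'0 : 0 < e' by rewrite divr_gt0.
have : \forall y \near x, A y /\ forall k : 'I_n,
    `|'D_(delta_mx 0 k) f y - 'D_(delta_mx 0 k) f x| <= e'.
  apply: filterI; first exact: open_nbhs_nbhs.
  apply: (@filter_forall _ _ (fun (k : 'I_n) y =>
    `|'D_(delta_mx 0 k) f y - 'D_(delta_mx 0 k) f x| <= e') (nbhs x)) => k.
  have [_ [/(_ x Ax) c _]] := fA (delta_mx 0 k).
  by move/cvgrPdistC_le : c => /(_ e' e'0).
(* An intermediate point differs from [x] in one coordinate by at most three terms, each below
   d/4. *)
move=> /nbhs_ballP[d /= d0 Hd]; exists (d / 4); first by rewrite divr_gt0.
move=> h h' hd hd'.
pose P m : 'rV[R]_n := \row_k (if (k < m)%N then h 0 k else h' 0 k).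
have main m : (m <= n)%N ->
  `|f (x + P m) - f (x + h') - \sum_(k < n | (k < m)%N)
      (h - h') 0 k *: 'D_(delta_mx 0 k) f x| <= m%:R * e' * `|h - h'|.
  elim: m => [_|m IH mn].
    rewrite big_pred0// subr0 mul0r mul0r.
    by rewrite (_ : P 0%N = h') ?subrr ?normr0//; apply/rowP => k; rewrite mxE.
  pose j := Ordinal mn.
  have PS : P m.+1 = P m + (h - h') 0 j *: delta_mx 0 j.
    apply/rowP => k; rewrite !mxE ltnS leq_eqVlt.
    have [->|kj] := eqVneq k j; first by rewrite /= eqxx ltnn/= mulr1 addrC subrK.
    by rewrite (_ : (k == m :> nat)%N = false) ?mulr0 ?addr0//; apply/negbTE.
  have step : `|f (x + P m.+1) - f (x + P m)
      - (h - h') 0 j *: 'D_(delta_mx 0 j) f x| <= e' * `|h - h'|.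
    set dj := delta_mx 0 j in PS *.
    pose u (t : R) := f ((x + P m) + t *: dj) - t *: 'D_dj f x.
    have near_x (t : R) : `|t - 0| <= `|(h - h') 0 j - 0| ->
        ball x d ((x + P m) + t *: dj).
      rewrite !subr0 => ht; rewrite -ball_normE/=.
      rewrite -addrA opprD addNKr normrN.
      apply: (@le_lt_trans _ _ (3 * (d / 4))); last by lra.
      apply/mx_norm_le; first lra.
      move=> i k; rewrite !mxE ord1.
      have h1 := mx_entry_le h 0 k; have h2 := mx_entry_le h' 0 k.
      have [->|kj] := eqVneq k j.
        rewrite ltnn eqxx mulr1; apply: le_trans (ler_normD _ _) _.
        have h3 := mx_entry_le h 0 j; have h4 := mx_entry_le h' 0 j.
        have : `|(h - h') 0 j| <= `|h 0 j| + `|h' 0 j|.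
          by rewrite !mxE; apply: ler_normB.
        lra.
      rewrite mulr0 addr0; case: ifP => _; lra.
    have du (t : R) : `|t - 0| <= `|(h - h') 0 j - 0| ->
        is_derive t (1 : R) u ('D_dj f ((x + P m) + t *: dj) - 'D_dj f x).
      move=> ht; have [Ay _] := Hd _ (near_x t ht).
      apply: is_derive_subf.
        by apply: is_derive_line; apply: DeriveDef => //; apply: (fA dj).1.
      have := is_derive_scaler (is_derive_id t (1 : R))
        (is_derive_cst ('D_dj f x) t (1 : R)).
      by rewrite scaler0 addr0 scale1r.
    have := mean_value_ineq du (fun t ht => (Hd _ (near_x t ht)).2 j).
    rewrite /u -[x + P m + _ *: _]addrA -PS scale0r scale0r addr0 !subr0 => H.
    rewrite addrAC.
    apply: le_trans H _; rewrite ler_wpM2l ?(ltW e'0)//; exact: mx_entry_le.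
  rewrite (bigD1 j)//=.
  rewrite [X in _ - (_ + X)](_ : _ = \sum_(k < n | (k < m)%N)
      (h - h') 0 k *: 'D_(delta_mx 0 k) f x); last first.
    apply: eq_bigl => k; rewrite ltnS leq_eqVlt.
    have [->|kj] := eqVneq k j; first by rewrite andbF ltnn.
    by rewrite andbT (_ : (k == m :> nat)%N = false)//; apply/negbTE.
  have := IH (ltnW mn).
  set X := \sum_(k < n | _) _; set Y := _ *: 'D_ _ f x in step *.
  move=> IH'.
  have -> : f (x + P m.+1) - f (x + h') - (Y + X) =
    (f (x + P m.+1) - f (x + P m) - Y) + (f (x + P m) - f (x + h') - X).
    by rewrite addrACA -opprD; congr (_ - _); rewrite addrA subrK.
  apply: le_trans (ler_normD _ _) _; rewrite -natr1 !mulrDl mul1r addrC.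
  exact: lerD.
have := main n (leqnn n).
rewrite (_ : P n = h); last by apply/rowP => k; rewrite mxE ltn_ord.
rewrite [X in _ - _ - X](_ : _ = dirder f x (h - h')); last first.
  by apply: eq_bigl => k; rewrite ltn_ord.
move=> H; apply: le_trans H _; rewrite ler_wpM2r// /e' mulrC -mulrA.
by rewrite ler_piMr ?(ltW e0)// mulrC ler_pdivrMr// mul1r ler_nat.
Qed.

Lemma C1_lipschitz A f x : open A -> Ck 1 A f -> A x ->
  exists2 d : R, 0 < d & exists2 K : R, 0 <= K & forall y y',
    `|y - x| < d -> `|y' - x| < d -> `|f y - f y'| <= K * `|y - y'|.
Proof.
move=> oA fA Ax; have [d d0 H] := C1_strict oA fA Ax ltr01.
have [K K0 HK] := dirder_bound f x.
exists d => //; exists (1 + K); first lra.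
move=> y y' hy hy'; have := H _ _ hy hy'.
rewrite !(addrC x) !subrK opprB addrA subrK mul1r => H1.
rewrite mulrDl mul1r -(subrK (dirder f x (y - y')) (f y - f y')).
by apply: le_trans (ler_normD _ _) _; apply: lerD.
Qed.

(** A chain rule in which [c] is differentiable in the single direction [v] only. Its difference
    quotient [Q] stays bounded near 0, so strict differentiability of [f] between the points c(y)
    and c(y) + h Q is enough. *)
Lemma is_derive_dirder (V : normedModType R) A f (c : V -> 'rV[R]_n) (y v : V) dc :
  open A -> Ck 1 A f -> A (c y) -> is_derive y v c dc ->
  is_derive y v (fun z => f (c z)) (dirder f (c y) dc).
Proof.
move=> oA fA Ay /is_derive_cvgP Hc; apply/is_derive_cvgP.
pose Q (h : R) := h^-1 *: (c (h *: v + y) - c y).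
have cE (h : R) : h != 0 -> c (h *: v + y) = c y + h *: Q h.
  by move=> h0; rewrite /Q scalerA mulfV// scale1r subrKC.
have [K K0 HK] := dirder_bound f (c y).
apply/cvgrPdist_le => e e0.
pose D := `|dc| + 1.
have D0 : 0 < D by rewrite ltr_wpDl.
have e1 : 0 < e / 2 / D by rewrite !divr_gt0.
have [d d0 Hd] := C1_strict oA fA Ay e1.
have e2 : 0 < Num.min 1 (e / 2 / (K + 1)).
  by rewrite lt_min ltr01/= !divr_gt0// ltr_wpDl.
have dD : 0 < d / D by rewrite divr_gt0.
near=> h.
have h0 : h != 0 by near: h; exact: nbhs_dnbhs_neq.
have hQ : `|dc - Q h| <= Num.min 1 (e / 2 / (K + 1)).
  by near: h; move/cvgrPdist_le : Hc => /(_ _ e2).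
have hd : `|h| < d / D.
  near: h; apply: dnbhs0_lt; exact: dD.
move: hQ; rewrite le_min => /andP[hQ1 hQ2].
have QD : `|Q h| <= D.
  rewrite -(subrKC dc (Q h)); apply: le_trans (ler_normD _ _) _.
  by rewrite lerD// distrC.
have := Hd (h *: Q h) 0; rewrite normr0 subr0 addr0 dirderZ => /(_ _ d0) H.
have {}H : `|f (c y + h *: Q h) - f (c y) - h *: dirder f (c y) (Q h)| <=
    e / 2 / D * `|h *: Q h|.
  apply: H; rewrite normrZ; apply: (@le_lt_trans _ _ (`|h| * D)).
    by rewrite ler_wpM2l.
  by rewrite -ltr_pdivlMr.
rewrite cE//.
have -> : dirder f (c y) dc - h^-1 *: (f (c y + h *: Q h) - f (c y)) =
  dirder f (c y) (dc - Q h) -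
  h^-1 *: (f (c y + h *: Q h) - f (c y) - h *: dirder f (c y) (Q h)).
  rewrite dirder_sub [h^-1 *: (_ - h *: _)]scalerBr [h^-1 *: (h *: _)]scalerA.
  rewrite mulVf// scale1r.
  by rewrite opprB addrA subrK.
apply: le_trans (ler_normB _ _) _.
rewrite [e]splitr; apply: lerD.
  apply: le_trans (HK _) _.
  apply: (@le_trans _ _ (K * (e / 2 / (K + 1)))); first by rewrite ler_wpM2l.
  rewrite mulrCA ler_piMr//; first by rewrite divr_ge0// ltW.
  by rewrite ler_pdivrMr ?mul1r ?lerDl// ltr_wpDl.
rewrite normrZ normfV ler_pdivrMl ?normr_gt0//.
apply: le_trans H _; rewrite normrZ mulrCA ler_wpM2l//.
rewrite mulrAC ler_pdivrMr// ler_wpM2l//; first by rewrite divr_ge0// ltW.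
Unshelve. all: by end_near. Qed.

Lemma derive_dirder A f x v : open A -> Ck 1 A f -> A x ->
  'D_v f x = dirder f x v.
Proof.
move=> oA fA Ax; have := is_derive_dirder oA fA Ax (is_derive_id x v).
by case.
Qed.

Lemma is_derive_comp (V : normedModType R) A f (c : V -> 'rV[R]_n) (y v : V) dc :
  open A -> Ck 1 A f -> A (c y) -> is_derive y v c dc ->
  is_derive y v (fun z => f (c z)) ('D_dc f (c y)).
Proof.
move=> oA fA Ay H; rewrite (derive_dirder dc oA fA Ay).
exact: (is_derive_dirder oA fA Ay H).
Qed.

Lemma C1_continuous_comp (V : normedModType R) A f (c : V -> 'rV[R]_n) (y : V) :
  Ck 0 A f -> A (c y) -> {for y, continuous c} ->
  {for y, continuous (fun z => f (c z))}.
Proof. by move=> [fA _] Ay H; apply: continuous_comp => //; exact: fA. Qed.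

End StrictDifferentiability.

(** * Functions of class C^k *)

Section CkClosure.
Context {R : realType} {V : normedModType R}.
Implicit Types A B : set V.

Lemma Ck_ext (W : normedModType R) k A (f g : V -> W) :
  open A -> (forall x, A x -> f x = g x) -> Ck k A f -> Ck k A g.
Proof.
move=> oA; elim: k f g => [|k IH] f g fg.
  move=> [H _]; split=> // x Ax; rewrite /prop_for /continuous_at -fg//.
  apply: cvg_trans (H x Ax); apply: near_eq_cvg.
  by apply: filterS (open_nbhs_nbhs (conj oA Ax)) => y Ay; rewrite fg.
have nfg x : A x -> \near x, f x = g x.
  by move=> Ax; apply: filterS (open_nbhs_nbhs (conj oA Ax)) => y Ay; rewrite fg.
move=> [H fA]; split=> [x Ax|v].
  rewrite /prop_for /continuous_at -fg//.
  apply: cvg_trans (H x Ax); apply: near_eq_cvg.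
  by apply: filterS (nfg x Ax) => y ->.
have [d c] := fA v; split=> [x Ax|].
  have [] := is_derive_ext (nfg x Ax) (DeriveDef (d x Ax) erefl). by [].
apply: IH c => x Ax.
by have [_ ->] := is_derive_ext (nfg x Ax) (DeriveDef (d x Ax) erefl).
Qed.

Lemma Ck_sub (W : normedModType R) k A B (f : V -> W) :
  B `<=` A -> Ck k A f -> Ck k B f.
Proof.
move=> BA; elim: k f => [|k IH] f [cf df]; split=> //; try by move=> x /BA; exact: cf.
by move=> v; have [d c] := df v; split=> [x /BA|]; [exact: d|exact: IH].
Qed.

Lemma Ck_local (W : normedModType R) k A (f : V -> W) :
  (forall x, A x -> exists B, [/\ open B, B x & Ck k B f]) -> Ck k A f.
Proof.
elim: k f => [|k IH] f H; split=> //.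
- by move=> x /H[B [_ Bx [cf _]]]; exact: cf.
- by move=> x /H[B [_ Bx [cf _]]]; exact: cf.
- move=> v; split=> [x /H[B [_ Bx [_ df]]]|]; first exact: (df v).1.
  by apply: IH => x /H[B [oB Bx [_ df]]]; exists B; split => //; exact: (df v).2.
Qed.

Lemma Ck_S (W : normedModType R) k A (f : V -> W) : Ck k.+1 A f -> Ck k A f.
Proof.
elim: k f => [|k IH] f [cf df]; split=> //.
by move=> v; have [d c] := df v; split=> //; exact: IH.
Qed.

Lemma Ck_le (W : normedModType R) k l A (f : V -> W) :
  (k <= l)%N -> Ck l A f -> Ck k A f.
Proof.
move=> /subnK <-; elim: (l - k)%N => [//|m IH] H.
by apply: IH; apply: Ck_S; rewrite addSn in H.
Qed.

Lemma Ck_is_derive (W : normedModType R) k A (f : V -> W) x v :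
  Ck k.+1 A f -> A x -> is_derive x v f ('D_v f x).
Proof. by move=> [_ /(_ v)[d _]] Ax; apply: DeriveDef => //; exact: d. Qed.

Lemma Ck_derive (W : normedModType R) k A (f : V -> W) v :
  Ck k.+1 A f -> Ck k A (fun x => 'D_v f x).
Proof. by move=> [_ /(_ v)[]]. Qed.

Lemma Ck_cst (W : normedModType R) k A (a : W) : open A -> Ck k A (fun=> a).
Proof.
move=> oA; elim: k a => [|k IH] a; split=> //; try by move=> x _; exact: cst_continuous.
move=> v; split=> [x _|]; first exact: derivable_cst.
by apply: Ck_ext (IH 0) => // x _; rewrite (@derive_cst _ _ _ a).
Qed.

Lemma Ck_add (W : normedModType R) k A (f g : V -> W) :
  open A -> Ck k A f -> Ck k A g -> Ck k A (fun x => f x + g x).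
Proof.
move=> oA; elim: k f g => [|k IH] f g [cf df] [cg dg].
  by split=> // x Ax; apply: continuousD; [exact: cf|exact: cg].
split=> [x Ax|v]; first by apply: continuousD; [exact: cf|exact: cg].
have D x : A x -> is_derive x v (fun x => f x + g x) ('D_v f x + 'D_v g x).
  by move=> Ax; apply: is_derive_addf; apply: (@Ck_is_derive _ k A).
split=> [x Ax|]; first by case: (D x Ax).
apply: (Ck_ext oA _ (IH _ _ (df v).2 (dg v).2)) => x Ax.
by have [_ ->] := D x Ax.
Qed.

Lemma Ck_mulr k A (f g : V -> R) :
  open A -> Ck k A f -> Ck k A g -> Ck k A (fun x => f x * g x).
Proof.
move=> oA; elim: k f g => [|k IH] f g fA gA.
  by split=> // x Ax; apply: continuousM; [exact: fA.1|exact: gA.1].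
split=> [x Ax|v]; first by apply: continuousM; [exact: fA.1|exact: gA.1].
have D x : A x -> is_derive x v (fun x => f x * g x) ('D_v f x * g x + f x * 'D_v g x).
  by move=> Ax; apply: is_derive_mulr; apply: (@Ck_is_derive _ k A).
split=> [x Ax|]; first by case: (D x Ax).
have [f' g'] := (Ck_derive v fA, Ck_derive v gA).
have E := Ck_add oA (IH _ _ f' (Ck_S gA)) (IH _ _ (Ck_S fA) g').
by apply: (Ck_ext oA _ E) => x Ax; have [_ ->] := D x Ax.
Qed.

Lemma Ck_sum (W : normedModType R) (I : Type) (r : seq I) (P : pred I)
    k A (f : I -> V -> W) :
  open A -> (forall i, Ck k A (f i)) -> Ck k A (fun x => \sum_(i <- r | P i) f i x).
Proof.
move=> oA H; elim: r => [|i r IH].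
  by apply: (Ck_ext oA _ (Ck_cst k 0 oA)) => x _; rewrite big_nil.
case Pi: (P i).
  by apply: (Ck_ext oA _ (Ck_add oA (H i) IH)) => x _; rewrite big_cons Pi.
by apply: (Ck_ext oA _ IH) => x _; rewrite big_cons Pi.
Qed.

Lemma continuous_mxP p q (f : V -> 'M[R]_(p, q)) x :
  {for x, continuous f} <-> forall i j, {for x, continuous (fun y => f y i j)}.
Proof.
split=> [H i j|H].
  apply: (@continuous_comp _ _ _ f (fun M : 'M[R]_(p, q) => M i j)) => //.
  exact: coord_continuous.
apply/cvgrPdist_le => e e0.
have : \forall y \near x, forall i j, `|f x i j - f y i j| <= e.
  apply: (@filter_forall _ _ (fun i y => forall j, `|f x i j - f y i j| <= e) (nbhs x)) => i.
  apply: (@filter_forall _ _ (fun j y => `|f x i j - f y i j| <= e) (nbhs x)) => j.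
  by move/cvgrPdist_le : (H i j) => /(_ e e0).
apply: filterS => y Hy; apply/mx_norm_le; first exact: ltW.
by move=> i j; rewrite !mxE; exact: Hy.
Qed.

Lemma Ck_mxP k p q A (f : V -> 'M[R]_(p, q)) : open A ->
  Ck k A f <-> forall i j, Ck k A (fun y => f y i j).
Proof.
move=> oA; elim: k f => [|k IH] f; split=> [fA i j|H].
- by split=> // x Ax; apply: (continuous_mxP f x).1 => //; exact: fA.1.
- by split=> // x Ax; apply/continuous_mxP => i j; exact: (H i j).1.
- split=> [x Ax|v]; first by apply: (continuous_mxP f x).1 => //; exact: fA.1.
  have D x : A x -> is_derive x v (fun y => f y i j) ('D_v f x i j).
    by move=> Ax; apply: (is_derive_mxP _ _ _ _).1; exact: Ck_is_derive fA Ax.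
  split=> [x Ax|]; first by case: (D x Ax).
  have /IH/(_ i j) := Ck_derive v fA; apply: Ck_ext => // x Ax.
  by have [_ ->] := D x Ax.
- split=> [x Ax|v]; first by apply/continuous_mxP => i j; exact: (H i j).1.
  have D x : A x -> is_derive x v f (\matrix_(i, j) 'D_v (fun y => f y i j) x).
    move=> Ax; apply/is_derive_mxP => i j; rewrite mxE; exact: Ck_is_derive (H i j) Ax.
  split=> [x Ax|]; first by case: (D x Ax).
  apply/IH => i j; apply: (Ck_ext oA _ (Ck_derive v (H i j))) => x Ax.
  by have [_ ->] := D x Ax; rewrite mxE.
Qed.

Lemma Ck_mulmx k p q r A (f : V -> 'M[R]_(p, q)) (g : V -> 'M[R]_(q, r)) :
  open A -> Ck k A f -> Ck k A g -> Ck k A (fun x => f x *m g x).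
Proof.
move=> oA /(Ck_mxP _ _ oA) fA /(Ck_mxP _ _ oA) gA; apply/Ck_mxP => // i j.
apply: (@Ck_ext _ _ _ (fun x => \sum_l f x i l * g x l j)) => // [x _|].
  by rewrite mxE.
by apply: Ck_sum => // l; exact: Ck_mulr.
Qed.

Lemma Ck_scaler k p q A (h : V -> R) (f : V -> 'M[R]_(p, q)) :
  open A -> Ck k A h -> Ck k A f -> Ck k A (fun x => h x *: f x).
Proof.
move=> oA hA /(Ck_mxP _ _ oA) fA; apply/Ck_mxP => // i j.
apply: (@Ck_ext _ _ _ (fun x => h x * f x i j)) => // [x _|].
  by rewrite mxE.
exact: Ck_mulr.
Qed.

Lemma Ck_linmx k p q a b A (L : {linear 'M[R]_(p, q) -> 'M[R]_(a, b)})
    (f : V -> 'M[R]_(p, q)) :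
  open A -> Ck k A f -> Ck k A (fun x => L (f x)).
Proof.
move=> oA fA; apply: (@Ck_ext _ _ _
    (fun y => \sum_i \sum_j f y i j *: L (delta_mx i j))) => // [x _|].
  by rewrite [RHS]linear_mx_sum.
apply: Ck_sum => // i; apply: Ck_sum => // j; apply: Ck_scaler => //.
  exact: (Ck_mxP k f oA).1.
exact: Ck_cst.
Qed.

End CkClosure.

(** The derivative of the composite is a sum of products of entries of the derivative of [c] with
    composites of partial derivatives of [f], to which the induction hypothesis applies. *)
Lemma Ck_comp (R : realType) (V : normedModType R) k n p q (A : set V) (B : set 'rV[R]_n) (c : V -> 'rV[R]_n)
    (f : 'rV[R]_n -> 'M[R]_(p, q)) :
  open A -> open B -> (forall x, A x -> B (c x)) -> Ck k A c -> Ck k B f ->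
  Ck k A (fun x => f (c x)).
Proof.
move=> oA oB AB; elim: k f => [|k IH] f cA fB.
  by split=> // x Ax; apply: C1_continuous_comp fB _ _; [exact: AB|exact: cA.1].
split=> [x Ax|v].
  exact: (C1_continuous_comp (Ck_le (leq0n k.+1) fB) (AB _ Ax) (cA.1 _ Ax)).
have fB1 : Ck 1 B f := Ck_le (ltn0Sn k) fB.
have D x : A x -> is_derive x v (fun x => f (c x)) (dirder f (c x) ('D_v c x)).
  move=> Ax; apply: is_derive_dirder oB fB1 (AB _ Ax) _.
  exact: Ck_is_derive cA Ax.
split=> [x Ax|]; first by case: (D x Ax).
apply: (Ck_ext (f := fun x => dirder f (c x) ('D_v c x)) oA).
  by move=> x Ax; have [_ ->] := D x Ax.
apply: Ck_sum => // i; apply: Ck_scaler => //.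
  exact: (Ck_mxP _ _ oA).1 (Ck_derive v cA) _ _.
exact: (IH (fun y => 'D_(delta_mx 0 i) f y) (Ck_S cA) (Ck_derive _ fB)).
Qed.

(** * Symmetry of second derivatives *)

Section Schwarz.
Context {R : realType}.

(** The second difference of [f] over a small parallelogram is evaluated by the mean value theorem
    in both orders. This makes the two mixed derivatives equal at two points near [x], and
    continuity moves both points to [x]. *)
Lemma derive_swap_real (V : normedModType R) (A : set V) (f : V -> R) x v w :
  open A -> Ck 2 A f -> A x -> 'D_v ('D_w f) x = 'D_w ('D_v f) x.
Proof.
move=> oA fA Ax.
apply/eqP; rewrite -subr_eq0 -normr_eq0; apply/eqP/le_anti; rewrite normr_ge0 andbT.
apply/ler_addgt0Pl => e e0; rewrite addr0.
have c1 := (Ck_derive v (Ck_derive w fA)).1 x Ax.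
have c2 := (Ck_derive w (Ck_derive v fA)).1 x Ax.
have e4 : 0 < e / 2 by rewrite divr_gt0.
have : \forall y \near x, [/\ A y, `|'D_v ('D_w f) x - 'D_v ('D_w f) y| <= e / 2
    & `|'D_w ('D_v f) x - 'D_w ('D_v f) y| <= e / 2].
  move/cvgrPdist_le : c1 => /(_ _ e4) n1; move/cvgrPdist_le : c2 => /(_ _ e4) n2.
  apply: filterS2 (open_nbhs_nbhs (conj oA Ax)) (filterI n1 n2) => y Ay [a b].
  exact: And3 Ay a b.
move=> /nbhs_ballP[d /= d0 Hd].
(* This side length keeps the parallelogram inside the ball of radius [d]; the summand 1 guards
   against v = w = 0. *)
pose h := d / 2 / (`|v| + `|w| + 1).
have vw : 0 < `|v| + `|w| + 1 by rewrite ltr_wpDl// addr_ge0.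
have h0 : 0 < h by rewrite !divr_gt0.
have inb (s t : R) : `|s| <= h -> `|t| <= h -> ball x d ((x + s *: v) + t *: w).
  move=> hs ht; rewrite -ball_normE/= -addrA opprD addNKr normrN.
  apply: le_lt_trans (ler_normD _ _) _; rewrite !normrZ.
  apply: (@le_lt_trans _ _ (h * `|v| + h * `|w|)).
    by rewrite lerD// ler_wpM2r.
  rewrite -mulrDr /h mulrAC ltr_pdivrMr//.
  rewrite (@le_lt_trans _ _ (d / 2 * (`|v| + `|w| + 1)))//.
    by rewrite ler_pM2l ?divr_gt0// lerDl.
  by rewrite ltr_pM2r// ltr_pdivrMr// mulr_natr mulr2n ltrDl.
have inA (s t : R) : `|s| <= h -> `|t| <= h -> A ((x + s *: v) + t *: w).
  by move=> hs ht; case: (Hd _ (inb s t hs ht)).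
have hh : `|h| <= h by rewrite ger0_norm// ltW.
have h00 : `|0 : R| <= h by rewrite normr0 ltW.
have dv g y u : Ck 1 A g -> A y -> is_derive y u g ('D_u g y).
  by move=> gA Ay; exact: Ck_is_derive gA Ay.
have h_le (t : R) : `|t - 0| <= `|h - 0| -> `|t| <= h.
  by rewrite !subr0 (gtr0_norm h0).
have f1 := Ck_S fA.
have [s1 /h_le hs1] : exists2 c, `|c - 0| <= `|h - 0| &
    (f ((x + h *: v) + h *: w) - f ((x + h *: v) + 0 *: w)) -
    (f ((x + 0 *: v) + h *: w) - f ((x + 0 *: v) + 0 *: w)) =
    (h - 0) * ('D_v f ((x + c *: v) + h *: w) - 'D_v f ((x + c *: v) + 0 *: w)).
  apply: (@mean_value _ (fun s => f ((x + s *: v) + h *: w) - f ((x + s *: v) + 0 *: w))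
    (fun c => 'D_v f ((x + c *: v) + h *: w) - 'D_v f ((x + c *: v) + 0 *: w))).
  move=> s /h_le hs; apply: is_derive_subf.
    have E z : z *: v + (x + h *: w) = (x + z *: v) + h *: w.
      by rewrite [z *: v + _]addrC addrAC.
    under eq_fun do rewrite -addrA [_ *: v + _]addrC addrA.
    rewrite addrAC; apply: is_derive_line; apply: dv => //.
    by rewrite addrAC; apply: inA.
  under eq_fun do rewrite -addrA [_ *: v + _]addrC addrA.
  rewrite addrAC; apply: is_derive_line; apply: dv => //.
  by rewrite addrAC; apply: inA.
have [t1 /h_le ht1 ->] : exists2 c, `|c - 0| <= `|h - 0| &
    'D_v f ((x + s1 *: v) + h *: w) - 'D_v f ((x + s1 *: v) + 0 *: w) =
    (h - 0) * 'D_w ('D_v f) ((x + s1 *: v) + c *: w).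
  apply: (@mean_value _ (fun t => 'D_v f ((x + s1 *: v) + t *: w))).
  move=> t /h_le ht; exact: (@is_derive_line _ _ _ (fun y => 'D_v f y) _ _ _ _
    (Ck_is_derive w (Ck_derive v fA) (inA s1 t hs1 ht))).
have [t2 /h_le ht2] : exists2 c, `|c - 0| <= `|h - 0| &
    (f ((x + h *: v) + h *: w) - f ((x + 0 *: v) + h *: w)) -
    (f ((x + h *: v) + 0 *: w) - f ((x + 0 *: v) + 0 *: w)) =
    (h - 0) * ('D_w f ((x + h *: v) + c *: w) - 'D_w f ((x + 0 *: v) + c *: w)).
  apply: (@mean_value _ (fun t => f ((x + h *: v) + t *: w) - f ((x + 0 *: v) + t *: w))
    (fun c => 'D_w f ((x + h *: v) + c *: w) - 'D_w f ((x + 0 *: v) + c *: w))).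
  move=> t /h_le ht; apply: is_derive_subf; apply: is_derive_line; apply: dv => //.
    exact: inA.
  exact: inA.
have [s2 /h_le hs2 ->] : exists2 c, `|c - 0| <= `|h - 0| &
    'D_w f ((x + h *: v) + t2 *: w) - 'D_w f ((x + 0 *: v) + t2 *: w) =
    (h - 0) * 'D_v ('D_w f) ((x + c *: v) + t2 *: w).
  apply: (@mean_value _ (fun s => 'D_w f ((x + s *: v) + t2 *: w))
    (fun c => 'D_v ('D_w f) ((x + c *: v) + t2 *: w))).
  move=> s /h_le hs; under eq_fun do rewrite -addrA [_ *: v + _]addrC addrA.
  rewrite addrAC; apply: (@is_derive_line _ _ _ (fun y => 'D_w f y)).
  apply: (Ck_is_derive v (Ck_derive w fA)).
  by rewrite addrAC; exact: inA.
rewrite !subr0 => E1 E2.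
have E : 'D_w ('D_v f) ((x + s1 *: v) + t1 *: w) =
         'D_v ('D_w f) ((x + s2 *: v) + t2 *: w).
  apply: (mulfI (lt0r_neq0 h0)); apply: (mulfI (lt0r_neq0 h0)).
  have exch (a b c d' : R) : a - b - (c - d') = a - c - (b - d') by ring.
  exact: (etrans (esym E2) (etrans (exch _ _ _ _) E1)).
have tri (a b z : R) : `|a - z| <= e / 2 -> `|b - z| <= e / 2 -> `|a - b| <= e.
  move=> H1 H2; rewrite (_ : a - b = (a - z) - (b - z)); last by ring.
  by rewrite (splitr e); apply: le_trans (ler_normB _ _) _; exact: lerD.
have [_ H1 _] := Hd _ (inb _ _ hs2 ht2); have [_ _ H2] := Hd _ (inb _ _ hs1 ht1).
exact: (tri _ _ _ H1
  (eq_ind _ (fun r => `|'D_w ('D_v f) x - r| <= e / 2) H2 _ E)).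
Qed.

Lemma derive_swap (V : normedModType R) p q (A : set V) (f : V -> 'M[R]_(p, q)) x v w :
  open A -> Ck 2 A f -> A x -> 'D_v ('D_w f) x = 'D_w ('D_v f) x.
Proof.
move=> oA fA Ax.
have D2 (u u' : V) i j : 'D_u ('D_u' f) x i j = 'D_u ('D_u' (fun y => f y i j)) x.
  have fij := (Ck_mxP 2 f oA).1 fA i j.
  have /is_derive_mxP/(_ i j) := Ck_is_derive u (Ck_derive u' fA) Ax.
  have nE : \near x, 'D_u' f x i j = 'D_u' (fun y => f y i j) x.
    apply: filterS (open_nbhs_nbhs (conj oA Ax)) => y Ay.
    by have /is_derive_mxP/(_ i j)[_ ->] := Ck_is_derive u' (Ck_S fA) Ay.
  by move=> /(is_derive_ext nE)[_ ->].
apply/matrixP => i j; apply: etrans (D2 v w i j) _.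
apply: etrans (esym (D2 w v i j)).
exact: (derive_swap_real v w oA ((Ck_mxP 2 f oA).1 fA i j) Ax).
Qed.

End Schwarz.

(** * Ordinary differential equations *)

(** Locally on [A] the property holds everywhere or nowhere, so the part of [A] where it holds is
    relatively open and closed. *)
Lemma connected_locally_constant (T : topologicalType) (A : set T) (P : T -> Prop) :
  connected A ->
  (forall x, A x -> exists2 U, nbhs x U &
     forall y z, A y -> A z -> U y -> U z -> P y -> P z) ->
  forall x y, A x -> A y -> P x -> P y.
Proof.
move=> cA H x y Ax Ay Px.
suff E : A `&` [set z | P z] = A by have [] : (A `&` [set z | P z]) y by rewrite E.
apply: cA.
- by exists x.
- exists (interior [set w | A w -> P w]); first exact: open_interior.
  rewrite predeqE => z; split=> [[Az Pz]|[Az /nbhs_singleton/(_ Az)]//].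
  split=> //; have [U Uz HU] := H z Az; have U0 := nbhs_singleton Uz.
  by apply: filterS Uz => w Uw Aw; exact: HU U0 Uw Pz.
- exists (~` interior [set w | A w -> ~ P w]).
    by apply: open_closedC; exact: open_interior.
  rewrite predeqE => z; split=> [[Az Pz]|[Az nPz]].
    by split=> // /nbhs_singleton/(_ Az).
  split=> //; apply: contrapT => nP; apply: nPz.
  have [U Uz HU] := H z Az; have U0 := nbhs_singleton Uz.
  by apply: filterS Uz => w Uw Aw Pw; apply: nP; exact: HU Uw U0 Pw.
Qed.

Lemma oitv_connected (R : realType) (a b : \bar R) : connected (oitv a b).
Proof.
apply/connected_intervalP => x y /andP[ax xb] /andP[ay yb] z /andP[xz zy].
apply/andP; split; first by apply: lt_le_trans ax _; rewrite lee_fin.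
by apply: le_lt_trans yb; rewrite lee_fin.
Qed.

Lemma oitv_open (R : realType) (a b : \bar R) : open (oitv a b).
Proof.
have -> : oitv a b = [set t : R | (a < t%:E)%E] `&` [set t | (t%:E < b)%E].
  by rewrite predeqE => t; split=> [/andP[]|[h1 h2]] //; apply/andP.
apply: openI.
  case: a => [a| |].
  - by rewrite [X in open X](_ : _ = [set t | a < t]) //; exact: open_gt.
  - have -> : [set t : R | (+oo < t%:E)%E] = classical_sets.set0; last exact: open0.
    by rewrite predeqE => t; split=> //=; rewrite ltNge leey.
  - have -> : [set t : R | (-oo < t%:E)%E] = classical_sets.setT; last exact: openT.
    by rewrite predeqE => t; split=> // _; rewrite /= ltNyr.
case: b => [b| |].
- by rewrite [X in open X](_ : _ = [set t | t < b]) //; exact: open_lt.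
- have -> : [set t : R | (t%:E < +oo)%E] = classical_sets.setT; last exact: openT.
  by rewrite predeqE => t; split=> // _; rewrite /= ltry.
- have -> : [set t : R | (t%:E < -oo)%E] = classical_sets.set0; last exact: open0.
  by rewrite predeqE => t; split=> //=; rewrite ltNge leNye.
Qed.

(** * Linear differential inequalities *)

Section LinearDifferentialInequality.
Context {R : realType} {p q p' q' : nat}.
Variables (u du : R -> 'M[R]_(p, q)) (w dw : R -> 'M[R]_(p', q')).

(* Comparison at the point where the norm is maximal; no exponential occurs
   because the interval is short. *)
Lemma linear_ineq_short (K T t0 : R) : 0 <= K -> 0 <= T -> 4 * K * T <= 1 ->
  (forall t, `|t - t0| <= T -> is_derive t (1 : R) u (du t) /\
                               is_derive t (1 : R) w (dw t)) ->
  (forall t, `|t - t0| <= T -> `|du t| <= K * (`|u t| + `|w t|) /\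
                               `|dw t| <= K * (`|u t| + `|w t|)) ->
  forall t, `|t - t0| <= T -> `|u t| + `|w t| <= 2 * (`|u t0| + `|w t0|).
Proof.
move=> K0 T0 KT D B.
pose g t := `|u t| + `|w t|.
have cg t : `|t - t0| <= T -> {for t, continuous g}.
  move=> /D[Du Dw]; apply: continuousD.
    exact: cvg_norm (is_derive_mx_continuous Du).
  exact: cvg_norm (is_derive_mx_continuous Dw).
have inT t : t \in `[t0 - T, t0 + T] = (`|t - t0| <= T).
  by rewrite in_itv/= ler_distl.
have tT : t0 - T <= t0 + T by lra.
have [|c] := EVT_max (f := g) tT.
  by apply: continuous_in_subspaceT => t /set_mem/=; rewrite inT; exact: cg.
rewrite inT => cT cmax.
have gc : g c - g t0 <= g c / 2.
  have bnd t : `|t - t0| <= `|c - t0| -> `|t - t0| <= T.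
    by move=> h; apply: le_trans h cT.
  have gle t : `|t - t0| <= `|c - t0| -> g t <= g c.
    by move=> /bnd h; apply: cmax; rewrite inT.
  have h1 : `|u c - u t0| <= K * g c * `|c - t0|.
    apply: (mean_value_ineq (fun t ht => (D t (bnd t ht)).1)) => t ht.
    by apply: le_trans (B t (bnd t ht)).1 _; rewrite ler_wpM2l// gle.
  have h2 : `|w c - w t0| <= K * g c * `|c - t0|.
    apply: (mean_value_ineq (fun t ht => (D t (bnd t ht)).2)) => t ht.
    by apply: le_trans (B t (bnd t ht)).2 _; rewrite ler_wpM2l// gle.
  have g0 : 0 <= g c by rewrite addr_ge0.
  have h3 := lerB_dist (u c) (u t0); have h4 := lerB_dist (w c) (w t0).
  have h5 : K * g c * `|c - t0| <= g c / 4.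
    rewrite mulrAC mulrC ler_wpM2l//.
    apply: (@le_trans _ _ (K * T)); first by rewrite ler_wpM2l.
    rewrite -(ler_pM2l (x := 4)) ?mulrA ?divff; lra.
  rewrite /g; rewrite /g in h1 h2 h5 *; lra.
move=> t ht; have := cmax t; rewrite inT => /(_ ht); rewrite /g in gc *; lra.
Qed.

Lemma linear_ineq_start (K T t0 : R) : 0 <= K -> 0 <= T -> 4 * (K + 1) * T <= 1 ->
  (forall t, `|t - t0| <= T -> is_derive t (1 : R) u (du t) /\
                               is_derive t (1 : R) w (dw t)) ->
  (forall t, `|t - t0| <= T -> `|du t| <= K * (`|u t| + `|w t|) /\
                               `|dw t| <= K * (`|u t| + `|w t|)) ->
  forall t, `|t - t0| <= T ->
    `|u t - u t0| <= 2 * K * (`|u t0| + `|w t0|) * `|t - t0| /\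
    `|w t - w t0| <= 2 * K * (`|u t0| + `|w t0|) * `|t - t0|.
Proof.
move=> K0 T0 KT D B t ht.
have KT' : 4 * K * T <= 1 by apply: le_trans KT; rewrite ler_wpM2r//; lra.
have S := linear_ineq_short K0 T0 KT' D B.
have bnd s : `|s - t0| <= `|t - t0| -> `|s - t0| <= T.
  by move=> h; apply: le_trans h ht.
split.
  apply: (mean_value_ineq (fun s hs => (D s (bnd s hs)).1)) => s hs.
  apply: le_trans (B s (bnd s hs)).1 _.
  by rewrite [2 * K]mulrC -mulrA ler_wpM2l// S// bnd.
apply: (mean_value_ineq (fun s hs => (D s (bnd s hs)).2)) => s hs.
apply: le_trans (B s (bnd s hs)).2 _.
by rewrite [2 * K]mulrC -mulrA ler_wpM2l// S// bnd.
Qed.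

(** Any two times within [r'] of [t] lie within the short interval of [linear_ineq_short] of each
    other, so vanishing passes in both directions. This is the form that
    [connected_locally_constant] takes. *)
Lemma linear_ineq_zero (K r t : R) : 0 <= K -> 0 < r ->
  (forall s, `|s - t| < r -> is_derive s (1 : R) u (du s) /\
                               is_derive s (1 : R) w (dw s)) ->
  (forall s, `|s - t| < r -> `|du s| <= K * (`|u s| + `|w s|) /\
                               `|dw s| <= K * (`|u s| + `|w s|)) ->
  exists2 r' : R, 0 < r' <= r & forall s s', `|s - t| < r' -> `|s' - t| < r' ->
    u s = 0 -> w s = 0 -> u s' = 0 /\ w s' = 0.
Proof.
move=> K0 r0 D B.
pose T := Num.min (r / 2) (4 * (K + 1))^-1.
have K1 : 0 < 4 * (K + 1) by lra.
have T0 : 0 < T by rewrite lt_min invr_gt0 K1 divr_gt0.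
have Tr : T <= r / 2 by rewrite ge_min lexx.
have TK : 4 * K * T <= 1.
  apply: (@le_trans _ _ (4 * (K + 1) * T)); first by rewrite ler_wpM2r ?ltW//; lra.
  by rewrite -ler_pdivlMl// mulr1 ge_min lexx orbT.
exists (T / 2); first by apply/andP; split; lra.
move=> s s' hs hs' us ws.
have near_t x : `|x - s| <= T -> `|x - t| < r.
  move=> hx; rewrite -(subrK s x) -addrA; apply: le_lt_trans (ler_normD _ _) _; lra.
have := linear_ineq_short K0 (ltW T0) TK
  (fun x hx => D x (near_t x hx)) (fun x hx => B x (near_t x hx)).
rewrite us ws !normr0 addr0 mulr0 => /(_ s') H.
have : `|u s'| + `|w s'| <= 0.
  apply: H; rewrite -(subrK t s') -addrA; apply: le_trans (ler_normD _ _) _.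
  by rewrite (distrC t); lra.
move=> H0; have h1 := normr_ge0 (u s'); have h2 := normr_ge0 (w s').
by split; apply/normr0_eq0; lra.
Qed.

End LinearDifferentialInequality.

Section ScalarStart.
Context {R : realType} {p q : nat}.
Variables (u du w dw : R -> 'M[R]_(p, q)).

(** Since [u] starts at 0, both [u] and the change of [w] are of order |t| |w 0|, and integrating u'
    - w 0 gives one more factor |t|. The error is relative to |w 0| itself; hence the first-order
    term decides whether [u] vanishes, uniformly in the initial value. *)
Lemma linear_system_start (K T : R) : 0 <= K -> 0 <= T -> 4 * (K + 2) * T <= 1 ->
  (forall t, `|t| <= T -> is_derive t (1 : R) u (du t) /\
                               is_derive t (1 : R) w (dw t)) ->
  (forall t, `|t| <= T -> `|du t - w t| <= K * `|u t| /\
                               `|dw t| <= K * (`|u t| + `|w t|)) ->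
  u 0 = 0 ->
  forall t, `|t| <= T ->
    `|u t - t *: w 0| <= 4 * (K + 1) ^+ 2 * `|t| ^+ 2 * `|w 0|.
Proof.
move=> K0 T0 KT D B u0 t ht.
have K1 : 0 <= K + 1 by lra.
have KT' : 4 * (K + 1 + 1) * T <= 1 by rewrite -addrA.
have D' s : `|s - 0| <= T -> is_derive s (1 : R) u (du s) /\
    is_derive s (1 : R) w (dw s) by rewrite subr0; exact: D.
have B' s : `|s - 0| <= T -> `|du s| <= (K + 1) * (`|u s| + `|w s|) /\
    `|dw s| <= (K + 1) * (`|u s| + `|w s|).
  rewrite subr0 => /B[b1 b2].
  have h1 := normr_ge0 (u s); have h2 := normr_ge0 (w s).
  have h3 : 0 <= K * `|w s| by rewrite mulr_ge0.
  split; last by rewrite mulrDl mul1r; lra.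
  have := ler_normD (du s - w s) (w s); rewrite subrK; lra.
have S s : `|s| <= T -> `|u s| <= 2 * (K + 1) * `|w 0| * `|s| /\
    `|w s - w 0| <= 2 * (K + 1) * `|w 0| * `|s|.
  move=> hs; have := linear_ineq_start K1 T0 KT' D' B' (t := s).
  by rewrite u0 !subr0 normr0 add0r; apply.
have bnd s : `|s - 0| <= `|t - 0| -> `|s| <= T.
  by rewrite !subr0 => h; apply: le_trans h ht.
have Dv s : `|s - 0| <= `|t - 0| ->
    is_derive s (1 : R) (fun s => u s - s *: w 0) (du s - w 0).
  move=> /bnd /D[Du _]; apply: is_derive_subf => //.
  have := is_derive_scaler (is_derive_id s (1 : R)) (is_derive_cst (w 0) s (1 : R)).
  by rewrite scaler0 addr0 scale1r.
have := @mean_value_ineq _ _ _ _ _ (4 * (K + 1) ^+ 2 * `|t| * `|w 0|) _ _ Dv.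
rewrite u0 scale0r !subr0 => H.
rewrite (_ : _ * `|w 0| = 4 * (K + 1) ^+ 2 * `|t| * `|w 0| * `|t|); last by ring.
apply: H => s; rewrite !subr0 => hs; have hT : `|s| <= T by apply: le_trans hs ht.
have [b1 _] := B s hT; have [s1 s2] := S s hT.
rewrite -(subrK (w s) (du s)) -addrA; apply: le_trans (ler_normD _ _) _.
have {}b1 : `|du s - w s| <= K * (2 * (K + 1) * `|w 0| * `|t|).
  apply: le_trans b1 _; rewrite ler_wpM2l//; apply: le_trans s1 _.
  by rewrite ler_wpM2l// !mulr_ge0.
have {}s2 : `|w s - w 0| <= 2 * (K + 1) * `|w 0| * `|t|.
  by apply: le_trans s2 _; rewrite ler_wpM2l// !mulr_ge0.
apply: le_trans (lerD b1 s2) _.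
rewrite (_ : _ + _ = 2 * (K + 1) ^+ 2 * `|t| * `|w 0|); last by ring.
do 3 rewrite ler_wpM2r ?sqr_ge0//; lra.
Qed.

End ScalarStart.

(** * Picard iteration *)

Section Picard.
Context {R : realType}.

Lemma primitive_exists (f : R -> R) (T : R) : 0 < T -> continuous f ->
  exists P : R -> R, P 0 = 0 /\
    forall t, `|t| < T -> is_derive t (1 : R) P (f t).
Proof.
move=> T0 cf; set mu := @lebesgue_measure.lebesgue_measure R.
(* The integral starts at -T, so that negative times are interior points too; subtracting [F 0]
   restores the initial value. *)
pose F (x : R) := (\int[mu]_(t in [set` `[- T, x]]) f t)%R.
exists (fun x => F x - F 0); split; first by rewrite subrr.
move=> t; rewrite ltr_norml => /andP[t1 t2].
have [d <-] : derivable F t 1 /\ (F^`()%classic) t = f t.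
  apply: (@continuous_FTC1_closed R f (- T) t T) => //.
  - apply: continuous_compact_integrable; first exact: segment_compact.
  
  - exact: continuous_subspaceT.
  - exact: cf.
have := is_derive_subf (DeriveDef d erefl) (is_derive_cst (F 0) t (1 : R)).
by rewrite subr0 derive1E.
Qed.

(* The closed ball of the sup norm is a box, and clamping the coordinates
   retracts onto it without increasing distances. *)
Definition clamp1 (r x : R) : R := Num.max (- r) (Num.min r x).

Lemma clamp1_norm r x : 0 <= r -> `|clamp1 r x| <= r.
Proof.
move=> r0; rewrite /clamp1 ler_norml.
by rewrite le_max lexx/= ge_max ge_min lexx andbT; lra.
Qed.

Lemma clamp1_id r x : `|x| <= r -> clamp1 r x = x.
Proof.
by rewrite ler_norml => /andP[h1 h2]; rewrite /clamp1 min_r// max_r.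
Qed.

Lemma clamp1_lip r x y : `|clamp1 r x - clamp1 r y| <= `|x - y|.
Proof.
rewrite /clamp1 /Num.max /Num.min /Order.max /Order.min.
by do !case: ifPn => //; rewrite -?leNgt => *; rewrite !ler_norml ?ler_normr;
  have := ler_norm (x - y); have := ler_norm (y - x); rewrite (distrC y); lra.
Qed.

Definition clampv m (c : 'rV[R]_m) (r : R) (y : 'rV[R]_m) : 'rV[R]_m :=
  c + \row_k clamp1 r ((y - c) 0 k).

Lemma clampv_in m (c y : 'rV[R]_m) r : 0 <= r -> `|clampv c r y - c| <= r.
Proof.
move=> r0; rewrite /clampv addrAC subrr add0r; apply/mx_norm_le => // i j.
by rewrite mxE clamp1_norm.
Qed.

Lemma clampv_id m (c y : 'rV[R]_m) r : `|y - c| <= r -> clampv c r y = y.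
Proof.
move=> h; rewrite /clampv; apply/rowP => k; rewrite mxE mxE clamp1_id.
  by rewrite !mxE subrKC.
exact: le_trans (mx_entry_le _ _ _) h.
Qed.

Lemma clampv_lip m (c y z : 'rV[R]_m) r : `|clampv c r y - clampv c r z| <= `|y - z|.
Proof.
apply/mx_norm_le => // i j; rewrite /clampv opprD addrACA subrr add0r !mxE.
apply: le_trans (clamp1_lip _ _ _) _.
rewrite (_ : _ - _ = (y - z) 0 j); last by rewrite !mxE; ring.
exact: mx_entry_le.
Qed.

Lemma lipschitz_continuous_comp p q (f : 'rV[R]_p -> 'rV[R]_q) (y : R -> 'rV[R]_p)
    (K t : R) : 0 <= K -> (forall x x', `|f x - f x'| <= K * `|x - x'|) ->
  {for t, continuous y} -> {for t, continuous (f \o y)}.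
Proof.
move=> K0 H cy; apply/cvgrPdist_le => e e0.
have d0 : 0 < e / (K + 1) by rewrite divr_gt0// ltr_wpDl.
move/cvgrPdist_le : cy => /(_ _ d0); apply: filterS => s hs.
apply: le_trans (H _ _) _; apply: (@le_trans _ _ (K * (e / (K + 1)))).
  by rewrite ler_wpM2l.
by rewrite mulrCA ler_piMr ?(ltW e0)// ler_pdivrMr ?mul1r ?lerDl// ltr_wpDl.
Qed.

Lemma le_geometric (x a B : R) : (forall k, x <= a + B * 2^-1 ^+ k) -> x <= a.
Proof.
move=> H; apply/ler_addgt0Pr => e e0.
have lt1 : `|2^-1 : R| < 1 by rewrite ger0_norm ?invr_ge0//; lra.
have /cvgrPdist_le/(_ e e0)[N _ /(_ N (leqnn N))] := cvg_geometric B lt1.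
rewrite sub0r normrN => /(le_trans (ler_norm _)) h.
by apply: le_trans (H N) _; rewrite lerD2l.
Qed.

(** The bounds a_k - 2 C 2^-k increase and a_k + 2 C 2^-k decrease, so the supremum of the lower
    ones is the limit and the error estimate comes with it. *)
Lemma geometric_limit (a : nat -> R) (C : R) :
  (forall k, `|a k.+1 - a k| <= C * 2^-1 ^+ k) ->
  exists l, forall k, `|l - a k| <= 2 * C * 2^-1 ^+ k.
Proof.
move=> H.
pose b k := a k - 2 * C * 2^-1 ^+ k; pose c k := a k + 2 * C * 2^-1 ^+ k.
have C0 : 0 <= C by have := H 0%N; rewrite expr0 mulr1; apply: le_trans.
have mono k m : b k <= b (k + m)%N /\ c (k + m)%N <= c k.
  elim: m => [|m [IH1 IH2]]; first by rewrite addn0.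
  have := H (k + m)%N; rewrite ler_distl => /andP[h1 h2].
  rewrite addnS; split; [apply: le_trans IH1 _|apply: le_trans _ IH2];
    rewrite /b /c exprS; lra.
have bc k m : b k <= c m.
  have [h1 _] := mono k m; have [_ h2] := mono m k; rewrite addnC in h2.
  apply: le_trans h1 _; apply: le_trans _ h2; rewrite /b /c lerD2l.
  have : 0 <= 2 * C * 2^-1 ^+ (k + m) by rewrite !mulr_ge0// exprn_ge0// invr_ge0.
  lra.
exists (sup (range b)) => k.
have h1 : b k <= sup (range b).
  apply: ub_le_sup; last by exists k.
  by exists (c 0%N) => _ [j _ <-].
have h2 : sup (range b) <= c k.
  by apply: ge_sup; [exists (b 0%N), 0%N|move=> _ [j _ <-]].
by rewrite ler_distl; apply/andP; split.
Qed.

Section GlobalLipschitz.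
Variables (m : nat) (F : 'rV[R]_m -> 'rV[R]_m) (K L : R).
Hypothesis K0 : 0 <= K.
Hypothesis F_lip : forall x y, `|F x - F y| <= K * `|x - y|.
Hypothesis F_bound : forall x, `|F x| <= L.
Let L0 : 0 <= L. Proof. exact: le_trans (normr_ge0 _) (F_bound 0). Qed.

Variables (T : R) (w : 'rV[R]_m).
Hypothesis T0 : 0 < T.
Hypothesis KT : K * T <= 2^-1.

Lemma picard_step (y : R -> 'rV[R]_m) : continuous y ->
  exists z : R -> 'rV[R]_m, [/\ continuous z, z 0 = w &
    forall t, `|t| < T -> is_derive t (1 : R) z (F (y t))].
Proof.
move=> cy.
have cF : continuous (F \o y).
  by move=> t; exact: lipschitz_continuous_comp K0 F_lip (cy t).
have T1 : 0 < T + 1 by rewrite addr_gt0.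
have /choice[P HP] (k : 'I_m) := @primitive_exists (fun t => F (y t) 0 k) (T + 1) T1
  (fun t => (continuous_mxP (F \o y) t).1 (cF t) 0 k).
have dP t : `|t| < T + 1 -> is_derive t (1 : R) (fun t => w + \row_k P k t) (F (y t)).
  move=> ht; rewrite -[F (y t)]add0r; apply: is_derive_addf.
  apply/is_derive_mxP => i k; rewrite ord1.
  by under eq_fun do rewrite mxE; exact: (HP k).2.
(* The primitive is known on a slightly larger interval; clamping the time makes it continuous on
   the whole line, as the next iterate requires. *)
exists (fun t => w + \row_k P k (clamp1 T t)); split.
- move=> t; apply: (@continuous_comp _ _ _ (clamp1 T) (fun t => w + \row_k P k t)).
    apply/cvgrPdist_le => e e0; near=> s.
    by apply: le_trans (clamp1_lip _ _ _) _; near: s; apply: cvgr_dist_le.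
  apply: is_derive_mx_continuous (dP _ _).
  by apply: le_lt_trans (clamp1_norm _ (ltW T0)) _; lra.
- rewrite clamp1_id ?normr0 ?ltW//; apply/rowP => k.
  by rewrite !mxE (HP k).1 addr0.
- move=> t ht; apply: is_derive_ext (dP t _); last by lra.
  have : \forall s \near t, `|s| < T.
    apply/nbhs_ballP; exists (T - `|t|) => /=; first by rewrite subr_gt0.
    move=> s; rewrite /ball/= distrC => hs; have := lerB_dist s t.
    by move=> /le_lt_trans/(_ hs); rewrite ltrD2r.
  by apply: filterS => s hs; rewrite clamp1_id// ltW.
Unshelve. all: by end_near. Qed.

Lemma picard_iterates : exists y : nat -> R -> 'rV[R]_m,
  (forall k, y k 0 = w) /\
  (forall k t, `|t| < T -> is_derive t (1 : R) (y k.+1) (F (y k t))) /\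
  y 0%N = cst w.
Proof.
have /choice[f Hf] (y : {y : R -> 'rV[R]_m | continuous y}) :
    exists z : {y : R -> 'rV[R]_m | continuous y}, sval z 0 = w /\
      forall t, `|t| < T -> is_derive t (1 : R) (sval z) (F (sval y t)).
  case: y => y cy; have [z [cz z0 dz]] := picard_step cy.
  by exists (exist _ z cz).
have c0 : continuous (fun _ : R => w) by move=> t; exact: cst_continuous.
pose y k := iter k f (exist _ _ c0).
exists (fun k => sval (y k)); split; last split => //.
  by case=> [//|k]; exact: (Hf _).1.
by move=> k t ht; exact: (Hf _).2.
Qed.

Lemma picard_global : exists y : R -> 'rV[R]_m, y 0 = w /\
  forall t, `|t| < T -> is_derive t (1 : R) y (F (y t)).
Proof.
have [y [y0 [dy yw]]] := picard_iterates.
have sub (t s : R) : `|t| < T -> `|s - 0| <= `|t - 0| -> `|s| < T.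
  by rewrite !subr0 => h1 h2; apply: le_lt_trans h2 h1.
pose C := L * T.
have C0 : 0 <= C by rewrite mulr_ge0// ltW.
have geo k t : `|t| < T -> `|y k.+1 t - y k t| <= C * 2^-1 ^+ k.
  elim: k t => [|k IH] t ht.
    rewrite yw/= -(y0 1%N) expr0 mulr1.
    apply: le_trans (mean_value_ineq (fun s hs => dy 0%N s (sub _ _ ht hs))
      (fun s hs => F_bound _)) _.
    by rewrite subr0 /C ler_wpM2l// ltW.
  have D s : `|s - 0| <= `|t - 0| -> is_derive s (1 : R)
      (fun s => y k.+2 s - y k.+1 s) (F (y k.+1 s) - F (y k s)).
    by move=> hs; apply: is_derive_subf; apply: dy; exact: sub hs.
  have := mean_value_ineq (C := K * (C * 2^-1 ^+ k)) D.
  rewrite !y0 subrr !subr0 => H; apply: le_trans (H _) _.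
    move=> s hs; apply: le_trans (F_lip _ _) _; rewrite ler_wpM2l// IH//.
    by apply: le_lt_trans ht; move: hs; rewrite subr0.
  have KtT : K * `|t| <= 2^-1 by apply: le_trans KT; rewrite ler_wpM2l// ltW.
  rewrite exprS; set a := 2^-1 ^+ k.
  have -> : K * (C * a) * `|t| = C * a * (K * `|t|) by ring.
  have -> : C * (2^-1 * a) = C * a * 2^-1 by ring.
  by rewrite ler_wpM2l// mulr_ge0// exprn_ge0// invr_ge0.
have p0 k : 0 <= 2^-1 ^+ k :> R by rewrite exprn_ge0// invr_ge0.
have /choice[z Hz] (t : R) : exists l, `|t| < T ->
    forall k, `|l - y k t| <= 2 * C * 2^-1 ^+ k.
  have [ht|ht] := ltP `|t| T; last by exists 0.
  have /choice[l Hl] (j : 'I_m) : exists l, forall k,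
      `|l - y k t 0 j| <= 2 * C * 2^-1 ^+ k.
    apply: geometric_limit => k; apply: le_trans (geo k t ht).
    by apply: le_trans (mx_entry_le _ 0 j); rewrite !mxE.
  exists (\row_j l j) => _ k; apply/mx_norm_le.
    by apply: mulr_ge0 (p0 k); exact: mulr_ge0.
  by move=> i j; rewrite !mxE ord1.
have small (x : 'rV[R]_m) B : (forall k, `|x| <= B * 2^-1 ^+ k) -> x = 0.
  move=> h; apply/normr0_eq0/le_anti; rewrite normr_ge0 andbT.
  by apply: (@le_geometric _ _ B) => k; rewrite add0r.
exists z; split.
  apply/eqP; rewrite -subr_eq0; apply/eqP; apply: small => k.
  by rewrite -(y0 k); apply: Hz; rewrite normr0.
move=> t ht.
(* Differentiability of the limit comes from a quadratic bound on its Taylor remainder: the bound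
   holds for the iterates up to an error of order 2^-k, and k is arbitrary. *)
have quad s : `|t| + `|s - t| < T ->
    `|z s - z t - (s - t) *: F (z t)| <= K * L * `|s - t| ^+ 2.
  move=> hs.
  have inT r : `|r - t| <= `|s - t| -> `|r| < T.
    move=> hr; rewrite -(subrK t r); apply: le_lt_trans (ler_normD _ _) _.
    by apply: le_lt_trans hs; rewrite addrC lerD2l.
  apply: (@le_geometric _ _ (2 * (2 * C) + K * (3 * (2 * C)) * `|s - t|)) => k.
  have lipk r : `|r - t| <= `|s - t| -> `|y k.+1 r - y k.+1 t| <= L * `|r - t|.
    move=> hr; apply: (mean_value_ineq (fun x hx => dy k x _)) => x hx //.
    by apply: inT; exact: le_trans hr.
  have D r : `|r - t| <= `|s - t| -> is_derive r (1 : R)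
      (fun r => y k.+1 r - r *: F (z t)) (F (y k r) - F (z t)).
    move=> hr; apply: is_derive_subf; first exact: dy (inT r hr).
    have := is_derive_scaler (is_derive_id r (1 : R)) (is_derive_cst (F (z t)) r (1 : R)).
    by rewrite scaler0 addr0 scale1r.
  set e := 2^-1 ^+ k.
  have e0 : 0 <= e := p0 k.
  have e1 : 2 * C * 2^-1 ^+ k.+1 <= 2 * C * e.
    apply: ler_wpM2l; first exact: mulr_ge0.
    by rewrite exprS ler_piMl// invf_le1// ler1n.
  have h1 := mean_value_ineq (C := K * (3 * (2 * C * e) + L * `|s - t|)) D.
  have {}h1 : `|y k.+1 s - s *: F (z t) - (y k.+1 t - t *: F (z t))| <=
      K * (3 * (2 * C * e) + L * `|s - t|) * `|s - t|.
    apply: h1 => r hr; apply: le_trans (F_lip _ _) _; rewrite ler_wpM2l//.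
    have a1 := Hz r (inT r hr) k; have a2 := Hz r (inT r hr) k.+1.
    have a3 := Hz t ht k.+1; have a4 := lipk r hr.
    have a5 : L * `|r - t| <= L * `|s - t| by rewrite ler_wpM2l.
    rewrite (_ : y k r - z t = (y k r - y k.+1 r) + (y k.+1 r - y k.+1 t)
      + (y k.+1 t - z t)); last by rewrite !addrA !subrK.
    apply: le_trans (ler_normD _ _) _; rewrite (distrC (y _ t)).
    apply: le_trans (lerD (ler_normD _ _) (lexx _)) _.
    have a6 := geo k r (inT r hr); rewrite distrC -/e in a6.
    have a7 : C * e <= 2 * C * e by rewrite ler_wpM2r// ler_peMl// ler1n.
    have a8 : 0 <= 2 * C * e := mulr_ge0 (mulr_ge0 (ler0n _ 2) C0) e0.
    have fin (n1 n2 n3 a b : R) : 0 <= a -> n1 <= a -> n2 <= b -> n3 <= a ->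
      n1 + n2 + n3 <= 3 * a + b by lra.
    exact: fin a8 (le_trans a6 a7) (le_trans a4 a5) (le_trans a3 e1).
  have b1 : `|z s - y k.+1 s| <= 2 * C * e.
    by apply: le_trans (Hz s (inT s (lexx _)) k.+1) e1.
  have b2 : `|y k.+1 t - z t| <= 2 * C * e.
    by rewrite distrC; apply: le_trans (Hz t ht k.+1) e1.
  rewrite (_ : z s - z t - (s - t) *: F (z t) = (z s - y k.+1 s) +
    (y k.+1 s - s *: F (z t) - (y k.+1 t - t *: F (z t))) + (y k.+1 t - z t)).
    apply: le_trans (ler_normD _ _) _.
    apply: le_trans (lerD (ler_normD _ _) (lexx _)) _.
    apply: le_trans (lerD (lerD b1 h1) b2) _.
    rewrite le_eqVlt; apply/orP; left; apply/eqP; ring.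
  apply/rowP => j; rewrite !mxE; ring.
apply/is_derive_cvgP/cvgrPdist_le => e e0.
have B0 : 0 < K * L + 1 by rewrite ltr_wpDl// mulr_ge0.
have d1 : 0 < T - `|t| by rewrite subr_gt0.
have d2 : 0 < e / (K * L + 1) by rewrite divr_gt0.
near=> h.
have h0 : h != 0 by near: h; exact: nbhs_dnbhs_neq.
have h1 : `|h| < T - `|t| by near: h; exact: dnbhs0_lt.
have h2 : `|h| < e / (K * L + 1) by near: h; exact: dnbhs0_lt.
have := quad (h + t); rewrite addrK -ltrBrDl => /(_ h1) Q.
rewrite [h *: 1]mulr1 -normrN opprB.
have -> : h^-1 *: (z (h + t) - z t) - F (z t) =
    h^-1 *: (z (h + t) - z t - h *: F (z t)).
  by rewrite [RHS]scalerBr [h^-1 *: (h *: _)]scalerA mulVf// scale1r.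
rewrite normrZ normfV ler_pdivrMl ?normr_gt0//; apply: le_trans Q _.
rewrite expr2 mulrA mulrC ler_wpM2l//.
apply: (@le_trans _ _ ((K * L + 1) * `|h|)).
  by rewrite ler_wpM2r// lerDl.
by rewrite mulrC -ler_pdivlMr// ltW.
Unshelve. all: by end_near. Qed.

End GlobalLipschitz.
End Picard.

(** * Local solutions and shooting for second-order equations *)

Section LocalFlow.
Context {R : realType}.

Lemma norm_row_mx p q r (A : 'M[R]_(p, q)) (B : 'M[R]_(p, r)) (c : R) : 0 <= c ->
  (`|row_mx A B| <= c) <-> (`|A| <= c /\ `|B| <= c).
Proof.
move=> c0; split.
  move=> /(mx_norm_le _ c0) H; split; apply/(mx_norm_le _ c0) => i j.
    by have := H i (lshift _ j); rewrite row_mxEl.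
  by have := H i (rshift _ j); rewrite row_mxEr.
move=> [/(mx_norm_le _ c0) HA /(mx_norm_le _ c0) HB]; apply/(mx_norm_le _ c0) => i j.
by case: (split_ordP j) => k ->; rewrite ?row_mxEl ?row_mxEr.
Qed.

(** The field is extended from the box by clamping its argument. The solution starts within r/2 of
    the centre and moves by at most L T <= r/2, so it never leaves the box and solves the original
    equation. *)
Lemma picard_local m (F : 'rV[R]_m -> 'rV[R]_m) (c w : 'rV[R]_m) (r K L T : R) :
  0 <= K -> 0 < r -> 0 < T -> K * T <= 2^-1 -> L * T <= r / 2 ->
  (forall x y, `|x - c| <= r -> `|y - c| <= r -> `|F x - F y| <= K * `|x - y|) ->
  (forall x, `|x - c| <= r -> `|F x| <= L) ->
  `|w - c| <= r / 2 ->
  exists y : R -> 'rV[R]_m, y 0 = w /\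
    forall t, `|t| < T -> `|y t - c| <= r /\ is_derive t (1 : R) y (F (y t)).
Proof.
move=> K0 r0 T0 KT LT FK FL wc.
have cl x := clampv_in c x (ltW r0).
have [y [y0 dy]] := @picard_global R m (F \o clampv c r) K L K0
  (fun x x' => le_trans (FK _ _ (cl x) (cl x'))
     (ler_wpM2l K0 (clampv_lip c x x' r)))
  (fun x => FL _ (cl x)) T w T0 KT.
exists y; split=> // t ht.
have yc : `|y t - c| <= r.
  rewrite -(subrK w (y t)) -addrA; apply: le_trans (ler_normD _ _) _.
  rewrite [r]splitr lerD//; apply: le_trans LT.
  have sub (s : R) : `|s - 0| <= `|t - 0| -> `|s| < T.
    by rewrite !subr0 => h; apply: le_lt_trans h ht.
  have := mean_value_ineq (fun s hs => dy s (sub s hs)) (fun s _ => FL _ (cl (y s))).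
  rewrite y0 subr0 => /le_trans; apply; rewrite ler_wpM2l ?(ltW ht)//.
  by apply: (@le_trans _ _ `|F c|) => //; apply: FL; rewrite subrr normr0 ltW.
by split=> //; have := dy t ht; rewrite /= clampv_id.
Qed.

(** The bound concerns the change of y - z rather than y - z itself: this says that the flow is
    close to the identity in the Lipschitz sense, as shooting requires. *)
Lemma flow_dependence m (F : 'rV[R]_m -> 'rV[R]_m) (c : 'rV[R]_m) (r K t0 t : R)
    (y z : R -> 'rV[R]_m) :
  0 <= K -> 4 * (K + 1) * `|t - t0| <= 1 ->
  (forall x x', `|x - c| <= r -> `|x' - c| <= r -> `|F x - F x'| <= K * `|x - x'|) ->
  (forall s, `|s - t0| <= `|t - t0| -> `|y s - c| <= r /\ is_derive s (1 : R) y (F (y s))) ->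
  (forall s, `|s - t0| <= `|t - t0| -> `|z s - c| <= r /\ is_derive s (1 : R) z (F (z s))) ->
  `|y t - z t - (y t0 - z t0)| <= 2 * K * `|y t0 - z t0| * `|t - t0|.
Proof.
move=> K0 Kt FK Hy Hz.
have D (s : R) : `|s - t0| <= `|t - t0| -> is_derive s (1 : R) (fun s => y s - z s)
    (F (y s) - F (z s)) /\ is_derive s (1 : R) (fun _ : R => (0 : 'M[R]_1)) 0.
  move=> hs; split; last exact: is_derive_cst.
  by apply: is_derive_subf; [exact: (Hy s hs).2|exact: (Hz s hs).2].
have B (s : R) : `|s - t0| <= `|t - t0| ->
    `|F (y s) - F (z s)| <= K * (`|y s - z s| + `|0 : 'M[R]_1|) /\
    `|0 : 'M[R]_1| <= K * (`|y s - z s| + `|0 : 'M[R]_1|).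
  move=> hs; rewrite normr0 addr0; split; last by rewrite mulr_ge0.
  by apply: FK; [exact: (Hy s hs).1|exact: (Hz s hs).1].
have := linear_ineq_start K0 (normr_ge0 _) Kt D B (lexx _).
by rewrite normr0 addr0 => -[].
Qed.

Lemma contraction_fixed_point n (Phi : 'rV[R]_n -> 'rV[R]_n) (rho : R) : 0 <= rho ->
  (forall u, `|u| <= rho -> `|Phi u| <= rho) ->
  (forall u u', `|u| <= rho -> `|u'| <= rho -> `|Phi u - Phi u'| <= 2^-1 * `|u - u'|) ->
  exists2 u, `|u| <= rho & Phi u = u.
Proof.
move=> rho0 stable contr.
pose a k := iter k Phi 0.
have a_in k : `|a k| <= rho by elim: k => [|k IH]; [rewrite normr0|exact: stable].
have step k : `|a k.+1 - a k| <= rho * 2^-1 ^+ k.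
  elim: k => [|k IH]; first by rewrite subr0 expr0 mulr1 (a_in 1%N).
  apply: le_trans (contr _ _ (a_in k.+1) (a_in k)) _.
  by rewrite exprS mulrCA ler_wpM2l// invr_ge0.
have p0 k : 0 <= 2^-1 ^+ k :> R by rewrite exprn_ge0// invr_ge0.
have /choice[l Hl] (j : 'I_n) : exists l, forall k, `|l - a k 0 j| <= 2 * rho * 2^-1 ^+ k.
  apply: geometric_limit => k; apply: le_trans (step k).
  by apply: le_trans (mx_entry_le _ 0 j); rewrite !mxE.
pose u := \row_j l j.
have ul k : `|u - a k| <= 2 * rho * 2^-1 ^+ k.
  apply/mx_norm_le; first by apply: mulr_ge0 (p0 k); exact: mulr_ge0.
  by move=> i j; rewrite !mxE ord1.
have u_in : `|u| <= rho.
  apply: (@le_geometric _ _ _ (2 * rho)) => k.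
  rewrite -(subrK (a k) u) addrC; apply: le_trans (ler_normD _ _) _; exact: lerD.
exists u => //; apply/eqP; rewrite -subr_eq0 -normr_le0; apply: (@le_geometric _ _ _ (4 * rho)) => k.
rewrite add0r -(subrK (a k.+1) (Phi u)) -addrA; apply: le_trans (ler_normD _ _) _.
have h1 := contr u (a k) u_in (a_in k); have h2 := ul k; have h3 := ul k.+1.
have h4 := mulr_ge0 rho0 (p0 k).
rewrite [`|a _ - _|]distrC exprS -/(a k.+1) in h1 h3 *.
rewrite (_ : 2 * rho * (2^-1 * 2^-1 ^+ k) = rho * 2^-1 ^+ k) in h3; last by field.
by apply: le_trans (lerD h1 h3) _; lra.
Qed.

Section SecondOrder.
Variables (n : nat) (A : 'rV[R]_n -> 'rV[R]_n -> 'rV[R]_n).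
Variables (p : 'rV[R]_n) (r K : R).
Hypothesis r0 : 0 < r.
Hypothesis K0 : 0 <= K.
Hypothesis A_lip : forall x x' v v', `|x - p| <= r -> `|x' - p| <= r ->
  `|v| <= r -> `|v'| <= r -> `|A x v - A x' v'| <= K * (`|x - x'| + `|v - v'|).
Hypothesis A0 : A p 0 = 0.

Let F (y : 'rV[R]_(n + n)) := row_mx (rsubmx y) (A (lsubmx y) (rsubmx y)).
Let c : 'rV[R]_(n + n) := row_mx p 0.
Let K' := 2 * K + 1.
Let K'0 : 0 <= K'. Proof. by rewrite /K' addr_ge0// mulr_ge0. Qed.

Let sub_bound (y : 'rV[R]_(n + n)) (s : R) : 0 <= s ->
  (`|y - c| <= s) <-> (`|lsubmx y - p| <= s /\ `|rsubmx y| <= s).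
Proof.
move=> s0; rewrite -{1}(hsubmxK y) /c opp_row_mx add_row_mx subr0.
exact: norm_row_mx.
Qed.

Let F_lip y y' : `|y - c| <= r -> `|y' - c| <= r -> `|F y - F y'| <= K' * `|y - y'|.
Proof.
move=> /(sub_bound _ (ltW r0))[h1 h2] /(sub_bound _ (ltW r0))[h1' h2'].
have [d1 d2] : `|lsubmx y - lsubmx y'| <= `|y - y'| /\
    `|rsubmx y - rsubmx y'| <= `|y - y'|.
  have : `|row_mx (lsubmx y) (rsubmx y) - row_mx (lsubmx y') (rsubmx y')| <= `|y - y'|.
    by rewrite !hsubmxK.
  by rewrite opp_row_mx add_row_mx => /(norm_row_mx _ _ (normr_ge0 _)).
rewrite /F opp_row_mx add_row_mx; apply/norm_row_mx; first by rewrite mulr_ge0.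
have d0 := normr_ge0 (y - y').
have k1 : 0 <= K * `|y - y'| by rewrite mulr_ge0.
split; first by apply: le_trans d2 _; rewrite /K' mulrDl mul1r lerDr -mulrA mulr_ge0.
apply: le_trans (A_lip h1 h1' h2 h2') _.
apply: (@le_trans _ _ (K * (`|y - y'| + `|y - y'|))); first by rewrite ler_wpM2l// lerD.
by rewrite /K' mulrDl mul1r mulrDr -mulrA; lra.
Qed.

Let F0 : F c = 0.
Proof. by rewrite /F /c row_mxKl row_mxKr A0 row_mx0. Qed.

(** The velocities of two solutions keep their initial difference u - u' up to half its norm. Hence
    u -> x u tau is tau times the identity up to a map of Lipschitz constant tau/2, and a fixed
    point yields a solution through any prescribed [q] near [p] at time tau. *)
Lemma second_order_family : exists (x v : 'rV[R]_n -> R -> 'rV[R]_n) (T : R),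
  [/\ 0 < T,
     forall u, `|u| <= r / 2 -> [/\ x u 0 = p, v u 0 = u & forall t, `|t| < T ->
       [/\ `|x u t - p| <= r, `|v u t| <= r,
           is_derive t (1 : R) (x u) (v u t) &
           is_derive t (1 : R) (v u) (A (x u t) (v u t))]] &
     forall tau q, 0 < tau < T -> `|q - p| <= tau * (r / 4) ->
       exists2 u, `|u| <= r / 2 & x u tau = q].
Proof.
(* This time satisfies both the contraction condition K' T <= 1/2 of the Picard iteration and the
   smallness condition of [flow_dependence]. *)
pose T := (4 * (K' + 1))^-1.
have K1 : 0 < 4 * (K' + 1) by rewrite mulr_gt0// ltr_wpDl.
have T0 : 0 < T by rewrite invr_gt0.
have KT4 : 4 * (K' + 1) * T = 1 by rewrite mulfV// lt0r_neq0.
have KT : K' * T <= 2^-1.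
  have : 0 <= K' * T by rewrite mulr_ge0// ltW.
  by move: KT4; rewrite -mulrA mulrDl mul1r; lra.
have Fb y : `|y - c| <= r -> `|F y| <= K' * r.
  move=> h; rewrite -[F y]subr0 -F0; apply: le_trans (F_lip h _) _.
    by rewrite subrr normr0 ltW.
  by rewrite ler_wpM2l.
have LT : K' * r * T <= r / 2.
  by rewrite mulrAC mulrC ler_wpM2l// ltW.
have r2 : 0 <= r / 2 by rewrite divr_ge0// ltW.
have /choice[y Hy] (u : 'rV[R]_n) : exists y : R -> 'rV[R]_(n + n), `|u| <= r / 2 ->
    y 0 = row_mx p u /\ forall t, `|t| < T ->
      `|y t - c| <= r /\ is_derive t (1 : R) y (F (y t)).
  have [hu|hu] := boolP (`|u| <= r / 2); last by exists (cst 0).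
  have hw : `|row_mx p u - c| <= r / 2.
    by apply/sub_bound => //; rewrite row_mxKl row_mxKr subrr normr0.
  by have [y Hy] := picard_local K'0 r0 T0 KT LT F_lip Fb hw; exists y.
have D u : `|u| <= r / 2 -> forall t, `|t| < T ->
    [/\ `|lsubmx (y u t) - p| <= r, `|rsubmx (y u t)| <= r,
     is_derive t (1 : R) (fun t => lsubmx (y u t)) (rsubmx (y u t)) &
     is_derive t (1 : R) (fun t => rsubmx (y u t)) (A (lsubmx (y u t)) (rsubmx (y u t)))].
  move=> /Hy[_ H] t /H[/(sub_bound _ (ltW r0))[h1 h2] dy]; split => //.
    have := is_derive_linmx (@lsubmx R 1 n n) dy; by rewrite /= /F row_mxKl.
  have := is_derive_linmx (@rsubmx R 1 n n) dy; by rewrite /= /F row_mxKr.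
exists (fun u t => lsubmx (y u t)), (fun u t => rsubmx (y u t)), T; split=> //.
  move=> u hu; have [y0 _] := Hy u hu.
  by split; [rewrite y0 row_mxKl|rewrite y0 row_mxKr|exact: D].
move=> tau q /andP[tau0 tauT] hq.
pose x u := lsubmx (y u tau).
have ttau : `|tau| < T by rewrite gtr0_norm.
have sub (s : R) : `|s - 0| <= `|tau - 0| -> `|s| < T.
  by rewrite !subr0 => h; apply: le_lt_trans h _.
have Kt (s : R) : `|s| < T -> 4 * (K' + 1) * `|s - 0| <= 1.
  move=> hs; rewrite subr0; apply: (@le_trans _ _ (4 * (K' + 1) * T)).
    by rewrite ler_wpM2l ?ltW.
  by rewrite KT4.
have dep u u' : `|u| <= r / 2 -> `|u'| <= r / 2 ->
    `|x u - x u' - tau *: (u - u')| <= 2^-1 * `|u - u'| * tau.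
  move=> hu hu'.
  have v_dep (s : R) : `|s - 0| <= `|tau - 0| ->
      `|rsubmx (y u s) - rsubmx (y u' s) - (u - u')| <= 2^-1 * `|u - u'|.
    move=> hs; have hsT := sub s hs.
    have sub' (s' : R) : `|s' - 0| <= `|s - 0| -> `|s'| < T.
      by rewrite !subr0 => h; apply: le_lt_trans h _.
    have := @flow_dependence _ F c r K' 0 s (y u) (y u') K'0 (Kt s hsT) F_lip
      (fun s' hs' => (Hy u hu).2 s' (sub' s' hs')) (fun s' hs' => (Hy u' hu').2 s' (sub' s' hs')).
    rewrite (Hy u hu).1 (Hy u' hu').1 opp_row_mx add_row_mx subrr => H.
    have E : `|row_mx 0 (u - u') : 'rV[R]_(n + n)| = `|u - u'|.
      apply/le_anti/andP; split.
        by apply/norm_row_mx => //; rewrite normr0.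
      have : `|row_mx (0 : 'rV[R]_n) (u - u')| <= `|row_mx (0 : 'rV[R]_n) (u - u')| by [].
      by move=> /(norm_row_mx _ _ (normr_ge0 _))[].
    rewrite E -(hsubmxK (y u s)) -(hsubmxK (y u' s)) !opp_row_mx !add_row_mx in H.
    have {}H : `|rsubmx (y u s) - rsubmx (y u' s) - (u - u')| <=
        2 * K' * `|u - u'| * `|s - 0|.
      have g0 : 0 <= 2 * K' * `|u - u'| * `|s - 0| by rewrite !mulr_ge0.
      by case: ((norm_row_mx _ _ g0).1 H).
    apply: le_trans H _; rewrite subr0 mulrAC ler_wpM2r//.
    have a1 : K' * `|s| <= K' * T by rewrite ler_wpM2l// ltW.
    have a2 : 4 * (K' * T) <= 1 by move: KT4; rewrite -mulrA mulrDl mul1r; lra.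
    by rewrite -mulrA; lra.
  have Dd (s : R) : `|s - 0| <= `|tau - 0| -> is_derive s (1 : R)
      (fun s => lsubmx (y u s) - lsubmx (y u' s) - s *: (u - u'))
      (rsubmx (y u s) - rsubmx (y u' s) - (u - u')).
    move=> /sub hs; have [_ _ d1 _] := D u hu s hs; have [_ _ d2 _] := D u' hu' s hs.
    apply: (is_derive_subf (is_derive_subf d1 d2)).
    have := is_derive_scaler (is_derive_id s (1 : R)) (is_derive_cst (u - u') s (1 : R)).
    by rewrite scaler0 addr0 scale1r.
  have := mean_value_ineq Dd v_dep.
  rewrite (Hy u hu).1 (Hy u' hu').1 !row_mxKl subrr scale0r !subr0.
  by rewrite (gtr0_norm tau0).
have x00 : x 0 = p.
  have n0 : `|0 : 'rV[R]_n| <= r / 2 by rewrite normr0.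
  have cd (s : R) : `|s - 0| <= `|tau - 0| ->
      `|(fun _ : R => c) s - c| <= r /\ is_derive s (1 : R) (fun _ : R => c) (F c).
    by move=> _; split; [rewrite subrr normr0 ltW|rewrite F0; exact: is_derive_cst].
  have := @flow_dependence _ F c r K' 0 tau (y 0) (fun=> c) K'0 (Kt tau ttau) F_lip
    (fun s' hs' => (Hy 0 n0).2 s' (sub s' hs')) cd.
  rewrite (Hy 0 n0).1 subrr normr0 subr0 mulr0 mul0r normr_le0 subr_eq0 => /eqP.
  by rewrite /x => ->; rewrite row_mxKl.
have rr : 0 < r / 2 by rewrite divr_gt0.
(* A fixed point of [Phi] is an initial velocity that hits [q]. The solution with u = 0 rests at
   [p], by [A0], which bounds [Phi 0] by r/4. *)
pose Phi u := u - tau^-1 *: (x u - q).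
have tn : tau != 0 by rewrite lt0r_neq0.
have contr u u' : `|u| <= r / 2 -> `|u'| <= r / 2 ->
    `|Phi u - Phi u'| <= 2^-1 * `|u - u'|.
  move=> hu hu'.
  have -> : Phi u - Phi u' = - (tau^-1 *: (x u - x u' - tau *: (u - u'))).
    rewrite [tau^-1 *: (_ - tau *: _)]scalerBr [tau^-1 *: (tau *: _)]scalerA.
    rewrite mulVf// scale1r /Phi; apply/rowP => j; rewrite !mxE; ring.
  rewrite normrN normrZ normfV (gtr0_norm tau0) ler_pdivrMl// mulrC; exact: dep.
have n0 : `|0 : 'rV[R]_n| <= r / 2 by rewrite normr0.
have [u|u hu] := contraction_fixed_point r2 _ contr; last first.
  rewrite /Phi => /eqP; rewrite -subr_eq0 addrAC subrr sub0r oppr_eq0.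
  rewrite scaler_eq0 invr_eq0 (negbTE tn) subr_eq0 => /eqP xu.
  by exists u.
move=> hu; rewrite -(subrK (Phi 0) (Phi u)); apply: le_trans (ler_normD _ _) _.
have h1 := contr u 0 hu n0; rewrite subr0 in h1.
have h2 : `|Phi 0| <= r / 4.
  rewrite /Phi x00 sub0r normrN normrZ normfV (gtr0_norm tau0) ler_pdivrMl//.
  by rewrite distrC.
by lra.
Qed.

End SecondOrder.
End LocalFlow.

(** * Clifford algebra *)

Notation eta := Defs.eta.

Section RealCliffordAction.
Context {R : realType} {n N : nat}.
Variable c : 'I_n -> 'M[R]_N.
Hypothesis cc : forall k l, c k *m c l + c l *m c k = (- 2 * eta k l)%:M.

Definition mink (x y : 'rV[R]_n) : R := \sum_k eps k * x 0 k * y 0 k.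

Definition cl (x : 'rV[R]_n) : 'M[R]_N := \sum_k x 0 k *: c k.

(** The spin representation of the Lie algebra of skew matrices, for matrices acting on row vectors
    from the right; therefore [sp_comm] reverses the order of the products. The factor 1/4, in place
    of 1/2, counts each pair of generators twice. *)
Definition sp (A : 'M[R]_n) : 'M[R]_N :=
  4^-1 *: \sum_k \sum_l (eps k * A k l) *: (c k *m c l).

(** Infinitesimal isometries of [eta], acting on row vectors. *)
Definition eta_skew (A : 'M[R]_n) := forall k l, A k l * eps l = - (A l k * eps k).

Lemma etaE (k l : 'I_n) : eta k l = (eps k *+ (k == l) : R).
Proof. by rewrite /eta !mxE. Qed.

Lemma eps_sq (k : 'I_n) : eps k * eps k = 1 :> R.
Proof. by rewrite /eps; case: ifP; rewrite ?mulrNN mulr1. Qed.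

Lemma sum_eta (V : lmodType R) (f : 'I_n -> V) k :
  \sum_l (eta l k : R) *: f l = eps k *: f k.
Proof.
rewrite (bigD1 k)//= etaE eqxx mulr1n big1 ?addr0// => l lk.
by rewrite etaE (negbTE lk) scale0r.
Qed.

Lemma cl_is_linear : linear cl.
Proof.
move=> a x y; rewrite /cl scaler_sumr -big_split/=; apply: eq_bigr => k _.
by rewrite !mxE scalerDl scalerA.
Qed.
HB.instance Definition _ := GRing.isLinear.Build R 'rV[R]_n 'M[R]_N *:%R cl cl_is_linear.

Lemma cl_delta k : cl (delta_mx 0 k) = c k.
Proof.
rewrite /cl (bigD1 k)//= mxE !eqxx scale1r big1 ?addr0// => l lk.
by rewrite mxE (negbTE lk) andbF scale0r.
Qed.

Lemma minkC x y : mink x y = mink y x.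
Proof. by apply: eq_bigr => k _; rewrite mulrAC. Qed.

Lemma minkE x y : (x *m eta *m y^T) 0 0 = mink x y.
Proof.
rewrite mxE; apply: eq_bigr => k _; rewrite !mxE; congr (_ * _).
rewrite (bigD1 k)//= etaE eqxx mulrC big1 ?addr0// => l lk.
by rewrite etaE (negbTE lk) mulr0.
Qed.

Lemma mink_delta x k : mink x (delta_mx 0 k) = eps k * x 0 k.
Proof.
rewrite /mink (bigD1 k)//= mxE !eqxx mulr1 big1 ?addr0// => l lk.
by rewrite mxE (negbTE lk) mulr0.
Qed.

Lemma minkDl x y z : mink (x + y) z = mink x z + mink y z.
Proof. by rewrite -big_split; apply: eq_bigr => k _; rewrite mxE mulrDr mulrDl. Qed.

Lemma minkZl a x y : mink (a *: x) y = a * mink x y.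
Proof. by rewrite /mink mulr_sumr; apply: eq_bigr => k _; rewrite mxE; ring. Qed.

Lemma mink_eq0 x : (forall y, mink x y = 0) -> x = 0.
Proof.
move=> H; apply/rowP => k; rewrite mxE; have := H (delta_mx 0 k).
rewrite mink_delta => /(congr1 (fun a => eps k * a)).
by rewrite mulrA eps_sq mul1r mulr0.
Qed.

Lemma cl_anti x y : cl x *m cl y + cl y *m cl x = (- 2 * mink x y)%:M.
Proof.
have E : cl x *m cl y + cl y *m cl x =
    \sum_k \sum_l (x 0 k * y 0 l) *: (c k *m c l + c l *m c k).
  rewrite {1 4}/cl mulmx_suml mulmx_sumr -big_split/=; apply: eq_bigr => k _.
  rewrite /cl mulmx_sumr mulmx_suml -big_split/=; apply: eq_bigr => l _.
  by rewrite -!scalemxAl -!scalemxAr !scalerA scalerDr [y 0 l * _]mulrC.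
rewrite E /mink mulr_sumr raddf_sum; apply: eq_bigr => k _ /=.
rewrite (bigD1 k)//= big1 => [|l lk].
  by rewrite addr0 cc etaE eqxx mulr1n scale_scalar_mx; congr (_%:M); ring.
by rewrite cc etaE eq_sym (negbTE lk) mulr0 scale_scalar_mx mulr0 raddf0.
Qed.

Lemma cl_sq x : cl x *m cl x = (- mink x x)%:M.
Proof.
have two : (2 : R) != 0 by rewrite pnatr_eq0.
apply: (scalerI two); rewrite scaler_nat mulr2n cl_anti scale_scalar_mx.
by congr (_%:M); ring.
Qed.

Lemma cl_swap x y : cl x *m cl y = - (cl y *m cl x) + (- 2 * mink x y)%:M.
Proof. by rewrite -cl_anti addrC addrK. Qed.

Lemma cl_sandwich x y : cl x *m cl y *m cl x =
  mink x x *: cl y - (2 * mink x y) *: cl x.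
Proof.
rewrite cl_swap mulmxDl mulNmx -mulmxA cl_sq mul_mx_scalar mul_scalar_mx.
by rewrite scaleNr opprK mulNr scaleNr.
Qed.

Lemma ccc k l m : c k *m c l *m c m - c m *m (c k *m c l) =
  (2 * eta k m) *: c l - (2 * eta l m) *: c k.
Proof.
have E a b : c a *m c b = - (c b *m c a) - (2 * eta a b)%:M.
  by rewrite -[LHS](addrK (c b *m c a)) cc addrC mulNr raddfN.
rewrite -mulmxA (E l m) mulmxBr mulmxN [c k *m (c m *m _)]mulmxA (E k m) mulmxBl mulNmx.
rewrite mul_mx_scalar mul_scalar_mx opprB opprK mulmxA.
by rewrite -!addrA [- _ + - _]addrC !addrA addrK.
Qed.

Lemma sp_is_linear : linear sp.
Proof.
move=> a A B; rewrite /sp scalerA mulrC -scalerA -scalerDr; congr (_ *: _).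
rewrite scaler_sumr -big_split; apply: eq_bigr => k _ /=.
rewrite scaler_sumr -big_split; apply: eq_bigr => l _ /=.
by rewrite !mxE scalerA -scalerDl; congr (_ *: _); ring.
Qed.
HB.instance Definition _ := GRing.isLinear.Build R 'M[R]_n 'M[R]_N *:%R sp sp_is_linear.

Lemma sp_gen A m : eta_skew A -> sp A *m c m - c m *m sp A = cl (row m A).
Proof.
move=> sA; rewrite /sp -scalemxAl -scalemxAr -scalerBr mulmx_suml mulmx_sumr -sumrB.
have E k : (\sum_l (eps k * A k l) *: (c k *m c l)) *m c m -
    c m *m (\sum_l (eps k * A k l) *: (c k *m c l)) =
    \sum_l (2 * eps k * eta k m * A k l) *: c l - (2 * eps k * A k m * eps m) *: c k.
  rewrite mulmx_suml mulmx_sumr -sumrB.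
  transitivity (\sum_l ((2 * eps k * eta k m * A k l) *: c l -
      (eta l m) *: ((2 * eps k * A k l) *: c k))).
    apply: eq_bigr => l _; rewrite -scalemxAl -scalemxAr -scalerBr ccc.
    by rewrite scalerBr !scalerA; congr (_ *: _ - _ *: _); ring.
  rewrite sumrB (sum_eta (fun l => (2 * eps k * A k l) *: c k)) scalerA.
  by congr (_ - _ *: _); ring.
under eq_bigr => k _ do rewrite E.
rewrite sumrB exchange_big/=.
have -> : \sum_l \sum_k (2 * eps k * eta k m * A k l) *: c l = 2 *: cl (row m A).
  rewrite /cl scaler_sumr; apply: eq_bigr => l _; rewrite mxE.
  transitivity (\sum_k (eta k m) *: ((2 * eps k * A k l) *: c l)).
    by apply: eq_bigr => k _; rewrite scalerA; congr (_ *: _); ring.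
  rewrite (sum_eta (fun k => (2 * eps k * A k l) *: c l)) !scalerA.
  congr (_ *: _); transitivity (2 * (eps m * eps m) * A m l); first by ring.
  by rewrite eps_sq; ring.
have -> : \sum_k (2 * eps k * A k m * eps m) *: c k = - 2 *: cl (row m A).
  rewrite /cl scaler_sumr; apply: eq_bigr => k _; rewrite mxE scalerA.
  congr (_ *: _); rewrite -mulrA sA.
  transitivity (- 2 * A m k * (eps k * eps k)); first by ring.
  by rewrite eps_sq; ring.
by rewrite scaleNr opprK -scalerDl scalerA -natrD mulVf ?pnatr_eq0// scale1r.
Qed.

Lemma sp_cl A y : eta_skew A -> sp A *m cl y = cl y *m sp A + cl (y *m A).
Proof.
move=> sA; apply/eqP; rewrite addrC -subr_eq; apply/eqP.
rewrite {1 2}/cl mulmx_suml mulmx_sumr -sumrB.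
transitivity (\sum_k y 0 k *: cl (row k A)).
  by apply: eq_bigr => k _; rewrite -scalemxAl -scalemxAr -scalerBr sp_gen.
rewrite mulmx_sum_row linear_sum; apply: eq_bigr => k _; by rewrite linearZ.
Qed.

(** Commutation with [sp A] is a derivation, so [sp_gen] gives its value on each product
    [c k *m c l]; the skewness of [A] then moves its matrix to the side of [B] on which it acts. *)
Lemma sp_comm A B : eta_skew A -> eta_skew B ->
  sp A *m sp B - sp B *m sp A = sp (B *m A - A *m B).
Proof.
move=> sA sB.
have E k l : sp A *m (c k *m c l) - (c k *m c l) *m sp A =
    cl (row k A) *m c l + c k *m cl (row l A).
  rewrite -!sp_gen// mulmxBl mulmxBr !mulmxA.
  by rewrite addrA subrK.
have sA' k m : eps k * A k m = - (eps m * A m k).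
  have /(congr1 (fun r => eps k * eps m * r)) := sA k m.
  rewrite (_ : _ * (A k m * _) = eps k * A k m * (eps m * eps m)); last by ring.
  rewrite (_ : _ * - _ = - (eps m * A m k * (eps k * eps k))); last by ring.
  by rewrite !eps_sq !mulr1.
have spB : sp B = 4^-1 *: \sum_k \sum_l (eps k * B k l) *: (c k *m c l) by [].
rewrite spB; move: (sp A) E => P E; rewrite -scalemxAr -scalemxAl -scalerBr.
rewrite mulmx_suml mulmx_sumr -sumrB /sp; congr (_ *: _).
transitivity (\sum_k \sum_l ((eps k * B k l) *: (cl (row k A) *m c l) +
    (eps k * B k l) *: (c k *m cl (row l A)))).
  apply: eq_bigr => k _; rewrite mulmx_suml mulmx_sumr -sumrB.
  by apply: eq_bigr => l _; rewrite -scalemxAl -scalemxAr -scalerBr E scalerDr.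
under eq_bigr do rewrite big_split.
rewrite big_split/=.
have -> : \sum_k \sum_l (eps k * B k l) *: (c k *m cl (row l A)) =
   \sum_k \sum_m (eps k * (B *m A) k m) *: (c k *m c m).
  apply: eq_bigr => k _.
  under eq_bigr => l _ do rewrite /cl mulmx_sumr scaler_sumr.
  rewrite exchange_big; apply: eq_bigr => m _.
  rewrite mxE mulr_sumr scaler_suml; apply: eq_bigr => l _.
  by rewrite mxE -scalemxAr scalerA mulrA.
have -> : \sum_k \sum_l (eps k * B k l) *: (cl (row k A) *m c l) =
   \sum_m \sum_l (- (eps m * (A *m B) m l)) *: (c m *m c l).
  under eq_bigr => k _.
    under eq_bigr => l _ do rewrite /cl mulmx_suml scaler_sumr.
    rewrite exchange_big; over.
  rewrite /= exchange_big; apply: eq_bigr => m _.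
  rewrite exchange_big; apply: eq_bigr => l _.
  rewrite mxE mulr_sumr -sumrN scaler_suml; apply: eq_bigr => k _.
  rewrite mxE -scalemxAl scalerA; congr (_ *: _).
  by rewrite mulrAC sA'; ring.
rewrite -big_split; apply: eq_bigr => k _; rewrite -big_split; apply: eq_bigr => l _.
by rewrite /= -scalerDl !mxE; congr (_ *: _); ring.
Qed.

End RealCliffordAction.

Section MinkowskiProduct.
Context {R : realType} {n : nat}.
Implicit Types x y z : 'rV[R]_n.

Lemma mink0l y : mink 0 y = 0.
Proof. by rewrite /mink big1// => k _; rewrite mxE mulr0 mul0r. Qed.

Lemma minkNl x y : mink (- x) y = - mink x y.
Proof. by rewrite -scaleN1r minkZl mulN1r. Qed.

Lemma minkBl x y z : mink (x - y) z = mink x z - mink y z.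
Proof. by rewrite minkDl minkNl. Qed.

Lemma minkBr x y z : mink x (y - z) = mink x y - mink x z.
Proof. by rewrite minkC minkBl !(minkC x). Qed.

Lemma minkZr a x y : mink x (a *: y) = a * mink x y.
Proof. by rewrite minkC minkZl minkC. Qed.

End MinkowskiProduct.

(** * Causal character of the current of a spinor *)

Section CausalCharacter.
Context {R : realType} {n N : nat}.
Variable c : 'I_n -> 'M[R]_N.
Variable H : 'M[R]_N.
Hypothesis cc : forall k l, c k *m c l + c l *m c k = (- 2 * eta k l)%:M.
Hypothesis H_sym : H^T = H.
Hypothesis H_c : forall k, (c k)^T *m H = H *m c k.
Hypothesis H_pos : forall k : 'I_n, (k = 0 :> nat)%N ->
  forall x : 'cV[R]_N, x != 0 -> 0 < (x^T *m H *m (c k *m x)) 0 0.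
Hypothesis n3 : (3 <= n)%N.

Notation cl := (cl c).
Implicit Types (x y z : 'rV[R]_n) (psi chi : 'cV[R]_N).

Definition hform psi chi : R := (psi^T *m H *m chi) 0 0.

Lemma hformC psi chi : hform psi chi = hform chi psi.
Proof.
have E : psi^T *m H *m chi = (chi^T *m H *m psi)^T.
  by rewrite !trmx_mul trmxK H_sym mulmxA.
by rewrite /hform E [LHS]mxE.
Qed.

Lemma hformDr psi chi chi' : hform psi (chi + chi') = hform psi chi + hform psi chi'.
Proof. by rewrite /hform mulmxDr mxE. Qed.

Lemma hformZr a psi chi : hform psi (a *: chi) = a * hform psi chi.
Proof. by rewrite /hform -scalemxAr mxE. Qed.

Lemma hformNr psi chi : hform psi (- chi) = - hform psi chi.
Proof. by rewrite -scaleN1r hformZr mulN1r. Qed.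

Lemma hformZl a psi chi : hform (a *: psi) chi = a * hform psi chi.
Proof. by rewrite hformC hformZr hformC. Qed.

Lemma hform0r psi : hform psi 0 = 0.
Proof. by rewrite /hform mulmx0 mxE. Qed.

Lemma hform_cl x psi chi : hform (cl x *m psi) chi = hform psi (cl x *m chi).
Proof.
have E : (cl x)^T *m H = H *m cl x.
  rewrite /cl linear_sum mulmx_suml mulmx_sumr; apply: eq_bigr => k _.
  by rewrite linearZ -scalemxAl -scalemxAr H_c.
by rewrite /hform trmx_mul -[_ *m _ *m H]mulmxA E !mulmxA.
Qed.

(** Frame components of the vector V with g(V, x) = <psi, x.psi>. This is minus the Dirac current,
    see [current_lphi]; the causal type is the same. *)
Definition current psi : 'rV[R]_n := \row_k (eps k * hform psi (c k *m psi)).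

Lemma mink_current psi x : mink (current psi) x = hform psi (cl x *m psi).
Proof.
rewrite /cl mulmx_suml /hform mulmx_sumr summxE; apply: eq_bigr => k _.
by rewrite mxE mulrA eps_sq mul1r mulrC -scalemxAl -scalemxAr mxE.
Qed.

Let k0 : 'I_n := Ordinal (ltnW (ltnW n3)).

Let pos0 psi : psi != 0 -> 0 < hform psi (c k0 *m psi).
Proof. exact: H_pos. Qed.

Definition current_sq psi := mink (current psi) (current psi).

Lemma current_neq0 psi : psi != 0 -> current psi != 0.
Proof.
move=> /pos0 h; apply/eqP => E; move: h.
by rewrite -cl_delta -mink_current E mink0l ltxx.
Qed.

(** The positive definite form <., e_0 .> is evaluated on V.psi, with V.e_0.V reduced by
    [cl_sandwich]. Positivity then shows that V is causal, and that V.psi = 0 when V is null. *)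
Lemma current_identity psi :
  hform (cl (current psi) *m psi) (c k0 *m (cl (current psi) *m psi)) =
  - (hform psi (c k0 *m psi) * current_sq psi).
Proof.
rewrite hform_cl -(cl_delta c k0) !mulmxA cl_sandwich// mulmxBl -!scalemxAl.
rewrite hformDr hformNr !hformZr -!mink_current -/(current_sq psi); ring.
Qed.

Lemma current_sq_le0 psi : current_sq psi <= 0.
Proof.
have [->|p0] := eqVneq psi 0.
  by rewrite /current_sq mink_current mulmx0 hform0r.
have [E|E] := eqVneq (cl (current psi) *m psi) 0.
  by rewrite /current_sq mink_current E hform0r.
have := pos0 E; rewrite current_identity oppr_gt0 pmulr_rlt0 ?pos0//.
exact: ltW.
Qed.

Lemma current_annihilates psi : current_sq psi = 0 -> cl (current psi) *m psi = 0.
Proof.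
move=> E; apply/eqP/negPn/negP => /pos0.
by rewrite current_identity E mulr0 oppr0 ltxx.
Qed.

Lemma mink_partner x : x != 0 -> exists y, mink x y != 0.
Proof.
move=> x0; apply: contrapT => Hn; move/eqP : x0; apply.
by apply: mink_eq0 => y; apply/eqP/negPn/negP => h; apply: Hn; exists y.
Qed.

(** From x.x.psi = 0 the vector x is null. With a partner y, psi is a multiple of x.y.psi, and x.z.x
    = -2 g(x,z) x for null x turns <psi, z.psi> into a fixed multiple of g(x,z); so the current is
    proportional to x. *)
Lemma annihilator x psi : cl x *m psi = 0 -> x != 0 -> psi != 0 ->
  [/\ mink x x = 0, current_sq psi = 0 & exists a, x = a *: current psi].
Proof.
move=> E x0 p0.
have xx : mink x x = 0.
  have : cl x *m (cl x *m psi) = 0 by rewrite E mulmx0.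
  rewrite mulmxA cl_sq// mul_scalar_mx => /eqP.
  by rewrite scaler_eq0 (negbTE p0) orbF oppr_eq0 => /eqP.
have [y xy] := mink_partner x0.
have E2 : cl x *m (cl y *m psi) = (- 2 * mink x y) *: psi.
  have := congr1 (fun A => A *m psi) (cl_anti cc x y).
  by rewrite mulmxDl -!mulmxA E mulmx0 addr0 mul_scalar_mx.
have m0 : - 2 * mink x y != 0 by rewrite mulf_neq0// oppr_eq0 pnatr_eq0.
pose b := hform (cl y *m psi) psi / mink x y.
have cE : current psi = b *: x.
  apply/eqP; rewrite -subr_eq0; apply/eqP/mink_eq0 => z.
  rewrite minkBl minkZl mink_current.
  apply: (mulfI m0); apply: (mulfI m0); rewrite !mulr0 mulrBr mulrBr.
  rewrite -hformZr -hformZl scalemxAr -E2 hform_cl !mulmxA cl_sandwich//.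
  rewrite xx scale0r sub0r -!mulmxA mulNmx -scalemxAl hformNr hformZr E2 hformZr.
  rewrite /b; field.
  by [].
have b0 : b != 0.
  by apply/eqP => b0; have := current_neq0 p0; rewrite cE b0 scale0r eqxx.
split=> //; first by rewrite /current_sq cE minkZl minkC minkZl xx !mulr0.
by exists b^-1; rewrite cE scalerA mulVf// scale1r.
Qed.

(** For non-null x this is g(x,x) times the reflection of the current in the hyperplane orthogonal
    to x. *)
Lemma current_cl x psi :
  current (cl x *m psi) = mink x x *: current psi - (2 * mink (current psi) x) *: x.
Proof.
apply/eqP; rewrite -subr_eq0; apply/eqP/mink_eq0 => z.
rewrite !(minkBl, minkZl).
rewrite !mink_current hform_cl !mulmxA cl_sandwich//.
rewrite mulmxBl -!scalemxAl hformDr hformNr !hformZr; ring.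
Qed.

Lemma current_sq_cl x psi : current_sq (cl x *m psi) = mink x x ^+ 2 * current_sq psi.
Proof.
rewrite /current_sq current_cl !(minkBl, minkBr, minkZl, minkZr).
rewrite (minkC x (current _)); ring.
Qed.

Lemma cl_inj_spacelike x psi : mink x x != 0 -> cl x *m psi = 0 -> psi = 0.
Proof.
move=> xx E; have : cl x *m (cl x *m psi) = 0 by rewrite E mulmx0.
rewrite mulmxA cl_sq// mul_scalar_mx => /eqP.
by rewrite scaler_eq0 oppr_eq0 (negbTE xx)/= => /eqP.
Qed.

(** Dimension at least 3 provides two spacelike basis vectors, and the plane spanned by them
    contains a non-zero vector orthogonal to x. *)
Lemma spacelike_orthogonal x : exists y, mink x y = 0 /\ mink y y != 0.
Proof.
pose i1 : 'I_n := Ordinal (ltnW n3); pose i2 : 'I_n := Ordinal n3.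
have e1 : eps i1 = 1 :> R by []. have e2 : eps i2 = 1 :> R by [].
have [x1|x1] := eqVneq (x 0 i1) 0.
  exists (delta_mx 0 i1); rewrite !mink_delta x1 mulr0; split=> //.
  by rewrite mxE !eqxx e1 mulr1 oner_neq0.
exists (x 0 i2 *: delta_mx 0 i1 - x 0 i1 *: delta_mx 0 i2); split.
  rewrite minkBr !minkZr !mink_delta e1 e2; ring.
rewrite !(minkBl, minkBr, minkZl, minkZr).
rewrite !mink_delta !mxE !eqxx/= e1 e2 !(mul1r, mulr1, mulr0, mulr0n, subr0, sub0r, mulrN, opprK).
rewrite gt_eqF// ltr_wpDl//; first by rewrite -expr2 sqr_ge0.
by rewrite -expr2 exprn_even_gt0.
Qed.

(* The difference of two candidates for chi, written in different
   trivialisations; it vanishes wherever the current is null. *)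
Lemma gauge_difference_zero (Z : 'rV[R]_n -> 'M[R]_N) psi delta :
  (forall v w, Z v *m cl w = cl w *m Z v) ->
  (forall v, Z v *m psi = cl v *m delta) ->
  current_sq psi = 0 -> delta = 0.
Proof.
move=> Zc Zd f0.
have [p0|p0] := eqVneq psi 0.
  have [y [_ yy]] := spacelike_orthogonal 0.
  by apply: (cl_inj_spacelike yy); rewrite -Zd p0 mulmx0.
have V0 := current_neq0 p0; set V := current psi in V0.
have VE : cl V *m psi = 0 := current_annihilates f0.
have Vv v : cl V *m (cl v *m delta) = 0.
  by rewrite -Zd mulmxA -Zc -mulmxA VE mulmx0.
have vV v : cl v *m (cl V *m delta) = (- 2 * mink V v) *: delta.
  have := congr1 (fun A => A *m delta) (cl_anti cc V v).
  by rewrite mulmxDl -!mulmxA Vv add0r mul_scalar_mx.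
have [y [Vy yy]] := spacelike_orthogonal V.
have Vd : cl V *m delta = 0.
  by apply: (cl_inj_spacelike yy); rewrite vV Vy mulr0 scale0r.
have [z Vz] := mink_partner V0.
have /eqP := vV z; rewrite Vd mulmx0 eq_sym scaler_eq0 mulf_eq0 (negbTE Vz).
by rewrite oppr_eq0 pnatr_eq0/= => /eqP.
Qed.

End CausalCharacter.

(** The pair symmetry of a curvature tensor, from both antisymmetries and a combination of four
    instances of the first Bianchi identity. *)
Lemma pair_symmetry (R : realType) (I : Type) (r : I -> I -> I -> I -> R) :
  (forall a b x d, r b a x d = - r a b x d) ->
  (forall a b x d, r a b d x = - r a b x d) ->
  (forall a b x d, r a b x d + r b x a d + r x a b d = 0) ->
  forall a b x d, r a b x d = r x d a b.
Proof.
move=> s12 s34 bi a b x d.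
have := bi a b x d; have := bi b x d a; have := bi x d a b; have := bi d a b x.
rewrite (s34 b x a d) (s34 x d a b) (s34 a b x d) (s34 d a x b).
rewrite (s12 d b a x) (s34 d b x a) (s12 x a d b) (s34 x a b d).
lra.
Qed.

(** * Spin curvature and the Schouten tensor *)

Section CliffordCurvature.
Context {R : realType} {n N : nat}.
Variable c : 'I_n -> 'M[R]_N.
Hypothesis cc : forall k l, c k *m c l + c l *m c k = (- 2 * eta k l)%:M.
Hypothesis n3 : (3 <= n)%N.

Lemma sum_eta2 (V : lmodType R) (f : 'I_n -> V) k :
  \sum_l (eta k l : R) *: f l = eps k *: f k.
Proof.
rewrite -sum_eta; apply: eq_bigr => l _; rewrite !etaE eq_sym.
by case: eqP => [->|].
Qed.

Lemma sum3D (V : zmodType) (f g : 'I_n -> 'I_n -> 'I_n -> V) :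
  \sum_a \sum_x \sum_d (f a x d + g a x d) =
  \sum_a \sum_x \sum_d f a x d + \sum_a \sum_x \sum_d g a x d.
Proof.
rewrite -big_split; apply: eq_bigr => a _; rewrite -big_split; apply: eq_bigr => x _.
exact: big_split.
Qed.

Lemma sum3Z (V : lmodType R) (k : R) (f : 'I_n -> 'I_n -> 'I_n -> V) :
  \sum_a \sum_x \sum_d k *: f a x d = k *: \sum_a \sum_x \sum_d f a x d.
Proof.
rewrite scaler_sumr; apply: eq_bigr => a _; rewrite scaler_sumr; apply: eq_bigr => x _.
by rewrite scaler_sumr.
Qed.

Lemma sum3_rot (V : zmodType) (f : 'I_n -> 'I_n -> 'I_n -> V) :
  \sum_a \sum_x \sum_d f a x d = \sum_a \sum_x \sum_d f d a x.
Proof.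
under [RHS]eq_bigr => a _ do rewrite exchange_big.
by rewrite [RHS]exchange_big.
Qed.

(** Moving one generator past the other two turns the cubic sum X into its cyclic rotations, up to
    multiples of the contraction Y. The three rotations add up to 0 by the cyclic identity, whence 3
    X + 6 Y = 0. *)
Lemma cyclic_cubic (w : 'I_n -> 'I_n -> 'I_n -> R) :
  (forall a x d, w a d x = - w a x d) ->
  (forall a x d, w a x d + w d a x + w x d a = 0) ->
  \sum_a \sum_x \sum_d w a x d *: (c a *m c x *m c d) =
  - 2 *: \sum_d (\sum_a eps a * w a a d) *: c d.
Proof.
move=> sk cy.
set X := LHS; set Y := \sum_d _.
have etaC (a b : 'I_n) : eta a b = eta b a :> R.
  by rewrite !etaE eq_sym; case: eqP => [->|].
have YE : \sum_a \sum_x \sum_d (w a x d * eta a x) *: c d = Y.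
  rewrite /Y; under [RHS]eq_bigr => d _ do rewrite scaler_suml.
  rewrite [RHS]exchange_big; apply: eq_bigr => a _.
  rewrite exchange_big; apply: eq_bigr => d _.
  rewrite -scalerA -(sum_eta2 (fun x => w a x d *: c d)).
  by apply: eq_bigr => x _; rewrite scalerA mulrC.
have YE' : \sum_a \sum_x \sum_d (w a x d * eta a d) *: c x = - Y.
  rewrite -YE -sumrN; apply: eq_bigr => a _; rewrite exchange_big -sumrN.
  apply: eq_bigr => d _; rewrite -sumrN; apply: eq_bigr => x _.
  by rewrite sk mulNr scaleNr.
have Z0 : \sum_a \sum_x \sum_d (w a x d * eta x d) *: c a = 0.
  rewrite big1// => a _; set S := \sum_x _; have : S = - S.
    rewrite {1}/S exchange_big -sumrN; apply: eq_bigr => x _; rewrite -sumrN.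
    by apply: eq_bigr => d _; rewrite sk -scaleNr -mulNr etaC.
  move=> /eqP; rewrite -subr_eq0 opprK -mulr2n -scaler_nat scaler_eq0 pnatr_eq0.
  by move=> /eqP.
have S1 : \sum_a \sum_x \sum_d w a x d *: (c x *m c d *m c a) = X + 4 *: Y.
  transitivity (\sum_a \sum_x \sum_d (w a x d *: (c a *m c x *m c d) +
     (2 *: ((w a x d * eta a x) *: c d) + (- 2) *: ((w a x d * eta a d) *: c x)))).
    apply: eq_bigr => a _; apply: eq_bigr => x _; apply: eq_bigr => d _.
    have /eqP := ccc cc x d a; rewrite subr_eq => /eqP ->.
    rewrite scalerDr scalerBr !scalerA addrC mulmxA -scaleNr (etaC x a) (etaC d a).
    by congr (_ + (_ *: _ + _ *: _)); ring.
  rewrite !sum3D !sum3Z YE YE' scalerN scaleNr opprK -scalerDl; congr (_ + _ *: _).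
  ring.
have S2 : \sum_a \sum_x \sum_d w a x d *: (c d *m c a *m c x) = X + 2 *: Y.
  transitivity (\sum_a \sum_x \sum_d (w a x d *: (c a *m c x *m c d) +
     ((- 2) *: ((w a x d * eta a d) *: c x) + 2 *: ((w a x d * eta x d) *: c a)))).
    apply: eq_bigr => a _; apply: eq_bigr => x _; apply: eq_bigr => d _.
    have := ccc cc a x d => /(congr1 (fun A => c a *m c x *m c d - A)).
    rewrite opprB addrCA subrr addr0 mulmxA => ->.
    move: (c a *m c x *m c d) (eta a d : R) (eta x d : R) => A e1 e2.
    by apply/matrixP => i j; rewrite !mxE; ring.
  by rewrite !sum3D !sum3Z YE' Z0 scaler0 addr0 scalerN scaleNr opprK.
have : X + (X + 4 *: Y) + (X + 2 *: Y) = 0.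
  rewrite -S1 -S2 (sum3_rot (fun a x d => w a x d *: (c x *m c d *m c a))) /=.
  rewrite (sum3_rot (fun a x d => w a x d *: (c d *m c a *m c x))) /=.
  rewrite (sum3_rot (fun a x d => w d a x *: (c x *m c d *m c a))) /=.
  rewrite -!sum3D big1// => a _; rewrite big1// => x _; rewrite big1// => d _.
  by rewrite -!scalerDl cy scale0r.
move: X Y {YE YE' S1 S2} => X Y E; apply/matrixP => i j.
by have := congr1 (fun A : 'M[R]_N => A i j) E; rewrite !mxE; lra.
Qed.

Lemma symmetric_quadratic (s : 'I_n -> 'I_n -> R) :
  (forall b d, s b d = s d b) ->
  \sum_b \sum_d s b d *: (c b *m c d) = (- \sum_b eps b * s b b)%:M.
Proof.
move=> sC; set X := LHS.
have E : X + X = (- 2 * \sum_b eps b * s b b)%:M.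
  rewrite {2}/X exchange_big /X -big_split mulr_sumr raddf_sum; apply: eq_bigr => b _ /=.
  rewrite -big_split (bigD1 b)//= big1 => [|d db].
    rewrite addr0 -scalerDr cc etaE eqxx mulr1n scale_scalar_mx; congr (_%:M); ring.
  by rewrite sC -scalerDr cc etaE eq_sym (negbTE db) mulr0 scale_scalar_mx mulr0 raddf0.
apply: (@scalerI _ _ (2 : R)); first by rewrite pnatr_eq0.
by rewrite scaler_nat mulr2n E scale_scalar_mx; congr (_%:M); ring.
Qed.

Variables (Rm : 'I_n -> 'I_n -> 'M[R]_n) (T : 'I_n -> 'cV[R]_N) (phi : 'cV[R]_N).
Hypothesis Rm_skew : forall a b, eta_skew (Rm a b).
Hypothesis Rm_anti : forall a b, Rm b a = - Rm a b.
Hypothesis Rm_bianchi : forall a b x d, Rm a b x d + Rm b x a d + Rm x a b d = 0.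
Hypothesis Rm_T : forall a b, sp c (Rm a b) *m phi = c b *m T a - c a *m T b.

Definition ricci (b d : 'I_n) : R := \sum_a eps a * (Rm a b a d * eps d).

Definition scalar_curv : R := \sum_b eps b * ricci b b.

(** Half the Schouten tensor, up to the sign convention of the curvature, with the second index
    raised. *)
Definition schouten (b : 'I_n) : 'rV[R]_n :=
  \row_d ((n%:R - 2)^-1 * (scalar_curv / (4 * (n%:R - 1)) * (b == d)%:R
          - 2^-1 * eps d * ricci b d)).

Lemma Rm_pair a b x d : Rm a b x d * eps d = Rm x d a b * eps b.
Proof.
apply: (pair_symmetry (r := fun a b x d => Rm a b x d * eps d)) => {}a {}b {}x {}d.
- by rewrite (Rm_anti a b) mxE mulNr.
- exact: Rm_skew.
- by rewrite -!mulrDl Rm_bianchi mul0r.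
Qed.

Lemma ricci_sym b d : ricci b d = ricci d b.
Proof. by apply: eq_bigr => a _; rewrite Rm_pair. Qed.

(** The pair symmetry puts the Bianchi identity into the cyclic form that [cyclic_cubic] asks for,
    so the cubic Clifford term collapses to a Ricci contraction. *)
Lemma contracted_curvature b : \sum_a eps a *: (c a *m sp c (Rm a b)) =
  cl c (\row_d (- 2^-1 * eps d * ricci b d)).
Proof.
pose w a x d := eps a * eps x * eps d * (Rm a b x d * eps d).
transitivity (4^-1 *: \sum_a \sum_x \sum_d w a x d *: (c a *m c x *m c d)).
  rewrite scaler_sumr; apply: eq_bigr => a _; rewrite /sp -scalemxAr scalerA mulrC -scalerA.
  congr (_ *: _); rewrite mulmx_sumr scaler_sumr; apply: eq_bigr => x _.
  rewrite mulmx_sumr scaler_sumr; apply: eq_bigr => d _.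
  rewrite -scalemxAr scalerA mulmxA; congr (_ *: _); rewrite /w.
  transitivity (eps a * eps x * Rm a b x d * (eps d * eps d)); last by ring.
  by rewrite eps_sq; ring.
rewrite cyclic_cubic; first last.
- move=> a x d; rewrite /w (Rm_pair a b x d) (Rm_pair d b a x) (Rm_pair x b d a).
  transitivity (eps a * eps x * eps d * eps b * (Rm x d a b + Rm d a x b + Rm a x d b)).
    ring.
  by rewrite Rm_bianchi mulr0.
- by move=> a x d; rewrite /w (Rm_skew a b d x); ring.
rewrite scalerA /cl scaler_sumr; apply: eq_bigr => d _; rewrite mxE scalerA.
congr (_ *: _); rewrite /ricci mulr_sumr mulr_sumr; apply: eq_bigr => a _; rewrite /w.
transitivity (4^-1 * - 2 * (eps a * eps a * eps a * (eps d * (Rm a b a d * eps d)))).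
  ring.
by rewrite eps_sq; field.
Qed.

Let c_sq a : c a *m c a = (- eps a)%:M.
Proof. by have := cl_sq cc (delta_mx 0 a); rewrite cl_delta mink_delta mxE !eqxx mulr1. Qed.

Lemma sum_const (v : 'cV[R]_N) : \sum_(a < n) v = n%:R *: v.
Proof. by rewrite sumr_const card_ord scaler_nat. Qed.

(** Contracting [Rm_T] with [c a] expresses (n - 2) T through the Ricci term and the trace D of T; a
    second contraction determines D from the scalar curvature, with the factor n - 1. Both factors
    are invertible for n >= 3. *)
Theorem clifford_curvature_vector b : T b = cl c (schouten b) *m phi.
Proof.
pose D := \sum_a eps a *: (c a *m T a).
pose q d := \row_e (- 2^-1 * eps e * ricci d e) : 'rV[R]_n.
have n2 : (n%:R - 2 : R) != 0 by rewrite subr_eq0 eqr_nat gtn_eqF.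
have n1 : (n%:R - 1 : R) != 0 by rewrite subr_eq0 (eqr_nat R n 1) gtn_eqF// ltnW.
have key d : cl c (q d) *m phi = (n%:R - 2) *: T d - c d *m D.
  rewrite -contracted_curvature mulmx_suml.
  transitivity (\sum_a (- (c d *m (eps a *: (c a *m T a))) - 2 *: ((eta a d : R) *: (eps a *: T a)) + T d)).
    apply: eq_bigr => a _; rewrite -scalemxAl -mulmxA Rm_T mulmxBr !mulmxA c_sq.
    rewrite mul_scalar_mx scaleNr opprK scalerDr [eps a *: (eps a *: T d)]scalerA.
    rewrite eps_sq scale1r; congr (_ + _).
    have -> : c a *m c d = (- 2 * eta a d)%:M - c d *m c a by rewrite -cc addrK.
    rewrite mulmxBl mul_scalar_mx scalerBr -scalemxAr mulmxA.
    rewrite !scalerA; apply/matrixP => i j.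
    by move: (c d *m c a *m T a) => A; rewrite !mxE; ring.
  rewrite big_split sumrB sumrN sum_const -scaler_sumr sum_eta [eps d *: (eps d *: _)]scalerA.
  rewrite eps_sq scale1r.
  rewrite -mulmx_sumr -/D /=; move: (c d *m D) => A.
  by apply/matrixP => i j; rewrite !mxE; ring.
have DE : D = (scalar_curv / (4 * (n%:R - 1))) *: phi.
  have E : \sum_d eps d *: (c d *m (cl c (q d) *m phi)) = (2^-1 * scalar_curv) *: phi.
    transitivity ((\sum_b \sum_d (- 2^-1 * eps b * eps d * ricci b d) *: (c b *m c d)) *m phi).
      rewrite mulmx_suml; apply: eq_bigr => d _; rewrite mulmxA scalemxAl; congr (_ *m _).
      rewrite /cl mulmx_sumr scaler_sumr; apply: eq_bigr => e _.
      by rewrite mxE -scalemxAr scalerA; congr (_ *: _); ring.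
    rewrite symmetric_quadratic => [|d e]; last by rewrite ricci_sym; ring.
    rewrite mul_scalar_mx; congr (_ *: _); rewrite /scalar_curv -sumrN mulr_sumr.
    apply: eq_bigr => d _.
    transitivity (2^-1 * (eps d * eps d) * (eps d * ricci d d)); first by ring.
    by rewrite eps_sq mulr1.
  have {}E : (2 * (n%:R - 1)) *: D = (2^-1 * scalar_curv) *: phi.
    rewrite -E; transitivity (\sum_d ((n%:R - 2) *: (eps d *: (c d *m T d)) + D)).
      rewrite big_split -scaler_sumr -/D /= sum_const -scalerDl; congr (_ *: _); ring.
    apply: eq_bigr => d _; rewrite key mulmxBr -scalemxAr !mulmxA c_sq mul_scalar_mx.
    by rewrite scaleNr opprK scalerDr !scalerA eps_sq scale1r [eps d * _]mulrC.
  apply: (@scalerI _ _ (2 * (n%:R - 1) : R)); first by rewrite mulf_neq0// pnatr_eq0.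
  by rewrite E scalerA; congr (_ *: _); field.
apply: (scalerI n2); have /eqP := key b; rewrite eq_sym subr_eq => /eqP ->.
have -> : schouten b = (n%:R - 2)^-1 *:
    (q b + (scalar_curv / (4 * (n%:R - 1))) *: delta_mx 0 b).
  apply/rowP => d; rewrite !mxE eqxx/= eq_sym; congr (_ * _); ring.
rewrite linearZ /= -scalemxAl scalerA mulfV// scale1r linearD linearZ /= cl_delta.
by rewrite DE mulmxDl -scalemxAl -scalemxAr.
Qed.

End CliffordCurvature.

(** * A cubic spinor invariant and its symmetries *)

Section CliffordFamily.
Context {R : realType} {m q : nat}.
Variables (Gam : 'I_q -> 'M[R]_m) (kap' : 'M[R]_q) (B : 'M[R]_m).
Implicit Types (P Q : 'cV[R]_m) (X : 'M[R]_m).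

Definition tri2 A C P Q : R := (P^T *m B *m (Gam A *m Gam C *m Q)) 0 0.

(** Here [kap'] stands for the inverse Gram matrix of the vectors represented by [Gam]. The three
    spinor arguments are kept apart so that [planar] can be differentiated by the product rule. *)
Definition tri A P Q P' : 'cV[R]_m :=
  \sum_C \sum_D (tri2 A C P Q * kap' C D) *: (Gam D *m P').

(* Contraction of the bilinear [<Gam_A Gam_B P, P>] with Clifford
   multiplication on P; it vanishes on the spinors annihilated by a totally
   null 2-plane. *)
Definition planar A P := tri A P P P.

Definition sand P (M : 'M[R]_m) : R := (P^T *m B *m M *m P) 0 0.

Lemma sandB P M M' : sand P (M - M') = sand P M - sand P M'.
Proof. by rewrite /sand mulmxBr mulmxBl !mxE. Qed.

Lemma sand_sum P (f : 'I_q -> R) (M : 'I_q -> 'M[R]_m) :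
  sand P (\sum_D f D *: M D) = \sum_D f D * sand P (M D).
Proof.
rewrite /sand mulmx_sumr mulmx_suml summxE; apply: eq_bigr => D _.
by rewrite -scalemxAr -scalemxAl mxE.
Qed.

Lemma tri2_sand A C P : tri2 A C P P = sand P (Gam A *m Gam C).
Proof. by rewrite /tri2 /sand !mulmxA. Qed.

(** The expression is built from [Gam], [B] and [kap'] alone, so an infinitesimal symmetry of all
    three acts on it as on a spinor with one vector index; the terms hitting the contraction cancel
    because [x] is skew for [kap']. This is why [planar] solves a linear equation of its own along
    curves. *)
Lemma planar_infinitesimal X (x : 'M[R]_q) P A :
  (forall A, X *m Gam A = Gam A *m X + \sum_D x A D *: Gam D) ->
  X^T *m B = - (B *m X) ->
  x^T *m kap' + kap' *m x = 0 ->
  tri A (X *m P) P P + tri A P (X *m P) P + tri A P P (X *m P) =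
  X *m planar A P - \sum_D x A D *: planar D P.
Proof.
move=> XG XB xk.
have first2 C : tri2 A C (X *m P) P + tri2 A C P (X *m P) =
    - (\sum_D x C D * tri2 A D P P) - \sum_D x A D * tri2 D C P P.
  have -> : tri2 A C (X *m P) P = - sand P (X *m Gam A *m Gam C).
    rewrite /tri2 /sand trmx_mul -!mulmxA [X^T *m _]mulmxA XB mulNmx mulmxN !mulmxA.
    by rewrite mxE.
  have -> : tri2 A C P (X *m P) = sand P (Gam A *m Gam C *m X).
    by rewrite /tri2 /sand !mulmxA.
  have -> : Gam A *m Gam C *m X = X *m Gam A *m Gam C -
      (\sum_D x C D *: (Gam A *m Gam D)) - (\sum_D x A D *: (Gam D *m Gam C)).
    rewrite XG mulmxDl -[Gam A *m X *m _]mulmxA XG mulmxDr mulmxA.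
    rewrite mulmx_suml mulmx_sumr.
    under [\sum_i Gam A *m _]eq_bigr do rewrite -scalemxAr.
    under [\sum_i _ *m Gam C]eq_bigr do rewrite -scalemxAl.
    by rewrite addrAC addrK addrK.
  rewrite !sandB !sand_sum addrA addKr.
  by congr (- _ - _); apply: eq_bigr => D _; rewrite tri2_sand.
have third D : Gam D *m (X *m P) = X *m (Gam D *m P) - \sum_E x D E *: (Gam E *m P).
  rewrite !mulmxA XG mulmxDl mulmx_suml.
  under [\sum_i _ *: Gam i *m P]eq_bigr do rewrite -scalemxAl.
  by rewrite addrK.
rewrite /planar /tri -big_split -big_split mulmx_sumr /=.
transitivity (\sum_C (\sum_D (tri2 A C P P * kap' C D) *: (X *m (Gam D *m P))) -
  \sum_C \sum_D ((\sum_F x A F * tri2 F C P P) * kap' C D) *: (Gam D *m P) -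
  (\sum_C \sum_D ((\sum_F x C F * tri2 A F P P) * kap' C D) *: (Gam D *m P) +
   \sum_C \sum_D (tri2 A C P P * kap' C D) *: \sum_E x D E *: (Gam E *m P))).
  rewrite -sumrB -big_split -sumrB /=; apply: eq_bigr => C _.
  rewrite -big_split /= -big_split /= -sumrB -big_split /= -sumrB.
  apply: eq_bigr => D _; rewrite third scalerBr -scalerDl -mulrDl first2.
  rewrite mulrBl mulNr scalerBl scaleNr.
  have alg (a b e f : 'cV[R]_m) : - a - b + (e - f) = e - b - (a + f).
    by apply/matrixP => i j; rewrite !mxE; ring.
  exact: alg.
have -> : \sum_C \sum_D ((\sum_F x C F * tri2 A F P P) * kap' C D) *: (Gam D *m P) =
   \sum_F \sum_D (tri2 A F P P * (x^T *m kap') F D) *: (Gam D *m P).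
  rewrite exchange_big [RHS]exchange_big; apply: eq_bigr => D _ /=.
  under eq_bigr do rewrite mulr_suml scaler_suml.
  rewrite exchange_big; apply: eq_bigr => F _ /=.
  rewrite mxE mulr_sumr scaler_suml; apply: eq_bigr => C _.
  by rewrite mxE; congr (_ *: _); ring.
have -> : \sum_C \sum_D (tri2 A C P P * kap' C D) *: \sum_E x D E *: (Gam E *m P) =
   \sum_F \sum_D (tri2 A F P P * (kap' *m x) F D) *: (Gam D *m P).
  apply: eq_bigr => F _; under eq_bigr do rewrite scaler_sumr.
  rewrite exchange_big; apply: eq_bigr => E _ /=.
  rewrite mxE mulr_sumr scaler_suml; apply: eq_bigr => C _.
  by rewrite scalerA mulrA.
rewrite -big_split /= [X in _ - _ - X = _]big1 => [|F _]; last first.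
  rewrite -big_split big1// => D _; rewrite /= -scalerDl -mulrDr.
  by have /matrixP/(_ F D) := xk; rewrite !mxE => ->; rewrite mulr0 scale0r.
rewrite subr0; congr (_ - _).
  by apply: eq_bigr => C _; rewrite mulmx_sumr; apply: eq_bigr => D _; rewrite -scalemxAr.
under eq_bigr => C _ do under eq_bigr => D _ do rewrite mulr_suml scaler_suml.
under eq_bigr => C _ do rewrite exchange_big.
rewrite exchange_big; apply: eq_bigr => F _ /=.
rewrite scaler_sumr; apply: eq_bigr => C _; rewrite scaler_sumr; apply: eq_bigr => D _.
by rewrite scalerA mulrA.
Qed.

(** The counterpart of [planar_infinitesimal] for a finite symmetry, used for changes of
    trivialisation. *)
Lemma planar_equivariant (L : 'M[R]_m) (o : 'M[R]_q) P A :
  (forall A, Gam A *m L = L *m \sum_D o A D *: Gam D) ->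
  L^T *m B *m L = B -> o^T *m kap' *m o = kap' ->
  planar A (L *m P) = L *m \sum_D o A D *: planar D P.
Proof.
move=> GL LB ok.
have GLP D : Gam D *m (L *m P) = L *m \sum_E o D E *: (Gam E *m P).
  rewrite mulmxA GL -mulmxA mulmx_suml; congr (_ *m _); apply: eq_bigr => E _.
  by rewrite -scalemxAl.
have T C : tri2 A C (L *m P) (L *m P) = \sum_D \sum_E o A D * o C E * tri2 D E P P.
  transitivity (sand P ((\sum_D o A D *: Gam D) *m (\sum_D o C D *: Gam D))).
    rewrite /tri2 /sand -[X in _ *m _ *m X]mulmxA [Gam C *m (L *m P)]mulmxA GL.
    by rewrite trmx_mul !mulmxA -[_ *m Gam A *m L]mulmxA GL -{2}LB !mulmxA.
  rewrite mulmx_suml.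
  under eq_bigr do rewrite -scalemxAl.
  rewrite sand_sum; apply: eq_bigr => D _; rewrite mulmx_sumr.
  under eq_bigr do rewrite -scalemxAr.
  by rewrite sand_sum mulr_sumr; apply: eq_bigr => E _; rewrite mulrA tri2_sand.
rewrite /planar /tri.
transitivity (L *m \sum_C \sum_D \sum_E
    (tri2 A C (L *m P) (L *m P) * (kap' C D * o D E)) *: (Gam E *m P)).
  rewrite mulmx_sumr; apply: eq_bigr => C _; rewrite mulmx_sumr; apply: eq_bigr => D _.
  rewrite GLP scalemxAr scaler_sumr; congr (_ *m _); apply: eq_bigr => E _.
  by rewrite scalerA mulrA.
congr (_ *m _).
transitivity (\sum_D \sum_F \sum_E
    (o A D * tri2 D F P P * (o^T *m kap' *m o) F E) *: (Gam E *m P)).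
  under eq_bigr => C _ do rewrite exchange_big.
  rewrite exchange_big /=.
  under [RHS]eq_bigr => D _ do rewrite exchange_big.
  rewrite [RHS]exchange_big /=; apply: eq_bigr => E _.
  under eq_bigr => C _ do rewrite -scaler_suml.
  rewrite -scaler_suml.
  under [RHS]eq_bigr => D _ do rewrite -scaler_suml.
  rewrite -scaler_suml; congr (_ *: _).
  under eq_bigr => C _ do rewrite -mulr_sumr T mulr_suml.
  rewrite exchange_big; apply: eq_bigr => D _ /=.
  under eq_bigr => C _ do rewrite mulr_suml.
  rewrite exchange_big; apply: eq_bigr => F _ /=.
  rewrite -mulmxA mxE mulr_sumr; apply: eq_bigr => C _.
  by rewrite !mxE; ring.
rewrite ok; apply: eq_bigr => D _; rewrite scaler_sumr; apply: eq_bigr => F _.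
by rewrite scaler_sumr; apply: eq_bigr => E _; rewrite scalerA mulrA.
Qed.

End CliffordFamily.

(* Tractor spinors: pairs (phi, chi) with the Clifford action of
   R^(1,n-1) + R^(1,1); [idx_p] and [idx_m] index a null basis of the last summand. *)
Section Tractor.
Context {R : realType} {n N : nat}.
Variable c : 'I_n -> 'M[R]_N.
Variable H : 'M[R]_N.
Hypothesis cc : forall k l, c k *m c l + c l *m c k = (- 2 * eta k l)%:M.
Hypothesis H_sym : H^T = H.
Hypothesis H_c : forall k, (c k)^T *m H = H *m c k.
Hypothesis H_pos : forall k : 'I_n, (k = 0 :> nat)%N ->
  forall x : 'cV[R]_N, x != 0 -> 0 < (x^T *m H *m (c k *m x)) 0 0.
Hypothesis n3 : (3 <= n)%N.

Notation cl := (cl c).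
Notation sp := (sp c).
Notation hform := (hform H).
Notation current := (current c H).
Notation current_sq := (current_sq c H).

Lemma opp_trmx p q (A : 'M[R]_(p, q)) : (- A)^T = - A^T.
Proof. by apply/matrixP => i j; rewrite !mxE. Qed.

Lemma scale_trmx p q (a : R) (A : 'M[R]_(p, q)) : (a *: A)^T = a *: A^T.
Proof. by apply/matrixP => i j; rewrite !mxE. Qed.

Lemma clN x : cl (- x) = - cl x.
Proof. by rewrite -scaleN1r linearZ /= scaleN1r. Qed.

Lemma cl0 : cl 0 = 0.
Proof. by rewrite -(scale0r 0) linearZ /= scale0r. Qed.

Definition idx_l (k : 'I_n) : 'I_(n + (1 + 1)) := lshift _ k.
Definition idx_p : 'I_(n + (1 + 1)) := rshift n (lshift 1 ord0).
Definition idx_m : 'I_(n + (1 + 1)) := rshift n (rshift 1 ord0).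

(** The opposite sign of [c k] on the second half makes these generators anticommute with the two
    null ones. *)
Definition tgam (A : 'I_(n + (1 + 1))) : 'M[R]_(N + N) :=
  match fintype.split A with
  | inl k => block_mx (c k) 0 0 (- c k)
  | inr j => match fintype.split j with
             | inl _ => block_mx 0 1%:M 0 0
             | inr _ => block_mx 0 0 1%:M 0
             end
  end.

Lemma tgam_l k : tgam (idx_l k) = block_mx (c k) 0 0 (- c k).
Proof. by rewrite /tgam (unsplitK (inl k)). Qed.

Lemma tgam_p : tgam idx_p = block_mx 0 1%:M 0 0.
Proof. by rewrite /tgam (unsplitK (inr _)) (unsplitK (inl _)). Qed.

Lemma tgam_m : tgam idx_m = block_mx 0 0 1%:M 0.
Proof. by rewrite /tgam (unsplitK (inr _)) (unsplitK (inr _)). Qed.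

Lemma sum_tractor (V : nmodType) (F : 'I_(n + (1 + 1)) -> V) :
  \sum_A F A = \sum_k F (idx_l k) + (F idx_p + F idx_m).
Proof. by rewrite big_split_ord big_split_ord !big_ord1. Qed.

Lemma tractor_ind (P : 'I_(n + (1 + 1)) -> Prop) :
  (forall k, P (idx_l k)) -> P idx_p -> P idx_m -> forall A, P A.
Proof.
move=> h1 h2 h3 A; case: (split_ordP A) => [k ->|j ->]; first exact: h1.
by case: (split_ordP j) => i ->; rewrite ord1.
Qed.

(** The pairing between the two halves. Clifford multiplication is self-adjoint and the spin
    representation skew for [H], and the relative sign makes all blocks of [tgen] skew for
    [tform]. *)
Definition tform : 'M[R]_(N + N) := block_mx 0 (- H) H 0.

(** The two null generators anticommute to 1 = -2 g, so their product is -1/2; [J] is the inverse of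
    their Gram matrix. *)
Let J : 'M[R]_(1 + 1) := block_mx 0 (- 2)%:M (- 2)%:M 0.

Definition tinv : 'M[R]_(n + (1 + 1)) := block_mx eta 0 0 J.

Notation planar := (planar tgam tinv tform).

(** Right-hand side of the system for (phi, chi) along a curve with connection matrix [om], frame
    velocity [y] and Schouten vector [P]. *)
Definition tgen (om : 'M[R]_n) (y P : 'rV[R]_n) : 'M[R]_(N + N) :=
  block_mx (- sp om) (cl y) (cl P) (- sp om).

(** The vector representation of the same infinitesimal rotation of R^(1,n-1) + R^(1,1), as
    [tgen_comm] shows. *)
Definition tvec (om : 'M[R]_n) (y P : 'rV[R]_n) : 'M[R]_(n + (1 + 1)) :=
  block_mx (- om) (row_mx (2 *: (eta *m y^T)) (- 2 *: (eta *m P^T)))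
           (col_mx (- P) y) 0.

Lemma sum_diag_block (f : 'I_n -> R) :
  \sum_k f k *: block_mx (c k) 0 0 (- c k) =
  block_mx (cl (\row_k f k)) 0 0 (- cl (\row_k f k)).
Proof.
have E k : f k *: block_mx (c k) 0 0 (- c k) =
    block_mx (f k *: c k) 0 0 (- (f k *: c k)).
  by rewrite scale_block_mx !scaler0 scalerN.
under eq_bigr do rewrite E.
have E2 : cl (\row_k f k) = \sum_k f k *: c k.
  by rewrite /cl; apply: eq_bigr => k _; rewrite mxE.
rewrite E2; elim/big_rec2 : _ => [|k A B _ ->]; first by rewrite oppr0 block_mx_const.
by rewrite add_block_mx !addr0 opprD.
Qed.

Lemma eta_col (y : 'rV[R]_n) k : (eta *m y^T) k 0 = eps k * y 0 k.
Proof.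
rewrite mxE (bigD1 k)//= etaE eqxx mulr1n mxE big1 ?addr0// => l lk.
by rewrite etaE eq_sym (negbTE lk) mul0r.
Qed.

Lemma tgen_comm om y P A : eta_skew om ->
  tgen om y P *m tgam A = tgam A *m tgen om y P + \sum_D tvec om y P A D *: tgam D.
Proof.
move=> sk; rewrite sum_tractor tgam_p tgam_m.
under eq_bigr do rewrite tgam_l.
rewrite sum_diag_block; elim/tractor_ind : A => [k||].
- have -> : (\row_l tvec om y P (idx_l k) (idx_l l)) = - row k om.
    by apply/rowP => l; rewrite mxE /tvec /idx_l block_mxEul !mxE.
  rewrite /tvec /idx_l /idx_p /idx_m !block_mxEur row_mxEl row_mxEr -/(idx_l k).
  rewrite tgam_l /tgen !mulmx_block !scale_block_mx !add_block_mx.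
  rewrite !(mul0mx, mulmx0, addr0, add0r, mulmxN, mulNmx, scaler0, opprK, clN).
  have e1 : (2 *: (eta *m y^T)) k ord0 = 2 * (eps k * y 0 k) :> R.
    by rewrite mxE; congr (_ * _); exact: eta_col.
  have e2 : (- 2 *: (eta *m P^T)) k ord0 = - 2 * (eps k * P 0 k) :> R.
    by rewrite mxE; congr (_ * _); exact: eta_col.
  rewrite e1 e2 !scale_scalar_mx !mulr1; congr block_mx.
  + by rewrite -cl_delta sp_cl// opprD cl_delta -rowE.
  + rewrite -(cl_delta c k) (cl_swap cc y) mink_delta opprD opprK; congr (_ + _).
    by rewrite -raddfN; congr (_%:M); ring.
  + by rewrite -(cl_delta c k) (cl_swap cc P) mink_delta.
  + by rewrite -cl_delta sp_cl// cl_delta -rowE.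
- have -> : (\row_l tvec om y P idx_p (idx_l l)) = - P.
    by apply/rowP => l; rewrite mxE /tvec /idx_l /idx_p block_mxEdl col_mxEu mxE.
  rewrite /tvec /idx_p /idx_m !block_mxEdr -/idx_p !mxE !scale0r !addr0.
  rewrite tgam_p /tgen !mulmx_block !add_block_mx.
  by rewrite !(mul0mx, mulmx0, mul1mx, mulmx1, addr0, add0r, clN, opprK) subrr.
- have -> : (\row_l tvec om y P idx_m (idx_l l)) = y.
    by apply/rowP => l; rewrite mxE /tvec /idx_l /idx_m block_mxEdl col_mxEd.
  rewrite /tvec /idx_p /idx_m !block_mxEdr -/idx_m !mxE !scale0r !addr0.
  rewrite tgam_m /tgen !mulmx_block !add_block_mx.
  by rewrite !(mul0mx, mulmx0, mul1mx, mulmx1, addr0, add0r, opprK) subrr.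
Qed.

Lemma cl_form x : (cl x)^T *m H = H *m cl x.
Proof.
rewrite /cl linear_sum mulmx_suml mulmx_sumr; apply: eq_bigr => k _.
by rewrite linearZ -scalemxAl -scalemxAr H_c.
Qed.

Lemma sp_form om : eta_skew om -> (sp om)^T *m H = - (H *m sp om).
Proof.
move=> sk; apply/eqP; rewrite -subr_eq0 opprK; apply/eqP.
rewrite /sp scale_trmx -scalemxAl -scalemxAr -scalerDr linear_sum mulmx_suml mulmx_sumr.
rewrite -big_split big1 ?scaler0// => k _ /=.
rewrite linear_sum mulmx_suml mulmx_sumr -big_split big1// => l _ /=.
rewrite scale_trmx -scalemxAl -scalemxAr -scalerDr trmx_mul -mulmxA H_c mulmxA H_c.
rewrite -mulmxA -mulmxDr addrC cc etaE; case: eqP => [->|_].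
  have /eqP := sk l l; rewrite -subr_eq0 opprK -mulr2n mulrn_eq0/=.
  rewrite mulrC => /eqP ->; exact: scale0r.
by rewrite mulr0 raddf0 mulmx0 scaler0.
Qed.

Lemma tgen_form om y P : eta_skew om ->
  (tgen om y P)^T *m tform = - (tform *m tgen om y P).
Proof.
move=> sk; rewrite /tgen /tform tr_block_mx !mulmx_block opp_block_mx.
rewrite !(mul0mx, mulmx0, addr0, add0r, mulmxN, mulNmx, opprK, opp_trmx).
by rewrite !cl_form !sp_form// !opprK.
Qed.

Lemma tvec_inv om y P : eta_skew om ->
  (tvec om y P)^T *m tinv + tinv *m tvec om y P = 0.
Proof.
move=> sk.
have ee : eta *m eta = 1%:M :> 'M[R]_n.
  rewrite /eta mulmx_diag -scalar_mx_is_diag || idtac.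
  apply/matrixP => i j; rewrite mxE (bigD1 i)//= big1 => [|k ki].
    by rewrite !etaE eqxx mulr1n addr0 mxE; case: eqP => _; rewrite ?mulr0// eps_sq.
  by rewrite etaE eq_sym (negbTE ki) mul0r.
have eT : eta^T = eta :> 'M[R]_n by rewrite tr_diag_mx.
have tT : tinv^T = tinv.
  by rewrite /tinv /J !tr_block_mx !trmx0 eT !tr_scalar_mx.
have -> : (tvec om y P)^T *m tinv = (tinv *m tvec om y P)^T by rewrite trmx_mul tT.
rewrite /tvec /tinv mulmx_block !(mul0mx, mulmx0, addr0, add0r) mul_mx_row.
rewrite -!scalemxAr !mulmxA ee !mul1mx /J mul_block_col !(mul0mx, add0r, addr0).
rewrite !mul_scalar_mx tr_block_mx add_block_mx tr_row_mx tr_col_mx.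
rewrite !scale_trmx !trmxK trmx0 addr0 add_col_mx add_row_mx.
have s1 p q (A : 'M[R]_(p, q)) : - 2 *: A + 2 *: A = 0.
  by rewrite -scalerDl addNr scale0r.
have s2 p q (A : 'M[R]_(p, q)) : 2 *: A + - 2 *: A = 0.
  by rewrite -scalerDl subrr scale0r.
rewrite mulmxN !opp_trmx !scalerN addNr subrr s1 s2 row_mx0 col_mx0.
have -> : (eta *m om)^T = - (eta *m om).
  apply/matrixP => i j; rewrite !mxE (bigD1 j)//= big1 => [|k kj]; last first.
    by rewrite etaE eq_sym (negbTE kj) mul0r.
  rewrite (bigD1 i)//= big1 => [|k ki]; last by rewrite etaE eq_sym (negbTE ki) mul0r.
  rewrite !etaE !eqxx !mulr1n !addr0.
  have /(congr1 (fun r => eps i * eps j * r)) := sk j i.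
  rewrite (_ : _ * (om j i * _) = eps j * om j i * (eps i * eps i)); last by ring.
  rewrite (_ : _ * - _ = - (eps i * om i j * (eps j * eps j))); last by ring.
  by rewrite !eps_sq !mulr1.
by rewrite opprK subrr block_mx_const.
Qed.

Implicit Types phi chi : 'cV[R]_N.

Lemma tgam_col phi chi A : tgam A *m col_mx phi chi =
  match fintype.split A with
  | inl k => col_mx (c k *m phi) (- (c k *m chi))
  | inr j => match fintype.split j with
             | inl _ => col_mx chi 0
             | inr _ => col_mx 0 phi
             end
  end.
Proof.
rewrite /tgam; case: fintype.split => [k|j]; last case: fintype.split => _;
by rewrite mul_block_col !(mul0mx, mul1mx, addr0, add0r, mulNmx).
Qed.

Lemma tgam_col_l phi chi k :
  tgam (idx_l k) *m col_mx phi chi = col_mx (c k *m phi) (- (c k *m chi)).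
Proof. by rewrite tgam_col (unsplitK (inl k)). Qed.

Lemma tgam_col_p phi chi : tgam idx_p *m col_mx phi chi = col_mx chi 0.
Proof. by rewrite tgam_col (unsplitK (inr _)) (unsplitK (inl _)). Qed.

Lemma tgam_col_m phi chi : tgam idx_m *m col_mx phi chi = col_mx 0 phi.
Proof. by rewrite tgam_col (unsplitK (inr _)) (unsplitK (inr _)). Qed.

Lemma tform_col phi chi phi' chi' :
  ((col_mx phi chi)^T *m tform *m col_mx phi' chi') 0 0 = hform chi phi' - hform phi chi'.
Proof.
rewrite tr_col_mx /tform mul_row_block !(mulmx0, add0r, addr0) mul_row_col.
by rewrite mulmxN mulNmx [LHS]mxE [X in _ + X]mxE.
Qed.

Lemma tinv_ll k l : tinv (idx_l k) (idx_l l) = eta k l.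
Proof. by rewrite /tinv /idx_l block_mxEul. Qed.

Lemma tinv_l k j : tinv (idx_l k) (rshift n j) = 0 /\ tinv (rshift n j) (idx_l k) = 0.
Proof. by rewrite /tinv /idx_l block_mxEur block_mxEdl !mxE. Qed.

Lemma tinv_pm : [/\ tinv idx_p idx_p = 0, tinv idx_m idx_m = 0,
  tinv idx_p idx_m = - 2 & tinv idx_m idx_p = - 2].
Proof.
rewrite /tinv /idx_p /idx_m !block_mxEdr /J block_mxEul block_mxEur block_mxEdl.
by rewrite !mxE.
Qed.

Lemma planarE A Psi : planar A Psi =
  \sum_k (tri2 tgam tform A (idx_l k) Psi Psi * eps k) *: (tgam (idx_l k) *m Psi)
  - ((2 * tri2 tgam tform A idx_p Psi Psi) *: (tgam idx_m *m Psi)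
     + (2 * tri2 tgam tform A idx_m Psi Psi) *: (tgam idx_p *m Psi)).
Proof.
have [pp mm pm mp] := tinv_pm.
rewrite /planar /tri sum_tractor opprD; congr (_ + (_ + _)).
- apply: eq_bigr => k _; rewrite sum_tractor (bigD1 k)//= big1 => [|l lk].
    rewrite tinv_ll etaE eqxx (tinv_l k _).1 (tinv_l k _).1.
    by rewrite !mulr0 !scale0r !addr0.
  by rewrite tinv_ll etaE eq_sym (negbTE lk) mulr0 scale0r.
- rewrite sum_tractor big1 => [|l _]; last by rewrite (tinv_l l _).2 mulr0 scale0r.
  by rewrite pp pm mulr0 scale0r !add0r -scaleNr; congr (_ *: _); ring.
- rewrite sum_tractor big1 => [|l _]; last by rewrite (tinv_l l _).2 mulr0 scale0r.
  by rewrite mm mp mulr0 scale0r add0r addr0 -scaleNr; congr (_ *: _); ring.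
Qed.

Lemma tri2_assoc A C (Psi : 'cV[R]_(N + N)) : tri2 tgam tform A C Psi Psi =
  (Psi^T *m tform *m (tgam A *m (tgam C *m Psi))) 0 0.
Proof. by rewrite /tri2 !mulmxA. Qed.

(** The upper half of this component is -V.phi, where V is the current of phi; and V.phi = 0 gives
    g(V,V) = <phi, V.phi> = 0. *)
Lemma planar_null phi chi : planar idx_m (col_mx phi chi) = 0 -> current_sq phi = 0.
Proof.
rewrite planarE; under eq_bigr do rewrite tri2_assoc tgam_col_l tgam_col_m tform_col hform0r sub0r.
rewrite !tri2_assoc !(tgam_col_p, tgam_col_m) !tform_col !hform0r !subr0 mulr0 scale0r addr0.
move=> /(congr1 usubmx); rewrite linearB linear_sum /= linearZ /= col_mxKu scaler0 subr0 linear0.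
move=> E; rewrite /current_sq mink_current//.
have -> : cl (current phi) *m phi = 0; last by rewrite hform0r.
apply/eqP; rewrite -oppr_eq0 -E; apply/eqP.
rewrite /cl mulmx_suml -sumrN; apply: eq_bigr => k _.
rewrite linearZ /= col_mxKu -scalemxAl mxE -scaleNr; congr (_ *: _); ring.
Qed.

(** With phi = 0 the only component that is not trivially 0 is that of [idx_p], which equals V.chi
    for the current V of chi. *)
Lemma planar_at_zero chi : current_sq chi = 0 -> forall A, planar A (col_mx 0 chi) = 0.
Proof.
move=> f0; have V0 : cl (current chi) *m chi = 0 by apply: current_annihilates.
have Gm : tgam idx_m *m col_mx 0 chi = 0 by rewrite tgam_col_m col_mx0.
have h0 (x : 'cV[R]_N) : hform 0 x = 0 by rewrite hformC// hform0r.
apply: tractor_ind => [k||]; rewrite planarE.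
- under eq_bigr do rewrite tri2_assoc !tgam_col_l mulmx0 tform_col mulmx0 hform0r h0 subr0 mul0r scale0r.
  rewrite big1// Gm scaler0 tri2_assoc Gm mulmx0 mulmx0 mxE mulr0 scale0r addr0.
  by rewrite subr0.
- rewrite Gm scaler0 tri2_assoc Gm mulmx0 mulmx0 mxE mulr0 scale0r addr0 subr0.
  under eq_bigr do rewrite tri2_assoc !tgam_col_l tgam_col_p tform_col h0 subr0 mulmx0.
  transitivity (col_mx (0 : 'cV[R]_N) (cl (current chi) *m chi)); last by rewrite V0 col_mx0.
  rewrite /cl mulmx_suml.
  rewrite -[LHS]vsubmxK; congr col_mx.
    by rewrite linear_sum big1// => k _; rewrite linearZ /= col_mxKu scaler0.
  rewrite linear_sum; apply: eq_bigr => k _; rewrite linearZ /= col_mxKd.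
  rewrite -scalemxAl scalerN -scaleNr mxE hformNr; congr (_ *: _); ring.
- under eq_bigr do rewrite tri2_assoc tgam_col_l tgam_col_m mulmx0 tform_col hform0r h0 subr0 mul0r scale0r.
  rewrite big1// Gm scaler0 tri2_assoc Gm mulmx0 mulmx0 mxE mulr0 scale0r addr0.
  by rewrite subr0.
Qed.

(** A spin transformation acts on both halves alike, and on vectors through its image on R^(1,n-1),
    fixing R^(1,1). *)
Lemma planar_lift (l : 'M[R]_N) (a : 'M[R]_n) phi chi :
  (forall k, c k *m l = l *m cl (row k a)) -> l^T *m H *m l = H ->
  a^T *m eta *m a = eta ->
  (forall A, planar A (col_mx phi chi) = 0) ->
  forall A, planar A (col_mx (l *m phi) (l *m chi)) = 0.
Proof.
move=> cl_l lH ae P0 A.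
pose L : 'M[R]_(N + N) := block_mx l 0 0 l.
pose o : 'M[R]_(n + (1 + 1)) := block_mx a 0 0 1%:M.
have -> : col_mx (l *m phi) (l *m chi) = L *m col_mx phi chi.
  by rewrite mul_block_col !mul0mx addr0 add0r.
rewrite (planar_equivariant (o := o)).
- by rewrite big1 ?mulmx0// => D _; rewrite P0 scaler0.
- move=> {}A; rewrite sum_tractor tgam_p tgam_m.
  under eq_bigr do rewrite tgam_l.
  rewrite sum_diag_block; elim/tractor_ind : A => [k||].
  + have -> : (\row_j o (idx_l k) (idx_l j)) = row k a.
      by apply/rowP => j; rewrite [LHS]mxE [RHS]mxE /o /idx_l block_mxEul.
    rewrite /o /idx_l /idx_p /idx_m !block_mxEur !mxE !scale0r !addr0 -/(idx_l k) tgam_l.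
    rewrite /L !mulmx_block !(mul0mx, mulmx0, addr0, add0r).
    by rewrite mulNmx mulmxN cl_l.
  + have -> : (\row_j o idx_p (idx_l j)) = 0.
      by apply/rowP => j; rewrite [LHS]mxE [RHS]mxE /o /idx_l /idx_p block_mxEdl mxE.
    rewrite /o /idx_p /idx_m !block_mxEdr !mxE -/idx_p /= scale1r scale0r addr0 cl0 oppr0.
    rewrite block_mx_const add0r tgam_p /L !mulmx_block !(mul0mx, mulmx0, addr0, add0r).
    by rewrite mul1mx mulmx1.
  + have -> : (\row_j o idx_m (idx_l j)) = 0.
      by apply/rowP => j; rewrite [LHS]mxE [RHS]mxE /o /idx_l /idx_m block_mxEdl mxE.
    rewrite /o /idx_p /idx_m !block_mxEdr !mxE -/idx_m /= scale1r scale0r add0r cl0 oppr0.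
    rewrite block_mx_const add0r tgam_m /L !mulmx_block !(mul0mx, mulmx0, addr0, add0r).
    by rewrite mul1mx mulmx1.
- rewrite /L /tform tr_block_mx !trmx0 !mulmx_block !(mul0mx, mulmx0, addr0, add0r).
  by rewrite !mulmxN !mulNmx lH.
- rewrite /o /tinv tr_block_mx !trmx0 trmx1 !mulmx_block.
  by rewrite !(mul0mx, mulmx0, addr0, add0r) mul1mx mulmx1 ae.
Qed.

End Tractor.

(** * Local Levi-Civita geometry *)

Section SmoothClosure.
Context {R : realType} {V : normedModType R}.
Variable A : set V.
Hypothesis oA : open A.

Lemma smooth_ext (W : normedModType R) (f g : V -> W) :
  (forall x, A x -> f x = g x) -> smooth_on A f -> smooth_on A g.
Proof. by move=> fg fA k; apply: (Ck_ext oA fg (fA k)). Qed.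

Lemma smooth_cst (W : normedModType R) (a : W) : smooth_on A (fun=> a).
Proof. by move=> k; exact: Ck_cst. Qed.

Lemma smooth_add (W : normedModType R) (f g : V -> W) :
  smooth_on A f -> smooth_on A g -> smooth_on A (fun x => f x + g x).
Proof. by move=> fA gA k; exact: Ck_add. Qed.

Lemma smooth_mulr (f g : V -> R) :
  smooth_on A f -> smooth_on A g -> smooth_on A (fun x => f x * g x).
Proof. by move=> fA gA k; exact: Ck_mulr. Qed.

Lemma smooth_sum (W : normedModType R) (I : Type) (r : seq I) (P : pred I)
    (f : I -> V -> W) :
  (forall i, smooth_on A (f i)) -> smooth_on A (fun x => \sum_(i <- r | P i) f i x).
Proof. by move=> fA k; apply: Ck_sum => // i; exact: fA. Qed.

Lemma smooth_mxP p q (f : V -> 'M[R]_(p, q)) :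
  smooth_on A f <-> forall i j, smooth_on A (fun y => f y i j).
Proof.
split=> [fA i j k|fA k]; first exact: (Ck_mxP k f oA).1.
by apply/(Ck_mxP k f oA) => i j; exact: fA.
Qed.

Lemma smooth_mulmx p q r (f : V -> 'M[R]_(p, q)) (g : V -> 'M[R]_(q, r)) :
  smooth_on A f -> smooth_on A g -> smooth_on A (fun x => f x *m g x).
Proof. by move=> fA gA k; exact: Ck_mulmx. Qed.

Lemma smooth_scaler p q (h : V -> R) (f : V -> 'M[R]_(p, q)) :
  smooth_on A h -> smooth_on A f -> smooth_on A (fun x => h x *: f x).
Proof. by move=> hA fA k; exact: Ck_scaler. Qed.

Lemma smooth_linmx p q a b (L : {linear 'M[R]_(p, q) -> 'M[R]_(a, b)})
    (f : V -> 'M[R]_(p, q)) :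
  smooth_on A f -> smooth_on A (fun x => L (f x)).
Proof. by move=> fA k; exact: Ck_linmx. Qed.

Lemma smooth_scale (W : normedModType R) (a : R) (f : V -> W) : smooth_on A f ->
  smooth_on A (fun x => a *: f x).
Proof.
move=> fA k; elim: k f fA => [|k IH] f fA.
  by split=> // x Ax; apply: continuousZr; exact: (fA 0%N).1.
have D x v : A x -> is_derive x v (fun x => a *: f x) (a *: 'D_v f x).
  by move=> Ax; apply: is_derive_scalef; exact: Ck_is_derive (fA k.+1) Ax.
split=> [x Ax|v]; first by apply: continuousZr; exact: (fA 0%N).1.
split=> [x Ax|]; first by case: (D x v Ax).
apply: (Ck_ext oA _ (IH (fun x => 'D_v f x) (fun l => Ck_derive v (fA l.+1)))) => x Ax.
by case: (D x v Ax).
Qed.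

Lemma smooth_opp (W : normedModType R) (f : V -> W) : smooth_on A f ->
  smooth_on A (fun x => - f x).
Proof.
move=> fA; apply: (smooth_ext (f := fun x => - 1 *: f x)) => [x _|].
  by rewrite scaleN1r.
exact: smooth_scale.
Qed.

Lemma smooth_sub (W : normedModType R) (f g : V -> W) :
  smooth_on A f -> smooth_on A g -> smooth_on A (fun x => f x - g x).
Proof. by move=> fA gA; apply: smooth_add => //; exact: smooth_opp. Qed.

Lemma smooth_derive (W : normedModType R) (f : V -> W) v : smooth_on A f ->
  smooth_on A (fun x => 'D_v f x).
Proof. by move=> fA k; exact: Ck_derive (fA k.+1). Qed.

Lemma smooth_is_derive (W : normedModType R) (f : V -> W) x v : smooth_on A f ->
  A x -> is_derive x v f ('D_v f x).
Proof. by move=> fA; exact: (Ck_is_derive v (fA 1%N)). Qed.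

Lemma derive_on (W : normedModType R) (f g : V -> W) x v d :
  A x -> (forall y, A y -> f y = g y) -> is_derive x v f d -> 'D_v g x = d.
Proof.
move=> Ax fg H; have n : \near x, f x = g x.
  by apply: filterS (open_nbhs_nbhs (conj oA Ax)) => y Ay; exact: fg.
by case: (is_derive_ext n H).
Qed.

End SmoothClosure.

Section ChristoffelAlgebra.
Context {R : realType} {n : nat}.
Implicit Types dG : 'I_n -> 'M[R]_n.

Definition lower_chr dG (i : 'I_n) : 'M[R]_n :=
  \matrix_(j, k) (2^-1 * (dG i j k + dG j i k - dG k i j)).

Lemma lower_chr_compat dG i : (forall k, (dG k)^T = dG k) ->
  lower_chr dG i + (lower_chr dG i)^T = dG i.
Proof.
move=> sG; apply/matrixP => j k; rewrite !mxE.
have h a b d : dG a b d = dG a d b by rewrite -{1}sG mxE.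
by rewrite (h i k j) (h k i j) (h j k i) (h k j i) || idtac; rewrite (h i k j); field.
Qed.

Lemma lower_chr_sym dG i j : (forall k, (dG k)^T = dG k) ->
  row j (lower_chr dG i) = row i (lower_chr dG j).
Proof.
move=> sG; apply/rowP => k; rewrite !mxE.
have h a b d : dG a b d = dG a d b by rewrite -{1}sG mxE.
by rewrite (h k i j); congr (_ * _); ring.
Qed.

Lemma eta_unit : eta *m eta = 1%:M :> 'M[R]_n.
Proof.
apply/matrixP => i j; rewrite mxE (bigD1 i)//= big1 => [|k ki].
  by rewrite !etaE eqxx mulr1n addr0 mxE; case: eqP => _; rewrite ?mulr0// eps_sq.
by rewrite etaE eq_sym (negbTE ki) mul0r.
Qed.

Lemma eta_trmx : eta^T = eta :> 'M[R]_n.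
Proof. by rewrite tr_diag_mx. Qed.

Lemma eta_skewP (A : 'M[R]_n) : eta_skew A <-> (A *m eta)^T = - (A *m eta).
Proof.
have E i j : (A *m eta) i j = A i j * eps j.
  rewrite mxE (bigD1 j)//= big1 => [|k kj].
    by rewrite etaE eqxx mulr1n addr0.
  by rewrite etaE (negbTE kj) mulr0.
split=> [sk|/matrixP sk k l].
  by apply/matrixP => i j; rewrite [LHS]mxE [RHS]mxE !E sk.
by have := sk l k; rewrite [LHS]mxE [RHS]mxE !E.
Qed.

End ChristoffelAlgebra.

Section LocalLeviCivita.
Context {R : realType} {n : nat}.
Variables (O : set 'rV[R]_n) (G E : 'rV[R]_n -> 'M[R]_n).
Hypothesis oO : open O.
Hypothesis Gs : smooth_on O G.
Hypothesis Es : smooth_on O E.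
Hypothesis Gsym : forall x, O x -> (G x)^T = G x.
Hypothesis EGE : forall x, O x -> E x *m G x *m (E x)^T = eta.

Local Notation e_ i := (delta_mx 0 i : 'rV[R]_n).

(** The inverse of [E], written without inversion by means of E G E^T = eta, so that its smoothness
    is immediate; [invG] does the same for [G]. *)
Definition coframe x : 'M[R]_n := G x *m (E x)^T *m eta.

Lemma frame_coframe x : O x -> E x *m coframe x = 1%:M.
Proof. by move=> Ox; rewrite /coframe !mulmxA EGE// eta_unit. Qed.

Lemma coframe_frame x : O x -> coframe x *m E x = 1%:M.
Proof. by move=> Ox; apply: mulmx1C; exact: frame_coframe. Qed.

Lemma frame_inverse x : O x -> invmx (E x) = coframe x.
Proof.
move=> Ox; have [uE _] := mulmx1_unit (frame_coframe Ox).
by rewrite -[RHS]mul1mx -(mulVmx uE) -mulmxA frame_coframe// mulmx1.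
Qed.

Definition invG x : 'M[R]_n := (E x)^T *m eta *m E x.

Lemma G_invG x : O x -> G x *m invG x = 1%:M.
Proof. by move=> Ox; rewrite /invG !mulmxA; exact: coframe_frame. Qed.

Lemma invG_G x : O x -> invG x *m G x = 1%:M.
Proof. by move=> Ox; apply: mulmx1C; exact: G_invG. Qed.

Lemma invG_E x : O x -> invmx (G x) = invG x.
Proof.
move=> Ox; have [uG _] := mulmx1_unit (G_invG Ox).
by rewrite -[RHS]mul1mx -(mulVmx uG) -mulmxA G_invG// mulmx1.
Qed.

Definition dG i x : 'M[R]_n := 'D_(e_ i) G x.
Definition dE i x : 'M[R]_n := 'D_(e_ i) E x.

(** Row j holds the coordinate components of nabla_i d_j. *)
Definition chr i x : 'M[R]_n := lower_chr (dG ^~ x) i *m invG x.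

(** Row k holds the frame components of nabla_i e_k. *)
Definition conn i x : 'M[R]_n := (dE i x + E x *m chr i x) *m coframe x.

Lemma dG_sym k x : O x -> (dG k x)^T = dG k x.
Proof.
move=> Ox; have h := is_derive_linmx (@trmx R n n) (smooth_is_derive (e_ k) Gs Ox).
by have := derive_on oO Ox Gsym h => /esym.
Qed.

Lemma smooth_dG k : smooth_on O (dG k).
Proof. exact: smooth_derive. Qed.

Lemma smooth_trmx p q (f : 'rV[R]_n -> 'M[R]_(p, q)) :
  smooth_on O f -> smooth_on O (fun x => (f x)^T).
Proof. by move=> fO; exact: (smooth_linmx oO (@trmx R p q)). Qed.

Lemma smooth_coframe : smooth_on O coframe.
Proof.
apply: (smooth_mulmx oO); last exact: (smooth_cst oO).
by apply: (smooth_mulmx oO) => //; exact: smooth_trmx.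
Qed.

Lemma smooth_invG : smooth_on O invG.
Proof.
apply: (smooth_mulmx oO) => //; apply: (smooth_mulmx oO); first exact: smooth_trmx.
exact: (smooth_cst oO).
Qed.

Lemma smooth_chr i : smooth_on O (chr i).
Proof.
apply: (smooth_mulmx oO); last exact: smooth_invG.
apply/(smooth_mxP oO) => j k.
apply: (smooth_ext oO (f := fun x => 2^-1 * (dG i x j k + dG j x i k - dG k x i j))).
  by move=> x _; rewrite /lower_chr [RHS]mxE.
have h a b d : smooth_on O (fun x => dG a x b d).
  exact: ((smooth_mxP oO (dG a)).1 (smooth_dG a)).
apply: (smooth_mulr oO); first exact: (smooth_cst oO).
by apply: (smooth_sub oO) => //; exact: (smooth_add oO).
Qed.

Lemma smooth_conn i : smooth_on O (conn i).
Proof.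
apply: (smooth_mulmx oO); last exact: smooth_coframe.
apply: (smooth_add oO); first exact: smooth_derive.
by apply: (smooth_mulmx oO) => //; exact: smooth_chr.
Qed.

Lemma chr_compat i x : O x ->
  dG i x = chr i x *m G x + G x *m (chr i x)^T.
Proof.
move=> Ox; have E1 : chr i x *m G x = lower_chr (dG ^~ x) i.
  by rewrite /chr -mulmxA invG_G// mulmx1.
have -> : G x *m (chr i x)^T = (chr i x *m G x)^T.
  by move: (chr i x) => C; rewrite trmx_mul Gsym.
by rewrite E1 lower_chr_compat// => k; exact: dG_sym.
Qed.

Lemma chr_sym i j x : O x -> row j (chr i x) = row i (chr j x).
Proof.
move=> Ox; rewrite /chr !row_mul; congr (_ *m _); apply: lower_chr_sym => k.
exact: dG_sym.
Qed.

(** Differentiating E G E^T = eta and inserting the metric property of [chr] gives exactly the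
    skewness relation. *)
Lemma conn_skew i x : O x -> eta_skew (conn i x).
Proof.
move=> Ox; apply/eta_skewP; apply/eqP; rewrite -subr_eq0 opprK addrC; apply/eqP.
have E1 : conn i x *m eta = dE i x *m G x *m (E x)^T + E x *m chr i x *m G x *m (E x)^T.
  rewrite /conn /coframe !mulmxA -[_ *m eta *m eta]mulmxA eta_unit mulmx1.
  by rewrite !mulmxDl.
have dd : is_derive x (e_ i) (fun y => E y *m G y *m (E y)^T)
   ((dE i x *m G x + E x *m dG i x) *m (E x)^T + E x *m G x *m (dE i x)^T).
  apply: is_derive_mulmx.
    by apply: is_derive_mulmx; [exact: smooth_is_derive Es Ox|exact: smooth_is_derive Gs Ox].
  exact: (is_derive_linmx (@trmx R n n) (smooth_is_derive (e_ i) Es Ox)).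
have /= := derive_on oO Ox EGE dd.
rewrite (@derive_cst _ _ _ (eta : 'M[R]_n)) => /esym Z.
rewrite -[RHS]Z E1 (chr_compat i Ox) mulmxDr.
move: (chr i x) => C; rewrite [in LHS]linearD /= !trmx_mul !trmxK Gsym// !mulmxDl !mulmxA.
move: (dE i x *m G x *m (E x)^T) (E x *m C *m G x *m (E x)^T).
move: (E x *m G x *m (dE i x)^T) (E x *m G x *m C^T *m (E x)^T) => a b a' b'.
by apply/matrixP => j k; rewrite !mxE; ring.
Qed.

Lemma derive_coframe i x : O x -> is_derive x (e_ i) coframe
  (chr i x *m coframe x - coframe x *m conn i x).
Proof.
move=> Ox; have d := smooth_is_derive (e_ i) smooth_coframe Ox.
suff -> : chr i x *m coframe x - coframe x *m conn i x = 'D_(e_ i) coframe x by [].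
have dd := is_derive_mulmx (smooth_is_derive (e_ i) Es Ox) d.
have /= := derive_on oO Ox frame_coframe dd.
rewrite (@derive_cst _ _ _ (1%:M : 'M[R]_n)) -/(dE i x).
have Z2 : dE i x *m coframe x = conn i x - E x *m chr i x *m coframe x.
  by rewrite /conn mulmxDl addrK.
have cf := coframe_frame Ox; clear dd d.
move: ('D_(e_ i) coframe x) (coframe x) (conn i x) (chr i x) Z2 cf => dTh Th om C Z2 cf Z.
have {}Z : Th *m (dE i x *m Th + E x *m dTh) = 0 by rewrite -Z mulmx0.
move: Z; rewrite mulmxDr [Th *m (E x *m dTh)]mulmxA cf mul1mx Z2.
rewrite mulmxBr !mulmxA cf mul1mx => /eqP; rewrite addrC addr_eq0 => /eqP ->.
by rewrite opprB.
Qed.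

(** Row k holds the frame components of R(d_i, d_j) e_k; the order of the products is that of
    matrices acting on row vectors. *)
Definition curv i j x : 'M[R]_n := 'D_(e_ i) (conn j) x - 'D_(e_ j) (conn i) x
  + conn j x *m conn i x - conn i x *m conn j x.

Lemma curv_anti i j x : curv j i x = - curv i j x.
Proof.
rewrite /curv; move: ('D__ _ x) ('D__ _ x) (conn j x *m _) (conn i x *m _) => a b d e.
by apply/matrixP => k l; rewrite !mxE; ring.
Qed.

Lemma curv_skew i j x : O x -> eta_skew (curv i j x).
Proof.
move=> Ox.
have dsk a b : eta_skew ('D_(e_ a) (conn b) x).
  move=> k l.
  have h := (is_derive_mxP _ _ _ _).1 (smooth_is_derive (e_ a) (smooth_conn b) Ox).
  have h1 := is_derive_mulr (h k l) (is_derive_cst (eps l : R) x (e_ a)).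
  have h2 := is_derive_oppf (is_derive_mulr (h l k) (is_derive_cst (eps k : R) x (e_ a))).
  have e1 := derive_on oO Ox (fun y Oy => conn_skew b Oy k l) h1.
  have {h2}[_ e2] := h2; move: e1; rewrite e2 !mulr0 !addr0 => ->. by [].
have [s1 s2] := (conn_skew i Ox, conn_skew j Ox).
have lin (A B : 'M[R]_n) : eta_skew A -> eta_skew B -> eta_skew (A - B).
  by move=> sA sB k l; rewrite !mxE !mulrBl sA sB; ring.
have cm (A B : 'M[R]_n) : eta_skew A -> eta_skew B -> eta_skew (A *m B - B *m A).
  move=> /eta_skewP sA /eta_skewP sB; apply/eta_skewP.
  have sA' : A^T = - (eta *m A *m eta).
    rewrite -[A^T]mul1mx -eta_unit -[LHS]mulmxA -{2}eta_trmx -trmx_mul sA mulmxN.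
    by rewrite mulmxA.
  have sB' : B^T = - (eta *m B *m eta).
    rewrite -[B^T]mul1mx -eta_unit -[LHS]mulmxA -{2}eta_trmx -trmx_mul sB mulmxN.
    by rewrite mulmxA.
  have pr (C D : 'M[R]_n) : C^T = - (eta *m C *m eta) -> D^T = - (eta *m D *m eta) ->
      (C *m D)^T = eta *m (D *m C) *m eta.
    move=> hC hD; rewrite trmx_mul hC hD mulmxN mulNmx opprK !mulmxA.
    by rewrite -[eta *m D *m eta *m eta]mulmxA eta_unit mulmx1.
  rewrite trmx_mul linearB /= (pr _ _ sA' sB') (pr _ _ sB' sA') eta_trmx mulmxBr.
  by rewrite !mulmxA eta_unit !mul1mx mulmxBl opprB.
have add (A B : 'M[R]_n) : eta_skew A -> eta_skew B -> eta_skew (A + B).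
  by move=> sA sB k l; rewrite !mxE !mulrDl sA sB; ring.
rewrite /curv -addrA; apply: add; last exact: cm.
exact: lin (dsk i j) (dsk j i).
Qed.

(** Row d of the coframe is the field d_d in the frame, and [h d f] is nabla_f d_d. Commuting the
    second derivatives of that row gives R(d_a, d_b) d_d as K a b d - K b a d, where K a b d is
    nabla_a nabla_b d_d. The absence of torsion makes K symmetric in its last two arguments, so the
    cyclic sum cancels. *)
Lemma curv_bianchi i j k x : O x ->
  row k (coframe x *m curv i j x) + row i (coframe x *m curv j k x)
  + row j (coframe x *m curv k i x) = 0.
Proof.
move=> Ox.
pose h a b y := row a (chr b y *m coframe y).
have hS a b : smooth_on O (h a b).
  apply: (smooth_linmx oO (row a)); apply: (smooth_mulmx oO); first exact: smooth_chr.
  exact: smooth_coframe.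
have h_sym a b y : O y -> h a b y = h b a y.
  by move=> Oy; rewrite /h [LHS]row_mul [RHS]row_mul (chr_sym b a Oy).
pose K a b d := 'D_(e_ a) (h d b) x + h d b x *m conn a x.
have K_sym a b d : K a b d = K a d b.
  have dh := derive_on oO Ox (h_sym d b) (smooth_is_derive (e_ a) (hS d b) Ox).
  have hx := h_sym d b x Ox.
  exact: (etrans (congr1 (fun A => 'D_(e_ a) (h d b) x + A *m conn a x) hx)
    (congr1 (fun A => A + h b d x *m conn a x) (esym dh))).
suff F a b d : row d (coframe x *m curv a b x) = K a b d - K b a d.
  rewrite !F (K_sym j i k) (K_sym k j i) (K_sym i k j).
  by move: (K i j k) (K j k i) (K k i j) => u v w; apply/rowP => l; rewrite !mxE; ring.
have D1 : smooth_on O (fun y => row d (coframe y)) by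
  apply: (smooth_linmx oO (row d)); exact: smooth_coframe.
have dTh f y : O y -> is_derive y (e_ f) (fun y => row d (coframe y))
    (h d f y - row d (coframe y) *m conn f y).
  move=> Oy; have := is_derive_linmx (row d) (derive_coframe f Oy).
  by rewrite linearB /= [row d (coframe y *m _)]row_mul.
have second u f : 'D_(e_ u) ('D_(e_ f) (fun y => row d (coframe y))) x =
    'D_(e_ u) (h d f) x - ((h d u x - row d (coframe x) *m conn u x) *m conn f x
      + row d (coframe x) *m 'D_(e_ u) (conn f) x).
  apply: (derive_on oO Ox (f := fun y => h d f y - row d (coframe y) *m conn f y)).
    by move=> y Oy; have [_ ->] := dTh f y Oy.
  apply: is_derive_subf; first exact: smooth_is_derive (hS d f) Ox.
  apply: is_derive_mulmx; first exact: dTh.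
  exact: smooth_is_derive (smooth_conn f) Ox.
have Z := etrans (esym (second a b))
  (etrans (derive_swap (e_ a) (e_ b) oO (D1 2%N) Ox) (second b a)).
have alg (dab dba hb ha th : 'rV[R]_n) (oab oba oa ob : 'M[R]_n) :
    dab - ((ha - th *m oa) *m ob + th *m oab) =
    dba - ((hb - th *m ob) *m oa + th *m oba) ->
    th *m (oab - oba + ob *m oa - oa *m ob) = dab + hb *m oa - (dba + ha *m ob).
  rewrite !mulmxBl !(mulmxBr, mulmxDr) !mulmxA.
  move: (th *m oab) (th *m oba) (th *m ob *m oa) (th *m oa *m ob) (hb *m oa) (ha *m ob).
  move=> p q r s t u /rowP Z'; apply/rowP => l; have := Z' l; rewrite !mxE; lra.
exact: etrans (row_mul _ _ _) (alg _ _ _ _ _ _ _ _ _ Z).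
Qed.

End LocalLeviCivita.

(** * The integrability condition of a twistor spinor *)

Section LocalTwistor.
Context {R : realType} {n N : nat}.
Variables (O : set 'rV[R]_n) (G E : 'rV[R]_n -> 'M[R]_n).
Hypothesis oO : open O.
Hypothesis Gs : smooth_on O G.
Hypothesis Es : smooth_on O E.
Hypothesis Gsym : forall x, O x -> (G x)^T = G x.
Hypothesis EGE : forall x, O x -> E x *m G x *m (E x)^T = eta.
Hypothesis n3 : (3 <= n)%N.
Variable c : 'I_n -> 'M[R]_N.
Hypothesis cc : forall k l, c k *m c l + c l *m c k = (- 2 * eta k l)%:M.

Local Notation e_ i := (delta_mx 0 i : 'rV[R]_n).
Local Notation coframe := (coframe G E).
Local Notation conn := (conn G E).
Local Notation chr := (chr G E).
Local Notation curv := (curv G E).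
Local Notation cl := (cl c).
Local Notation sp := (sp c).

Definition frame_curv x (a b : 'I_n) : 'M[R]_n :=
  \sum_i \sum_j (E x a i * E x b j) *: curv i j x.

Definition schouten_coord i x : 'rV[R]_n :=
  \sum_a coframe x i a *: schouten (frame_curv x) a.

Lemma frame_curv_skew x a b : O x -> eta_skew (frame_curv x a b).
Proof.
move=> Ox k l; rewrite /frame_curv !summxE !mulr_suml -sumrN; apply: eq_bigr => i _.
rewrite !summxE !mulr_suml -sumrN; apply: eq_bigr => j _.
rewrite [X in X * _ = _]mxE [X in _ = - (X * _)]mxE -mulrA (curv_skew oO Gs Es Gsym EGE _ _ Ox).
by rewrite mulrN mulrA.
Qed.

Lemma frame_curv_anti x a b : frame_curv x b a = - frame_curv x a b.
Proof.
rewrite /frame_curv exchange_big -sumrN; apply: eq_bigr => i _.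
rewrite -sumrN; apply: eq_bigr => j _.
by rewrite curv_anti scalerN mulrC.
Qed.

Lemma frame_curv_bianchi x a b d f : O x ->
  frame_curv x a b d f + frame_curv x b d a f + frame_curv x d a b f = 0.
Proof.
move=> Ox.
pose T i j k := row k (coframe x *m curv i j x) 0 f.
have F a' b' d' : frame_curv x a' b' d' f =
    \sum_i \sum_j \sum_k (E x a' i * E x b' j * E x d' k) * T i j k.
  rewrite /frame_curv summxE; apply: eq_bigr => i _; rewrite summxE; apply: eq_bigr => j _.
  rewrite mxE -[curv i j x]mul1mx -(frame_coframe EGE Ox) -mulmxA mxE mulr_sumr.
  by apply: eq_bigr => k _; rewrite /T [in RHS]mxE mulrA.
have rot (g : 'I_n -> 'I_n -> 'I_n -> R) :
    \sum_i \sum_j \sum_k g i j k = \sum_i \sum_j \sum_k g k i j by exact: sum3_rot.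
have main (S : 'I_n -> 'I_n -> 'I_n -> R) (p q r : 'I_n -> R) :
    (forall i j k, S i j k + S j k i + S k i j = 0) ->
    \sum_i \sum_j \sum_k (p i * q j * r k) * S i j k +
    \sum_i \sum_j \sum_k (q i * r j * p k) * S i j k +
    \sum_i \sum_j \sum_k (r i * p j * q k) * S i j k = 0.
  move=> cyc; rewrite (rot (fun i j k => q i * r j * p k * S i j k)).
  rewrite (rot (fun i j k => q k * r i * p j * S k i j)) /=.
  rewrite (rot (fun i j k => r i * p j * q k * S i j k)) /=.
  rewrite -!sum3D big1// => i _; rewrite big1// => j _; rewrite big1// => k _ /=.
  transitivity (p i * q j * r k * (S i j k + S j k i + S k i j)); first by ring.
  by rewrite cyc mulr0.
rewrite !F; apply: main => i j k.
have mx3 (A B C : 'rV[R]_n) : (A + B + C) 0 f = A 0 f + B 0 f + C 0 f by rewrite !mxE.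
have z0 : (0 : 'rV[R]_n) 0 f = 0 by rewrite mxE.
exact: etrans (esym (mx3 _ _ _)) (etrans (congr1 (fun v : 'rV[R]_n => v 0 f)
  (curv_bianchi oO Gs Es Gsym EGE i j k Ox)) z0).
Qed.

Lemma spD A B : sp (A + B) = sp A + sp B.
Proof. exact: linearD. Qed.

Lemma spB A B : sp (A - B) = sp A - sp B.
Proof. exact: linearB. Qed.

Lemma clB x y : cl (x - y) = cl x - cl y.
Proof. exact: linearB. Qed.

(** The algebra behind [twistor_curvature]: the premise is the equality of the mixed second
    derivatives of phi after the twistor equation has been inserted. The terms with hi = hj cancel
    for lack of torsion, and [sp_cl] collects the derivatives of chi into covariant ones. *)
Lemma twistor_curvature_algebra (ti tj : 'rV[R]_n) (hi hj : 'rV[R]_n) (oi oj oij oji : 'M[R]_n)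
    (ph ch di dj : 'cV[R]_N) :
  eta_skew oi -> eta_skew oj -> hi = hj ->
  cl (hi - tj *m oi) *m ch + cl tj *m di - (sp oij *m ph + sp oj *m (cl ti *m ch - sp oi *m ph)) =
  cl (hj - ti *m oj) *m ch + cl ti *m dj - (sp oji *m ph + sp oi *m (cl tj *m ch - sp oj *m ph)) ->
  sp (oij - oji + oj *m oi - oi *m oj) *m ph =
  cl tj *m (di + sp oi *m ch) - cl ti *m (dj + sp oj *m ch).
Proof.
move=> si sj -> Q.
  have -> : sp (oij - oji + oj *m oi - oi *m oj) =
      sp oij - sp oji + (sp oi *m sp oj - sp oj *m sp oi).
    by rewrite sp_comm// -addrA spD spB.
  move: Q; rewrite !mulmxBr !mulmxDr [sp oj *m (cl ti *m ch)]mulmxA [sp oi *m (cl tj *m ch)]mulmxA.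
  rewrite !sp_cl// !clB !mulmxDl !mulNmx !mulmxA.
  move: (cl hj *m ch) (cl (tj *m oi) *m ch) (cl (ti *m oj) *m ch) (cl tj *m di) (cl ti *m dj).
  move: (sp oij *m ph) (sp oji *m ph) (cl ti *m sp oj *m ch) (cl tj *m sp oi *m ch).
  move: (sp oj *m sp oi *m ph) (sp oi *m sp oj *m ph).
  move=> a1 a2 a3 a4 a5 a6 a7 a8 a9 a10 a11 /colP Q.
  by apply/colP => l; have := Q l; rewrite !mxE; lra.
Qed.

Variables (phi chi : 'rV[R]_n -> 'cV[R]_N).
Hypothesis phis : smooth_on O phi.
Hypothesis chis : smooth_on O chi.
Hypothesis tw : forall i x, O x ->
  'D_(e_ i) phi x = cl (row i (coframe x)) *m chi x - sp (conn i x) *m phi x.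

Definition nabla_chi i x := 'D_(e_ i) chi x + sp (conn i x) *m chi x.

Lemma twistor_curvature i j x : O x ->
  sp (curv i j x) *m phi x = cl (row j (coframe x)) *m nabla_chi i x -
                             cl (row i (coframe x)) *m nabla_chi j x.
Proof.
move=> Ox.
have second u f : 'D_(e_ u) ('D_(e_ f) phi) x =
    cl (row f (chr u x *m coframe x - coframe x *m conn u x)) *m chi x
    + cl (row f (coframe x)) *m 'D_(e_ u) chi x
    - (sp ('D_(e_ u) (conn f) x) *m phi x + sp (conn f x) *m 'D_(e_ u) phi x).
  apply: (derive_on oO Ox (f := fun y => cl (row f (coframe y)) *m chi y - sp (conn f y) *m phi y)).
    by move=> y Oy; rewrite tw.
  apply: is_derive_subf; apply: is_derive_mulmx.
  - apply: (is_derive_linmx cl); apply: (is_derive_linmx (row f)).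
    exact: (derive_coframe oO Gs Es EGE u Ox).
  - exact: smooth_is_derive chis Ox.
  - apply: (is_derive_linmx sp); exact: smooth_is_derive (smooth_conn oO Gs Es f) Ox.
  - exact: smooth_is_derive phis Ox.
have Z := etrans (esym (second i j))
  (etrans (derive_swap (e_ i) (e_ j) oO (phis 2%N) Ox) (second j i)).
have s1 := conn_skew oO Gs Es Gsym EGE i Ox; have s2 := conn_skew oO Gs Es Gsym EGE j Ox.
have hh : row j (chr i x *m coframe x) = row i (chr j x *m coframe x).
  by rewrite [LHS]row_mul [RHS]row_mul (chr_sym E oO Gs Gsym j i Ox).
apply: (twistor_curvature_algebra (hi := row j (chr i x *m coframe x)) (hj := row i (chr j x *m coframe x)) s1 s2 hh).
have r1 := row_mul j (coframe x) (conn i x); have r2 := row_mul i (coframe x) (conn j x).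
rewrite -r1 -r2 -(tw i Ox) -(tw j Ox).
have rB k (A B : 'M[R]_n) : row k (A - B) = row k A - row k B by rewrite linearB.
by rewrite -!rB; exact: Z.
Qed.

(** In frame components the integrability condition becomes the hypothesis [Rm_T] of
    [clifford_curvature_vector], which can be solved for the covariant derivative of chi. *)
Lemma derive_chi i x : O x ->
  'D_(e_ i) chi x = cl (schouten_coord i x) *m phi x - sp (conn i x) *m chi x.
Proof.
move=> Ox.
pose T a := \sum_i E x a i *: nabla_chi i x.
have Rm_T a b : sp (frame_curv x a b) *m phi x = c b *m T a - c a *m T b.
  have cE d : c d = \sum_j E x d j *: cl (row j (coframe x)).
    rewrite -cl_delta -[delta_mx 0 d]mulmx1 -(frame_coframe EGE Ox) mulmxA -rowE.
    rewrite mulmx_sum_row linear_sum; apply: eq_bigr => j _ /=.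
    by rewrite linearZ /= mxE.
  rewrite /frame_curv linear_sum mulmx_suml.
  transitivity (\sum_i \sum_j ((E x a i * E x b j) *: (cl (row j (coframe x)) *m nabla_chi i x)
     - (E x a i * E x b j) *: (cl (row i (coframe x)) *m nabla_chi j x))).
    apply: eq_bigr => k _; rewrite linear_sum mulmx_suml; apply: eq_bigr => j _ /=.
    by rewrite linearZ /= -scalemxAl twistor_curvature// scalerBr.
  under eq_bigr do rewrite sumrB.
  rewrite sumrB; congr (_ - _).
    rewrite /T mulmx_sumr; apply: eq_bigr => k _; rewrite cE mulmx_suml; apply: eq_bigr => j _.
    by rewrite -scalemxAl -scalemxAr scalerA mulrC.
  rewrite exchange_big /T mulmx_sumr; apply: eq_bigr => k _; rewrite cE mulmx_suml.
  by apply: eq_bigr => j _; rewrite -scalemxAl -scalemxAr scalerA.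
have TE := clifford_curvature_vector cc n3 (fun a b => frame_curv_skew a b Ox)
  (frame_curv_anti x) (fun a b d f => frame_curv_bianchi a b d f Ox) Rm_T.
suff <- : nabla_chi i x = cl (schouten_coord i x) *m phi x.
  by rewrite /nabla_chi; move: ('D__ _ _) => d; rewrite addrK.
transitivity (\sum_a coframe x i a *: T a).
  rewrite /T; under eq_bigr do rewrite scaler_sumr.
  rewrite exchange_big; under eq_bigr => j _ do under eq_bigr => a _ do rewrite scalerA.
  under eq_bigr => j _ do rewrite -scaler_suml.
  rewrite (bigD1 i)//= [X in _ + X]big1 => [|j ji].
    have /matrixP/(_ i i) := coframe_frame EGE Ox; rewrite [LHS]mxE => ->.
    by rewrite [X in X *: _]mxE eqxx scale1r addr0.
  have /matrixP/(_ i j) := coframe_frame EGE Ox; rewrite [LHS]mxE => ->.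
  by rewrite [X in X *: _]mxE eq_sym (negbTE ji) scale0r.
rewrite /schouten_coord linear_sum mulmx_suml; apply: eq_bigr => a _.
by rewrite linearZ /= TE -scalemxAl.
Qed.

Lemma smooth_curv i j : smooth_on O (curv i j).
Proof.
have sC k := smooth_conn oO Gs Es k.
have sD a b : smooth_on O (fun x => 'D_(e_ a) (conn b) x) by exact: smooth_derive.
apply: (smooth_sub oO); last exact: (smooth_mulmx oO).
apply: (smooth_add oO); last exact: (smooth_mulmx oO).
exact: (smooth_sub oO).
Qed.

Lemma smooth_schouten_coord i : smooth_on O (schouten_coord i).
Proof.
have sE a j : smooth_on O (fun x => E x a j) by exact: (smooth_mxP oO E).1.
have sF a b k l : smooth_on O (fun x => frame_curv x a b k l).
  apply: (smooth_ext oO (f := fun x => \sum_i \sum_j (E x a i * E x b j) * curv i j x k l)).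
    move=> x _; rewrite /frame_curv summxE; apply: eq_bigr => u _.
    by rewrite summxE; apply: eq_bigr => v _; rewrite [RHS]mxE.
  apply: (smooth_sum oO) => u; apply: (smooth_sum oO) => v.
  apply: (smooth_mulr oO); first exact: (smooth_mulr oO).
  exact: (smooth_mxP oO (curv u v)).1 (smooth_curv u v) _ _.
have sK (a : R) : smooth_on O (fun _ : 'rV[R]_n => a) by exact: (smooth_cst oO).
have sR b d : smooth_on O (fun x => ricci (frame_curv x) b d).
  apply: (smooth_sum oO) => a; apply: (smooth_mulr oO) => //; exact: (smooth_mulr oO).
apply: (smooth_sum oO) => a; apply: (smooth_scaler oO).
  exact: (smooth_mxP oO coframe).1 (smooth_coframe oO Gs Es) _ _.
apply/(smooth_mxP oO) => k l.
apply: (smooth_ext oO (f := fun x => (n%:R - 2)^-1 *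
   (scalar_curv (frame_curv x) / (4 * (n%:R - 1)) * (a == l)%:R
          - 2^-1 * eps l * ricci (frame_curv x) a l))).
  by move=> x _; rewrite [RHS]mxE.
apply: (smooth_mulr oO) => //; apply: (smooth_sub oO); last exact: (smooth_mulr oO).
apply: (smooth_mulr oO) => //; apply: (smooth_mulr oO) => //.
by apply: (smooth_sum oO) => b; exact: (smooth_mulr oO).
Qed.

Definition conn_dir x (u : 'rV[R]_n) : 'M[R]_n := \sum_i u 0 i *: conn i x.
Definition chr_dir x (u : 'rV[R]_n) : 'M[R]_n := \sum_i u 0 i *: chr i x.
Definition schouten_dir x (u : 'rV[R]_n) : 'rV[R]_n := \sum_i u 0 i *: schouten_coord i x.

Lemma conn_dir_skew x u : O x -> eta_skew (conn_dir x u).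
Proof.
move=> Ox k l; rewrite /conn_dir !summxE !mulr_suml -sumrN; apply: eq_bigr => i _.
rewrite [X in X * _ = _]mxE [X in _ = - (X * _)]mxE -mulrA (conn_skew oO Gs Es Gsym EGE _ Ox).
by rewrite mulrN mulrA.
Qed.

Lemma sp_conn_dir x u : sp (conn_dir x u) = \sum_i u 0 i *: sp (conn i x).
Proof.
rewrite /conn_dir linear_sum; apply: eq_bigr => i _; move: (conn i x) => A.
by rewrite [LHS]linearZ.
Qed.

Lemma cl_schouten_dir x u : cl (schouten_dir x u) = \sum_i u 0 i *: cl (schouten_coord i x).
Proof.
rewrite /schouten_dir linear_sum; apply: eq_bigr => i _; move: (schouten_coord i x) => A.
by rewrite [LHS]linearZ.
Qed.

Lemma cl_rows (A : 'M[R]_n) u : cl (u *m A) = \sum_i u 0 i *: cl (row i A).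
Proof. by rewrite mulmx_sum_row linear_sum; apply: eq_bigr => i _; rewrite [LHS]linearZ. Qed.

Lemma curve_phi (x : R -> 'rV[R]_n) t u : O (x t) -> is_derive t (1 : R) x u ->
  is_derive t (1 : R) (fun s => phi (x s))
    (cl (u *m coframe (x t)) *m chi (x t) - sp (conn_dir (x t) u) *m phi (x t)).
Proof.
move=> Ox xu; apply: (is_derive_eq (is_derive_dirder oO (phis 1%N) Ox xu)).
rewrite sp_conn_dir cl_rows !mulmx_suml -sumrB; apply: eq_bigr => i _.
by rewrite -[_ *: cl _ *m _]scalemxAl -[_ *: sp _ *m _]scalemxAl -scalerBr; congr (_ *: _); exact: tw.
Qed.

Lemma curve_chi (x : R -> 'rV[R]_n) t u : O (x t) -> is_derive t (1 : R) x u ->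
  is_derive t (1 : R) (fun s => chi (x s))
    (cl (schouten_dir (x t) u) *m phi (x t) - sp (conn_dir (x t) u) *m chi (x t)).
Proof.
move=> Ox xu; apply: (is_derive_eq (is_derive_dirder oO (chis 1%N) Ox xu)).
rewrite sp_conn_dir cl_schouten_dir !mulmx_suml -sumrB; apply: eq_bigr => i _.
by rewrite -[_ *: cl _ *m _]scalemxAl -[_ *: sp _ *m _]scalemxAl -scalerBr; congr (_ *: _); exact: derive_chi.
Qed.

Lemma curve_coframe (x : R -> 'rV[R]_n) t u : O (x t) -> is_derive t (1 : R) x u ->
  is_derive t (1 : R) (fun s => coframe (x s))
    (chr_dir (x t) u *m coframe (x t) - coframe (x t) *m conn_dir (x t) u).
Proof.
move=> Ox xu.
apply: (is_derive_eq (is_derive_dirder oO (smooth_coframe oO Gs Es 1%N) Ox xu)).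
rewrite /conn_dir /chr_dir mulmx_suml mulmx_sumr -sumrB.
apply: eq_bigr => i _; rewrite -scalemxAl -scalemxAr -scalerBr.
by congr (_ *: _); have [_ ->] := derive_coframe oO Gs Es EGE i Ox.
Qed.

End LocalTwistor.

(** * Uniform bounds near a point *)

Section LocalBounds.
Context {R : realType}.

Lemma linear_bounded p q a b (L : {linear 'M[R]_(p, q) -> 'M[R]_(a, b)}) :
  exists2 K : R, 0 <= K & forall A, `|L A| <= K * `|A|.
Proof.
exists (\sum_i \sum_j `|L (delta_mx i j)|).
  by apply: sumr_ge0 => i _; apply: sumr_ge0.
move=> A; rewrite linear_mx_sum mulr_suml; apply: le_trans (ler_norm_sum _ _ _) _.
apply: ler_sum => i _; rewrite mulr_suml; apply: le_trans (ler_norm_sum _ _ _) _.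
by apply: ler_sum => j _; rewrite normrZ mulrC ler_wpM2l// mx_entry_le.
Qed.

(** The family is packed into one matrix-valued map, so that one radius and one constant bound all
    members together with their Lipschitz constants. *)
Lemma smooth_family_bound n a b (I : finType) (O : set 'rV[R]_n)
    (f : I -> 'rV[R]_n -> 'M[R]_(a, b)) (p : 'rV[R]_n) :
  open O -> (forall i, smooth_on O (f i)) -> O p ->
  exists r K : R, [/\ 0 < r, 0 <= K & forall x x', `|x - p| <= r -> `|x' - p| <= r ->
    O x /\ forall i, `|f i x| <= K /\ `|f i x - f i x'| <= K * `|x - x'|].
Proof.
move=> oO fO Op.
pose F x := \matrix_(i < #|I|, j < a * b) mxvec (f (enum_val i) x) 0 j.
have Fs : smooth_on O F.
  apply/(smooth_mxP oO) => i j.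
  apply: (smooth_ext oO (f := fun x => mxvec (f (enum_val i) x) 0 j)).
    by move=> x _; rewrite [RHS]mxE.
  by apply: (smooth_mxP oO _).1; apply: (smooth_linmx oO (@mxvec R a b)).
have FE i x k l : f i x k l = F x (enum_rank i) (mxvec_index k l).
  by rewrite [RHS]mxE enum_rankK mxvecE.
have [d d0 [K K0 HK]] := C1_lipschitz oO (Fs 1%N) Op.
have /nbhs_ballP[e /= e0 He] := open_nbhs_nbhs (conj oO Op).
pose r := Num.min (d / 2) (e / 2).
have r0 : 0 < r by rewrite lt_min !divr_gt0.
have rd : r < d.
  by rewrite gt_min (_ : d / 2 < d)// ltr_pdivrMr// mulr_natr mulr2n ltrDl.
have re : r < e.
  by rewrite gt_min (_ : e / 2 < e) ?orbT// ltr_pdivrMr// mulr_natr mulr2n ltrDl.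
exists r, (`|F p| + K * r + K); split=> //.
  by rewrite !addr_ge0// mulr_ge0// ltW.
move=> x x' hx hx'; split.
  by apply: He; rewrite -ball_normE/= distrC; apply: le_lt_trans hx re.
have lip y y' : `|y - p| <= r -> `|y' - p| <= r -> `|F y - F y'| <= K * `|y - y'|.
  by move=> hy hy'; apply: HK; [exact: le_lt_trans hy rd|exact: le_lt_trans hy' rd].
have Kr : 0 <= K * r by rewrite mulr_ge0// ltW.
move=> i; split.
  apply/mx_norm_le; first by rewrite !addr_ge0.
  move=> k l; rewrite FE; apply: le_trans (mx_entry_le _ _ _) _.
  rewrite -(subrK (F p) (F x)); apply: le_trans (ler_normD _ _) _.
  have h : `|F x - F p| <= K * r.
    apply: le_trans (lip _ _ hx _) _; first by rewrite subrr normr0 ltW.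
    by rewrite ler_wpM2l.
  by rewrite addrC -addrA lerD2l (le_trans h)// lerDl.
have hxx := lip x x' hx hx'.
apply/mx_norm_le; first by rewrite mulr_ge0// !addr_ge0.
move=> k l; rewrite mxE [X in _ + X]mxE !FE.
rewrite (_ : _ - _ = (F x - F x') (enum_rank i) (mxvec_index k l)); last first.
  by rewrite [RHS]mxE [X in _ = _ + X]mxE.
apply: le_trans (mx_entry_le _ _ _) _; apply: le_trans hxx _.
by rewrite ler_wpM2r// lerDr addr_ge0.
Qed.

Lemma dir_bound n a b (f : 'I_n -> 'M[R]_(a, b)) (u : 'rV[R]_n) (K : R) :
  (forall i, `|f i| <= K) -> `|\sum_i u 0 i *: f i| <= n%:R * K * `|u|.
Proof.
move=> H; apply: le_trans (ler_norm_sum _ _ _) _.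
apply: (@le_trans _ _ (\sum_(i < n) K * `|u|)).
  apply: ler_sum => i _; rewrite normrZ mulrC; apply: ler_pM => //.
  exact: mx_entry_le.
by rewrite sumr_const card_ord -[leLHS]mulr_natl mulrA.
Qed.

End LocalBounds.

(* The data of a twistor spinor in a chart and a local frame, as seen by
   curves: coframe, connection, Christoffel map, Schouten tensor, spinor and
   (up to a factor) its Dirac image. *)
Record twistor_system (R : realType) (n N : nat) (c : 'I_n -> 'M[R]_N) := TwistorSystem {
  ts_dom : set 'rV[R]_n;
  ts_th : 'rV[R]_n -> 'M[R]_n;
  ts_e : 'rV[R]_n -> 'M[R]_n;
  ts_om : 'rV[R]_n -> 'rV[R]_n -> 'M[R]_n;
  ts_ch : 'rV[R]_n -> 'rV[R]_n -> 'M[R]_n;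
  ts_sch : 'rV[R]_n -> 'rV[R]_n -> 'rV[R]_n;
  ts_phi : 'rV[R]_n -> 'cV[R]_N;
  ts_chi : 'rV[R]_n -> 'cV[R]_N;
  ts_open : open ts_dom;
  ts_inv : forall x, ts_dom x -> ts_th x *m ts_e x = 1%:M;
  ts_skew : forall x u, ts_dom x -> eta_skew (ts_om x u);
  ts_curve_phi : forall (x : R -> 'rV[R]_n) t u, ts_dom (x t) -> is_derive t (1 : R) x u ->
    is_derive t (1 : R) (fun s => ts_phi (x s))
      (cl c (u *m ts_th (x t)) *m ts_chi (x t) - sp c (ts_om (x t) u) *m ts_phi (x t));
  ts_curve_chi : forall (x : R -> 'rV[R]_n) t u, ts_dom (x t) -> is_derive t (1 : R) x u ->
    is_derive t (1 : R) (fun s => ts_chi (x s))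
      (cl c (ts_sch (x t) u) *m ts_phi (x t) - sp c (ts_om (x t) u) *m ts_chi (x t));
  ts_curve_th : forall (x : R -> 'rV[R]_n) t u, ts_dom (x t) -> is_derive t (1 : R) x u ->
    is_derive t (1 : R) (fun s => ts_th (x s))
      (ts_ch (x t) u *m ts_th (x t) - ts_th (x t) *m ts_om (x t) u);
  ts_chB : forall x u u', ts_ch x (u - u') = ts_ch x u - ts_ch x u';
  ts_bound : forall p, ts_dom p -> exists r K : R, [/\ 0 < r, 0 <= K &
    forall x x', `|x - p| <= r -> `|x' - p| <= r -> [/\ ts_dom x, `|ts_th x| <= K,
      (forall u, `|ts_om x u| <= K * `|u|), (forall u, `|ts_sch x u| <= K * `|u|) &
      forall u, `|ts_ch x u| <= K * `|u| /\
                `|ts_ch x u - ts_ch x' u| <= K * `|x - x'| * `|u| ] ]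
}.

Section LocalSystem.
Context {R : realType} {n N : nat}.
Variables (O : set 'rV[R]_n) (G E : 'rV[R]_n -> 'M[R]_n).
Hypothesis oO : open O.
Hypothesis Gs : smooth_on O G.
Hypothesis Es : smooth_on O E.
Hypothesis Gsym : forall x, O x -> (G x)^T = G x.
Hypothesis EGE : forall x, O x -> E x *m G x *m (E x)^T = eta.
Hypothesis n3 : (3 <= n)%N.
Variable c : 'I_n -> 'M[R]_N.
Hypothesis cc : forall k l, c k *m c l + c l *m c k = (- 2 * eta k l)%:M.
Variables (phi chi : 'rV[R]_n -> 'cV[R]_N).
Hypothesis phis : smooth_on O phi.
Hypothesis chis : smooth_on O chi.
Hypothesis tw : forall i x, O x -> 'D_(delta_mx 0 i) phi x =
  cl c (row i (coframe G E x)) *m chi x - sp c (conn G E i x) *m phi x.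

Lemma chr_dirB x u u' : chr_dir G E x (u - u') = chr_dir G E x u - chr_dir G E x u'.
Proof.
by rewrite /chr_dir -sumrB; apply: eq_bigr => i _; rewrite mxE [X in _ + X]mxE scalerBl.
Qed.

Lemma local_system_bound p : O p -> exists r K : R, [/\ 0 < r, 0 <= K &
    forall x x', `|x - p| <= r -> `|x' - p| <= r -> [/\ O x, `|coframe G E x| <= K,
      (forall u, `|conn_dir G E x u| <= K * `|u|), (forall u, `|schouten_dir G E x u| <= K * `|u|) &
      forall u, `|chr_dir G E x u| <= K * `|u| /\
                `|chr_dir G E x u - chr_dir G E x' u| <= K * `|x - x'| * `|u| ] ].
Proof.
move=> Op.
have [r1 [K1 [r10 K10 B1]]] := smooth_family_bound (f := fun _ : unit => coframe G E) oO (fun _ => smooth_coframe oO Gs Es) Op.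
have [r2 [K2 [r20 K20 B2]]] := smooth_family_bound oO (smooth_conn oO Gs Es) Op.
have [r3 [K3 [r30 K30 B3]]] := smooth_family_bound oO (smooth_schouten_coord oO Gs Es) Op.
have [r4 [K4 [r40 K40 B4]]] := smooth_family_bound oO (smooth_chr oO Gs Es) Op.
pose K := K1 + n%:R * K2 + n%:R * K3 + n%:R * K4.
have nK k : 0 <= k -> 0 <= n%:R * k :> R by move=> h; rewrite mulr_ge0.
have a2 := nK _ K20; have a3 := nK _ K30; have a4 := nK _ K40.
exists (Num.min (Num.min r1 r2) (Num.min r3 r4)), K; split.
- by rewrite !lt_min r10 r20 r30 r40.
- by rewrite /K !addr_ge0.
move=> x x'; rewrite !le_min => /andP[/andP[h1 h2] /andP[h3 h4]].
move=> /andP[/andP[h1' h2'] /andP[h3' h4']].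
have [Ox /(_ tt)[b1 _]] := B1 x x' h1 h1'; have [_ b2] := B2 x x' h2 h2'.
have [_ b3] := B3 x x' h3 h3'; have [_ b4] := B4 x x' h4 h4'.
have up k u : k <= K -> k * `|u : 'rV[R]_n| <= K * `|u| by move=> h; rewrite ler_wpM2r.
split=> //.
- by apply: le_trans b1 _; rewrite /K; lra.
- move=> u; apply: le_trans (dir_bound u (fun i => (b2 i).1)) _; apply: up; rewrite /K; lra.
- move=> u; apply: le_trans (dir_bound u (fun i => (b3 i).1)) _; apply: up; rewrite /K; lra.
- move=> u; split.
    by apply: le_trans (dir_bound u (fun i => (b4 i).1)) _; apply: up; rewrite /K; lra.
  have -> : chr_dir G E x u - chr_dir G E x' u = \sum_i u 0 i *: (chr G E i x - chr G E i x').
    by rewrite /chr_dir -sumrB; apply: eq_bigr => i _; rewrite scalerBr.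
  apply: le_trans (dir_bound u (fun i => (b4 i).2)) _; rewrite ler_wpM2r// mulrA ler_wpM2r//.
  by rewrite /K; lra.
Qed.

Definition local_system : twistor_system c := @TwistorSystem R n N c O
  (coframe G E) E (conn_dir G E) (chr_dir G E) (schouten_dir G E) phi chi oO
  (coframe_frame EGE) (conn_dir_skew oO Gs Es Gsym EGE)
  (curve_phi oO phis tw)
  (curve_chi oO Gs Es Gsym EGE n3 cc phis chis tw)
  (curve_coframe oO Gs Es EGE) chr_dirB local_system_bound.

End LocalSystem.

(** * Twistor spinors along curves *)

Section LinearZero.
Context {R : realType} {p q : nat}.
Variables (u du : R -> 'M[R]_(p, q)).

Lemma linear_zero_single (K r t : R) : 0 <= K -> 0 < r ->
  (forall s, `|s - t| < r -> is_derive s (1 : R) u (du s)) ->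
  (forall s, `|s - t| < r -> `|du s| <= K * `|u s|) ->
  exists2 r' : R, 0 < r' <= r & forall s s', `|s - t| < r' -> `|s' - t| < r' ->
    u s = 0 -> u s' = 0.
Proof.
move=> K0 r0 hu hb.
have [r' hr' H] := @linear_ineq_zero R p q 1 1 u du (fun=> 0) (fun=> 0) K r t K0 r0
  (fun s hs => conj (hu s hs) (is_derive_cst _ _ _))
  (fun s hs => ltac:(rewrite !normr0 addr0; split; [exact: hb|by rewrite mulr_ge0])).
by exists r' => // s s' hs hs' h; case: (H s s' hs hs' h).
Qed.

End LinearZero.

Section TwistorAlongCurves.
Context {R : realType} {n N : nat}.
Variable c : 'I_n -> 'M[R]_N.
Variable H : 'M[R]_N.
Hypothesis cc : forall k l, c k *m c l + c l *m c k = (- 2 * eta k l)%:M.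
Hypothesis H_sym : H^T = H.
Hypothesis H_c : forall k, (c k)^T *m H = H *m c k.
Hypothesis H_pos : forall k : 'I_n, (k = 0 :> nat)%N ->
  forall x : 'cV[R]_N, x != 0 -> 0 < (x^T *m H *m (c k *m x)) 0 0.
Hypothesis n3 : (3 <= n)%N.
Variable S : twistor_system c.
Notation cl := (cl c).
Notation sp := (sp c).
Notation planar := (planar (tgam c) tinv (tform H)).

Record spinor_bound (C : R) (x u : 'rV[R]_n) : Prop := SpinorBound {
  sb_dom : ts_dom S x;
  sb_th : `|u *m ts_th S x| <= C * `|u|;
  sb_sch : `|ts_sch S x u| <= C * `|u|;
  sb_om : `|ts_om S x u| <= C * `|u|;
  sb_om_mul : forall y : 'rV[R]_n, `|y *m ts_om S x u| <= C * `|u| * `|y|;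
  sb_cl_th : `|cl (u *m ts_th S x)| <= C * `|u|;
  sb_cl_sch : `|cl (ts_sch S x u)| <= C * `|u|;
  sb_sp : `|sp (ts_om S x u)| <= C * `|u|;
  sb_cl_th_mul : forall w : 'cV[R]_N, `|cl (u *m ts_th S x) *m w| <= C * `|u| * `|w|;
  sb_cl_sch_mul : forall w : 'cV[R]_N, `|cl (ts_sch S x u) *m w| <= C * `|u| * `|w|;
  sb_sp_mul : forall w : 'cV[R]_N, `|sp (ts_om S x u) *m w| <= C * `|u| * `|w|
}.

Lemma spinor_boundP p : ts_dom S p -> exists r C : R, [/\ 0 < r, 0 <= C &
  forall x u, `|x - p| <= r -> spinor_bound C x u].
Proof.
move=> pS; have [r [K [r0 K0 HK]]] := ts_bound pS.
have [Kc Kc0 HKc] := linear_bounded cl.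
have [Ks Ks0 HKs] := linear_bounded sp.
pose K1 := n%:R * K + K.
have K10 : 0 <= K1 by rewrite addr_ge0// mulr_ge0.
pose K2 := K1 + Kc * K1 + Ks * K1.
have a0 : 0 <= Kc * K1 by rewrite mulr_ge0.
have b0 : 0 <= Ks * K1 by rewrite mulr_ge0.
have K20 : 0 <= K2 by rewrite /K2; lra.
have NK : 0 <= N%:R * K2 by rewrite mulr_ge0.
pose C := K2 + N%:R * K2.
have C0 : 0 <= C by rewrite addr_ge0.
have nK : 0 <= n%:R * K by rewrite mulr_ge0.
exists r, C; split=> // x u hx; have [dx hth hom hsch _] := HK x x hx hx.
have up k (b : R) : k <= C -> 0 <= b -> k * b <= C * b by move=> h h'; rewrite ler_wpM2r.
have u0 : 0 <= `|u| by [].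
have bth : `|u *m ts_th S x| <= K1 * `|u|.
  apply: le_trans (mulmx_norm_le _ _) _; rewrite mulrAC ler_wpM2r//.
  apply: (@le_trans _ _ (n%:R * K)); last by rewrite lerDl.
  by rewrite ler_wpM2l.
have bsch : `|ts_sch S x u| <= K1 * `|u|.
  by apply: le_trans (hsch u) _; rewrite ler_wpM2r// lerDr.
have bom : `|ts_om S x u| <= K1 * `|u|.
  by apply: le_trans (hom u) _; rewrite ler_wpM2r// lerDr.
have K2C : K2 <= C by rewrite /C; lra.
have K1C : K1 <= C by apply: le_trans K2C; rewrite /K2; lra.
have K1K2 : Kc * K1 <= K2 by rewrite /K2; lra.
have KsK2 : Ks * K1 <= K2 by rewrite /K2; lra.
have c1 : `|cl (u *m ts_th S x)| <= K2 * `|u|.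
  apply: le_trans (HKc _) _; apply: (@le_trans _ _ (Kc * K1 * `|u|)); last by rewrite ler_wpM2r.
  by rewrite -mulrA ler_wpM2l.
have c2 : `|cl (ts_sch S x u)| <= K2 * `|u|.
  apply: le_trans (HKc _) _; apply: (@le_trans _ _ (Kc * K1 * `|u|)); last by rewrite ler_wpM2r.
  by rewrite -mulrA ler_wpM2l.
have c3 : `|sp (ts_om S x u)| <= K2 * `|u|.
  apply: le_trans (HKs _) _; apply: (@le_trans _ _ (Ks * K1 * `|u|)); last by rewrite ler_wpM2r.
  by rewrite -mulrA ler_wpM2l.
have pr (A : 'M[R]_N) (w : 'cV[R]_N) : `|A| <= K2 * `|u| -> `|A *m w| <= C * `|u| * `|w|.
  move=> hA; apply: le_trans (mulmx_norm_le _ _) _; rewrite ler_wpM2r//.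
  apply: (@le_trans _ _ (N%:R * K2 * `|u|)); first by rewrite -mulrA ler_wpM2l.
  by rewrite ler_wpM2r// /C lerDr.
split=> //.
- by apply: le_trans bth _; apply: up.
- by apply: le_trans bsch _; apply: up.
- by apply: le_trans bom _; apply: up.
- move=> y; apply: le_trans (mulmx_norm_le _ _) _.
  rewrite mulrAC ler_wpM2r//; apply: (@le_trans _ _ (n%:R * K * `|u|)).
    by rewrite -mulrA ler_wpM2l.
  by rewrite ler_wpM2r//; apply: le_trans K1C; rewrite /K1 lerDl.
- by apply: le_trans c1 _; apply: up.
- by apply: le_trans c2 _; apply: up.
- by apply: le_trans c3 _; apply: up.
- by move=> w; apply: pr.
- by move=> w; apply: pr.
- by move=> w; apply: pr.
Qed.

Lemma is_derive_col_mx (V : normedModType R) a b q (f : V -> 'M[R]_(a, q))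
    (g : V -> 'M[R]_(b, q)) (x v : V) df dg :
  is_derive x v f df -> is_derive x v g dg ->
  is_derive x v (fun y => col_mx (f y) (g y)) (col_mx df dg).
Proof.
move=> /is_derive_mxP hf /is_derive_mxP hg; apply/is_derive_mxP => i j.
rewrite -(splitK i); case: (fintype.split i) => k /=.
  rewrite col_mxEu; apply: (is_derive_ext _ (hf k j)).
  by apply: nearW => y; rewrite col_mxEu.
rewrite col_mxEd; apply: (is_derive_ext _ (hg k j)).
by apply: nearW => y; rewrite col_mxEd.
Qed.

Definition geodesic_pair (x v : R -> 'rV[R]_n) t := [/\ ts_dom S (x t),
  is_derive t (1 : R) x (v t) & is_derive t (1 : R) v (- (v t *m ts_ch S (x t) (v t)))].

Definition vel (x v : R -> 'rV[R]_n) t := v t *m ts_th S (x t).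

(** The Christoffel terms of the velocity and of the coframe cancel: in the frame, the geodesic
    equation says that the velocity is parallel. *)
Lemma vel_derive x v t : geodesic_pair x v t ->
  is_derive t (1 : R) (vel x v) (- (vel x v t *m ts_om S (x t) (v t))).
Proof.
case=> dx dv dd; apply: is_derive_eq.
  exact: (is_derive_mulmx dd (ts_curve_th dx dv)).
rewrite /vel; move: (ts_ch S _ _) (ts_th S _) (ts_om S _ _) => A B C.
by rewrite mulNmx mulmxBr !mulmxA addrA addNr add0r.
Qed.

Lemma mink_skew (om : 'M[R]_n) y : eta_skew om -> mink (y *m om) y = 0.
Proof.
move=> sk; have E : mink (y *m om) y = - mink (y *m om) y; last by lra.
have tr1 (A : 'M[R]_1) : A 0 0 = A^T 0 0 by rewrite mxE.
have h : (y *m om *m eta *m y^T)^T = - (y *m om *m eta *m y^T).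
  rewrite -(mulmxA y) trmx_mul [(y *m _)^T]trmx_mul trmxK (eta_skewP om).1//.
  by rewrite mulNmx mulmxN mulmxA.
by rewrite -(minkE (y *m om) y) {1}tr1 h mxE.
Qed.

Lemma is_derive_mink (V : normedModType R) (f g : V -> 'rV[R]_n) (x v : V) df dg :
  is_derive x v f df -> is_derive x v g dg ->
  is_derive x v (fun y => mink (f y) (g y)) (mink df (g x) + mink (f x) dg).
Proof.
move=> /is_derive_mxP hf /is_derive_mxP hg.
rewrite /mink -big_split/=; apply: is_derive_bigsum => i.
by apply: is_derive_eq; rewrite /GRing.scale/=; ring.
Qed.

Lemma vel_sq_derive x v t : geodesic_pair x v t ->
  is_derive t (1 : R) (fun s => mink (vel x v s) (vel x v s)) 0.
Proof.
move=> g; have d := vel_derive g; case: g => dx _ _.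
apply: is_derive_eq; first exact: (is_derive_mink d d).
by rewrite [mink (vel x v t) _]minkC minkNl mink_skew ?oppr0 ?addr0//; apply: ts_skew.
Qed.

(** The covariant derivative of gamma'.phi is gamma'.gamma'.chi = -g(gamma',gamma') chi; for null
    geodesics it is 0. *)
Lemma derive_clif_phi x v t : geodesic_pair x v t ->
  is_derive t (1 : R) (fun s => cl (vel x v s) *m ts_phi S (x s))
   (- (sp (ts_om S (x t) (v t)) *m (cl (vel x v t) *m ts_phi S (x t)))
    - mink (vel x v t) (vel x v t) *: ts_chi S (x t)).
Proof.
move=> g; have d := vel_derive g; case: g => dx dv _.
apply: is_derive_eq.
  exact: (is_derive_mulmx (is_derive_linmx cl d) (ts_curve_phi dx dv)).
have sk := ts_skew (v t) dx; rewrite -/(vel x v t).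
move: (vel x v t) (ts_om S _ _) (ts_phi S _) (ts_chi S _) sk => y om w z sk.
rewrite /= clN mulmxBr !mulmxA (sp_cl cc y sk) cl_sq// mul_scalar_mx.
by rewrite scaleNr mulNmx !mulmxDl !opprD addrCA [RHS]addrC; congr (_ + _); rewrite addrC.
Qed.

(** The derivative of gamma'.chi involves only gamma'.chi and phi, so together with the equation of
    phi it forms a closed linear system. *)
Lemma derive_clif_chi x v t : geodesic_pair x v t ->
  is_derive t (1 : R) (fun s => cl (vel x v s) *m ts_chi S (x s))
   (cl (vel x v t) *m (cl (ts_sch S (x t) (v t)) *m ts_phi S (x t))
    - sp (ts_om S (x t) (v t)) *m (cl (vel x v t) *m ts_chi S (x t))).
Proof.
move=> g; have d := vel_derive g; case: g => dx dv _.
apply: is_derive_eq.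
  exact: (is_derive_mulmx (is_derive_linmx cl d) (ts_curve_chi dx dv)).
have sk := ts_skew (v t) dx.
move: (vel x v t) (ts_om S _ _) (ts_phi S _) (ts_chi S _) (ts_sch S _ _) sk => y om w z P sk.
rewrite /= clN mulmxBr !mulmxA (sp_cl cc y sk) mulNmx mulmxDl opprD.
by rewrite addrCA; congr (_ + _); rewrite addrC.
Qed.

Lemma geodesic_bound x v t0 (eps : R) : 0 < eps ->
  (forall s, `|s - t0| < eps -> geodesic_pair x v s) ->
  exists d C : R, [/\ 0 < d <= eps, 0 <= C & forall s, `|s - t0| < d ->
    [/\ geodesic_pair x v s, spinor_bound C (x s) (v s) & `|v s| <= C] ].
Proof.
move=> e0 g; have [dx hx hv] : geodesic_pair x v t0 by apply: g; rewrite subrr normr0.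
have [r [C [r0 C0 HC]]] := spinor_boundP dx.
have /(cvgrPdist_lt (FF := nbhs_filter t0))/(_ _ r0)/nbhs_ballP[d1 /= d10 H1] := is_derive_mx_continuous hx.
have /(cvgrPdist_lt (FF := nbhs_filter t0))/(_ 1 ltr01)/nbhs_ballP[d2 /= d20 H2] := is_derive_mx_continuous hv.
exists (Num.min eps (Num.min d1 d2)), (C + (1 + `|v t0|)); split.
- by rewrite !lt_min e0 d10 d20/= ge_min lexx.
- by rewrite !addr_ge0.
move=> s; rewrite !lt_min => /and3P[h h1 h2]; split; first exact: g.
  have hs : `|x s - x t0| <= r.
    by rewrite distrC ltW//; apply: H1; rewrite -ball_normE/= distrC.
  have hC : C <= C + (1 + `|v t0|) by rewrite lerDl addr_ge0.
  have up (k : R) : 0 <= k -> C * k <= (C + (1 + `|v t0|)) * k by move=> h'; rewrite ler_wpM2r.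
  have up2 (k : R) : 0 <= k -> C * `|v s| * k <= (C + (1 + `|v t0|)) * `|v s| * k.
    by move=> h'; rewrite ler_wpM2r// up.
  case: (HC _ (v s) hs) => a1 a2 a3 a4 a5 a6 a7 a8 a9 a10 a11; split=> //; try by apply: le_trans (up _ _).
  - by move=> y; apply: le_trans (a5 y) (up2 _ _).
  - by move=> y; apply: le_trans (a9 y) (up2 _ _).
  - by move=> y; apply: le_trans (a10 y) (up2 _ _).
  - by move=> y; apply: le_trans (a11 y) (up2 _ _).
have : `|v t0 - v s| < 1 by apply: H2; rewrite -ball_normE/= distrC.
move=> h3; have : `|v s| <= `|v t0| + `|v t0 - v s|.
  by rewrite -{1}(subKr (v t0) (v s)) (le_trans (ler_normB _ _)).
lra.
Qed.

Lemma scaled_bound (C u b w : R) : 0 <= C -> 0 <= u -> 0 <= w -> u <= C ->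
  b <= C * u * w -> b <= C * C * w.
Proof.
by move=> C0 u0 w0 uC /le_trans; apply; rewrite ler_wpM2r// ler_wpM2l.
Qed.

(** Each clause is the conservation of a quantity or the vanishing of a solution of a linear
    differential inequality. One radius serves for all of them, in the form required to propagate
    along an interval by local constancy. *)
Lemma geodesic_zero x v t0 (eps : R) : 0 < eps ->
  (forall s, `|s - t0| < eps -> geodesic_pair x v s) ->
  exists2 d : R, 0 < d <= eps & forall s s', `|s - t0| < d -> `|s' - t0| < d ->
    [/\ vel x v s = 0 -> vel x v s' = 0,
        mink (vel x v s) (vel x v s) = mink (vel x v s') (vel x v s'),
        mink (vel x v t0) (vel x v t0) = 0 -> cl (vel x v s) *m ts_phi S (x s) = 0 ->
        cl (vel x v s') *m ts_phi S (x s') = 0 &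
        ts_phi S (x s) = 0 -> cl (vel x v s) *m ts_chi S (x s) = 0 ->
        ts_phi S (x s') = 0 /\ cl (vel x v s') *m ts_chi S (x s') = 0].
Proof.
move=> e0 g; have [d [C [/andP[d0 de] C0 B]]] := geodesic_bound e0 g.
have CC : 0 <= C * C by rewrite mulr_ge0.
have t0d : `|t0 - t0| < d by rewrite subrr normr0.
have mc s s' : `|s - t0| < d -> `|s' - t0| < d ->
    mink (vel x v s) (vel x v s) = mink (vel x v s') (vel x v s').
  have m0 s1 : `|s1 - t0| < d -> mink (vel x v s1) (vel x v s1) = mink (vel x v t0) (vel x v t0).
    move=> hs; have [t' _] := @mean_value R (fun s => mink (vel x v s) (vel x v s)) (fun=> 0) t0 s1
      (fun t ht => vel_sq_derive (let: And3 h _ _ := B t (le_lt_trans ht hs) in h)).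
    by rewrite mulr0 => /eqP; rewrite subr_eq0 => /eqP.
  by move=> h h'; rewrite !m0.
have [d1 /andP[d10 d1d] H1] : exists2 r' : R, 0 < r' <= d &
    forall s s', `|s - t0| < r' -> `|s' - t0| < r' -> vel x v s = 0 -> vel x v s' = 0.
  apply: (linear_zero_single CC d0 (du := fun s => - (vel x v s *m ts_om S (x s) (v s)))) => s hs.
    by case: (B s hs) => gs _ _; exact: vel_derive gs.
  case: (B s hs) => _ sb vC; rewrite normrN.
  exact: scaled_bound C0 (normr_ge0 _) (normr_ge0 _) vC (sb_om_mul sb _).
have [d2 /andP[d20 d2d] H2] : exists2 r' : R, 0 < r' <= d &
    forall s s', `|s - t0| < r' -> `|s' - t0| < r' -> mink (vel x v t0) (vel x v t0) = 0 ->
      cl (vel x v s) *m ts_phi S (x s) = 0 -> cl (vel x v s') *m ts_phi S (x s') = 0.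
  case: (eqVneq (mink (vel x v t0) (vel x v t0)) 0) => [m0|mn]; last first.
    by exists d; [rewrite d0 lexx|move=> s s' _ _ h; rewrite h eqxx in mn].
  have [r' hr' H'] : exists2 r' : R, 0 < r' <= d &
    forall s s', `|s - t0| < r' -> `|s' - t0| < r' ->
      cl (vel x v s) *m ts_phi S (x s) = 0 -> cl (vel x v s') *m ts_phi S (x s') = 0.
    apply: (linear_zero_single CC d0 (du := fun s => - (sp (ts_om S (x s) (v s)) *m (cl (vel x v s) *m ts_phi S (x s)))
      - mink (vel x v s) (vel x v s) *: ts_chi S (x s))) => s hs.
      by case: (B s hs) => gs _ _; exact: derive_clif_phi gs.
    case: (B s hs) => _ sb vC; rewrite (mc s t0)// m0 scale0r subr0 normrN.
    exact: scaled_bound C0 (normr_ge0 _) (normr_ge0 _) vC (sb_sp_mul sb _).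
  by exists r' => // s s' hs hs' _; exact: H'.
have [d3 /andP[d30 d3d] H3] : exists2 r' : R, 0 < r' <= d &
    forall s s', `|s - t0| < r' -> `|s' - t0| < r' ->
      ts_phi S (x s) = 0 -> cl (vel x v s) *m ts_chi S (x s) = 0 ->
      ts_phi S (x s') = 0 /\ cl (vel x v s') *m ts_chi S (x s') = 0.
  apply: (linear_ineq_zero (u := fun s => ts_phi S (x s))
    (w := fun s => cl (vel x v s) *m ts_chi S (x s)) (K := 1 + C * C + C * C * (C * C)) _ d0
    (du := fun s => cl (vel x v s) *m ts_chi S (x s) - sp (ts_om S (x s) (v s)) *m ts_phi S (x s))
    (dw := fun s => cl (vel x v s) *m (cl (ts_sch S (x s) (v s)) *m ts_phi S (x s))
      - sp (ts_om S (x s) (v s)) *m (cl (vel x v s) *m ts_chi S (x s)))).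
  - by rewrite !addr_ge0// mulr_ge0.
  - move=> s hs; case: (B s hs) => gs _ _; split; last exact: derive_clif_chi gs.
    by case: gs => gs1 gs2 _; exact: ts_curve_phi gs1 gs2.
  - move=> s hs; case: (B s hs) => _ sb vC.
    have b1 := scaled_bound C0 (normr_ge0 _) (normr_ge0 _) vC (sb_sp_mul sb (ts_phi S (x s))).
    have b2 := scaled_bound C0 (normr_ge0 _) (normr_ge0 _) vC (sb_sp_mul sb (cl (vel x v s) *m ts_chi S (x s))).
    have b3 := scaled_bound C0 (normr_ge0 _) (normr_ge0 _) vC (sb_cl_sch_mul sb (ts_phi S (x s))).
    have b4 := scaled_bound C0 (normr_ge0 _) (normr_ge0 _) vC (sb_cl_th_mul sb (cl (ts_sch S (x s) (v s)) *m ts_phi S (x s))).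
    have b5 := ler_wpM2l CC b3; rewrite -/(vel x v s) in b4.
    have p1 := normr_ge0 (ts_phi S (x s)); have p2 := normr_ge0 (cl (vel x v s) *m ts_chi S (x s)).
    have q1 := mulr_ge0 CC p1; have q2 := mulr_ge0 CC p2.
    have q3 := mulr_ge0 CC q1; have q4 := mulr_ge0 CC q2.
    by split; apply: le_trans (ler_normB _ _) _; lra.
exists (Num.min d (Num.min d1 (Num.min d2 d3))).
  by rewrite !lt_min d0 d10 d20 d30/= ge_min de.
move=> s s'; rewrite !lt_min => /and4P[h h1 h2 h3] /and4P[h' h1' h2' h3']; split.
- exact: H1.
- exact: mc.
- exact: H2.
- exact: H3.
Qed.
End TwistorAlongCurves.

Section NormBlock.
Context {R : realType}.

Lemma norm_block_mx a b a' b' (A : 'M[R]_(a, b)) (B : 'M[R]_(a, b')) (C : 'M[R]_(a', b))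
    (D : 'M[R]_(a', b')) (k : R) : 0 <= k ->
  `|A| <= k -> `|B| <= k -> `|C| <= k -> `|D| <= k -> `|block_mx A B C D| <= k.
Proof.
move=> k0 /mx_norm_le-/(_ k0) hA /mx_norm_le-/(_ k0) hB /mx_norm_le-/(_ k0) hC /mx_norm_le-/(_ k0) hD.
apply/mx_norm_le => // i j; rewrite -(splitK i) -(splitK j).
case: (fintype.split i) => i'; case: (fintype.split j) => j' /=.
- by rewrite block_mxEul.
- by rewrite block_mxEur.
- by rewrite block_mxEdl.
- by rewrite block_mxEdr.
Qed.

Lemma norm_trmx a b (A : 'M[R]_(a, b)) : `|A^T| = `|A|.
Proof.
apply/eqP; rewrite eq_le; apply/andP; split; apply/mx_norm_le => // i j.
  by rewrite mxE mx_entry_le.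
by apply: le_trans (mx_entry_le A^T j i); rewrite mxE.
Qed.

Lemma norm_col_mx a a' b (A : 'M[R]_(a, b)) (C : 'M[R]_(a', b)) (k : R) : 0 <= k ->
  `|A| <= k -> `|C| <= k -> `|col_mx A C| <= k.
Proof.
move=> k0 hA hC; rewrite -norm_trmx tr_col_mx; apply/norm_row_mx => //.
by rewrite !norm_trmx.
Qed.

End NormBlock.

Section CliffordFamilyDerivative.
Context {R : realType} {m q : nat}.
Variables (Gam : 'I_q -> 'M[R]_m) (kap' : 'M[R]_q) (B : 'M[R]_m).
Local Notation tri := (tri Gam kap' B).
Local Notation tri2 := (tri2 Gam B).

Lemma is_derive_planar (P : R -> 'cV[R]_m) t dP A : is_derive t (1 : R) P dP ->
  is_derive t (1 : R) (fun s => planar Gam kap' B A (P s))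
    (tri A dP (P t) (P t) + tri A (P t) dP (P t) + tri A (P t) (P t) dP).
Proof.
move=> hP; rewrite /planar /tri.
have h2 C : is_derive t (1 : R) (fun s => tri2 A C (P s) (P s)) (tri2 A C dP (P t) + tri2 A C (P t) dP).
  have hT := is_derive_linmx (@trmx R m 1) hP.
  have hB := is_derive_mulmx hT (is_derive_cst B t 1).
  have hG := is_derive_mulmx (is_derive_cst (Gam A *m Gam C) t 1) hP.
  apply: (is_derive_eq ((is_derive_mxP _ _ _ _).1 (is_derive_mulmx hB hG) 0 0)).
  by rewrite /cst mulmx0 addr0 mul0mx add0r [LHS]mxE.
have h3 C D : is_derive t (1 : R) (fun s => (tri2 A C (P s) (P s) * kap' C D) *: (Gam D *m P s))
   (((tri2 A C dP (P t) + tri2 A C (P t) dP) * kap' C D) *: (Gam D *m P t)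
    + (tri2 A C (P t) (P t) * kap' C D) *: (Gam D *m dP)).
  apply: (is_derive_eq (is_derive_scaler (is_derive_mulr (h2 C) (is_derive_cst (kap' C D) t 1))
    (is_derive_mulmx (is_derive_cst (Gam D) t 1) hP))).
  by rewrite /cst mulr0 addr0 mul0mx add0r.
apply: is_derive_eq.
  by apply: is_derive_bigsum => C; apply: is_derive_bigsum => D; exact: h3.
rewrite -!big_split/=; apply: eq_bigr => C _; rewrite -!big_split/=; apply: eq_bigr => D _.
by rewrite mulrDl scalerDl.
Qed.

End CliffordFamilyDerivative.

(** * Propagation along coordinate segments *)

Section TwistorSegments.
Context {R : realType} {n N : nat}.
Variable c : 'I_n -> 'M[R]_N.
Variable H : 'M[R]_N.
Hypothesis cc : forall k l, c k *m c l + c l *m c k = (- 2 * eta k l)%:M.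
Hypothesis H_sym : H^T = H.
Hypothesis H_c : forall k, (c k)^T *m H = H *m c k.
Hypothesis H_pos : forall k : 'I_n, (k = 0 :> nat)%N ->
  forall x : 'cV[R]_N, x != 0 -> 0 < (x^T *m H *m (c k *m x)) 0 0.
Hypothesis n3 : (3 <= n)%N.
Variable S : twistor_system c.
Notation cl := (cl c).
Notation sp := (sp c).
Notation planar := (planar (tgam c) tinv (tform H)).

Definition tractor x : 'cV[R]_(N + N) := col_mx (ts_phi S x) (ts_chi S x).

(** All components of [planar] as the columns of one matrix: each column alone does not solve a
    closed equation, but the matrix does. *)
Definition planar_mx x : 'M[R]_(N + N, n + (1 + 1)) := \matrix_(i, A) planar A (tractor x) i 0.

Lemma planar_mx0 x : planar_mx x = 0 <-> forall A, planar A (tractor x) = 0.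
Proof.
split=> [/matrixP h A|h]; apply/matrixP => i j.
  by have := h i A; rewrite !mxE ord1.
by rewrite !mxE h mxE.
Qed.

Lemma tractor_derive (x : R -> 'rV[R]_n) t u : ts_dom S (x t) -> is_derive t (1 : R) x u ->
  is_derive t (1 : R) (fun s => tractor (x s))
    (tgen c (ts_om S (x t) u) (u *m ts_th S (x t)) (ts_sch S (x t) u) *m tractor (x t)).
Proof.
move=> hx hu; apply: is_derive_eq.
  exact: (is_derive_col_mx (ts_curve_phi hx hu) (ts_curve_chi hx hu)).
by rewrite /tractor /tgen mul_block_col !mulNmx addrC; congr col_mx.
Qed.

Lemma planar_mx_derive (x : R -> 'rV[R]_n) t u : ts_dom S (x t) -> is_derive t (1 : R) x u ->
  is_derive t (1 : R) (fun s => planar_mx (x s))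
   (tgen c (ts_om S (x t) u) (u *m ts_th S (x t)) (ts_sch S (x t) u) *m planar_mx (x t)
    - planar_mx (x t) *m (tvec (ts_om S (x t) u) (u *m ts_th S (x t)) (ts_sch S (x t) u))^T).
Proof.
move=> hx hu; have sk := ts_skew u hx; apply/is_derive_mxP => i A.
have hP := is_derive_planar (tgam c) tinv (tform H) A (tractor_derive hx hu).
rewrite (_ : (fun y => planar_mx (x y) i A) = fun s => planar A (tractor (x s)) i 0); last first.
  by apply/funext => s; rewrite mxE.
apply: (is_derive_eq ((is_derive_mxP _ _ _ _).1 hP i 0)).
rewrite (planar_infinitesimal (x := tvec (ts_om S (x t) u) (u *m ts_th S (x t)) (ts_sch S (x t) u))).
- move: (tgen _ _ _ _) (tvec _ _ _) => X Y.
  rewrite [LHS]mxE [RHS]mxE; congr (_ + _).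
    by rewrite [LHS]mxE [RHS]mxE; apply: eq_bigr => k _; rewrite [planar_mx _ _ _]mxE.
  rewrite [LHS]mxE [RHS]mxE summxE; congr (- _); rewrite [RHS]mxE; apply: eq_bigr => k _.
  by rewrite [LHS]mxE [planar_mx _ _ _]mxE [Y^T _ _]mxE mulrC.
- by move=> B; exact: tgen_comm.
- exact: tgen_form.
- exact: tvec_inv.
Qed.

Lemma segment_zero p q p' q' (u du : R -> 'M[R]_(p, q)) (w dw : R -> 'M[R]_(p', q')) (K : R) :
  0 <= K -> 4 * K <= 1 ->
  (forall t, `|t| <= 1 -> is_derive t (1 : R) u (du t) /\ is_derive t (1 : R) w (dw t)) ->
  (forall t, `|t| <= 1 -> `|du t| <= K * (`|u t| + `|w t|) /\
                          `|dw t| <= K * (`|u t| + `|w t|)) ->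
  u 0 = 0 -> w 0 = 0 -> u 1 = 0 /\ w 1 = 0.
Proof.
move=> K0 K4 hd hb u0 w0.
have := @linear_ineq_short R p q p' q' u du w dw K 1 0 K0 ler01 _ _ _ 1 _.
rewrite mulr1 u0 w0 !normr0 addr0 mulr0 => /(_ K4).
have sub0 (t : R) : `|t - 0| <= 1 -> `|t| <= 1 by rewrite subr0.
move=> /(_ (fun t ht => hd t (sub0 t ht)) (fun t ht => hb t (sub0 t ht))).
rewrite subr0 normr1 => /(_ (lexx _)) h.
have a := normr_ge0 (u 1); have b := normr_ge0 (w 1).
by split; apply/eqP; rewrite -normr_eq0 eq_le; apply/andP; split=> //; lra.
Qed.

(** The evolution equations hold along every curve, so two nearby points are joined by a straight
    segment in the chart. Its velocity is small near [p], which makes unit time short in the sense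
    of [linear_ineq_short]. *)
Lemma twistor_segment p : ts_dom S p -> exists2 r : R, 0 < r & forall q q',
  `|q - p| <= r -> `|q' - p| <= r ->
  [/\ ts_dom S q,
      ts_phi S q = 0 -> ts_chi S q = 0 -> ts_phi S q' = 0 /\ ts_chi S q' = 0 &
      (forall A, planar A (tractor q) = 0) -> forall A, planar A (tractor q') = 0].
Proof.
move=> pS; have [r [C [r0 C0 HC]]] := spinor_boundP pS.
(* Up to the factor C |u|, [D] bounds both [tgen] and [tvec], and [M] collects the dimensions from
   the two matrix products. *)
pose D := 1 + 2 * n%:R * (1 + `|eta : 'M[R]_n|).
have D1 : 1 <= D by rewrite /D lerDl !mulr_ge0// addr_ge0.
have D0 : 0 <= D by lra.
pose M := (N + N)%:R + (n + (1 + 1))%:R : R.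
have M0 : 0 <= M by rewrite addr_ge0.
pose K := 2 * (1 + D * M) * C.
have DM0 : 0 <= D * M by rewrite mulr_ge0.
have K0 : 0 <= K by rewrite mulr_ge0// mulr_ge0// addr_ge0.
(* For |t| <= 1 the line through q and q' stays within 3 r' of [p]; the second bound makes four
   times each coefficient at most 1. *)
pose r' := Num.min (r / 3) (1 / (8 * (K + 1))).
have K8 : 0 < 8 * (K + 1) by lra.
have r'0 : 0 < r' by rewrite lt_min !divr_gt0.
have r'r : r' <= r / 3 by rewrite ge_min lexx.
have r'K : r' * (8 * (K + 1)) <= 1.
  by rewrite -ler_pdivlMr// ge_min lexx orbT.
exists r' => // q q' hq hq'.
pose u := q' - q; pose x (t : R) := q + t *: u.
have hu : `|u| <= 2 * r'.
  rewrite /u (_ : q' - q = q' - p - (q - p)); last by rewrite opprB addrA subrK.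
  by apply: le_trans (ler_normB _ _) _; lra.
have dx t : is_derive t (1 : R) x u by exact: (is_derive_line (f := id)).
have B t : `|t| <= 1 -> spinor_bound S C (x t) u.
  move=> t1; apply: HC; rewrite /x addrAC; apply: le_trans (ler_normD _ _) _.
  rewrite normrZ; have : `|t| * `|u| <= 1 * (2 * r') by apply: ler_pM.
  lra.
have Cu : C * `|u| <= C * (2 * r') by rewrite ler_wpM2l.
have KK k : 0 <= k -> k <= 2 * (1 + D * M) -> 4 * (k * C * `|u|) <= 1.
  move=> k0 kb; have : k * (C * `|u|) <= 2 * (1 + D * M) * (C * (2 * r')).
    by apply: ler_pM => //; rewrite mulr_ge0.
  rewrite !mulrA -/K => h; have : K * (2 * r') = K * 2 * r' by rewrite mulrA.
  nra.
have x0 : x 0 = q by rewrite /x scale0r addr0.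
have x1 : x 1 = q' by rewrite /x scale1r /u addrC subrK.
have CU0 : 0 <= C * `|u| by rewrite mulr_ge0.
split.
- by rewrite -x0; case: (B 0 _); rewrite ?normr0.
- rewrite -x0 -x1.
  apply: (@segment_zero _ _ _ _ (fun t => ts_phi S (x t)) _ (fun t => ts_chi S (x t)) _ (1 * C * `|u|)).
  + by rewrite mul1r.
  + by apply: KK => //; lra.
  + move=> t t1; have sb := B t t1; split; first exact: ts_curve_phi (sb_dom sb) (dx t).
    exact: ts_curve_chi (sb_dom sb) (dx t).
  + move=> t t1; have sb := B t t1; rewrite mul1r mulrDr; split.
      apply: le_trans (ler_normB _ _) _; rewrite addrC; apply: lerD; [exact: sb_sp_mul|exact: sb_cl_th_mul].
    apply: le_trans (ler_normB _ _) _; apply: lerD; [exact: sb_cl_sch_mul|exact: sb_sp_mul].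
- rewrite -x0 -x1 => h0; apply/planar_mx0.
  apply: (@segment_zero _ _ 1 1 (fun t => planar_mx (x t)) _ (fun=> 0) (fun=> 0) (D * M * C * `|u|) _ _ _ _ _ _).1 => //.
  + by rewrite -mulrA mulr_ge0.
  + by apply: KK => //; lra.
  + move=> t t1; split; last exact: is_derive_cst.
    exact: (planar_mx_derive (sb_dom (B t t1)) (dx t)).
  + move=> t t1; have sb := B t t1; rewrite normr0 addr0; split; last first.
      by rewrite -mulrA !mulr_ge0.
    have DCu : C * `|u| <= D * (C * `|u|) by rewrite -{1}(mul1r (C * _)) ler_wpM2r.
    have DCu0 : 0 <= D * (C * `|u|) by rewrite mulr_ge0.
    have h1 : `|tgen c (ts_om S (x t) u) (u *m ts_th S (x t)) (ts_sch S (x t) u)| <= D * (C * `|u|).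
      case: sb => a1 a2 a3 a4 a5 a6 a7 a8 _ _ _.
      by apply: norm_block_mx => //; rewrite ?normrN; apply: le_trans DCu.
    have h2 : `|tvec (ts_om S (x t) u) (u *m ts_th S (x t)) (ts_sch S (x t) u)| <= D * (C * `|u|).
      case: sb => a1 a2 a3 a4 a5 a6 a7 a8 _ _ _.
      have et y : `|y : 'rV[R]_n| <= C * `|u| -> `|2 *: (eta *m y^T)| <= D * (C * `|u|).
        move=> hy; rewrite normrZ ger0_norm//; apply: (@le_trans _ _ (2 * (n%:R * `|eta : 'M[R]_n| * `|y^T|))).
          by rewrite ler_wpM2l// mulmx_norm_le.
        rewrite norm_trmx [leLHS]mulrA; apply: ler_pM => //.
        have n0 : 0 <= n%:R :> R by []; have := mulr_ge0 n0 (normr_ge0 (eta : 'M[R]_n)).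
        by rewrite /D; lra.
      apply: norm_block_mx => //; rewrite ?normrN ?normr0//; first exact: le_trans DCu.
        apply/norm_row_mx => //; split; first exact: et.
        by rewrite scaleNr normrN; exact: et.
      by apply: norm_col_mx => //; rewrite ?normrN; apply: le_trans DCu.
    have -> (W : R) : D * M * C * `|u| * W =
        (N + N)%:R * (D * (C * `|u|)) * W + (n + (1 + 1))%:R * W * (D * (C * `|u|)).
      by clear; rewrite /M; clearbody D; ring.
    apply: le_trans (ler_normB _ _) _; apply: lerD.
      apply: le_trans (mulmx_norm_le _ _) _; rewrite ler_wpM2r//.
      by rewrite ler_wpM2l.
    apply: le_trans (mulmx_norm_le _ _) _; rewrite norm_trmx.
    by rewrite ler_wpM2l// mulr_ge0.
  + exact/planar_mx0.
Qed.

End TwistorSegments.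

(** * Twistor spinors near a zero *)

Section TwistorNearZero.
Context {R : realType} {n N : nat}.
Variable c : 'I_n -> 'M[R]_N.
Variable H : 'M[R]_N.
Hypothesis cc : forall k l, c k *m c l + c l *m c k = (- 2 * eta k l)%:M.
Hypothesis H_sym : H^T = H.
Hypothesis H_c : forall k, (c k)^T *m H = H *m c k.
Hypothesis H_pos : forall k : 'I_n, (k = 0 :> nat)%N ->
  forall x : 'cV[R]_N, x != 0 -> 0 < (x^T *m H *m (c k *m x)) 0 0.
Hypothesis n3 : (3 <= n)%N.
Variable S : twistor_system c.
Notation cl := (cl c).
Notation sp := (sp c).
Notation current_sq := (current_sq c H).

Definition spray x v := - (v *m ts_ch S x v).

(** The spray is quadratic in the velocity, so a Lipschitz constant exists only for bounded
    velocities. *)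
Lemma spray_lipschitz p r : ts_dom S p -> 0 <= r -> exists r0 K : R, [/\ 0 < r0, 0 <= K &
  forall x x' v v', `|x - p| <= r0 -> `|x' - p| <= r0 -> `|v| <= r -> `|v'| <= r ->
    `|spray x v - spray x' v'| <= K * (`|x - x'| + `|v - v'|)].
Proof.
move=> pS r0; have [r1 [K [r10 K0 HK]]] := ts_bound pS.
exists r1, (2 * n%:R * K * r * (1 + r)); split=> //.
  by rewrite !mulr_ge0// addr_ge0.
move=> x x' v v' xr xr' vr vr'.
have [_ _ _ _ ch] := HK x x' xr xr'; have [_ _ _ _ ch'] := HK x' x xr' xr.
rewrite /spray opprK addrC.
have -> : v' *m ts_ch S x' v' - v *m ts_ch S x v =
    (v' - v) *m ts_ch S x v - v' *m (ts_ch S x v - ts_ch S x' v) - v' *m ts_ch S x' (v - v').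
  rewrite ts_chB; move: (ts_ch S x v) (ts_ch S x' v) (ts_ch S x' v') => A B C.
  rewrite mulmxBl !mulmxBr; move: (v' *m A) (v *m A) (v' *m B) (v' *m C) => a b d e.
  by clear; apply/matrixP => i j; rewrite !mxE; ring.
have n0 : 0 <= n%:R :> R by [].
have b1 : `|(v' - v) *m ts_ch S x v| <= n%:R * `|v - v'| * (K * r).
  rewrite distrC; apply: le_trans (mulmx_norm_le _ _) _; apply: ler_pM => //.
  by apply: le_trans (ch v).1 _; rewrite ler_wpM2l.
have b2 : `|v' *m (ts_ch S x v - ts_ch S x' v)| <= n%:R * r * (K * `|x - x'| * r).
  apply: le_trans (mulmx_norm_le _ _) _; apply: ler_pM => //.
    by rewrite ler_wpM2l.
  by apply: le_trans (ch v).2 _; rewrite ler_wpM2l// mulr_ge0.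
have b3 : `|v' *m ts_ch S x' (v - v')| <= n%:R * r * (K * `|v - v'|).
  apply: le_trans (mulmx_norm_le _ _) _; apply: ler_pM => //.
    by rewrite ler_wpM2l.
  exact: (ch' _).1.
apply: le_trans (ler_normB _ _) _.
apply: le_trans (lerD (ler_normB _ _) (lexx _)) _.
apply: le_trans (lerD (lerD b1 b2) b3) _.
have q1 : 0 <= n%:R * K * r * `|x - x'| by rewrite !mulr_ge0.
have q2 : 0 <= n%:R * K * r * r * `|v - v'| by rewrite !mulr_ge0.
have q3 : 0 <= n%:R * K * r * r * `|x - x'| by rewrite !mulr_ge0.
by clear -q1 q2 q3; lra.
Qed.

Lemma current_sqZ a psi : current_sq (a *: psi) = a ^+ 4 * current_sq psi.
Proof.
change (mink (current c H (a *: psi)) (current c H (a *: psi)) =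
  a ^+ 4 * mink (current c H psi) (current c H psi)).
have -> : current c H (a *: psi) = a ^+ 2 *: current c H psi.
  apply/matrixP => i k; rewrite [LHS]mxE [RHS]mxE [in RHS]mxE -scalemxAr.
  have -> : hform H (a *: psi) (a *: (c k *m psi)) = a * (a * hform H psi (c k *m psi)).
    by rewrite (hformZl H_sym) (hformZr H).
  ring.
by rewrite minkZl minkZr; ring.
Qed.

Lemma smooth_id (V : normedModType R) (A : set V) : open A -> smooth_on A (fun x : V => x).
Proof.
move=> oA; case=> [|k]; split=> //; try by move=> x _; exact: cvg_id.
move=> v; split=> [x _|]; first exact: derivable_id.
by apply: (Ck_ext (f := fun=> v) oA) => [x _|]; [rewrite derive_id|exact: Ck_cst].
Qed.

Lemma current_sq_continuous psi : {for psi, continuous current_sq}.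
Proof.
have oT : open [set: 'cV[R]_N] by exact: openT.
have sI := smooth_id oT.
suff h : smooth_on [set: 'cV[R]_N] current_sq by exact: (h 0%N).1.
have sH k : smooth_on [set: 'cV[R]_N] (fun psi => current c H psi 0 k).
  apply: (smooth_ext oT (f := fun psi => eps k * ((psi^T *m H) *m (c k *m psi)) 0 0)).
    by move=> x _; rewrite [RHS]mxE.
  apply: (smooth_mulr oT (smooth_cst oT _)).
  apply: ((smooth_mxP oT _).1 _ 0 0); apply: (smooth_mulmx oT).
    by apply: (smooth_mulmx oT _ (smooth_cst oT _)); exact: (smooth_linmx oT (@trmx R N 1) sI).
  exact: (smooth_mulmx oT (smooth_cst oT _) sI).
apply: (smooth_sum oT) => k; apply: (smooth_mulr oT) => //.
exact: (smooth_mulr oT (smooth_cst oT _)).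
Qed.

Lemma start_estimate (f : R -> 'cV[R]_N) (b0 : 'cV[R]_N) (B t d : R) : 0 < `|t| -> 0 < d ->
  `|f t - t *: b0| <= 4 * B * `|t| ^+ 2 * `|b0| -> 4 * B * `|t| * (`|b0| + 1) < d -> 0 <= B ->
  `|t^-1 *: f t - b0| < d.
Proof.
move=> t0 d0 h hd B0; have tn : t != 0 by rewrite -normr_gt0.
rewrite (_ : _ - _ = t^-1 *: (f t - t *: b0)); last by rewrite scalerBr scalerA mulVf// scale1r.
rewrite normrZ normfV ltr_pdivrMl//; apply: le_lt_trans h _.
have q := normr_ge0 b0; have q2 : 0 <= 4 * B * `|t| ^+ 2 by rewrite !mulr_ge0.
have := ltr_pM2l t0 (4 * B * `|t| * (`|b0| + 1)) d; rewrite hd => h2.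
have {}h2 : `|t| * (4 * B * `|t| * (`|b0| + 1)) < `|t| * d by rewrite h2.
apply: le_lt_trans h2; move: q2; rewrite expr2 mulrA => q2; lra.
Qed.

Theorem geodesics_near_zero p : ts_dom S p -> ts_phi S p = 0 ->
  exists (x v : 'rV[R]_n -> R -> 'rV[R]_n) (T rho : R),
  [/\ 0 < T, 0 < rho,
    forall u, `|u| <= rho -> [/\ x u 0 = p, v u 0 = u & forall t, `|t| < T -> geodesic_pair S (x u) (v u) t],
    forall tau, 0 < tau < T -> exists2 d : R, 0 < d & forall q, `|q - p| <= d ->
      exists2 u, `|u| <= rho & x u tau = q &
    forall u t, `|u| <= rho -> 0 < `|t| < T ->
     [/\ ts_phi S (x u t) = 0 -> cl (u *m ts_th S p) *m ts_chi S p = 0,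
         cl (u *m ts_th S p) *m ts_chi S p = 0 -> ts_phi S (x u t) = 0 &
         current_sq (ts_chi S p) < 0 -> current_sq (ts_phi S (x u t)) = 0 ->
         mink (u *m ts_th S p) (u *m ts_th S p) = 0] ].
Proof.
move=> pS phi0.
have [r1 [K [r10 K0 A_lip]]] := spray_lipschitz pS ler01.
have [r2 [C [r20 C0 HC]]] := spinor_boundP pS.
pose r := Num.min (Num.min r1 1) r2.
have r0 : 0 < r by rewrite !lt_min r10 ltr01.
have rr1 : r <= r1 by rewrite !ge_min lexx.
have rr : r <= 1 by rewrite !ge_min lexx orbT.
have rr2 : r <= r2 by rewrite !ge_min lexx orbT.
have A0 : spray p 0 = 0 by rewrite /spray mul0mx oppr0.
have [x [v [T0 [T00 fam shoot]]]] := second_order_family r0 K0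
  (fun x x' v v' h1 h2 h3 h4 => A_lip x x' v v' (le_trans h1 rr1) (le_trans h2 rr1)
    (le_trans h3 rr) (le_trans h4 rr)) A0.
pose k := C * r; have k0 : 0 <= k by rewrite mulr_ge0// ltW.
have kk : 0 <= k * k by rewrite mulr_ge0.
pose B := k + k * k; have B0 : 0 <= B by rewrite addr_ge0.
have [d d0 Hd] : exists2 d : R, 0 < d & current_sq (ts_chi S p) < 0 ->
    forall w, `|w - ts_chi S p| < d -> current_sq w < 0.
  case: (ltP (current_sq (ts_chi S p)) 0) => [neg|_]; last by exists 1.
  have np : 0 < - current_sq (ts_chi S p) by rewrite oppr_gt0.
  have /(cvgrPdist_lt (FF := nbhs_filter _))/(_ _ np)/nbhs_ballP[d /= d0 Hd] := @current_sq_continuous (ts_chi S p).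
  exists d => // _ w hw; have := Hd w; rewrite -ball_normE/= distrC => /(_ hw).
  by rewrite distrC ltr_norml => /andP[_]; rewrite ltrBlDl subrr.
pose M := 4 * (B + 1) ^+ 2 * (`|ts_chi S p| + 1).
have M0 : 0 < M by rewrite !mulr_gt0 ?exprn_gt0// ltr_wpDl.
pose Mb := 8 * (B + 1) ^+ 2.
have Mb0 : 0 < Mb by rewrite mulr_gt0 ?exprn_gt0// ltr_wpDl.
have B20 : 0 < 4 * (B + 2) by rewrite mulr_gt0// ltr_wpDl.
(* The four bounds are the lifetime of the geodesics, the smallness condition of
   [linear_system_start], z/t within [d] of chi(p), and an error in the expansion of phi smaller
   than its leading term. *)
pose T := Num.min (Num.min T0 (4 * (B + 2))^-1) (Num.min (d / M) Mb^-1).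
have T_gt0 : 0 < T by rewrite !lt_min T00 invr_gt0 B20 divr_gt0// invr_gt0.
have TT0 : T <= T0 by rewrite !ge_min lexx.
have TB : T <= (4 * (B + 2))^-1 by rewrite !ge_min lexx !orbT.
have TM : T <= d / M by rewrite !ge_min lexx !orbT.
have TMb : T <= Mb^-1 by rewrite !ge_min lexx !orbT.
have hB (t : R) : `|t| < T -> 4 * (B + 2) * `|t| <= 1.
  by move=> h; rewrite mulrC -ler_pdivlMr// div1r (le_trans (ltW h)).
exists x, v, T, (r / 2); split=> //; first by rewrite divr_gt0.
- move=> u hu; have [x0 v0 gu] := fam u hu; split=> // t ht.
  have [hx hv dx dv] := gu t (lt_le_trans ht TT0); split=> //.
  by case: (HC (x u t) 0 (le_trans hx rr2)).
- move=> tau /andP[tau0 tauT]; exists (tau * (r / 4)); first by rewrite mulr_gt0// divr_gt0.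
  by move=> q hq; apply: shoot hq; rewrite tau0 (lt_le_trans tauT).
move=> u t hu /andP[t0 tT]; have [x0 v0 gu] := fam u hu.
have geo s : `|s| <= `|t| -> geodesic_pair S (x u) (v u) s /\ spinor_bound S C (x u s) (v u s).
  move=> hs; have [hx hv dx dv] := gu s (lt_le_trans (le_lt_trans hs tT) TT0).
  have sb := HC (x u s) (v u s) (le_trans hx rr2); split=> //.
  by split=> //; exact: sb_dom sb.
have bd s : `|s| <= `|t| -> `|v u s| <= r.
  by move=> hs; have [_ hv _ _] := gu s (lt_le_trans (le_lt_trans hs tT) TT0).
have scale s (b w : R) : `|s| <= `|t| -> 0 <= w -> b <= C * `|v u s| * w -> b <= k * w.
  by move=> hs w0 /le_trans; apply; rewrite ler_wpM2r// ler_wpM2l// bd.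
pose y s := vel S (x u) (v u) s.
have y0 : y 0 = u *m ts_th S p by rewrite /y /vel v0 x0.
have start (f df g dg : R -> 'cV[R]_N) : (forall s, `|s| <= `|t| -> is_derive s (1 : R) f (df s) /\ is_derive s (1 : R) g (dg s)) ->
   (forall s, `|s| <= `|t| -> `|df s - g s| <= B * `|f s| /\ `|dg s| <= B * (`|f s| + `|g s|)) ->
   f 0 = 0 -> `|f t - t *: g 0| <= 4 * (B + 1) ^+ 2 * `|t| ^+ 2 * `|g 0|.
  move=> h1 h2 h3; exact: (linear_system_start B0 (normr_ge0 _) (hB t tT) h1 h2 h3 (lexx _)).
have est : `|ts_phi S (x u t) - t *: (cl (y 0) *m ts_chi S p)| <=
     4 * (B + 1) ^+ 2 * `|t| ^+ 2 * `|cl (y 0) *m ts_chi S p|.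
  rewrite -x0; apply: (start (fun s => ts_phi S (x u s)) (fun s => cl (y s) *m ts_chi S (x u s) - sp (ts_om S (x u s) (v u s)) *m ts_phi S (x u s))
    (fun s => cl (y s) *m ts_chi S (x u s)) (fun s => cl (y s) *m (cl (ts_sch S (x u s) (v u s)) *m ts_phi S (x u s))
      - sp (ts_om S (x u s) (v u s)) *m (cl (y s) *m ts_chi S (x u s)))).
  - move=> s hs; have [gs _] := geo s hs; split; last exact: derive_clif_chi.
    by case: gs => g1 g2 _; exact: ts_curve_phi.
  - move=> s hs; have [_ sb] := geo s hs; split.
      rewrite addrC addrA addNr sub0r normrN.
      apply: (@le_trans _ _ (k * `|ts_phi S (x u s)|)).
        by apply: (scale s) => //; exact: sb_sp_mul.
      by rewrite ler_wpM2r// /B lerDl.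
    have b1 := scale s _ _ hs (normr_ge0 _) (sb_cl_sch_mul sb (ts_phi S (x u s))).
    have b2 := scale s _ _ hs (normr_ge0 _) (sb_cl_th_mul sb (cl (ts_sch S (x u s) (v u s)) *m ts_phi S (x u s))).
    have b3 := scale s _ _ hs (normr_ge0 _) (sb_sp_mul sb (cl (y s) *m ts_chi S (x u s))).
    apply: le_trans (ler_normB _ _) _; rewrite -/(vel S (x u) (v u) s) -/(y s) in b2.
    have b4 := ler_wpM2l k0 b1.
    have p1 := normr_ge0 (ts_phi S (x u s)); have p2 := normr_ge0 (cl (y s) *m ts_chi S (x u s)).
    have q1 := mulr_ge0 k0 p1; have q2 := mulr_ge0 kk p2.
    by rewrite /B; lra.
  - by rewrite x0.
split.
- move=> pt; move: est; rewrite pt sub0r normrN normrZ -y0.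
  set b := cl (y 0) *m _ => est; apply/eqP; rewrite -normr_eq0; apply/negPn/negP => bn.
  have b0 : 0 < `|b| by rewrite lt_neqAle eq_sym bn normr_ge0.
  have : 1 <= 4 * (B + 1) ^+ 2 * `|t|.
    by rewrite -(ler_pM2r t0) mul1r -(ler_pM2r b0) -[X in _ <= X * _]mulrA -expr2.
  have : `|t| * Mb < 1 by rewrite -ltr_pdivlMr// div1r (lt_le_trans tT).
  by rewrite /Mb; lra.
- by move=> b0; move: est; rewrite y0 b0 scaler0 normr0 mulr0 subr0 normr_le0 => /eqP.
move=> neg nul; apply/eqP/negPn/negP => sn.
pose s := mink (y 0) (y 0); have s0 : s != 0 by rewrite /s y0.
have ys t' : `|t'| <= `|t| -> mink (y t') (y t') = s.
  move=> ht'; have [t2 _] := @mean_value R (fun s => mink (y s) (y s)) (fun=> 0) 0 t'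
    (fun s hs => vel_sq_derive (geo s (ltac:(by rewrite !subr0 in hs; exact: le_trans hs ht'))).1).
  by rewrite mulr0 => /eqP; rewrite subr_eq0 => /eqP.
(* Since gamma'.gamma' = -s, this spinor satisfies gamma'.z = phi. Its covariant derivative is chi
   and it vanishes at time 0, so [linear_system_start] applies to (z, chi) with initial value
   chi(p). *)
pose z t' := - s^-1 *: (cl (y t') *m ts_phi S (x u t')).
have zphi t' : `|t'| <= `|t| -> ts_phi S (x u t') = cl (y t') *m z t'.
  move=> ht'; rewrite /z -scalemxAr mulmxA cl_sq// ys// mul_scalar_mx scalerA mulrNN mulVf//.
  by rewrite scale1r.
have estz : `|z t - t *: ts_chi S p| <= 4 * (B + 1) ^+ 2 * `|t| ^+ 2 * `|ts_chi S p|.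
  rewrite -x0; apply: (start z (fun t' => ts_chi S (x u t') - sp (ts_om S (x u t') (v u t')) *m z t')
    (fun s => ts_chi S (x u s)) (fun s => cl (ts_sch S (x u s) (v u s)) *m ts_phi S (x u s)
      - sp (ts_om S (x u s) (v u s)) *m ts_chi S (x u s))).
  - move=> t' ht'; have [gs _] := geo t' ht'; split; last by case: gs => g1 g2 _; exact: ts_curve_chi.
    apply: (is_derive_eq (is_derive_scalef (- s^-1) (derive_clif_phi cc gs))).
    rewrite -/(y t') ys// scalerBr scalerA mulNr mulVf// scaleN1r opprK addrC; congr (_ + _).
    by rewrite /z -scalemxAr scalerN.
  - move=> t' ht'; have [_ sb] := geo t' ht'.
    have b1 := scale t' _ _ ht' (normr_ge0 _) (sb_sp_mul sb (z t')).
    have b2 := scale t' _ _ ht' (normr_ge0 _) (sb_cl_sch_mul sb (ts_phi S (x u t'))).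
    have b3 := scale t' _ _ ht' (normr_ge0 _) (sb_sp_mul sb (ts_chi S (x u t'))).
    have b4 := scale t' _ _ ht' (normr_ge0 _) (sb_cl_th_mul sb (z t')).
    rewrite -/(vel S (x u) (v u) t') -/(y t') -zphi// in b4; have b5 := ler_wpM2l k0 b4.
    have p1 := normr_ge0 (z t'); have p2 := normr_ge0 (ts_chi S (x u t')).
    have q1 := mulr_ge0 k0 p1; have q2 := mulr_ge0 kk p2; have q3 := mulr_ge0 kk p1.
    split; first by rewrite addrC addrA addNr sub0r normrN /B; lra.
    by apply: le_trans (ler_normB _ _) _; rewrite /B; lra.
  - by rewrite /z x0 phi0 mulmx0 scaler0.
have B1 : 0 <= (B + 1) ^+ 2 by rewrite exprn_ge0// addr_ge0.
have small : 4 * (B + 1) ^+ 2 * `|t| * (`|ts_chi S p| + 1) < d.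
  have : `|t| * M < d by rewrite -ltr_pdivlMr// (lt_le_trans tT).
  by rewrite /M; lra.
have := Hd neg _ (start_estimate t0 d0 estz small B1).
rewrite current_sqZ; have := nul; rewrite zphi// (current_sq_cl cc H_c) ys// => /eqP.
by rewrite mulf_eq0 expf_eq0 (negPf s0) andbF/= => /eqP ->; rewrite mulr0 ltxx.
Qed.
End TwistorNearZero.

(** * From complex to real spinors *)

(* Complex matrices act on real columns of twice the size. *)
Section Realification.
Context {R : realType}.
Local Notation C := R[i].
Notation Rez := (map_mx (@complex.Re R)).
Notation Imz := (map_mx (@complex.Im R)).

Definition cre p q (A : 'M[C]_(p, q)) : 'M[R]_(p + p, q + q) :=
  block_mx (Rez A) (- Imz A) (Imz A) (Rez A).

Definition rv p q (A : 'M[C]_(p, q)) : 'M[R]_(p + p, q) := col_mx (Rez A) (Imz A).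

Lemma Re_add (x y : C) : complex.Re (x + y) = complex.Re x + complex.Re y.
Proof. by case: x; case: y. Qed.

Lemma Im_add (x y : C) : complex.Im (x + y) = complex.Im x + complex.Im y.
Proof. by case: x; case: y. Qed.

Lemma Re_opp (x : C) : complex.Re (- x) = - complex.Re x.
Proof. by case: x. Qed.

Lemma Re_mul (x y : C) :
  complex.Re (x * y) = complex.Re x * complex.Re y - complex.Im x * complex.Im y.
Proof. by case: x; case: y. Qed.

Lemma Im_mul (x y : C) :
  complex.Im (x * y) = complex.Re x * complex.Im y + complex.Im x * complex.Re y.
Proof. by case: x; case: y. Qed.

Lemma Re_sum (I : Type) (r : seq I) (F : I -> C) :
  complex.Re (\sum_(i <- r) F i) = \sum_(i <- r) complex.Re (F i).
Proof.
by elim: r => [|i r IH]; rewrite ?big_nil// !big_cons Re_add IH.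
Qed.

Lemma Im_sum (I : Type) (r : seq I) (F : I -> C) :
  complex.Im (\sum_(i <- r) F i) = \sum_(i <- r) complex.Im (F i).
Proof.
by elim: r => [|i r IH]; rewrite ?big_nil// !big_cons Im_add IH.
Qed.

Lemma Re_conj (x : C) : complex.Re (Num.conj x) = complex.Re x.
Proof. by case: x. Qed.

Lemma Im_conj (x : C) : complex.Im (Num.conj x) = - complex.Im x.
Proof. by case: x. Qed.

Lemma ReD p q (A B : 'M[C]_(p, q)) : Rez (A + B) = Rez A + Rez B.
Proof. by apply/matrixP => i j; rewrite !mxE Re_add. Qed.

Lemma ImD p q (A B : 'M[C]_(p, q)) : Imz (A + B) = Imz A + Imz B.
Proof. by apply/matrixP => i j; rewrite !mxE Im_add. Qed.

Lemma ReM p q r (A : 'M[C]_(p, q)) (B : 'M[C]_(q, r)) :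
  Rez (A *m B) = Rez A *m Rez B - Imz A *m Imz B.
Proof.
apply/matrixP => i j; rewrite !mxE Re_sum -sumrB; apply: eq_bigr => k _.
by rewrite !mxE Re_mul.
Qed.

Lemma ImM p q r (A : 'M[C]_(p, q)) (B : 'M[C]_(q, r)) :
  Imz (A *m B) = Rez A *m Imz B + Imz A *m Rez B.
Proof.
apply/matrixP => i j; rewrite !mxE Im_sum -big_split; apply: eq_bigr => k _.
by rewrite !mxE Im_mul.
Qed.

Lemma ReZ p q (a : R) (A : 'M[C]_(p, q)) : Rez (a%:C%C *: A) = a *: Rez A.
Proof. by apply/matrixP => i j; rewrite !mxE Re_mul mul0r subr0. Qed.

Lemma ImZ p q (a : R) (A : 'M[C]_(p, q)) : Imz (a%:C%C *: A) = a *: Imz A.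
Proof. by apply/matrixP => i j; rewrite !mxE Im_mul mul0r addr0. Qed.

Lemma Re0 p q : Rez (0 : 'M[C]_(p, q)) = 0.
Proof. by apply/matrixP => i j; rewrite !mxE. Qed.

Lemma Im0 p q : Imz (0 : 'M[C]_(p, q)) = 0.
Proof. by apply/matrixP => i j; rewrite !mxE. Qed.

Lemma rv0 p q : rv (0 : 'M[C]_(p, q)) = 0.
Proof.
by rewrite /rv Re0 Im0 col_mx0.
Qed.

Lemma rvD p q (A B : 'M[C]_(p, q)) : rv (A + B) = rv A + rv B.
Proof. by rewrite /rv ReD ImD add_col_mx. Qed.

Lemma rvZ p q (a : R) (A : 'M[C]_(p, q)) : rv (a%:C%C *: A) = a *: rv A.
Proof. by rewrite /rv ReZ ImZ scale_col_mx. Qed.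

Lemma rv_sum p q (I : Type) (r : seq I) (P : pred I) (F : I -> 'M[C]_(p, q)) :
  rv (\sum_(i <- r | P i) F i) = \sum_(i <- r | P i) rv (F i).
Proof. exact: (big_morph (@rv p q) (@rvD p q) (@rv0 p q)). Qed.

Lemma rvM p q r (A : 'M[C]_(p, q)) (B : 'M[C]_(q, r)) : rv (A *m B) = cre A *m rv B.
Proof. by rewrite /rv /cre mul_block_col ReM ImM mulNmx; congr col_mx; rewrite addrC. Qed.

Lemma rv_inj p q : injective (@rv p q).
Proof.
move=> A B /eq_col_mx[/matrixP hR /matrixP hI]; apply/matrixP => i j.
have := hR i j; have := hI i j; rewrite !mxE.
by case: (A i j) => a b; case: (B i j) => a' b' /= -> ->.
Qed.

Lemma rv_eq0 p q (A : 'M[C]_(p, q)) : rv A = 0 <-> A = 0.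
Proof. by split=> [h|->]; [apply: rv_inj; rewrite h rv0|rewrite rv0]. Qed.

Lemma rv_surj p q (A : 'M[R]_(p + p, q)) : exists B, rv B = A.
Proof.
exists (map2_mx (@Complex R) (usubmx A) (dsubmx A)).
by rewrite -[RHS]vsubmxK /rv; congr col_mx; apply/matrixP => i j; rewrite !mxE.
Qed.

Lemma creD p q (A B : 'M[C]_(p, q)) : cre (A + B) = cre A + cre B.
Proof. by rewrite /cre ReD ImD add_block_mx opprD. Qed.

Lemma cre0 p q : cre (0 : 'M[C]_(p, q)) = 0.
Proof.
by rewrite /cre Re0 Im0 oppr0 block_mx0.
Qed.

Lemma creZ p q (a : R) (A : 'M[C]_(p, q)) : cre (a%:C%C *: A) = a *: cre A.
Proof. by rewrite /cre ReZ ImZ scale_block_mx scalerN. Qed.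

Lemma cre_sum p q (I : Type) (r : seq I) (P : pred I) (F : I -> 'M[C]_(p, q)) :
  cre (\sum_(i <- r | P i) F i) = \sum_(i <- r | P i) cre (F i).
Proof. exact: (big_morph (@cre p q) (@creD p q) (@cre0 p q)). Qed.

Lemma creM p q r (A : 'M[C]_(p, q)) (B : 'M[C]_(q, r)) : cre (A *m B) = cre A *m cre B.
Proof.
rewrite /cre mulmx_block ReM ImM !mulNmx !mulmxN !opprD; congr block_mx.
- by rewrite addrC.
- by rewrite addrC.
Qed.

Lemma cre_scalar p (a : R) : cre (a%:C%C%:M : 'M[C]_p) = a%:M.
Proof.
rewrite /cre (_ : Rez a%:C%C%:M = a%:M); last first.
  by apply/matrixP => i j; rewrite !mxE; case: eqP.
rewrite (_ : Imz a%:C%C%:M = 0); last by apply/matrixP => i j; rewrite !mxE; case: eqP.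
by rewrite oppr0 -scalar_mx_block.
Qed.

Lemma cre_adj p q (A : 'M[C]_(p, q)) : cre (adjmx A) = (cre A)^T.
Proof.
rewrite /cre tr_block_mx; congr block_mx; apply/matrixP => i j; rewrite !mxE ?Re_conj ?Im_conj//.
by rewrite opprK.
Qed.

Lemma cre_inj p q : injective (@cre p q).
Proof.
move=> A B /eq_block_mx[/matrixP hR _ /matrixP hI _]; apply/matrixP => i j.
have := hR i j; have := hI i j; rewrite !mxE.
by case: (A i j) => a b; case: (B i j) => a' b' /= -> ->.
Qed.

Lemma rv_form p (A : 'M[C]_p) (x y : 'cV[C]_p) :
  complex.Re ((adjmx x *m A *m y) 0 0) = ((rv x)^T *m cre A *m rv y) 0 0.
Proof.
rewrite -!mulmxA -rvM; move: (A *m y) => z.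
rewrite /rv tr_col_mx mul_row_col.
have -> : complex.Re ((adjmx x *m z) 0 0) = (Rez (adjmx x *m z)) 0 0 by rewrite [RHS]mxE.
rewrite ReM; have -> : Rez (adjmx x) = (Rez x)^T.
  by apply/matrixP => i j; rewrite !mxE Re_conj.
have -> : Imz (adjmx x) = - (Imz x)^T.
  by apply/matrixP => i j; rewrite !mxE Im_conj.
by rewrite mulNmx opprK.
Qed.

End Realification.

(** * Real form of the spinor module *)

Section RealSpinorModule.
Context {R : realType} {n : nat}.
Variable D : spinor_module R n.
Hypothesis n3 : (3 <= n)%N.

Definition rgam (k : 'I_n) := cre (gam D k).
Definition rform := cre (spform D).

Lemma rgam_clifford k l : rgam k *m rgam l + rgam l *m rgam k = (- 2 * eta k l)%:M.
Proof. by rewrite /rgam -!creM -creD gam_clifford cre_scalar. Qed.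

Lemma rform_sym : rform^T = rform.
Proof. by rewrite /rform -cre_adj spform_herm. Qed.

Lemma rgam_cl x : cl rgam x = cre (clifford_mul (gam D) x).
Proof. by rewrite cre_sum; apply: eq_bigr => k _; rewrite creZ. Qed.

Lemma rform_spin s : spin_o (gam D) s -> (cre s)^T *m rform *m cre s = rform.
Proof. by move=> h; rewrite -cre_adj /rform -!creM spform_inv. Qed.

Lemma rform_pos (k : 'I_n) : (k = 0 :> nat)%N ->
  forall x : 'cV_(spdim n + spdim n), x != 0 -> 0 < (x^T *m rform *m (rgam k *m x)) 0 0.
Proof.
move=> k0 x x0; have [psi xE] := rv_surj x.
have psi0 : psi != 0 by apply: contra_neq x0; rewrite -xE => ->; rewrite rv0.
have := spform_pos D k0 psi0; rewrite ltcE => /andP[_]; rewrite rv_form -xE.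
by rewrite rvM.
Qed.

Lemma alternating_form p (M : 'M[R]_p) :
  (forall x : 'cV[R]_p, (x^T *m M *m x) 0 0 = 0) -> M^T = - M.
Proof.
move=> h; pose q (x y : 'cV[R]_p) := (x^T *m M *m y) 0 0.
have qE i j : q (delta_mx i 0) (delta_mx j 0) = M i j.
  by rewrite /q trmx_delta -rowE -colE !mxE.
have qD x y : q (x + y) (x + y) = q x x + q x y + (q y x + q y y).
  rewrite /q; have -> : (x + y)^T = x^T + y^T by rewrite linearD.
  by rewrite mulmxDl !mulmxDr !mulmxDl !mxE; ring.
apply/matrixP => i j; rewrite !mxE -!qE.
have := qD (delta_mx i 0) (delta_mx j 0); rewrite {1 2 5}/q !h; lra.
Qed.

(* Positivity makes [spform *m gam 0] Hermitian; the boosts of [spin_o] then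
   give the other generators. *)
Lemma rform_gam k : (rgam k)^T *m rform = rform *m rgam k.
Proof.
pose k0 : 'I_n := Ordinal (ltnW (ltnW n3)).
have cc := rgam_clifford.
pose J := cre (('i%C : R[i])%:M : 'M[R[i]]_(spdim n)).
have Jsq : J *m J = - 1%:M.
  rewrite /J -creM -scalar_mxM -expr2 sqr_i -(cre_scalar (spdim n) 1) -[RHS]addr0.
  by apply/eqP; rewrite addr0 -addr_eq0 -creD -raddfD/= addNr raddf0 cre0.
have JT : J^T = - J.
  apply/eqP; rewrite -addr_eq0 -cre_adj -creD; apply/eqP; rewrite -[RHS]cre0; congr cre.
  apply/matrixP => i j; rewrite !mxE eq_sym; case: eqP => _; rewrite ?mulr1n ?mulr0n ?rmorph0 ?addr0//.
  by apply/eqP; rewrite eq_complex /= addr0 addNr !eqxx.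
have JC A : J *m cre A = cre A *m J by rewrite /J -!creM scalar_mxC.
have herm : (rgam k0)^T *m rform = rform *m rgam k0.
  (* [J] is multiplication by i. The values <psi, e_0.psi> are real, being positive, so i times them
     has real part 0: the real form is alternating. *)
  have alt : (rform *m rgam k0 *m J)^T = - (rform *m rgam k0 *m J).
    apply: alternating_form => x; have [psi <-] := rv_surj x.
    have -> : (rv psi)^T *m (rform *m rgam k0 *m J) *m rv psi =
        (rv psi)^T *m cre (spform D *m gam D k0) *m rv ('i%C%:M *m psi).
      by rewrite rvM creM -/J /rform /rgam !mulmxA.
    rewrite -rv_form mul_scalar_mx -scalemxAr mxE mulrC ReiNIm.
    case: (eqVneq psi 0) => [->|h]; first by rewrite mulmx0 mxE /= oppr0.
    have := spform_pos D (k := k0) erefl h; rewrite mulmxA -[_ *m gam D k0]mulmxA.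
    by rewrite ltcE => /andP[/eqP -> _]; rewrite /= oppr0.
  move: alt; rewrite trmx_mul JT trmx_mul rform_sym mulNmx => /oppr_inj.
  have -> : rform *m rgam k0 *m J = J *m (rform *m rgam k0) by rewrite -creM JC.
  by move=> /(congr1 (mulmx J)); rewrite !(mulmxA J J) Jsq !mulNmx !mul1mx => /oppr_inj.
case: (eqVneq k k0) => [->//|kk0].
(* (5/4, 3/4) is a rational point of the unit hyperbola, so [u] is a unit timelike vector and e_0.u
   lies in Spin_o. Invariance under this element makes [u] self-adjoint, and subtracting e_0 leaves
   e_k. *)
pose e0 : 'rV[R]_n := delta_mx 0 k0; pose u : 'rV[R]_n := (5 / 4) *: e0 + (3 / 4) *: delta_mx 0 k.
have m00 : mink e0 e0 = -1 by rewrite mink_delta mxE !eqxx mulr1.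
have muu : mink u u = -1.
  rewrite /u minkDl !minkZl ![mink _ (_ + _)]minkC !minkDl !minkZl m00 !mink_delta !mxE !eqxx.
  rewrite (negPf kk0) eq_sym (negPf kk0)/= /eps ifN; last by rewrite -[0%N]/(k0 : nat) (inj_eq val_inj).
  by field.
have hs : spin_o (gam D) (clifford_mul (gam D) e0 *m clifford_mul (gam D) u).
  exists [:: e0; u]; last by rewrite !big_cons big_nil mulmx1.
  by split=> //=; rewrite /eta_norm !minkE m00 muu ?normrN1 ?eqxx// oppr_lt0 ltr01.
have := rform_spin hs; rewrite creM -!rgam_cl /e0 cl_delta -/e0.
have uu : cl rgam u *m cl rgam u = 1%:M by rewrite cl_sq// muu opprK.
have ee : rgam k0 *m rgam k0 = 1%:M by rewrite -[rgam k0]cl_delta cl_sq// m00 opprK.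
have uE : cl rgam u = (5 / 4) *: rgam k0 + (3 / 4) *: rgam k.
  by rewrite /u linearD !linearZ/= !cl_delta.
have uET : (cl rgam u)^T = (5 / 4) *: (rgam k0)^T + (3 / 4) *: (rgam k)^T.
  by rewrite uE linearD !linearZ.
move: (cl rgam u) uu uE uET => U uu uE uET.
rewrite trmx_mul -!mulmxA => h.
have {}h : U^T *m ((rgam k0)^T *m rform) = rform *m (U *m rgam k0).
  rewrite -{2}h -!mulmxA (mulmxA U U) uu mul1mx ee mulmx1; reflexivity.
have {}h : U^T *m rform = rform *m U.
  have := congr1 (mulmx^~ (rgam k0)) h; rewrite herm -!mulmxA ee !mulmx1; exact.
move: h; rewrite uET uE mulmxDl mulmxDr -!scalemxAl -!scalemxAr herm => /addrI.
by apply: scalerI; rewrite mulf_neq0 ?invr_eq0.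
Qed.

End RealSpinorModule.

(** * From the spinor bundle to systems in a chart and a frame *)

Section ChartDomains.
Context {R : realType} {n : nat} {M : smooth_manifold R n}.
Implicit Types (U : set M) (i : chart_idx M).

Lemma chart_image_open i U : open U -> open (chart i @` (dom i `&` U)).
Proof.
move=> oU; rewrite openE => _ [p [dp Up] <-].
have cx : (chart i @` dom i) (chart i p) by exists p.
have h1 : nbhs (chart i p) (chart i @` dom i).
  exact: (open_nbhs_nbhs (conj (@codom_open R n M i) cx)).
have h2 : nbhs (chart i p) (param i @^-1` U).
  apply: (param_continuous cx); rewrite chartK//; exact: (open_nbhs_nbhs (conj oU Up)).
apply: filterS2 h1 h2 => _ [q dq <-] /=; rewrite chartK// => Uq.
by exists q.
Qed.

Lemma chart_image_param i U x : (chart i @` (dom i `&` U)) x ->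
  [/\ dom i (param i x), U (param i x) & chart i (param i x) = x].
Proof. by case=> q [dq Uq] <-; rewrite chartK. Qed.

Lemma chart_nbhs i p (B : set 'rV[R]_n) : dom i p -> nbhs (chart i p) B ->
  nbhs p [set q | dom i q /\ B (chart i q)].
Proof.
move=> dp hB; have h1 : nbhs p (dom i) by exact: (open_nbhs_nbhs (conj (@dom_open R n M i) dp)).
by apply: filterS2 h1 (chart_continuous dp hB).
Qed.

Lemma param_nbhs i p U : dom i p -> nbhs p U -> nbhs (chart i p) (param i @^-1` U).
Proof.
move=> dp hU; have cx : (chart i @` dom i) (chart i p) by exists p.
by apply: (param_continuous cx); rewrite chartK.
Qed.

End ChartDomains.

Section ChristoffelMap.
Context {R : realType} {n : nat}.

Lemma lower_chr_koszul (dG : 'I_n -> 'M[R]_n) (u w : 'rV[R]_n) :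
  2^-1 *: (w *m (\sum_i u 0 i *: dG i) + u *m (\sum_i w 0 i *: dG i)
           - \row_k (u *m dG k *m w^T) 0 0) = w *m \sum_i u 0 i *: lower_chr dG i.
Proof.
apply/matrixP => a k; rewrite {a}ord1 !mxE.
have e1 : \sum_j w 0 j * (\sum_i u 0 i *: dG i) j k = \sum_j \sum_i w 0 j * u 0 i * dG i j k.
  apply: eq_bigr => j _; rewrite summxE mulr_sumr; apply: eq_bigr => i _.
  by rewrite mxE mulrA.
have e2 : \sum_j u 0 j * (\sum_i w 0 i *: dG i) j k = \sum_j \sum_i w 0 j * u 0 i * dG j i k.
  rewrite exchange_big/=; apply: eq_bigr => i _; rewrite summxE mulr_sumr.
  by apply: eq_bigr => j _; rewrite mxE mulrCA mulrA.
have e3 : \sum_j (u *m dG k) 0 j * w^T j 0 = \sum_j \sum_i w 0 j * u 0 i * dG k i j.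
  apply: eq_bigr => j _; rewrite !mxE mulr_suml; apply: eq_bigr => i _.
  by rewrite mulrC mulrA.
have e4 : \sum_j w 0 j * (\sum_i u 0 i *: lower_chr dG i) j k =
    \sum_j \sum_i w 0 j * u 0 i * (2^-1 * (dG i j k + dG j i k - dG k i j)).
  apply: eq_bigr => j _; rewrite summxE mulr_sumr; apply: eq_bigr => i _.
  by rewrite !mxE mulrA.
rewrite e1 e2 e3 e4 -big_split -sumrB mulr_sumr; apply: eq_bigr => j _.
rewrite -big_split -sumrB mulr_sumr; apply: eq_bigr => i _ /=; ring.
Qed.

Lemma derive_sum_coord p q (O : set 'rV[R]_n) (f : 'rV[R]_n -> 'M[R]_(p, q)) x u :
  open O -> smooth_on O f -> O x -> 'D_u f x = \sum_i u 0 i *: 'D_(delta_mx 0 i) f x.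
Proof. by move=> oO fs Ox; rewrite (derive_dirder u oO (fs 1%N) Ox). Qed.

End ChristoffelMap.

Section LocalTwistorData.
Context {R : realType} {n : nat} {M : smooth_manifold R n}.
Context {g : lorentz_metric M} {o : orientation g} {D : spinor_module R n}.
Context {S : spin_structure o D}.
Variable phi : spinor_field S.
Hypothesis n3 : (3 <= n)%N.
Implicit Types (b : frame_idx o) (i : chart_idx M).
Notation c := (rgam D).

Definition patch b i : set 'rV[R]_n := chart i @` (dom i `&` fdom b).
Definition lmetric i x := metric g i (param i x).
Definition lframe b i x := frame b i (param i x).
Definition lphi b i x := rv (phi b (param i x)).
(** The Dirac image times -1/n, see [rv_dirac], expanded in coordinate derivatives of the real
    spinor so that its smoothness can be read off. *)
Definition lchi b i x := - n%:R^-1 *: \sum_k eps k *: (c k *m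
  \sum_j lframe b i x k j *: ('D_(delta_mx 0 j) (lphi b i) x
    + sp c (conn (lmetric i) (lframe b i) j x) *m lphi b i x)).

Lemma patch_open b i : open (patch b i).
Proof. exact: chart_image_open (fdom_open b). Qed.

Lemma patch_chart b i p : dom i p -> fdom b p -> patch b i (chart i p).
Proof. by move=> dp bp; exists p. Qed.

Lemma lmetric_smooth b i : smooth_on (patch b i) (lmetric i).
Proof.
move=> k; apply: (Ck_sub _ (metric_smooth g i k)).
by move=> _ [p [dp _] <-]; exists p.
Qed.

Lemma lframe_smooth b i : smooth_on (patch b i) (lframe b i).
Proof. exact: frame_smooth. Qed.

Lemma lmetric_sym b i x : patch b i x -> (lmetric i x)^T = lmetric i x.
Proof. by move=> /chart_image_param[dp _ _]; exact: metric_sym. Qed.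

Lemma lframe_orthonormal b i x : patch b i x ->
  lframe b i x *m lmetric i x *m (lframe b i x)^T = eta.
Proof. by move=> /chart_image_param[dp bp _]; exact: frame_orthonormal. Qed.

Lemma smooth_col_mx (V : normedModType R) (A : set V) p q r (f : V -> 'M[R]_(p, r)) (h : V -> 'M[R]_(q, r)) :
  open A -> smooth_on A f -> smooth_on A h -> smooth_on A (fun x => col_mx (f x) (h x)).
Proof.
move=> oA fs hs; apply/(smooth_mxP oA) => j k; rewrite -(splitK j).
case: (fintype.split j) => l /=.
  apply: (smooth_ext oA (f := fun x => f x l k)) => [x _|]; first by rewrite col_mxEu.
  exact: (smooth_mxP oA _).1.
apply: (smooth_ext oA (f := fun x => h x l k)) => [x _|]; first by rewrite col_mxEd.
exact: (smooth_mxP oA _).1.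
Qed.

Lemma smooth_rv (V : normedModType R) (A : set V) p q (f : V -> 'M[R[i]]_(p, q)) : open A ->
  csmooth_on A f -> smooth_on A (fun x => rv (f x)).
Proof. by move=> oA [hr hi]; exact: smooth_col_mx. Qed.

Lemma lphi_smooth b i : smooth_on (patch b i) (lphi b i).
Proof. exact: (smooth_rv (@patch_open b i) (scomp_smooth phi b i)). Qed.

Lemma lchi_smooth b i : smooth_on (patch b i) (lchi b i).
Proof.
have oO := @patch_open b i.
have Gs := @lmetric_smooth b i; have Es := @lframe_smooth b i.
have ps := @lphi_smooth b i.
apply: (smooth_scale oO); apply: (smooth_sum oO) => k; apply: (smooth_scale oO).
apply: (smooth_mulmx oO (smooth_cst oO _)); apply: (smooth_sum oO) => j.
apply: (smooth_scaler oO); first exact: (smooth_mxP oO _).1.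
apply: (smooth_add oO); first exact: smooth_derive.
apply: (smooth_mulmx oO) => //; apply: (smooth_linmx oO (sp c)).
exact: smooth_conn.
Qed.

Lemma christoffel_chr b i p u w : dom i p -> fdom b p ->
  christoffel g i p u w = w *m chr_dir (lmetric i) (lframe b i) (chart i p) u.
Proof.
move=> dp bp; have Ox := patch_chart dp bp; have oO := @patch_open b i.
have Gs := @lmetric_smooth b i.
have dGu (v : 'rV[R]_n) : dmetric g i p v = \sum_j v 0 j *: dG (lmetric i) j (chart i p).
  exact: (derive_sum_coord v oO Gs Ox).
rewrite /christoffel [dmetric g i p u]dGu [dmetric g i p w]dGu.
have -> : \row_k (u *m dmetric g i p (delta_mx 0 k) *m w^T) 0 0 =
    \row_k (u *m dG (lmetric i) k (chart i p) *m w^T) 0 0 by [].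
rewrite lower_chr_koszul -mulmxA; congr (_ *m _).
have -> : invmx (metric g i p) = invG (lframe b i) (chart i p).
  rewrite -(invG_E (O := patch b i) (G := lmetric i) (@lframe_orthonormal b i) Ox).
  by rewrite /lmetric chartK.
by rewrite mulmx_suml; apply: eq_bigr => j _; rewrite -scalemxAl.
Qed.

Lemma conn_dirE b i x u : patch b i x ->
  conn_dir (lmetric i) (lframe b i) x u =
  ('D_u (lframe b i) x + lframe b i x *m chr_dir (lmetric i) (lframe b i) x u)
  *m coframe (lmetric i) (lframe b i) x.
Proof.
move=> Ox; have oO := @patch_open b i.
rewrite (derive_sum_coord u oO (@lframe_smooth b i) Ox) /conn_dir /chr_dir.
rewrite mulmx_sumr -big_split mulmx_suml; apply: eq_bigr => j _ /=.
rewrite -[in RHS]scalemxAr -scalerDr; exact: scalemxAl.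
Qed.

Lemma row_sandwich (A G E : 'M[R]_n) k l :
  (row k A *m G *m (row l E)^T) 0 0 = (A *m G *m E^T) k l.
Proof.
by rewrite -row_mul mxE [RHS]mxE; apply: eq_bigr => m _; rewrite !mxE.
Qed.

Lemma connection_formE b i p u k l : dom i p -> fdom b p ->
  connection_form b i p u k l =
  conn_dir (lmetric i) (lframe b i) (chart i p) u k l * eps l.
Proof.
move=> dp bp; have Ox := patch_chart dp bp; have oO := @patch_open b i.
have Es := @lframe_smooth b i.
rewrite /connection_form /nabla (christoffel_chr _ _ dp bp) conn_dirE//.
have -> : 'D_u ((fun q => row k (frame b i q)) \o param i) (chart i p) =
    row k ('D_u (lframe b i) (chart i p)).
  have h := smooth_is_derive u Es Ox.
  exact: (@derive_val _ _ _ _ _ _ _ (is_derive_linmx (row k) h)).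
move: ('D_u _ _) => dE; move: (chr_dir _ _ _ _) => X.
have -> : frame b i p = lframe b i (chart i p) by rewrite /lframe chartK.
rewrite /ip; have -> : metric g i p = lmetric i (chart i p) by rewrite /lmetric chartK.
rewrite /coframe; move: (lframe b i _) (lmetric i _) => E G.
have -> : row k dE + row k E *m X = row k (dE + E *m X) by rewrite linearD/= row_mul.
rewrite row_sandwich; move: (dE + _) => A.
rewrite !mulmxA; move: (A *m G *m E^T) => B.
rewrite [in RHS]mxE (bigD1 l)//= big1 ?addr0 => [|m ml]; last first.
  by rewrite etaE (negPf ml) mulr0n mulr0.
by rewrite etaE eqxx mulr1n -mulrA eps_sq mulr1.
Qed.

(** The summands of [sp] are symmetric in k and l, as both the matrix and the generators change
    sign, and vanish on the diagonal. So 1/2 times the sum over k < l is 1/4 times the full sum. *)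
Lemma sp_upper (A : 'M[R]_n) (f : 'I_n -> 'I_n -> R) (psi : 'cV[R]_(spdim n + spdim n)) :
  eta_skew A -> (forall k l, f k l = A k l * eps l) ->
  2^-1 *: \sum_(k < n) \sum_(l < n | (k < l)%N) (eps k * eps l * f k l) *: (c k *m c l *m psi) =
  sp c A *m psi.
Proof.
move=> sk fE; pose t k l : 'M[R]_(spdim n + spdim n) := (eps k * A k l) *: (c k *m c l).
have tE k l : (eps k * eps l * f k l) *: (c k *m c l *m psi) = t k l *m psi.
  by rewrite /t -scalemxAl fE; congr (_ *: _); rewrite [A k l * _]mulrC !mulrA -(mulrA (eps k)) eps_sq mulr1.
have tsym k l : k != l -> t k l = t l k.
  move=> kl; rewrite /t; have := rgam_clifford D k l; rewrite etaE (negPf kl) mulr0n mulr0.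
  rewrite (_ : 0%:M = 0) ?raddf0// => /eqP; rewrite addr_eq0 => /eqP ->.
  rewrite scalerN -scaleNr; congr (_ *: _); have := sk k l.
  move=> h; have h2 : A k l = - (A l k * eps k * eps l) by rewrite -mulNr -h -mulrA eps_sq mulr1.
  rewrite h2; have -> : - (eps k * - (A l k * eps k * eps l)) = eps k * eps k * (eps l * A l k) by ring.
  by rewrite eps_sq mul1r.
have tdiag k : t k k = 0.
  rewrite /t (_ : A k k = 0) ?mulr0 ?scale0r//.
  have := sk k k => h; have h2 : A k k * eps k = 0 by lra.
  by rewrite -[A k k]mulr1 -(eps_sq k) mulrA h2 mul0r.
rewrite /sp -scalemxAl mulmx_suml.
have -> : \sum_k (\sum_l (eps k * A k l) *: (c k *m c l)) *m psi =
    \sum_k \sum_l t k l *m psi by apply: eq_bigr => k _; rewrite mulmx_suml.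
have up (k : 'I_n) : \sum_(l < n | (k < l)%N) (eps k * eps l * f k l) *: (c k *m c l *m psi) =
  \sum_(l < n | (k < l)%N) t k l *m psi by apply: eq_bigr => l _; exact: tE.
rewrite (eq_bigr _ (fun k _ => up k)).
have split3 (k : 'I_n) : \sum_l t k l *m psi = \sum_(l < n | (k < l)%N) t k l *m psi +
    \sum_(l < n | (l < k)%N) t l k *m psi.
  rewrite (bigID (fun l : 'I_n => (k < l)%N))/=; congr (_ + _).
  rewrite (bigID (fun l : 'I_n => l == k))/= [X in X + _]big1 ?add0r; last first.
    by move=> l /andP[_ /eqP ->]; rewrite tdiag mul0mx.
  have e (l : 'I_n) : ~~ (k < l)%N && (l != k) = (l < k)%N by rewrite -leqNgt ltn_neqAle andbC.
  rewrite (eq_bigl _ _ e); apply: eq_bigr => l lk; rewrite tsym//.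
  by apply: contraTneq lk => ->; rewrite ltnn.
rewrite (eq_bigr _ (fun k _ => split3 k)) big_split/= [X in _ *: (_ + X)](exchange_big_dep xpredT)//=.
have half (X : 'cV[R]_(spdim n + spdim n)) : 2^-1 *: X = 4^-1 *: (X + X).
  by rewrite scalerDr -scalerDl; congr (_ *: _); field.
exact: half.
Qed.

Lemma real_inv_nat m : (m%:R^-1 : R[i]) = (m%:R^-1)%:C%C.
Proof. by rewrite fmorphV rmorph_nat. Qed.

Lemma rv_cderive b i x v : patch b i x ->
  rv (cderive v (phi b \o param i) x) = 'D_v (lphi b i) x.
Proof.
move=> Ox; have [hr hi] := scomp_smooth phi b i.
rewrite /rv /cderive.
have -> (A B : 'cV[R]_(spdim n)) : map_mx (@complex.Re R) (map2_mx (@Complex R) A B) = A.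
  by apply/matrixP => k l; rewrite !mxE.
have -> (A B : 'cV[R]_(spdim n)) : map_mx (@complex.Im R) (map2_mx (@Complex R) A B) = B.
  by apply/matrixP => k l; rewrite !mxE.
apply: esym; apply: (@derive_val _ _ _ _ _ _ _ (is_derive_col_mx _ _)).
  exact: (smooth_is_derive v hr Ox).
exact: (smooth_is_derive v hi Ox).
Qed.

Lemma rv_nablaS b i p v : dom i p -> fdom b p ->
  rv (nablaS phi b i p v) = 'D_v (lphi b i) (chart i p) +
    sp c (conn_dir (lmetric i) (lframe b i) (chart i p) v) *m lphi b i (chart i p).
Proof.
move=> dp bp; have Ox := patch_chart dp bp; have oO := @patch_open b i.
rewrite /nablaS rvD rv_cderive//; congr (_ + _).
have sk := conn_dir_skew oO (@lmetric_smooth b i) (@lframe_smooth b i) (@lmetric_sym b i)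
  (@lframe_orthonormal b i) v Ox.
rewrite -(sp_upper _ sk (f := connection_form b i p v)); last first.
  by move=> k l; exact: connection_formE.
rewrite real_inv_nat rvZ rv_sum; congr (_ *: _); apply: eq_bigr => k _.
rewrite rv_sum; apply: eq_bigr => l _; rewrite rvZ !rvM creM.
by rewrite /lphi chartK// mulmxA.
Qed.

Lemma coframe_inverse b i p : dom i p -> fdom b p ->
  invmx (frame b i p) = coframe (lmetric i) (lframe b i) (chart i p).
Proof.
move=> dp bp; have Ox := patch_chart dp bp.
rewrite -(frame_inverse (O := patch b i) (G := lmetric i) (@lframe_orthonormal b i) Ox).
by rewrite /lframe chartK.
Qed.

Lemma cre_clif b i p v : dom i p -> fdom b p ->
  cre (@clif R n M g o D b i p v) = cl c (v *m coframe (lmetric i) (lframe b i) (chart i p)).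
Proof. by move=> dp bp; rewrite /clif -rgam_cl coframe_inverse. Qed.

Lemma rv_dirac b i p : dom i p -> fdom b p ->
  lchi b i (chart i p) = - n%:R^-1 *: rv (dirac phi b i p).
Proof.
move=> dp bp; have Ox := patch_chart dp bp; have oO := @patch_open b i.
rewrite /lchi /dirac; congr (_ *: _); rewrite rv_sum; apply: eq_bigr => k _.
rewrite rvZ rvM rv_nablaS//; congr (_ *: (_ *m _)).
rewrite (derive_sum_coord _ oO (@lphi_smooth b i) Ox) sp_conn_dir mulmx_suml -big_split.
apply: eq_bigr => j _ /=; rewrite mxE /lframe chartK// scalerDr.
by congr (_ + _); exact: scalemxAl.
Qed.

Hypothesis tw : conformal_killing phi.

Lemma local_twistor_equation b i j x : patch b i x ->
  'D_(delta_mx 0 j) (lphi b i) x =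
  cl c (row j (coframe (lmetric i) (lframe b i) x)) *m lchi b i x
  - sp c (conn (lmetric i) (lframe b i) j x) *m lphi b i x.
Proof.
case=> p [dp bp] <-; have := congr1 (@rv _ _ _) (tw (delta_mx 0 j) bp dp).
rewrite rvD rv0 rv_nablaS// real_inv_nat rvZ rvM cre_clif// rv_dirac//.
rewrite -rowE -scalemxAr.
have -> : conn_dir (lmetric i) (lframe b i) (chart i p) (delta_mx 0 j) =
    conn (lmetric i) (lframe b i) j (chart i p).
  rewrite /conn_dir (bigD1 j)//= big1 ?addr0; last first.
    by move=> k kj; rewrite mxE (negPf kj) andbF scale0r.
  by rewrite mxE !eqxx scale1r.
move/eqP; rewrite addrAC addr_eq0 => /eqP h.
by rewrite scaleNr -h [RHS]addrC addrK.
Qed.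

Definition patch_system b i : twistor_system c := local_system (@patch_open b i)
  (@lmetric_smooth b i) (@lframe_smooth b i) (@lmetric_sym b i) (@lframe_orthonormal b i)
  n3 (rgam_clifford D) (@lphi_smooth b i) (@lchi_smooth b i)
  (fun j x => @local_twistor_equation b i j x).

Lemma ip_mink b i p v w : dom i p -> fdom b p ->
  ip g i p v w = mink (v *m coframe (lmetric i) (lframe b i) (chart i p))
                      (w *m coframe (lmetric i) (lframe b i) (chart i p)).
Proof.
move=> dp bp; have Ox := patch_chart dp bp.
have := coframe_frame (O := patch b i) (@lframe_orthonormal b i) Ox.
have := @lframe_orthonormal b i _ Ox; rewrite {1}/lmetric chartK//.
move: (coframe _ _ _) (lframe b i (chart i p)) => T E EGE TE.
have GE : metric g i p = T *m eta *m T^T.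
  rewrite -EGE -!mulmxA -trmx_mul TE trmx1 mulmx1 mulmxA TE mul1mx; reflexivity.
by rewrite -minkE trmx_mul /ip GE !mulmxA.
Qed.

Lemma current_lphi (V : tangent_field M) b i p : is_dirac_current phi V ->
  dom i p -> fdom b p ->
  V i p *m coframe (lmetric i) (lframe b i) (chart i p) =
  - current c (rform D) (lphi b i (chart i p)).
Proof.
move=> hV dp bp; have Ox := patch_chart dp bp.
apply/eqP; rewrite -subr_eq0; apply/eqP/mink_eq0 => y.
have -> : y = (y *m lframe b i (chart i p)) *m coframe (lmetric i) (lframe b i) (chart i p).
  by rewrite -mulmxA (frame_coframe (O := patch b i) (@lframe_orthonormal b i) Ox) mulmx1.
move: (y *m _) => v; apply/eqP; rewrite minkBl subr_eq0 -ip_mink// minkNl mink_current.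
have := congr1 (@complex.Re R) (hV b i p v bp dp); rewrite Re_opp /spprod rv_form rvM cre_clif//.
by rewrite /lphi chartK// => <-.
Qed.

Lemma current_sq_lphi (V : tangent_field M) b i p : is_dirac_current phi V ->
  dom i p -> fdom b p ->
  ip g i p (V i p) (V i p) = current_sq c (rform D) (lphi b i (chart i p)).
Proof.
move=> hV dp bp; rewrite (ip_mink _ _ dp bp) current_lphi// minkNl minkC minkNl opprK.
by [].
Qed.

End LocalTwistorData.

(** * Change of chart and of frame *)

Section Jacobian.
Context {R : realType} {n m : nat}.

(** Strict differentiability with [h' = 0] exhibits the matrix of partial derivatives as a
    differential, and differentials are unique. *)
Lemma C1_jacobian (A : set 'rV[R]_n) (f : 'rV[R]_n -> 'rV[R]_m) x v : open A -> Ck 1 A f -> A x ->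
  v *m jacobian f x = 'D_v f x.
Proof.
move=> oA fA Ax.
pose J : 'M[R]_(n, m) := \matrix_(k < n) 'D_(delta_mx 0 k) f x.
have dJ h : dirder f x h = h *m J.
  by rewrite mulmx_sum_row; apply: eq_bigr => k _; rewrite rowK.
have oT : open [set: 'rV[R]_n] by exact: openT.
have Jc : continuous (mulmxr J : 'rV[R]_n -> 'rV[R]_m).
  by move=> y; exact: ((smooth_mulmx oT (smooth_id oT) (smooth_cst oT J)) 0%N).1.
have h : f \o shift x = cst (f x) + (mulmxr J : 'rV[R]_n -> 'rV[R]_m) +o_ (0 : 'rV[R]_n) id.
  apply/eqaddoP => e e0; have [d d0 H] := C1_strict oA fA Ax e0.
  near=> h; have hd : `|h| < d.
    by near: h; apply/nbhs_ballP; exists d => //= y; rewrite -ball_normE/= sub0r normrN.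
  have := H h 0 hd; rewrite normr0 subr0 addr0 dJ => /(_ d0).
  rewrite (_ : (f \o shift x - (cst (f x) + mulmxr J)) h = f (x + h) - f x - h *m J)//.
  change (f (h + x) - (f x + h *m J) = f (x + h) - f x - h *m J).
  by rewrite [h + x]addrC opprD addrA.
rewrite /jacobian mul_rV_lin1 (diff_unique Jc h)/= -dJ.
by rewrite (derive_dirder v oA fA Ax).
Unshelve. all: by end_near.
Qed.

End Jacobian.

Section LocalLeviCivitaDirections.
Context {R : realType} {n : nat}.
Variables (O : set 'rV[R]_n) (G E : 'rV[R]_n -> 'M[R]_n).
Hypothesis oO : open O.
Hypothesis Gs : smooth_on O G.
Hypothesis Es : smooth_on O E.
Hypothesis Gsym : forall x, O x -> (G x)^T = G x.
Hypothesis EGE : forall x, O x -> E x *m G x *m (E x)^T = eta.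

Lemma chr_dir_compat x v : O x ->
  'D_v G x = chr_dir G E x v *m G x + G x *m (chr_dir G E x v)^T.
Proof.
move=> Ox; rewrite (derive_sum_coord v oO Gs Ox) /chr_dir mulmx_suml.
have -> : (\sum_i v 0 i *: chr G E i x)^T = \sum_i v 0 i *: (chr G E i x)^T.
  by rewrite (linear_sum trmx); apply: eq_bigr => i _; exact: scale_trmx.
rewrite mulmx_sumr -big_split; apply: eq_bigr => i _ /=.
rewrite (chr_compat oO Gs Gsym EGE i Ox : 'D_(delta_mx 0 i) G x = _) scalerDr.
by congr (_ + _); [exact: scalemxAl|exact: scalemxAr].
Qed.

Lemma chr_dir_sym x u v : O x -> u *m chr_dir G E x v = v *m chr_dir G E x u.
Proof.
move=> Ox; rewrite /chr_dir !mulmx_sumr.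
have e (a w : 'rV[R]_n) : \sum_i a *m (w 0 i *: chr G E i x) =
    \sum_i \sum_j (w 0 i * a 0 j) *: row j (chr G E i x).
  apply: eq_bigr => i _; move: (chr G E i x) => C.
  rewrite -scalemxAr mulmx_sum_row scaler_sumr; apply: eq_bigr => j _.
  by rewrite scalerA.
rewrite !e exchange_big/=; apply: eq_bigr => i _; apply: eq_bigr => j _.
by rewrite (chr_sym E oO Gs Gsym j i Ox) mulrC.
Qed.

End LocalLeviCivitaDirections.

(** The product of the two transpositions has order three and acts as -1, so T = -T. *)
Lemma symmetric_skew_zero (R : realType) (V : Type) (T : V -> V -> V -> R) :
  (forall v u w, T v u w = T u v w) -> (forall v u w, T v u w = - T v w u) ->
  forall v u w, T v u w = 0.
Proof.
move=> sym skew v u w; suff : T v u w = - T v u w by lra.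
by rewrite {1}sym skew sym skew opprK sym skew.
Qed.

(** The uniqueness of the Levi-Civita connection at a point: [X] is the difference of two
    torsion-free metric connections. *)
Lemma connection_unique (R : realType) (n : nat) (X : 'rV[R]_n -> 'M[R]_n) (K : 'M[R]_n) :
  (forall u v, u *m X v = v *m X u) -> (forall v, (X v *m K)^T = - (X v *m K)) ->
  K \in unitmx -> forall v, X v = 0.
Proof.
move=> sym skew uK v; pose T (v u w : 'rV[R]_n) : R := (u *m (X v *m K) *m w^T) 0 0.
have T0 : forall v u w, T v u w = 0.
  apply: symmetric_skew_zero => {}v u w; first by rewrite /T !mulmxA sym.
  rewrite /T; have -> : (u *m (X v *m K) *m w^T) 0 0 = (u *m (X v *m K) *m w^T)^T 0 0 by rewrite [RHS]mxE.
  by rewrite !(trmx_mul (u *m _)) !(trmx_mul u) skew trmxK mulNmx mulmxN mxE mulmxA.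
have : X v *m K = 0.
  apply/matrixP => i j; have := T0 v (delta_mx 0 i) (delta_mx 0 j).
  by rewrite /T -rowE trmx_delta -colE !mxE.
by move=> /(congr1 (mulmx^~ (invmx K))); rewrite mulmxK// mul0mx.
Qed.

(** The transformation law of the Christoffel map, deduced from uniqueness: the transformed
    connection is again torsion-free and metric, so no expansion of Koszul's formula is required. *)
Lemma christoffel_algebra (R : realType) (n : nat) (Ci Cj dJ : 'rV[R]_n -> 'M[R]_n) (J G : 'M[R]_n) :
  G^T = G -> J \in unitmx -> G \in unitmx ->
  (forall u v, u *m Ci v = v *m Ci u) -> (forall u v, u *m dJ v = v *m dJ u) ->
  (forall u v, u *m J *m Cj v = v *m J *m Cj u) ->
  (forall v, Ci v *m (J *m G *m J^T) + J *m G *m J^T *m (Ci v)^T =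
    dJ v *m G *m J^T + J *m (Cj v *m G + G *m (Cj v)^T) *m J^T + J *m G *m (dJ v)^T) ->
  forall v, Ci v *m J = dJ v + J *m Cj v.
Proof.
move=> Gt Ju Gu si sd sj comp v; apply/eqP; rewrite -subr_eq0 opprD addrA; apply/eqP.
apply: (@connection_unique _ _ (fun v => Ci v *m J - dJ v - J *m Cj v) (G *m J^T)) => {v}.
- by move=> u v; rewrite !mulmxBr !mulmxA si sd sj.
- move=> v; apply/eqP; rewrite -addr_eq0; apply/eqP.
  rewrite trmx_mul trmx_mul trmxK Gt.
  have -> : (Ci v *m J - dJ v - J *m Cj v)^T = J^T *m (Ci v)^T - (dJ v)^T - (Cj v)^T *m J^T.
    by rewrite !linearB/= !trmx_mul.
  rewrite !mulmxBr !mulmxBl !mulmxA; have := comp v.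
  rewrite mulmxDr mulmxDl !mulmxA.
  move: (Ci v *m J *m G *m J^T) (J *m G *m J^T *m _) (dJ v *m G *m J^T)
    (J *m Cj v *m G *m J^T) (J *m G *m (Cj v)^T *m J^T) (J *m G *m (dJ v)^T) => X1 X2 X3 X4 X5 X6.
  clear=> /matrixP h; apply/matrixP => k m; have := h k m; rewrite !mxE; lra.
- by rewrite unitmx_mul Gu unitmx_tr.
Qed.

Lemma transition_algebra (R : realType) (n : nat) (v : 'rV[R]_n) (C J dJ X : 'M[R]_n) :
  C *m J = dJ + J *m X -> - (v *m C) *m J + v *m dJ = - (v *m J *m X).
Proof.
move=> h; rewrite mulNmx -(mulmxA v C) h mulmxDr opprD addrC addrA subrr add0r.
by rewrite mulmxA.
Qed.

Lemma connection_algebra (R : realType) (n : nat)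
    (oi oj dE E Ci dEj E' Cj B dB J dJ : 'M[R]_n) :
  oi *m E = dE + E *m Ci -> oj *m E' = dEj + E' *m Cj ->
  dEj = dB *m E *m J + B *m dE *m J + B *m E *m dJ -> Ci *m J = dJ + J *m Cj ->
  E' = B *m E *m J -> J \in unitmx -> E \in unitmx -> oj *m B = dB + B *m oi.
Proof.
move=> hi hj dEjE ch fc Ju Eu.
have EJu : E *m J \in unitmx by rewrite unitmx_mul Eu.
suff e : oj *m B *m (E *m J) = (dB + B *m oi) *m (E *m J).
  by rewrite -(mulmxK EJu (oj *m B)) e mulmxK.
have -> : oj *m B *m (E *m J) = oj *m E' by rewrite fc !mulmxA.
have -> : (dB + B *m oi) *m (E *m J) = dB *m E *m J + B *m (oi *m E) *m J.
  by rewrite mulmxDl !mulmxA.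
have -> : B *m (oi *m E) *m J = B *m dE *m J + B *m E *m (Ci *m J).
  by rewrite hi mulmxDr mulmxDl !mulmxA.
by rewrite hj dEjE fc ch mulmxDr !mulmxA !addrA.
Qed.

Lemma cre1 (R : realType) p : cre (1%:M : 'M[R[i]]_p) = 1%:M.
Proof. by rewrite -[RHS](cre_scalar p 1) rmorph1. Qed.

Lemma spin_o_unit (R : realType) (n : nat) (D : spinor_module R n) s : spin_o (gam D) s -> s \in unitmx.
Proof.
case=> vs [/allP hu _ _] ->; elim: vs hu => [|x vs IH] hu.
  by rewrite big_nil unitmx1.
rewrite big_cons unitmx_mul; apply/andP; split; last first.
  by apply: IH => y hy; apply: hu; rewrite inE hy orbT.
have hx : mink x x != 0.
  have := hu x; rewrite inE eqxx => /(_ isT); rewrite /eta_norm minkE.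
  by apply: contraTneq => ->; rewrite normr0 eq_sym oner_eq0.
have e : clifford_mul (gam D) x *m ((- (mink x x)^-1)%:C%C *: clifford_mul (gam D) x) = 1%:M.
  apply: cre_inj; rewrite creM creZ -!rgam_cl -scalemxAr cl_sq; last exact: rgam_clifford.
  by rewrite cre1 scale_scalar_mx mulrNN mulVf.
by have [] := mulmx1_unit e.
Qed.

(** The first factor is the difference of two spin connections, written in one trivialisation.
    Differentiating the covering relation l W' = W l shows that it commutes with Clifford
    multiplication. *)
Lemma gauge_commute (R : realType) (N : nat) (l li dl si sj W' W dW Ui Uj Uj' : 'M[R]_N) :
  l *m li = 1%:M -> dl *m W' = dW *m l + W *m dl -> l *m W' = W *m l ->
  si *m W = W *m si + Ui -> sj *m W' = W' *m sj + Uj -> l *m Uj = Uj' *m l ->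
  Uj' = dW + Ui ->
  (dl *m li + si - l *m sj *m li) *m W = W *m (dl *m li + si - l *m sj *m li).
Proof.
move=> lli h1 h2 h3 h4 h5 h6; have lil : li *m l = 1%:M by exact: mulmx1C.
have WE : li *m W = W' *m li by rewrite -[W]mulmx1 -lli !mulmxA -(mulmxA li) -h2 mulmxA lil mul1mx.
have e1 : dl *m li *m W = dW + W *m (dl *m li).
  by rewrite -mulmxA WE mulmxA h1 mulmxDl -(mulmxA dW) lli mulmx1 -mulmxA.
have e2 : l *m sj *m li *m W = W *m (l *m sj *m li) + Uj'.
  rewrite -mulmxA WE mulmxA -(mulmxA l sj) h4 mulmxDr mulmxDl h5 -(mulmxA Uj') lli mulmx1.
  by rewrite !mulmxA h2.
rewrite mulmxBl mulmxDl e1 h3 e2 h6 mulmxBr mulmxDr; clear.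
by apply/matrixP => i j; rewrite !mxE; ring.
Qed.

(** Comparison of the twistor equations in two patches: the difference of the spin connections,
    applied to phi, is Clifford multiplication on the difference of the two chi. *)
Lemma gauge_difference (R : realType) (N : nat) (l li dl si sj cy cyj : 'M[R]_N)
    (fi fj di dj xi xj : 'cV[R]_N) :
  l *m li = 1%:M -> fi = l *m fj -> di = dl *m fj + l *m dj ->
  di = cy *m xi - si *m fi -> dj = cyj *m xj - sj *m fj -> l *m cyj = cy *m l ->
  (dl *m li + si - l *m sj *m li) *m fi = cy *m (xi - l *m xj).
Proof.
move=> lli hf hd hi hj hc; have lil : li *m l = 1%:M by exact: mulmx1C.
have e1 : dl *m li *m fi = dl *m fj by rewrite hf -mulmxA (mulmxA li) lil mul1mx.
have e2 : l *m sj *m li *m fi = l *m (sj *m fj).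
  by rewrite hf -mulmxA (mulmxA li) lil mul1mx mulmxA.
rewrite mulmxBl mulmxDl e1 e2 mulmxBr (mulmxA cy) -hc.
have -> : cy *m xi = di + si *m fi by rewrite hi subrK.
rewrite -(mulmxA l cyj); have -> : cyj *m xj = dj + sj *m fj by rewrite hj subrK.
by rewrite hd mulmxDr; clear; apply/matrixP => i j; rewrite !mxE; ring.
Qed.

Section ChangeOfPatch.
Context {R : realType} {n : nat} {M : smooth_manifold R n}.
Context {g : lorentz_metric M} {o : orientation g} {D : spinor_module R n}.
Context {S : spin_structure o D}.
Variable phi : spinor_field S.
Hypothesis n3 : (3 <= n)%N.
Hypothesis tw : conformal_killing phi.
Notation gamc := (rgam D).
Variables (b c : frame_idx o) (i j : chart_idx M).

Definition overlap : set 'rV[R]_n := chart i @` (dom i `&` (dom j `&` (fdom b `&` fdom c))).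
Let F : 'rV[R]_n -> 'rV[R]_n := chart j \o param i.
Let J x := chart_jac i j (param i x).
Let A x := frame_trans b c (param i x).
Let l x := cre (Defs.lift S b c (param i x)).
Let Gi := lmetric (g := g) i.
Let Gj := lmetric (g := g) j.
Let Ei := lframe b i.
Let Ej := lframe c j.
Implicit Types (x u v w : 'rV[R]_n).

Let oO : open overlap.
Proof.
apply: chart_image_open; apply: openI; first exact: (@dom_open R n M j).
by apply: openI; [exact: (fdom_open b)|exact: (fdom_open c)].
Qed.

Let overlapP x : overlap x -> [/\ dom i (param i x), dom j (param i x),
  fdom b (param i x), fdom c (param i x) & chart i (param i x) = x].
Proof. by case=> p [dp [dj [hb hc]]] <-; rewrite chartK. Qed.

Let patch_i x : overlap x -> patch b i x.
Proof. by case/overlapP => di dj hb hc <-; exact: patch_chart. Qed.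

Let patch_j x : overlap x -> patch c j (F x).
Proof. by case/overlapP => di dj hb hc _; exact: patch_chart. Qed.

Let param_F x : overlap x -> param j (F x) = param i x.
Proof. by case/overlapP => di dj hb hc _; exact: chartK. Qed.

Let F_smooth : smooth_on overlap F.
Proof.
move=> k; apply: (Ck_sub _ (transition_smooth i j k)).
by move=> _ [p [dp [dj _]] <-]; exists p.
Qed.

Let jac x v : overlap x -> v *m J x = 'D_v F x.
Proof.
move=> Ox; have [_ _ _ _ e] := overlapP Ox.
by rewrite -(C1_jacobian v oO (F_smooth 1%N) Ox) /J /chart_jac e.
Qed.

Let J_smooth : smooth_on overlap J.
Proof.
apply/(smooth_mxP oO) => k m.
apply: (smooth_ext oO (f := fun x => ('D_(delta_mx 0 k) F x) 0 m)).
  move=> x Ox; rewrite -(jac (delta_mx 0 k) Ox) -rowE; exact: mxE.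
by apply: (smooth_mxP oO _).1; exact: (smooth_derive _ F_smooth).
Qed.

Let dJ_sym x u v : overlap x -> u *m 'D_v J x = v *m 'D_u J x.
Proof.
move=> Ox; have h a w : w *m 'D_a J x = 'D_a ('D_w F) x.
  apply: esym; apply: (derive_on oO Ox (f := fun y => w *m J y)); first by move=> y; exact: jac.
  apply: (is_derive_eq (is_derive_mulmx (is_derive_cst w x a) (smooth_is_derive a J_smooth Ox))).
  by rewrite mul0mx add0r.
by rewrite !h; exact: (derive_swap _ _ oO (F_smooth 2%N) Ox).
Qed.

Let is_derive_F x v : overlap x -> is_derive x v F (v *m J x).
Proof. by move=> Ox; rewrite jac//; exact: (smooth_is_derive v F_smooth Ox). Qed.

Let is_derive_j p q (f : 'rV[R]_n -> 'M[R]_(p, q)) x v : overlap x ->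
  smooth_on (patch c j) f -> is_derive x v (fun y => f (F y)) ('D_(v *m J x) f (F x)).
Proof.
move=> Ox fs.
exact: (is_derive_comp (@patch_open _ _ _ _ o c j) (fs 1%N) (patch_j Ox) (is_derive_F v Ox)).
Qed.

Let metric_change x : overlap x -> Gi x = J x *m Gj (F x) *m (J x)^T.
Proof.
move=> Ox; have [di dj _ _ _] := overlapP Ox.
by rewrite /Gi /Gj /lmetric param_F// (metric_compat g di dj).
Qed.

Let Gi_unit x : overlap x -> Gi x *m invG Ei x = 1%:M.
Proof. by move=> Ox; exact: (G_invG (@lframe_orthonormal _ _ _ _ _ b i) (patch_i Ox)). Qed.

Let J_unit x : overlap x -> J x \in unitmx.
Proof.
move=> Ox; have := Gi_unit Ox; rewrite metric_change// -!mulmxA => /mulmx1_unit[]//.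
Qed.

Let chri v x := chr_dir Gi Ei x v.
Let chrj v x := chr_dir Gj Ej (F x) v.

Lemma christoffel_change x v : overlap x ->
  chri v x *m J x = 'D_v J x + J x *m chrj (v *m J x) x.
Proof.
move=> Ox; have Pi := patch_i Ox; have Pj := patch_j Ox.
have oi := @patch_open _ _ _ _ o b i; have oj := @patch_open _ _ _ _ o c j.
have Gis := @lmetric_smooth _ _ _ g o b i; have Gjs := @lmetric_smooth _ _ _ g o c j.
have Gisym := @lmetric_sym _ _ _ g o b i; have Gjsym := @lmetric_sym _ _ _ g o c j.
have EGEi := @lframe_orthonormal _ _ _ g o b i; have EGEj := @lframe_orthonormal _ _ _ g o c j.
have Gt : (Gj (F x))^T = Gj (F x) by exact: Gjsym.
have Gu : Gj (F x) \in unitmx.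
  by have := G_invG EGEj Pj => /mulmx1_unit[].
apply: (christoffel_algebra (Ci := fun v => chri v x) (Cj := fun v => chrj (v *m J x) x)
   (dJ := fun v => 'D_v J x) Gt (J_unit Ox) Gu).
- by move=> u w; exact: (chr_dir_sym Ei oi Gis Gisym u w Pi).
- by move=> u w; exact: dJ_sym.
- by move=> u w; exact: (chr_dir_sym Ej oj Gjs Gjsym (u *m J x) (w *m J x) Pj).
- move=> {}v.
  have ci : 'D_v Gi x = chri v x *m Gi x + Gi x *m (chri v x)^T.
    exact: (chr_dir_compat oi Gis Gisym EGEi).
  have cj : 'D_(v *m J x) Gj (F x) = chrj (v *m J x) x *m Gj (F x) + Gj (F x) *m (chrj (v *m J x) x)^T.
    exact: (chr_dir_compat oj Gjs Gjsym EGEj).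
  rewrite -(metric_change Ox) -ci -cj.
  apply: (derive_on oO Ox (f := fun y => J y *m Gj (F y) *m (J y)^T)).
    by move=> y Oy; rewrite -metric_change.
  have hJ := smooth_is_derive v J_smooth Ox.
  apply: (is_derive_eq (is_derive_mulmx (is_derive_mulmx hJ (is_derive_j v Ox Gjs))
    (is_derive_linmx (@trmx R n n) hJ))).
  exact: (congr1 (fun X => X + _) (mulmxDl _ _ _)).
Qed.

Let A_smooth : smooth_on overlap A.
Proof.
have Es (d : frame_idx o) : (d = b \/ d = c) -> smooth_on overlap (lframe d i).
  move=> h k; apply: (Ck_sub _ (frame_smooth d i k)) => _ [p [dp [dj [hb hc]]] <-].
  by exists p => //; split=> //; case: h => ->.
have Gs : smooth_on overlap Gi.
  by move=> k; apply: (Ck_sub _ (@lmetric_smooth _ _ _ g o b i k)) => x; exact: patch_i.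
(* The smoothness of the frame transition is inherited from that of the two frames. *)
apply: (smooth_ext oO (f := fun x => lframe c i x *m coframe Gi Ei x)).
  move=> x Ox; have [di dj hb hc _] := overlapP Ox.
  rewrite /lframe (frame_transP hb hc di) -mulmxA.
  by rewrite (frame_coframe (@lframe_orthonormal _ _ _ _ _ b i) (patch_i Ox)) mulmx1.
apply: (smooth_mulmx oO); first by apply: Es; right.
by apply: (smooth_coframe oO Gs); apply: Es; left.
Qed.

Let frame_change x : overlap x -> Ej (F x) = A x *m Ei x *m J x.
Proof.
move=> Ox; have [di dj hb hc _] := overlapP Ox.
by rewrite /Ej /lframe param_F// (frame_transP hb hc dj) (frame_compat hb di dj) mulmxA.
Qed.

Let omi v x := conn_dir Gi Ei x v.
Let omj v x := conn_dir Gj Ej (F x) v.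

Lemma connection_change x v : overlap x ->
  omj (v *m J x) x *m A x = 'D_v A x + A x *m omi v x.
Proof.
move=> Ox; have Pi := patch_i Ox; have Pj := patch_j Ox.
have EGEi := @lframe_orthonormal _ _ _ g o b i; have EGEj := @lframe_orthonormal _ _ _ g o c j.
have Eis := @lframe_smooth _ _ _ g o b i; have Ejs := @lframe_smooth _ _ _ g o c j.
have hi : omi v x *m Ei x = 'D_v Ei x + Ei x *m chri v x.
  rewrite /omi conn_dirE// -(mulmxA _ (coframe _ _ _)).
  by rewrite (coframe_frame EGEi Pi) mulmx1.
have hj : omj (v *m J x) x *m Ej (F x) = 'D_(v *m J x) Ej (F x) + Ej (F x) *m chrj (v *m J x) x.
  rewrite /omj conn_dirE// -(mulmxA _ (coframe _ _ _)).
  by rewrite (coframe_frame EGEj Pj) mulmx1.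
have hE : is_derive x v Ei ('D_v Ei x).
  exact: (smooth_is_derive v Eis Pi).
have dE : 'D_(v *m J x) Ej (F x) = 'D_v A x *m Ei x *m J x + A x *m 'D_v Ei x *m J x
    + A x *m Ei x *m 'D_v J x.
  have h1 := is_derive_j v Ox Ejs.
  rewrite -(derive_on oO Ox (fun y Oy => erefl) h1).
  apply: (derive_on oO Ox (f := fun y => A y *m Ei y *m J y)) => [y Oy|]; first by rewrite -frame_change.
  have hA := smooth_is_derive v A_smooth Ox; have hJ := smooth_is_derive v J_smooth Ox.
  apply: (is_derive_eq (is_derive_mulmx (is_derive_mulmx hA hE) hJ)).
  exact: (congr1 (fun X => X + _) (mulmxDl _ _ _)).
have ch := christoffel_change v Ox; have Ju := J_unit Ox.
have Eu : Ei x \in unitmx by have := frame_coframe EGEi Pi => /mulmx1_unit[].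
exact: (connection_algebra hi hj dE ch (frame_change Ox) Ju Eu).
Qed.

Notation current_sq := (current_sq gamc (rform D)).
Notation planar := (planar (tgam gamc) tinv (tform (rform D))).


Let l_unit x : overlap x -> l x \in unitmx.
Proof.
move=> Ox; have [_ _ hb hc _] := overlapP Ox.
have u := spin_o_unit (lift_spin S hb hc).
have e : l x *m cre (invmx (Defs.lift S b c (param i x))) = 1%:M.
  by rewrite -creM mulmxV// -(cre_scalar _ 1) rmorph1.
by have [] := mulmx1_unit e.
Qed.

Let l_form x : overlap x -> (l x)^T *m rform D *m l x = rform D.
Proof. by move=> Ox; have [_ _ hb hc _] := overlapP Ox; exact: rform_spin (lift_spin S hb hc). Qed.

Let l_cl x k : overlap x -> l x *m gamc k = cl gamc (row k (A x)) *m l x.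
Proof.
move=> Ox; have [_ _ hb hc _] := overlapP Ox.
by rewrite rgam_cl -!creM lift_covers.
Qed.

Let l_clv x w : overlap x -> l x *m cl gamc w = cl gamc (w *m A x) *m l x.
Proof.
move=> Ox; rewrite cl_rows mulmx_suml /cl mulmx_sumr; apply: eq_bigr => k _.
by rewrite -scalemxAr -scalemxAl l_cl.
Qed.

Let l_smooth : smooth_on overlap l.
Proof.
have [hr hi] := lift_smooth S b c i.
have sub : overlap `<=` chart i @` (dom i `&` (fdom b `&` fdom c)).
  by move=> _ [p [dp [_ h]] <-]; exists p.
have r1 : smooth_on overlap (remx (Defs.lift S b c \o param i)) by move=> k; exact: (Ck_sub sub (hr k)).
have r2 : smooth_on overlap (immx (Defs.lift S b c \o param i)) by move=> k; exact: (Ck_sub sub (hi k)).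
apply/(smooth_mxP oO) => k m; rewrite -(splitK k) -(splitK m).
case: (fintype.split k) => k'; case: (fintype.split m) => m' /=.
- apply: (smooth_ext oO (f := fun x => remx (Defs.lift S b c \o param i) x k' m')).
    by move=> x _; rewrite /l /cre block_mxEul.
  exact: (smooth_mxP oO _).1.
- apply: (smooth_ext oO (f := fun x => (- immx (Defs.lift S b c \o param i) x) k' m')).
    by move=> x _; rewrite /l /cre block_mxEur.
  by apply: (smooth_mxP oO _).1; exact: smooth_opp.
- apply: (smooth_ext oO (f := fun x => immx (Defs.lift S b c \o param i) x k' m')).
    by move=> x _; rewrite /l /cre block_mxEdl.
  exact: (smooth_mxP oO _).1.
- apply: (smooth_ext oO (f := fun x => remx (Defs.lift S b c \o param i) x k' m')).
    by move=> x _; rewrite /l /cre block_mxEdr.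
  exact: (smooth_mxP oO _).1.
Qed.

Lemma lphi_change x : overlap x -> lphi phi b i x = l x *m lphi phi c j (F x).
Proof.
move=> Ox; have [_ _ hb hc _] := overlapP Ox.
by rewrite /lphi param_F// (scomp_compat phi hb hc) rvM.
Qed.

Lemma lphi_derive (b' : frame_idx o) (i' : chart_idx M) x v : patch b' i' x -> 'D_v (lphi phi b' i') x =
  cl gamc (v *m coframe (lmetric (g := g) i') (lframe b' i') x) *m lchi phi b' i' x
  - sp gamc (conn_dir (lmetric (g := g) i') (lframe b' i') x v) *m lphi phi b' i' x.
Proof.
move=> Px; rewrite (derive_sum_coord v (@patch_open _ _ _ _ o b' i') (@lphi_smooth _ _ _ _ _ _ _ phi b' i') Px).
rewrite cl_rows sp_conn_dir !mulmx_suml -sumrB; apply: eq_bigr => k _.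
rewrite (local_twistor_equation tw k Px) scalerBr; congr (_ - _); exact: scalemxAl.
Qed.

Let coframe_change x : overlap x ->
  J x *m coframe Gj Ej (F x) *m A x = coframe Gi Ei x.
Proof.
move=> Ox; have EGEi := @lframe_orthonormal _ _ _ g o b i; have EGEj := @lframe_orthonormal _ _ _ g o c j.
have h1 := frame_coframe EGEj (patch_j Ox); have h2 := frame_coframe EGEi (patch_i Ox).
move: h1 h2; rewrite -/Gj -/Gi -/Ei -/Ej frame_change//.
move: (coframe Gj Ej _) (coframe Gi Ei x) => tj ti; rewrite -mulmxA => /mulmx1C h1 h2.
by rewrite -[LHS]mulmx1 -h2 mulmxA -(mulmxA _ (A x)) h1 mul1mx.
Qed.

Let coframe_changev x v : overlap x ->
  v *m J x *m coframe Gj Ej (F x) *m A x = v *m coframe Gi Ei x.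
Proof.
move=> Ox; rewrite -(coframe_change Ox); move: (coframe Gj Ej (F x)) => T.
by rewrite !mulmxA.
Qed.

(** By [gauge_commute] and [gauge_difference] the two candidates for chi satisfy the hypotheses of
    [gauge_difference_zero], which needs the null current. *)
Lemma lchi_change x : overlap x -> current_sq (lphi phi b i x) = 0 ->
  lchi phi b i x = l x *m lchi phi c j (F x).
Proof.
move=> Ox f0; have Pi := patch_i Ox; have Pj := patch_j Ox.
have EGEi := @lframe_orthonormal _ _ _ g o b i.
have lli : l x *m invmx (l x) = 1%:M by rewrite mulmxV// l_unit.
apply/eqP; rewrite -subr_eq0; apply/eqP.
pose Z v := 'D_v l x *m invmx (l x) + sp gamc (omi v x) - l x *m sp gamc (omj (v *m J x) x) *m invmx (l x).
have ski v := conn_dir_skew (@patch_open _ _ _ _ o b i) (@lmetric_smooth _ _ _ g o b i)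
  (@lframe_smooth _ _ _ g o b i) (@lmetric_sym _ _ _ g o b i) EGEi v Pi.
have skj v := conn_dir_skew (@patch_open _ _ _ _ o c j) (@lmetric_smooth _ _ _ g o c j)
  (@lframe_smooth _ _ _ g o c j) (@lmetric_sym _ _ _ g o c j) (@lframe_orthonormal _ _ _ g o c j) v Pj.
have dl v := smooth_is_derive v l_smooth Ox; have dA v := smooth_is_derive v A_smooth Ox.
have Au : A x \in unitmx.
  have := frame_coframe (@lframe_orthonormal _ _ _ g o c j) Pj.
  by rewrite -/Ej frame_change// -!mulmxA => /mulmx1_unit[].
apply: (gauge_difference_zero (rgam_clifford D) (rform_gam D n3) (rform_pos D) n3
  (Z := fun y => Z (y *m Ei x)) (psi := lphi phi b i x)) => //.
- move=> y w; move: (y *m Ei x) => v.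
  (* Writing the vector as a constant row times [A] puts the covering relation into a form that can
     be differentiated. *)
  have -> : w = w *m invmx (A x) *m A x by rewrite mulmxKV.
  move: (w *m invmx (A x)) => {}w.
  apply: (gauge_commute (W' := cl gamc w) (dW := cl gamc (w *m 'D_v A x)) (Ui := cl gamc (w *m A x *m omi v x))
    (Uj := cl gamc (w *m omj (v *m J x) x)) (Uj' := cl gamc (w *m omj (v *m J x) x *m A x)) lli).
  + have h1 : 'D_v (fun z => l z *m cl gamc w) x = 'D_v l x *m cl gamc w.
      apply: (@derive_val _ _ _ _ _ _ _ _).
      apply: (is_derive_eq (is_derive_mulmx (dl v) (is_derive_cst (cl gamc w) x v))).
      by rewrite mulmx0 addr0.
    rewrite -h1; apply: (derive_on oO Ox (f := fun z => cl gamc (w *m A z) *m l z)).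
      by move=> z Oz; rewrite l_clv.
    have hw : is_derive x v (fun z => w *m A z) (w *m 'D_v A x).
      by apply: (is_derive_eq (is_derive_mulmx (is_derive_cst w x v) (dA v))); rewrite mul0mx add0r.
    exact: (is_derive_mulmx (is_derive_linmx (cl gamc) hw) (dl v)).
  + exact: l_clv.
  + exact: (sp_cl (rgam_clifford D) (w *m A x) (ski v)).
  + exact: (sp_cl (rgam_clifford D) w (skj _)).
  + exact: l_clv.
  + by rewrite -mulmxA connection_change// mulmxDr mulmxA; exact: linearD.
- move=> y; have yE : y = y *m Ei x *m coframe Gi Ei x.
    by rewrite -mulmxA (frame_coframe EGEi Pi) mulmx1.
  rewrite {2}yE; move: (y *m Ei x) => v.
  apply: (gauge_difference lli (lphi_change Ox) (dj := 'D_(v *m J x) (lphi phi c j) (F x)) _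
    (lphi_derive v Pi) (lphi_derive (v *m J x) Pj)).
    apply: (derive_on oO Ox (f := fun z => l z *m lphi phi c j (F z))).
      by move=> z Oz; rewrite -lphi_change.
    exact: (is_derive_mulmx (dl v) (is_derive_j v Ox (@lphi_smooth _ _ _ _ _ _ _ phi c j))).
  by rewrite l_clv// (coframe_changev v Ox).
Qed.

Lemma clif_phi_change x v : overlap x ->
  cl gamc (v *m coframe Gi Ei x) *m lphi phi b i x =
  l x *m (cl gamc (v *m J x *m coframe Gj Ej (F x)) *m lphi phi c j (F x)).
Proof.
move=> Ox; rewrite mulmxA l_clv// -mulmxA -lphi_change//.
by rewrite (coframe_changev v Ox).
Qed.

Let A_unit x : overlap x -> A x \in unitmx.
Proof.
move=> Ox; have := frame_coframe (@lframe_orthonormal _ _ _ g o c j) (patch_j Ox).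
by rewrite -/Ej frame_change// -!mulmxA => /mulmx1_unit[].
Qed.

(** A null current annihilates its spinor. The transition carries it to a non-zero vector
    annihilating the transformed spinor, and [annihilator] gives the claim. *)
Lemma current_null_change x : overlap x ->
  current_sq (lphi phi c j (F x)) = 0 -> current_sq (lphi phi b i x) = 0.
Proof.
move=> Ox; rewrite (lphi_change Ox); move: (lphi phi c j (F x)) => psi f0.
case: (eqVneq psi 0) => [->|psi0].
  by rewrite mulmx0 -[0](scale0r 0) current_sqZ ?expr0n ?mul0r//; exact: rform_sym.
pose y := current gamc (rform D) psi.
have y0 : y != 0 by exact: (current_neq0 (rform_pos D) n3 psi0).
have yA : y *m A x != 0.
  by apply: contra_neq y0 => h; rewrite -(mulmxK (A_unit Ox) y) h mul0mx.
have lpsi : l x *m psi != 0.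
  by apply: contra_neq psi0 => h; rewrite -(mulKmx (l_unit Ox) psi) h mulmx0.
have ann : cl gamc (y *m A x) *m (l x *m psi) = 0.
  rewrite mulmxA -l_clv// -mulmxA (current_annihilates (rgam_clifford D) (rform_gam D n3) (rform_pos D) n3 f0).
  by rewrite mulmx0.
by have [] := annihilator (rgam_clifford D) (@rform_sym _ _ D) (rform_gam D n3) (rform_pos D) n3 ann yA lpsi.
Qed.

Lemma planar_change x : overlap x ->
  (forall B, planar B (col_mx (lphi phi c j (F x)) (lchi phi c j (F x))) = 0) ->
  forall B, planar B (col_mx (lphi phi b i x) (lchi phi b i x)) = 0.
Proof.
move=> Ox h; have [di dj hb hc _] := overlapP Ox.
have f0 : current_sq (lphi phi b i x) = 0.
  apply: (current_null_change Ox).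
  exact: (planar_null (h _)).
rewrite (lchi_change Ox f0) (lphi_change Ox).
(* The covering relation has [l] on the left of the generator; solved for the generator on the left,
   it involves the inverse matrix. *)
apply: (planar_lift (a := invmx (A x))) h.
- move=> k; rewrite l_clv// -row_mul mulVmx ?A_unit// rowE mulmx1 cl_delta//.
- exact: l_form.
- have [AeA _ _] := frame_trans_SOo hb hc; rewrite -/(A x) in AeA.
  have Au := A_unit Ox.
  have iA : invmx (A x) = eta *m (A x)^T *m eta.
    apply: (can_inj (mulKmx Au)); rewrite mulmxV// !mulmxA AeA eta_unit.
    reflexivity.
  rewrite iA !trmx_mul trmxK !eta_trmx -!mulmxA (mulmxA eta eta) eta_unit mul1mx.
  have -> : A x *m (eta *m ((A x)^T *m eta)) = 1%:M by rewrite !mulmxA AeA eta_unit.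
  by rewrite mulmx1.
Qed.

Lemma geodesic_transition (x v : R -> 'rV[R]_n) s : overlap (x s) ->
  is_derive s (1 : R) x (v s) -> is_derive s (1 : R) v (- (v s *m chri (v s) (x s))) ->
  is_derive s (1 : R) (fun t => F (x t)) (v s *m J (x s)) /\
  is_derive s (1 : R) (fun t => v t *m J (x t))
    (- (v s *m J (x s) *m chrj (v s *m J (x s)) (x s))).
Proof.
move=> Ox dx dv; split; first by rewrite (jac (v s) Ox); exact: (is_derive_comp oO (F_smooth 1%N) Ox dx).
apply: (is_derive_eq (is_derive_mulmx dv (is_derive_comp oO (J_smooth 1%N) Ox dx))).
exact: transition_algebra (christoffel_change (v s) Ox).
Qed.
End ChangeOfPatch.

(** * Curves and the regularity of geodesics *)

Section RealCurves.
Context {R : realType} {V : normedModType R}.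

Lemma is_derive_derive1 (f : R -> V) t d : is_derive t (1 : R) f d -> derive1 f t = d.
Proof. by move=> h; rewrite derive1E; exact: (@derive_val _ _ _ _ _ _ _ h). Qed.

Lemma near_radius (t eps s : R) (P : R -> Prop) : `|s - t| < eps ->
  (forall r, `|r - t| < eps -> P r) -> \near s, P s.
Proof.
move=> h H; apply/nbhs_ballP; exists (eps - `|s - t|); first by rewrite /= subr_gt0.
move=> r; rewrite -ball_normE/= distrC => hr; apply: H.
rewrite -(subrK s r) -addrA; apply: le_lt_trans (ler_normD _ _) _.
by rewrite -ltrBrDr.
Qed.

Lemma nbhs_radius (t : R) (P : R -> Prop) : (\near t, P t) ->
  exists2 e : R, 0 < e & forall s, `|s - t| < e -> P s.
Proof.
move=> /nbhs_ballP[e /= e0 H]; exists e => // s hs; apply: H.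
by rewrite -ball_normE/= distrC.
Qed.

Lemma is_derive_any (f : R -> V) t d (w : R) : is_derive t (1 : R) f d ->
  is_derive t w f (w *: d).
Proof.
move=> h; have df : derivable f t 1 by exact: (@ex_derive _ _ _ _ _ _ _ h).
have dd : differentiable f t by apply/derivable1_diffP.
apply: DeriveDef; first exact: diff_derivable.
rewrite deriveE//; have -> : w = w *: (1 : R) by rewrite /GRing.scale/= mulr1.
by rewrite linearZ/= -deriveE// (@derive_val _ _ _ _ _ _ _ h) /GRing.scale/= mulr1.
Qed.

Lemma Ck_curve (k : nat) (B : set R^o) (f df : R -> V) : open B ->
  (forall t, B t -> is_derive t (1 : R) f (df t)) ->
  (forall t, B t -> {for t, continuous f}) -> (forall w : R, Ck k B (fun t => w *: df t)) ->
  Ck k.+1 B f.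
Proof.
move=> oB hd hc hk; split=> // w; split.
  by move=> t Bt; exact: (@ex_derive _ _ _ _ _ _ _ (is_derive_any w (hd t Bt))).
apply: (Ck_ext (f := fun t => w *: df t) oB) => // t Bt.
by apply: esym; exact: (@derive_val _ _ _ _ _ _ _ (is_derive_any w (hd t Bt))).
Qed.

End RealCurves.

Lemma curve_near (R : realType) p q (f : R -> 'M[R]_(p, q)) t d (e : R) :
  is_derive t (1 : R) f d -> 0 < e ->
  exists2 r : R, 0 < r & forall s, `|s - t| < r -> `|f t - f s| < e.
Proof.
move=> h e0; apply: nbhs_radius.
by have /(cvgrPdist_lt (FF := nbhs_filter t))/(_ _ e0) := is_derive_mx_continuous h.
Qed.

Lemma norm_close (R : realType) (V : normedModType R) (a b : V) (k : R) :
  `|a - b| < 1 -> `|a| + 1 <= k -> `|b| <= k.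
Proof.
move=> h hk; rewrite -(subKr a b); apply: le_trans (ler_normB _ _) _.
by apply: le_trans hk; rewrite lerD2l ltW.
Qed.

Lemma oitv_locally_constant (R : realType) (a b : \bar R) (P : R -> Prop) :
  (forall t, oitv a b t -> exists2 r : R, 0 < r & forall y z, `|y - t| < r -> `|z - t| < r ->
     oitv a b y -> oitv a b z -> P y -> P z) ->
  forall t t', oitv a b t -> oitv a b t' -> P t -> P t'.
Proof.
move=> H; apply: connected_locally_constant; first exact: oitv_connected.
move=> t /H[r r0 Hr]; exists [set s | `|s - t| < r].
  by apply/nbhs_ballP; exists r => // s; rewrite -ball_normE/= distrC.
by move=> y z oy oz hy hz; exact: Hr.
Qed.

Section GeodesicSmoothness.
Context {R : realType} {n : nat}.
Variables (O : set 'rV[R]_n) (ch : 'I_n -> 'rV[R]_n -> 'M[R]_n).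
Hypothesis oO : open O.
Hypothesis chs : forall i, smooth_on O (ch i).
Variables (B : set R^o) (x v : R -> 'rV[R]_n).
Hypothesis oB : open B.
Hypothesis hx : forall t, B t -> O (x t) /\ is_derive t (1 : R) x (v t).
Hypothesis hv : forall t, B t ->
  is_derive t (1 : R) v (- (v t *m \sum_i v t 0 i *: ch i (x t))).

(** Bootstrapping: if [x] and [v] are of class C^k, so are the right-hand sides of their
    equations. *)
Lemma geodesic_smooth : smooth_on B x.
Proof.
suff h k : Ck k B x /\ Ck k B v by move=> k; exact: (h k).1.
have cx t : B t -> {for t, continuous x} by move=> Bt; exact: is_derive_mx_continuous (hx Bt).2.
have cv t : B t -> {for t, continuous v} by move=> Bt; exact: is_derive_mx_continuous (hv Bt).
elim: k => [|k [IHx IHv]]; first by split; split.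
have IHc i : Ck k B (fun t => ch i (x t)).
  by apply: (Ck_comp oB oO _ IHx (chs i k)) => t Bt; exact: (hx Bt).1.
split.
  apply: (Ck_curve (df := v) oB) => //; first by move=> t Bt; exact: (hx Bt).2.
  by move=> w; apply: (Ck_scaler oB _ IHv); exact: Ck_cst.
apply: (Ck_curve (df := fun t => - (v t *m \sum_i v t 0 i *: ch i (x t))) oB) => //.
move=> w; apply: (Ck_ext (f := fun t => (- w) *: (v t *m \sum_i v t 0 i *: ch i (x t))) oB).
  by move=> t _; rewrite scaleNr scalerN.
apply: (Ck_scaler oB (Ck_cst k _ oB)); apply: (Ck_mulmx oB IHv).
apply: (Ck_sum _ _ oB) => i; apply: (Ck_scaler oB _ (IHc i)).
exact: (Ck_mxP k _ oB).1.
Qed.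

End GeodesicSmoothness.

(** * Geodesics *)

Section GeodesicsOnManifold.
Context {R : realType} {n : nat} {M : smooth_manifold R n}.
Context {g : lorentz_metric M} {o : orientation g} {D : spinor_module R n}.
Context {S : spin_structure o D}.
Variable phi : spinor_field S.
Hypothesis n3 : (3 <= n)%N.
Hypothesis tw : conformal_killing phi.
Notation gamc := (rgam D).
Notation PS := (patch_system n3 tw).
Implicit Types (b : frame_idx o) (i j : chart_idx M) (c : R -> M).

Definition patch_geodesic b i c (v : R -> 'rV[R]_n) (t eps : R) := 0 < eps /\
  forall s, `|s - t| < eps -> [/\ {for s, continuous c}, dom i (c s), fdom b (c s) &
    geodesic_pair (PS b i) (chart i \o c) v s].

(** One patch suffices here, because [patch_geodesic_change] moves the first-order equations to any
    other patch around the point. *)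
Definition geodesic_at c t := exists b i v eps, patch_geodesic b i c v t eps.

Lemma near_open c t (U : set M) : {for t, continuous c} -> open U -> U (c t) ->
  exists2 e : R, 0 < e & forall s, `|s - t| < e -> U (c s).
Proof. by move=> hc oU Ut; apply: nbhs_radius; exact: hc (open_nbhs_nbhs (conj oU Ut)). Qed.

Lemma patch_geodesic_change b i c t b' j : dom j (c t) -> fdom b' (c t) ->
  (exists v eps, patch_geodesic b i c v t eps) -> exists v eps, patch_geodesic b' j c v t eps.
Proof.
move=> dj hb' [v [eps [e0 H]]].
have [hc _ _ _] : [/\ {for t, continuous c}, dom i (c t), fdom b (c t) &
    geodesic_pair (PS b i) (chart i \o c) v t] by apply: H; rewrite subrr normr0.
have [e1 e10 H1] := near_open hc (@dom_open R n M j) dj.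
have [e2 e20 H2] := near_open hc (fdom_open b') hb'.
exists (fun s => v s *m chart_jac i j (c s)), (Num.min eps (Num.min e1 e2)).
have H3 s : `|s - t| < Num.min eps (Num.min e1 e2) ->
    [/\ {for s, continuous c}, overlap b b' i j (chart i (c s)), dom i (c s), dom j (c s) &
     fdom b' (c s) /\ geodesic_pair (PS b i) (chart i \o c) v s].
  rewrite !lt_min => /and3P[/H[h1 h2 h3 h4] /H1 h5 /H2 h6]; split=> //.
  by exists (c s).
split; first by rewrite !lt_min e0 e10 e20.
move=> s hs; have [cs Os di dj' [b's gs]] := H3 s hs; split=> //.
case: gs => _ dx dv; have [d1 d2] := geodesic_transition Os dx dv.
have pc : param i (chart i (c s)) = c s by rewrite chartK.
have eqx : \near s, (chart j \o param i) (chart i (c s)) = (chart j \o c) s.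
  by apply: (near_radius hs) => r /H3[_ _ di' _ _]; rewrite /= chartK.
have eqv : \near s, v s *m chart_jac i j (param i (chart i (c s))) = v s *m chart_jac i j (c s).
  by apply: (near_radius hs) => r /H3[_ _ di' _ _]; rewrite chartK.
split; first exact: patch_chart.
- by move: (is_derive_ext eqx d1); rewrite /= pc.
- by move: (is_derive_ext eqv d2); rewrite /= pc.
Qed.

Lemma geodesic_at_patch c t b i : geodesic_at c t -> dom i (c t) -> fdom b (c t) ->
  exists v eps, patch_geodesic b i c v t eps.
Proof. move=> [b' [j [v [eps h]]]] di hb.
exact: (patch_geodesic_change di hb (ex_intro _ v (ex_intro _ eps h))). Qed.

Lemma geodesic_at_continuous c t : geodesic_at c t -> {for t, continuous c}.
Proof. by move=> [b [i [v [eps [e0 h]]]]]; case: (h t _) => //; rewrite subrr normr0. Qed.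

Lemma oitv_radius (a b : \bar R) t : oitv a b t -> exists2 e : R, 0 < e & forall s, `|s - t| < e -> oitv a b s.
Proof.
move=> h; apply: nbhs_radius; exact: (open_nbhs_nbhs (conj (@oitv_open R a b) h)).
Qed.

Lemma geodesic_of_local (a b : \bar R) c : (forall t, oitv a b t -> geodesic_at c t) ->
  geodesic g a b c.
Proof.
move=> H; split=> [t /H|i]; first exact: geodesic_at_continuous.
have cov (t : R) : oitv a b t /\ dom i (c t) -> exists b' v (e : R), [/\ 0 < e,
    patch_geodesic b' i c v t e & forall s, `|s - t| < e -> oitv a b s].
  case=> ht di; have [b' hb] := fdom_cover o (c t).
  have [v [eps [e0 h]]] := geodesic_at_patch (H t ht) di hb.
  have [e1 e10 h1] := oitv_radius ht.
  exists b', v, (Num.min eps e1); split; first by rewrite lt_min e0.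
    by split=> [|s]; rewrite lt_min ?e0// => /andP[/h].
  by move=> s; rewrite lt_min => /andP[_ /h1].
split.
  move=> k; apply: Ck_local => t Jt; have [b' [v [e [e0 [_ h] he]]]] := cov t Jt.
  exists [set s : R^o | `|s - t| < e]; split.
  - rewrite (_ : [set s : R^o | _] = ball t e); last by apply/seteqP; split=> s; rewrite -ball_normE/= distrC.
    exact: ball_open.
  - by rewrite /= subrr normr0.
  have oB : open [set s : R^o | `|s - t| < e].
    rewrite (_ : [set s : R^o | _] = ball t e); last by apply/seteqP; split=> s; rewrite -ball_normE/= distrC.
    exact: ball_open.
  apply: (geodesic_smooth (@patch_open _ _ _ _ o b' i) (ch := chr (lmetric (g := g) i) (lframe b' i)) _ oB (v := v)).
  - exact: (smooth_chr (@patch_open _ _ _ _ o b' i) (@lmetric_smooth _ _ _ g o b' i) (@lframe_smooth _ _ _ g o b' i)).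
  - by move=> s /h[_ _ _ []].
  - by move=> s /h[_ _ _ []].
move=> t Jt; have [b' [v [e [e0 [_ h] he]]]] := cov t Jt.
have tt : `|t - t| < e by rewrite subrr normr0.
have [_ di hb [_ dx dv]] := h t tt.
have vE s : `|s - t| < e -> derive1 (chart i \o c) s = v s.
  by move=> /h[_ _ _ [_ d _]]; exact: is_derive_derive1 d.
have -> : derive1n 2 (chart i \o c) t = - (v t *m chr_dir (lmetric (g := g) i) (lframe b' i) (chart i (c t)) (v t)).
  apply: is_derive_derive1; apply: is_derive_ext dv.
  by apply: (near_radius tt) => s hs; rewrite vE.
by rewrite !vE// (christoffel_chr _ _ di hb) addNr.
Qed.

Lemma geodesic_in_patch (a b : \bar R) c t b' i : geodesic g a b c -> oitv a b t ->
  dom i (c t) -> fdom b' (c t) ->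
  exists2 eps : R, patch_geodesic b' i c (derive1 (chart i \o c)) t eps &
    forall s, `|s - t| < eps -> oitv a b s.
Proof.
move=> [hc hg] ht di hb.
have [e1 e10 h1] := oitv_radius ht.
have [e2 e20 h2] := near_open (hc t ht) (@dom_open R n M i) di.
have [e3 e30 h3] := near_open (hc t ht) (fdom_open b') hb.
exists (Num.min e1 (Num.min e2 e3)); last by move=> s; rewrite lt_min => /andP[/h1].
split; first by rewrite !lt_min e10 e20.
move=> s; rewrite !lt_min => /and3P[/h1 os /h2 ds /h3 bs].
have [sm eq] := hg i; have Js : oitv a b s /\ dom i (c s) by [].
have d1 (r : R) : oitv a b r /\ dom i (c r) -> is_derive r (1 : R) (chart i \o c) (derive1 (chart i \o c) r).
  by move=> Jr; rewrite derive1E; exact: (@Ck_is_derive R R^o _ 0 _ _ r (1 : R) (sm 1%N) Jr).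
split; [exact: hc|exact: ds|exact: bs|].
split; [exact: patch_chart|exact: d1|].
have oJ : open ([set t | oitv a b t /\ dom i (c t)] : set R^o).
  rewrite openE => r [or dr]; have [e1' e10' h1'] := oitv_radius or.
  have [e2' e20' h2'] := near_open (hc r or) (@dom_open R n M i) dr.
  apply/nbhs_ballP; exists (Num.min e1' e2'); first by rewrite /= lt_min e10'.
  by move=> q; rewrite -ball_normE/= distrC lt_min => /andP[/h1' ? /h2' ?].
have d2 : Ck 1 ([set t | oitv a b t /\ dom i (c t)] : set R^o) (derive1 (chart i \o c)).
  apply: (Ck_ext (f := fun r : R^o => 'D_(1 : R) (chart i \o c) r) oJ) => [r _|]; first by rewrite derive1E.
  exact: (@Ck_derive R R^o _ 1 _ _ (1 : R) (sm 2%N)).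
apply: (is_derive_eq (@Ck_is_derive R R^o _ 0 _ _ s (1 : R) d2 Js)); rewrite -derive1E.
have := eq s Js; rewrite (christoffel_chr _ _ ds bs) => /eqP; rewrite addr_eq0 => /eqP <-.
by [].
Qed.

Lemma geodesic_local (a b : \bar R) c t : geodesic g a b c -> oitv a b t -> geodesic_at c t.
Proof.
move=> hg ht; have [i di] := dom_cover (c t); have [b' hb] := fdom_cover o (c t).
by have [eps h _] := geodesic_in_patch hg ht di hb; exists b', i, (derive1 (chart i \o c)), eps.
Qed.

Lemma velocity_change (a b : \bar R) c t i j : geodesic g a b c -> oitv a b t ->
  dom i (c t) -> dom j (c t) ->
  derive1 (chart j \o c) t = derive1 (chart i \o c) t *m chart_jac i j (c t).
Proof.
move=> hg ht di dj; have [b' hb] := fdom_cover o (c t).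
have [e [e0 H] _] := geodesic_in_patch hg ht di hb.
have [_ _ _ [_ dx dv]] := H t (ltac:(by rewrite subrr normr0)).
have Ot : overlap b' b' i j (chart i (c t)) by exists (c t).
have [d1 _] := geodesic_transition Ot dx dv.
have [e2 e20 H2] := near_open (hg.1 t ht) (@dom_open R n M i) di.
have eqx : \near t, (chart j \o param i) (chart i (c t)) = (chart j \o c) t.
  by apply: (@near_radius _ t e2) => [|r /H2 dr]; [rewrite subrr normr0|rewrite /= chartK].
by rewrite (is_derive_derive1 (is_derive_ext eqx d1)) chartK.
Qed.

Lemma ip_change i j (p : M) v w : dom i p -> dom j p ->
  ip g i p v w = ip g j p (v *m chart_jac i j p) (w *m chart_jac i j p).
Proof. by move=> di dj; rewrite /ip (metric_compat g di dj) trmx_mul !mulmxA. Qed.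

(* Equality of two geodesics is an open and closed condition; the Hausdorff
   property excludes branching. *)
Lemma geodesic_unique (a b a1 b1 a2 b2 : \bar R) c1 c2 t0 t i :
  geodesic g a1 b1 c1 -> geodesic g a2 b2 c2 ->
  (forall t, oitv a b t -> oitv a1 b1 t /\ oitv a2 b2 t) ->
  oitv a b t0 -> oitv a b t -> dom i (c1 t0) -> c1 t0 = c2 t0 ->
  derive1 (chart i \o c1) t0 = derive1 (chart i \o c2) t0 ->
  c1 t = c2 t.
Proof.
move=> g1 g2 sub ht0 ht di0 e0 v0.
have loc s j : oitv a b s -> dom j (c1 s) -> c1 s = c2 s ->
  exists2 r : R, 0 < r & forall s1 s2, `|s1 - s| < r -> `|s2 - s| < r ->
    c1 s1 = c2 s1 -> derive1 (chart j \o c1) s1 = derive1 (chart j \o c2) s1 -> c1 s2 = c2 s2.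
  move=> hs dj es; have [ok1 ok2] := sub s hs; have [b' hb] := fdom_cover o (c1 s).
  have dj2 : dom j (c2 s) by rewrite -es.
  have hb2 : fdom b' (c2 s) by rewrite -es.
  have [r1 [r10 H1] _] := geodesic_in_patch g1 ok1 dj hb.
  have [r2 [r20 H2] _] := geodesic_in_patch g2 ok2 dj2 hb2.
  pose x1 := chart j \o c1; pose x2 := chart j \o c2.
  have ss : `|s - s| < r1 by rewrite subrr normr0.
  have ss2 : `|s - s| < r2 by rewrite subrr normr0.
  have [_ _ _ [dom1 dx1 dv1]] := H1 s ss; have [_ _ _ [_ dx2 dv2]] := H2 s ss2.
  pose rho := `|derive1 x1 s| + `|derive1 x2 s| + 1.
  have rho0 : 0 <= rho by rewrite !addr_ge0.
  have [r3 [K [r30 K0 L]]] := spray_lipschitz dom1 rho0.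
  have [q1 q10 Q1] := curve_near dx1 r30.
  have [q2 q20 Q2] := curve_near dx2 r30.
  have [q3 q30 Q3] := curve_near dv1 ltr01.
  have [q4 q40 Q4] := curve_near dv2 ltr01.
  pose r := Num.min (Num.min r1 r2) (Num.min (Num.min q1 q2) (Num.min q3 q4)).
  have r0 : 0 < r by rewrite !lt_min r10 r20 q10 q20 q30 q40.
  have B s1 : `|s1 - s| < r -> [/\ geodesic_pair (PS b' j) x1 (derive1 x1) s1,
      geodesic_pair (PS b' j) x2 (derive1 x2) s1, dom j (c1 s1) /\ dom j (c2 s1) &
      [/\ `|x1 s1 - chart j (c1 s)| <= r3, `|x2 s1 - chart j (c1 s)| <= r3,
        `|derive1 x1 s1| <= rho & `|derive1 x2 s1| <= rho] ].
    rewrite !lt_min => /andP[/andP[h1 h2] /andP[/andP[h3 h4] /andP[h5 h6]]].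
    have [_ a1' _ a2'] := H1 s1 h1; have [_ a3' _ a4'] := H2 s1 h2.
    split; [exact: a2'|exact: a4'|by split|split].
    - by rewrite distrC ltW// Q1.
    - by rewrite es distrC ltW// Q2.
    - by apply: (norm_close (Q3 s1 h5)); rewrite -[leRHS]addrA lerD2l lerDr.
    - by apply: (norm_close (Q4 s1 h6)); rewrite -[leRHS]addrA lerDr.
  have [r' /andP[r'0 r'r] Z] : exists2 r' : R, 0 < r' <= r & forall s1 s2, `|s1 - s| < r' -> `|s2 - s| < r' ->
      x1 s1 - x2 s1 = 0 -> derive1 x1 s1 - derive1 x2 s1 = 0 ->
      x1 s2 - x2 s2 = 0 /\ derive1 x1 s2 - derive1 x2 s2 = 0.
    apply: (linear_ineq_zero (u := fun s => x1 s - x2 s) (w := fun s => derive1 x1 s - derive1 x2 s)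
      (du := fun s => derive1 x1 s - derive1 x2 s)
      (dw := fun s => spray (PS b' j) (x1 s) (derive1 x1 s) - spray (PS b' j) (x2 s) (derive1 x2 s))
      (K := K + 1) _ r0).
    - by rewrite addr_ge0.
    - move=> s1 hs1; have [[_ p1 p2] [_ p3 p4] _ _] := B s1 hs1.
      by split; exact: is_derive_subf.
    - move=> s1 hs1; have [_ _ _ [p1 p2 p3 p4]] := B s1 hs1; split.
        by rewrite mulrDl mul1r -[leLHS]add0r lerD ?mulr_ge0 ?addr_ge0// lerDr.
      apply: le_trans (L _ _ _ _ p1 p2 p3 p4) _.
      by rewrite ler_wpM2r ?addr_ge0// lerDl.
  exists r' => // s1 s2 hs1 hs2 ce ve.
  have [E _] : x1 s2 - x2 s2 = 0 /\ derive1 x1 s2 - derive1 x2 s2 = 0.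
    by apply: (Z s1 s2 hs1 hs2); [rewrite /x1 /x2 /= ce subrr|rewrite ve subrr].
  have [_ _ [d1 d2] _] := B s2 (lt_le_trans hs2 r'r).
  by rewrite -(chartK d1) -(chartK d2); congr (param j _); apply/eqP; rewrite -subr_eq0; apply/eqP.
(* Equality on a neighbourhood also contains the equality of velocities, so the local uniqueness can
   be restarted from any nearby time. *)
pose P (s : R) := \near s, c1 s = c2 s.
have start : P t0.
  have [r r0 H] := loc t0 i ht0 di0 e0.
  have t00 : `|t0 - t0| < r by rewrite subrr normr0.
  by apply: (near_radius t00) => s hs; exact: (H t0).
suff : P t by move=> /nbhs_singleton.
apply: (oitv_locally_constant _ ht0 ht start) => s hs.
have [ok1 ok2] := sub s hs.
have [es|ne] := pselect (c1 s = c2 s).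
  have [j dj] := dom_cover (c1 s); have [r r0 H] := loc s j hs dj es.
  have [r2 r20 H2] := near_open (g1.1 s ok1) (@dom_open R n M j) dj.
  exists (Num.min r r2); first by rewrite lt_min r0.
  move=> y z + + oy oz; rewrite lt_min => /andP[hy _]; rewrite lt_min => /andP[hz _] Py.
  apply: (near_radius hz) => z' hz'; apply: (H y z' hy hz'); first exact: nbhs_singleton Py.
  rewrite !derive1E; apply: near_eq_derive.
  by apply: filterS Py => w /= ->.
have ne' : c1 s != c2 s by apply/eqP.
have := @manifold_hausdorff R n M; rewrite open_hausdorff => /(_ _ _ ne')[[A B] /= [/set_mem Ac1 /set_mem Bc2] [oA oB /eqP AB]].
have [r r0 H1] := near_open (g1.1 s ok1) oA Ac1; have [r2 r20 H2] := near_open (g2.1 s ok2) oB Bc2.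
exists (Num.min r r2); first by rewrite lt_min r0.
move=> y z + _ _ _ /nbhs_singleton e; rewrite lt_min => /andP[/H1 Ay /H2 By].
have : (A `&` B) (c1 y) by split; [exact: Ay|rewrite e].
by rewrite AB.
Qed.

Notation current_sq := (current_sq gamc (rform D)).
Notation velocity c i t := (derive1 (chart i \o c) t).

Lemma zero_setP b i p : dom i p -> fdom b p -> zero_set phi p <-> lphi phi b i (chart i p) = 0.
Proof.
move=> di hb; rewrite /lphi chartK// rv_eq0; split=> [/(_ b hb)//|h b' hb'].
by rewrite (scomp_compat phi hb' hb) h mulmx0.
Qed.

Lemma vel_ip b i c (v : R -> 'rV[R]_n) t : dom i (c t) -> fdom b (c t) ->
  ip g i (c t) (v t) (v t) = mink (vel (PS b i) (chart i \o c) v t) (vel (PS b i) (chart i \o c) v t).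
Proof. by move=> di hb; exact: ip_mink. Qed.

Lemma vel_eq0 b i c (v : R -> 'rV[R]_n) t : dom i (c t) -> fdom b (c t) ->
  vel (PS b i) (chart i \o c) v t = 0 <-> v t = 0.
Proof.
move=> di hb; rewrite /vel; split=> [h|->]; last by rewrite mul0mx.
have := @ts_inv _ _ _ _ (PS b i) (chart i (c t)) (patch_chart di hb) => e.
by rewrite -[v t]mulmx1 -e mulmxA h mul0mx.
Qed.

Definition null_velocity c t := exists i, [/\ dom i (c t), velocity c i t != 0 &
  ip g i (c t) (velocity c i t) (velocity c i t) = 0].

Lemma null_velocity_chart (a b : \bar R) c t i : geodesic g a b c -> oitv a b t -> null_velocity c t ->
  dom i (c t) -> velocity c i t != 0 /\ ip g i (c t) (velocity c i t) (velocity c i t) = 0.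
Proof.
move=> hg ht [j [dj nz nul]] di; have e := velocity_change hg ht di dj; split.
  by apply: contra_neq nz => h; rewrite e h mul0mx.
by rewrite (ip_change _ _ di dj) -e.
Qed.

Lemma null_geodesic_of (a b : \bar R) c t : geodesic g a b c -> oitv a b t -> null_velocity c t ->
  null_geodesic g a b c.
Proof.
move=> hg ht nt; split=> // i s hs di; apply: (null_velocity_chart hg hs) di.
apply: (oitv_locally_constant _ ht hs nt) => {i}r hr.
have [i di] := dom_cover (c r); have [b' hb] := fdom_cover o (c r).
have [e [e0 H] _] := geodesic_in_patch hg hr di hb.
have [d /andP[d0 de] Z] := geodesic_zero (rgam_clifford D) e0 (fun s hs => let: And4 _ _ _ p := H s hs in p).
exists d; first exact: d0.
  move=> y z hy hz oy oz ny.
have [_ dy by' _] := H y (lt_le_trans hy de); have [_ dz bz _] := H z (lt_le_trans hz de).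
have [nz nul] := null_velocity_chart hg oy ny dy.
have [Z1 _ _ _] := Z z y hz hy; have [_ Z2 _ _] := Z y z hy hz.
exists i; split; first exact: dz.
  by apply: contra_neq nz => /(vel_eq0 (derive1 (chart i \o c)) dz bz) /Z1 /(vel_eq0 (derive1 (chart i \o c)) dy by').
by rewrite (vel_ip (derive1 (chart i \o c)) dz bz) -Z2 -(vel_ip (derive1 (chart i \o c)) dy by').
Qed.

Definition clif_vanishes c t := forall b i, dom i (c t) -> fdom b (c t) ->
  cl gamc (vel (PS b i) (chart i \o c) (derive1 (chart i \o c)) t) *m lphi phi b i (chart i (c t)) = 0.

Lemma clif_vanishes_patch (a' b' : \bar R) c t b i : geodesic g a' b' c -> oitv a' b' t ->
  dom i (c t) -> fdom b (c t) ->
  cl gamc (vel (PS b i) (chart i \o c) (derive1 (chart i \o c)) t) *m lphi phi b i (chart i (c t)) = 0 ->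
  clif_vanishes c t.
Proof.
move=> hg ht di hb h b2 j dj hb2.
have Ot : overlap b2 b j i (chart j (c t)) by exists (c t).
have := clif_phi_change phi (derive1 (chart j \o c) t) Ot.
rewrite /= chartK// -(velocity_change hg ht dj di).
by rewrite -[X in _ = _ *m X]/(cl gamc (vel (PS b i) (chart i \o c) (derive1 (chart i \o c)) t) *m _) h mulmx0.
Qed.

(* The Dirac current stays proportional to the velocity of a null geodesic
   issuing from a zero. *)
Lemma null_geodesic_singular (a b : \bar R) c t : null_geodesic g a b c ->
  oitv a b 0 -> zero_set phi (c 0) -> oitv a b t -> forall b' i, dom i (c t) -> fdom b' (c t) ->
  current_sq (lphi phi b' i (chart i (c t))) = 0.
Proof.
move=> [hg nul] h0 z0 ht b' i di hb.
have start : clif_vanishes c 0.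
  by move=> b2 j dj hb2; rewrite ((zero_setP dj hb2).1 z0) mulmx0.
have van : clif_vanishes c t.
  apply: (oitv_locally_constant _ h0 ht start) => {di hb}r hr.
  have [j dj] := dom_cover (c r); have [b2 hb2] := fdom_cover o (c r).
  have [e [e0 H] _] := geodesic_in_patch hg hr dj hb2.
  have [d /andP[d0 de] Z] := geodesic_zero (rgam_clifford D) e0 (fun s hs => let: And4 _ _ _ p := H s hs in p).
  exists d; first exact: d0.
  move=> y z hy hz oy oz vy.
  have [_ dy by' _] := H y (lt_le_trans hy de); have [_ dz bz _] := H z (lt_le_trans hz de).
  have [_ _ Z3 _] := Z y z hy hz.
  apply: (clif_vanishes_patch hg oz dz bz); apply: Z3; last exact: vy.
  by rewrite -(vel_ip (derive1 (chart j \o c)) dj hb2) (nul j r hr dj).2.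
case: (eqVneq (lphi phi b' i (chart i (c t))) 0) => [->|nz].
  by rewrite -[0](scale0r 0) current_sqZ ?expr0n ?mul0r//; exact: rform_sym.
have vn : vel (PS b' i) (chart i \o c) (derive1 (chart i \o c)) t != 0.
  apply/eqP => /(vel_eq0 (derive1 (chart i \o c)) di hb) h.
  by have := (nul i t ht di).1; rewrite h eqxx.
by have [] := annihilator (rgam_clifford D) (@rform_sym _ _ D) (rform_gam D n3) (rform_pos D) n3 (van b' i di hb) vn nz.
Qed.

(** Where phi vanishes on an interval of times, its derivative shows that gamma'.chi = 0 as well. So
    both initial values of the linear system are 0 and the vanishing continues. *)
Lemma zero_along_geodesic (a b : \bar R) c t : geodesic g a b c -> oitv a b 0 ->
  (\forall s \near (0 : R), zero_set phi (c s)) -> oitv a b t -> zero_set phi (c t).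
Proof.
move=> hg h0 z0 ht; pose P (s : R) := \near s, zero_set phi (c s).
suff : P t by exact: nbhs_singleton.
apply: (oitv_locally_constant _ h0 ht z0) => r hr.
have [j dj] := dom_cover (c r); have [b2 hb2] := fdom_cover o (c r).
have [e [e0 H] _] := geodesic_in_patch hg hr dj hb2.
have [d /andP[d0 de] Z] := geodesic_zero (rgam_clifford D) e0 (fun s hs => let: And4 _ _ _ p := H s hs in p).
exists d; first exact: d0.
  move=> y z hy hz oy oz Py.
have [_ dy by' gy] := H y (lt_le_trans hy de).
have phi0 : \near y, (0 : 'cV[R]_(spdim n + spdim n)) = ts_phi (PS b2 j) ((chart j \o c) y).
  near=> w; have [_ dw bw _] : [/\ {for w, continuous c}, dom j (c w), fdom b2 (c w) &
      geodesic_pair (PS b2 j) (chart j \o c) (derive1 (chart j \o c)) w].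
    near: w; apply: (near_radius hy) => w hw; exact: (H w (lt_le_trans hw de)).
  apply: esym; apply/(zero_setP dw bw); near: w; exact: Py.
have py : ts_phi (PS b2 j) ((chart j \o c) y) = 0 by rewrite -(nbhs_singleton phi0).
have by0 : cl gamc (vel (PS b2 j) (chart j \o c) (derive1 (chart j \o c)) y) *m ts_chi (PS b2 j) ((chart j \o c) y) = 0.
  have [dom1 dx _] := gy; have d1 := ts_curve_phi dom1 dx.
  have := is_derive_ext phi0 (is_derive_cst (0 : 'cV[R]_(spdim n + spdim n)) y 1).
  move=> d2; have := @derive_val _ _ _ _ _ _ _ d1; rewrite (@derive_val _ _ _ _ _ _ _ d2) py mulmx0 subr0.
  by move=> <-.
apply: (near_radius hz) => w hw; have [_ _ _ Z4] := Z y w hy hw.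
have [_ dw bw _] := H w (lt_le_trans hw de).
by apply/(zero_setP dw bw); exact: (Z4 py by0).1.
Unshelve. all: by end_near.
Qed.

End GeodesicsOnManifold.

(** * Maximal geodesics *)

Section MaximalGeodesics.
Context {R : realType} {n : nat} {M : smooth_manifold R n}.
Context {g : lorentz_metric M} {o : orientation g} {D : spinor_module R n}.
Context {S : spin_structure o D}.
Variable phi : spinor_field S.
Hypothesis n3 : (3 <= n)%N.
Hypothesis tw : conformal_killing phi.
Notation gamc := (rgam D).
Notation PS := (patch_system n3 tw).
Notation velocity c i t := (derive1 (chart i \o c) t).
Implicit Types (b : frame_idx o) (i j : chart_idx M) (c : R -> M).

Lemma oitv_norm (T t : R) : oitv (- T)%:E T%:E t <-> `|t| < T.
Proof. by rewrite /oitv /= !lte_fin ltr_norml. Qed.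

Lemma geodesic_at_eq c c' t (e : R) : 0 < e -> (forall s, `|s - t| < e -> c' s = c s) ->
  geodesic_at n3 tw c t -> geodesic_at n3 tw c' t.
Proof.
move=> e0 he [b [i [v [eps [eps0 H]]]]]; exists b, i, v, (Num.min eps e).
split; first by rewrite lt_min eps0.
move=> s; rewrite lt_min => /andP[/H[h1 h2 h3 [d1 d2 d3]] hs].
have ne : \near s, c s = c' s by apply: (near_radius hs) => r /he.
have es := he s hs; split.
- have h : c @ s --> c' s by rewrite es.
  exact: (cvg_trans (near_eq_cvg ne) h).
- by rewrite es.
- by rewrite es.
have nx : \near s, (chart i \o c) s = (chart i \o c') s by apply: filterS ne => r /= ->.
by split; rewrite /= ?es //; exact: is_derive_ext nx d2.
Qed.

Lemma geodesic_of_pair b i (x v : R -> 'rV[R]_n) (T : R) :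
  (forall t, `|t| < T -> geodesic_pair (PS b i) x v t) ->
  geodesic g (- T)%:E T%:E (param i \o x) /\
  forall t, `|t| < T -> velocity (param i \o x) i t = v t.
Proof.
move=> H.
have loc t : `|t| < T -> [/\ dom i (param i (x t)), fdom b (param i (x t)) & chart i (param i (x t)) = x t].
  by move=> /H[dx _ _]; exact: (chart_image_param dx).
have rad t : `|t| < T -> forall s : R, `|s - t| < T - `|t| -> `|s| < T.
  move=> ht s hs; rewrite -(subrK t s); apply: le_lt_trans (ler_normD _ _) _.
  by rewrite -ltrBrDr.
have ext t : `|t| < T -> \near t, x t = (chart i \o (param i \o x)) t.
  move=> ht; apply: (@near_radius _ t (T - `|t|)); first by rewrite subrr normr0 subr_gt0.
  by move=> s /(rad t ht)/loc[_ _ e]; rewrite /= e.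
split; last by move=> t ht; have [_ d _] := H t ht; exact: is_derive_derive1 (is_derive_ext (ext t ht) d).
apply: (@geodesic_of_local _ _ _ _ _ _ _ phi n3 tw) => t /oitv_norm ht.
exists b, i, v, (T - `|t|); split; first by rewrite subr_gt0.
move=> s /(rad t ht) hs; have [d1 d2 d3] := H s hs; have [l1 l2 l3] := loc s hs; split=> //.
- have cx := is_derive_mx_continuous d2.
  have cc : (chart i @` dom i) (x s) by exists (param i (x s)).
  exact: (continuous_comp cx (param_continuous cc)).
- by split; rewrite /= ?l3//; exact: is_derive_ext (ext s hs) d2.
Qed.

(** All geodesics with the given initial point and velocity agree on common intervals, so their
    union is a geodesic and contains each of them. *)
Lemma geodesic_maximal (a0 b0 : \bar R) c0 i : (a0 < 0 < b0)%E -> geodesic g a0 b0 c0 -> dom i (c0 0) ->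
  exists (a b : \bar R) c, [/\ (a < 0 < b)%E, geodesic g a b c, c 0 = c0 0, velocity c i 0 = velocity c0 i 0 &
    forall (a' b' : \bar R) c', (a' < 0 < b')%E -> geodesic g a' b' c' -> c' 0 = c0 0 ->
      velocity c' i 0 = velocity c0 i 0 ->
      [/\ (a <= a')%E, (b' <= b)%E & forall t, oitv a' b' t -> c' t = c t] ].
Proof.
move=> ab0 hg0 di.
pose G (z : \bar R * \bar R * (R -> M)) := [/\ (z.1.1 < 0 < z.1.2)%E, geodesic g z.1.1 z.1.2 z.2,
  z.2 0 = c0 0 & velocity z.2 i 0 = velocity c0 i 0].
have G0 : G (a0, b0, c0) by [].
have compat z z' t : G z -> G z' -> oitv z.1.1 z.1.2 t -> oitv z'.1.1 z'.1.2 t -> z.2 t = z'.2 t.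
  move=> [/andP[za zb] zg z0 zv] [/andP[za' zb'] zg' z0' zv'] ht ht'.
  apply: (@geodesic_unique _ _ _ _ _ _ _ phi n3 tw (maxe z.1.1 z'.1.1) (mine z.1.2 z'.1.2) _ _ _ _ _ _ 0 t i zg zg').
  - move=> s; rewrite /oitv /= gt_max lt_min => /andP[/andP[h1 h2] /andP[h3 h4]].
    by rewrite h1 h2 h3 h4.
  - by rewrite /oitv /= gt_max lt_min za za' zb zb'.
  - by move: ht ht'; rewrite /oitv /= gt_max lt_min => /andP[-> ->] /andP[-> ->].
  - by rewrite z0.
  - by rewrite z0 z0'.
  - by rewrite zv zv'.
pose a := ereal_inf [set z.1.1 | z in G]; pose b := ereal_sup [set z.1.2 | z in G].
have aG z : G z -> (a <= z.1.1)%E by move=> Gz; apply: ereal_inf_lbound; exists z.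
have bG z : G z -> (z.1.2 <= b)%E by move=> Gz; apply: ereal_sup_ubound; exists z.
have cover t : oitv a b t -> exists2 z, G z & oitv z.1.1 z.1.2 t.
  move=> /andP[hat htb]; case: (leP 0 t) => t0.
    have [_ [z Gz <-] hz] := ereal_sup_gt htb; exists z => //.
    have [/andP[za _] _ _ _] := Gz; rewrite /oitv /= hz andbT.
    by apply: lt_le_trans za _; rewrite lee_fin.
  have [_ [z Gz <-] hz] := ereal_inf_lt hat; exists z => //.
  have [/andP[_ zb] _ _ _] := Gz; rewrite /oitv /= hz /=.
  by apply: lt_trans zb; rewrite lte_fin.
(* The value at time t of any member of [G] defined there; [c0 0] is the default outside their
   intervals. *)
pose c t := xget (c0 0) [set q | exists z, [/\ G z, oitv z.1.1 z.1.2 t & q = z.2 t] ].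
have cE z t : G z -> oitv z.1.1 z.1.2 t -> z.2 t = c t.
  move=> Gz ht; have ex : [set q | exists z, [/\ G z, oitv z.1.1 z.1.2 t & q = z.2 t] ] (z.2 t) by exists z.
  have [z' [Gz' ht' e']] := xgetPex (c0 0) (ex_intro _ _ ex).
  by rewrite [RHS]e'; exact: compat.
have O0 z : G z -> oitv z.1.1 z.1.2 0 by case.
have nearE z t : G z -> oitv z.1.1 z.1.2 t -> exists2 e : R, 0 < e & forall s, `|s - t| < e -> c s = z.2 s.
  move=> Gz /oitv_radius[e e0 He]; exists e => // s /He hs; exact: esym (cE z s Gz hs).
exists a, b, c; split.
- case/andP: ab0 => h1 h2; apply/andP; split.
    exact: le_lt_trans (aG _ G0) h1.
  exact: lt_le_trans h2 (bG _ G0).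
- apply: (@geodesic_of_local _ _ _ _ _ _ _ phi n3 tw) => t /cover[z Gz ht].
  have [e e0 he] := nearE z t Gz ht; have [_ zg _ _] := Gz.
  exact: (geodesic_at_eq e0 he (geodesic_local n3 tw zg ht)).
- by rewrite -(cE _ 0 G0).
- have [e e0 he] := nearE _ 0 G0 (O0 _ G0); rewrite !derive1E; apply: near_eq_derive.
  apply: (@near_radius _ 0 e); first by rewrite subrr normr0.
  by move=> s /he /= ->.
move=> a' b' c' ab' hg' c'0 v'0.
have G' : G (a', b', c') by [].
split; [exact: (aG _ G')|exact: (bG _ G')|].
by move=> t ht; exact: (cE _ t G' ht).
Qed.

Lemma maximal_null_geodesic_exists (a0 b0 : \bar R) c0 i : (a0 < 0 < b0)%E -> geodesic g a0 b0 c0 ->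
  dom i (c0 0) -> velocity c0 i 0 != 0 -> ip g i (c0 0) (velocity c0 i 0) (velocity c0 i 0) = 0 ->
  exists (a b : \bar R) c, [/\ maximal_null_geodesic g a b c, c 0 = c0 0 &
    forall (a' b' : \bar R) c', (a' < 0 < b')%E -> geodesic g a' b' c' -> c' 0 = c0 0 ->
      velocity c' i 0 = velocity c0 i 0 ->
      forall t, oitv a' b' t -> oitv a b t /\ c' t = c t].
Proof.
move=> ab0 hg0 di nz nul.
have [a [b [c [ab hg c0E vE mx]]]] := geodesic_maximal ab0 hg0 di.
have ng : null_geodesic g a b c.
  apply: (null_geodesic_of n3 tw hg ab); exists i.
  by rewrite c0E vE.
exists a, b, c; split; [|exact: c0E|].
  split; [exact: ab|exact: ng|].
  move=> a' b' c' ha hb hg' e'.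
  have ab' : (a' < 0 < b')%E.
    by case/andP: ab => h1 h2; rewrite (le_lt_trans ha h1) (lt_le_trans h2 hb).
  have c'0 : c' 0 = c0 0 by rewrite e'.
  have v' : velocity c' i 0 = velocity c0 i 0.
    rewrite -vE !derive1E; apply: near_eq_derive.
    have [e e0 he] := oitv_radius (ab : oitv a b 0).
    apply: (@near_radius _ 0 e); first by rewrite subrr normr0.
    by move=> s /he hs /=; rewrite e'.
  have [h1 h2 _] := mx a' b' c' ab' hg' c'0 v'.
  by split; apply/eqP; rewrite eq_le ?ha ?hb ?h1 ?h2.
move=> a' b' c' ab' hg' e' v' t ht; have [h1 h2 h3] := mx a' b' c' ab' hg' e' v'.
split; last exact: h3.
by case/andP: ht => t1 t2; rewrite /oitv /= (le_lt_trans h1 t1) (lt_le_trans t2 h2).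
Qed.

End MaximalGeodesics.

(** * Zeros of twistor spinors *)

(** For each set of a countable basis whose trace on [Z] fits into a set with property [Q], one such
    set is chosen. *)
Lemma countable_cover (T : topologicalType) (Z : set T) (Q : set T -> Prop) :
  @second_countable T ->
  (forall p, Z p -> exists A U, [/\ Q A, nbhs p U & Z `&` U `<=` A]) ->
  exists F : set (set T), [/\ countable F, forall A, F A -> Q A & Z `<=` \bigcup_(A in F) A].
Proof.
move=> [B cB [_ Bb]] H.
pose good (b : set T) := [set A | Q A /\ Z `&` b `<=` A].
pose f b := xget classical_sets.set0 (good b).
pose B' := [set b | B b /\ exists A, good b A].
exists [set f b | b in B']; split.
- apply: sub_countable (card_image_le _ _) _; apply: sub_countable cB.
  by apply: subset_card_le => b [].
- by move=> _ [b [_ ex] <-]; have [h _] := xgetPex classical_sets.set0 ex.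
move=> p Zp; have [A [U [QA hU sub]]] := H p Zp.
have [b [Bb' bp] bU] := Bb p U hU.
have ex : exists A, good b A.
  by exists A; split=> // q [Zq bq]; apply: sub; split=> //; exact: bU.
exists (f b); first by exists b.
by have [_ h] := xgetPex classical_sets.set0 ex; apply: h.
Qed.

Section TwistorSpinorZeros.
Context {R : realType} {n : nat} {M : smooth_manifold R n}.
Context {g : lorentz_metric M} {o : orientation g} {D : spinor_module R n}.
Context {S : spin_structure o D}.
Variable phi : spinor_field S.
Variable V : tangent_field M.
Hypothesis n3 : (3 <= n)%N.
Hypothesis M_connected : connected [set: M].
Hypothesis tw : conformal_killing phi.
Hypothesis hV : is_dirac_current phi V.
Notation gamc := (rgam D).
Notation PS := (patch_system n3 tw).
Notation velocity c i t := (derive1 (chart i \o c) t).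
Notation current_sq := (current_sq gamc (rform D)).
Notation planar := (planar (tgam gamc) tinv (tform (rform D))).
Implicit Types (b : frame_idx o) (i j : chart_idx M) (c : R -> M).
Let cc := rgam_clifford D.
Let Hs := @rform_sym _ _ D.
Let Hc := rform_gam D n3.
Let Hp := rform_pos D.

Lemma null_atP b i p : dom i p -> fdom b p ->
  null_at g V p <-> current_sq (lphi phi b i (chart i p)) = 0.
Proof.
move=> di hb; rewrite -(current_sq_lphi hV di hb); split=> [/(_ i di)//|h j dj].
by rewrite (ip_change _ _ dj di) -(tcomp_compat V dj di).
Qed.

Definition chart_ball b i (x : 'rV[R]_n) (r : R) : set M :=
  [set q | [/\ dom i q, fdom b q & `|chart i q - x| < r] ].

Lemma chart_ball_nbhs b i x r p : chart_ball b i x r p -> nbhs p (chart_ball b i x r).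
Proof.
move=> [di hb hr]; have h1 : nbhs p (fdom b) by exact: (open_nbhs_nbhs (conj (fdom_open b) hb)).
have h2 : nbhs (chart i p) [set y | `|y - x| < r].
  apply/nbhs_ballP; exists (r - `|chart i p - x|); first by rewrite /= subr_gt0.
  move=> y; rewrite -ball_normE/= distrC => hy.
  rewrite -(subrK (chart i p) y) -addrA; apply: le_lt_trans (ler_normD _ _) _.
  by rewrite -ltrBrDr.
by apply: filterS2 h1 (chart_nbhs di h2) => q hq [dq xq].
Qed.

Lemma chart_ball_center b i p r : dom i p -> fdom b p -> 0 < r -> chart_ball b i (chart i p) r p.
Proof. by move=> di hb r0; split=> //; rewrite subrr normr0. Qed.

(** All derivatives of phi vanish at p, so the twistor equation gives v.chi = 0 for every v, and a
    non-null v can be cancelled. *)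
Lemma locally_zero_chi b i p : dom i p -> fdom b p -> nbhs p (zero_set phi) ->
  lphi phi b i (chart i p) = 0 /\ lchi phi b i (chart i p) = 0.
Proof.
move=> di hb hz; have Px := patch_chart di hb.
have p0 : lphi phi b i (chart i p) = 0 by apply/zero_setP => //; exact: nbhs_singleton hz.
split=> //; have [y [_ yy]] := spacelike_orthogonal n3 (0 : 'rV[R]_n).
apply: (cl_inj_spacelike cc yy).
have near0 : \forall x \near chart i p, (fun=> 0 : 'cV[R]_(spdim n + spdim n)) x = lphi phi b i x.
  have h := param_nbhs di hz.
  have hP : nbhs (chart i p) (patch b i).
    exact: (open_nbhs_nbhs (conj (@patch_open _ _ _ _ o b i) Px)).
  apply: filterS2 h hP => x zx /chart_image_param[dx bx e].
  by have /(zero_setP _ dx bx) := zx; rewrite e.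
pose v := y *m lframe b i (chart i p).
have := lphi_derive tw v Px; rewrite -(near_eq_derive v near0) derive_cst p0 mulmx0 subr0 => h.
rewrite [RHS]h /v -mulmxA (frame_coframe (@lframe_orthonormal _ _ _ g o b i) Px) mulmx1.
by [].
Qed.

(** If chi vanished at p as well, phi would vanish near p. The property carried over the connected
    manifold is that phi vanishes on a neighbourhood: it does not refer to a patch, and by
    [locally_zero_chi] it brings back chi = 0 in any patch. *)
Lemma chi_neq0 b i p : (exists q, ~ zero_set phi q) -> zero_set phi p -> dom i p -> fdom b p ->
  lchi phi b i (chart i p) != 0.
Proof.
move=> [q nq] zp di hb; apply/eqP => chi0; apply: nq.
suff : nbhs q (zero_set phi) by exact: nbhs_singleton.
have seg b' j x : dom j x -> fdom b' x -> exists2 r : R, 0 < r & forall y z,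
    chart_ball b' j (chart j x) r y -> chart_ball b' j (chart j x) r z ->
    lphi phi b' j (chart j y) = 0 -> lchi phi b' j (chart j y) = 0 -> zero_set phi z.
  move=> dj hb'; have Px := patch_chart dj hb'.
  have [r r0 H] := @twistor_segment _ _ _ _ _ cc Hc (PS b' j) (chart j x) Px.
  exists r => // y z [dy by' hy] [dz bz hz] e1 e2.
  have [_ h _] := H _ _ (ltW hy) (ltW hz); have [e _] := h e1 e2.
  exact/(zero_setP _ dz bz).
have start : nbhs p (zero_set phi).
  have [r r0 H] := seg b i p di hb; have cp := chart_ball_center di hb r0.
  apply: filterS (chart_ball_nbhs cp) => z hz; apply: (H p z cp hz) => //.
  exact/(zero_setP _ di hb).
apply: (connected_locally_constant (P := fun x => nbhs x (zero_set phi)) M_connected _ I I start) => x _.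
have [j dj] := dom_cover x; have [b' hb'] := fdom_cover o x.
have [r r0 H] := seg b' j x dj hb'.
exists (chart_ball b' j (chart j x) r); first exact: chart_ball_nbhs (chart_ball_center dj hb' r0).
move=> y z _ _ hy hz ny; have [dy by' _] := hy.
have [e1 e2] := locally_zero_chi dy by' ny.
by apply: filterS (chart_ball_nbhs hz) => w hw; exact: (H y w hy hw e1 e2).
Qed.

(* The tractor invariant [planar] is parallel, so one zero with null chi makes
   the Dirac current null on all of M. *)
Lemma null_everywhere b i p q : zero_set phi p -> dom i p -> fdom b p ->
  current_sq (lchi phi b i (chart i p)) = 0 -> null_at g V q.
Proof.
move=> zp di hb chi0.
pose P q := forall b j, dom j q -> fdom b q -> forall A,
  planar A (col_mx (lphi phi b j (chart j q)) (lchi phi b j (chart j q))) = 0.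
have change q' b' j : dom j q' -> fdom b' q' -> (forall A,
    planar A (col_mx (lphi phi b' j (chart j q')) (lchi phi b' j (chart j q'))) = 0) -> P q'.
  move=> dj hb' h b2 k dk hb2 A.
  have O : overlap b2 b' k j (chart k q') by exists q'.
  by apply: (planar_change n3 tw O); rewrite /= chartK.
have start : P p.
  apply: (change p b i di hb); rewrite ((zero_setP phi di hb).1 zp).
  exact: (planar_at_zero cc Hs Hc Hp n3 chi0).
have Pq : P q.
  apply: (connected_locally_constant M_connected _ _ _ start) => // x _.
  have [j dj] := dom_cover x; have [b' hb'] := fdom_cover o x.
  have Px := patch_chart dj hb'.
  have [r r0 H] := @twistor_segment _ _ _ _ _ cc Hc (PS b' j) (chart j x) Px.
  exists (chart_ball b' j (chart j x) r); first exact: chart_ball_nbhs (chart_ball_center dj hb' r0).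
  move=> y z _ _ [dy by' hy] [dz bz hz] Py; apply: (change z b' j dz bz).
  by have [_ _ h] := H _ _ (ltW hy) (ltW hz); apply: h; exact: Py.
have [j dj] := dom_cover q; have [b' hb'] := fdom_cover o q.
by apply/(null_atP dj hb'); exact: (planar_null (Pq b' j dj hb' _)).
Qed.

Lemma ts_th_unit b i p (u : 'rV[R]_n) : dom i p -> fdom b p ->
  u *m ts_th (PS b i) (chart i p) *m lframe b i (chart i p) = u.
Proof.
move=> di hb; have := @ts_inv _ _ _ _ (PS b i) (chart i p) (patch_chart di hb) => e.
by rewrite -mulmxA e mulmx1.
Qed.

Lemma chr_dirZ (G E : 'rV[R]_n -> 'M[R]_n) x (a : R) (u : 'rV[R]_n) :
  chr_dir G E x (a *: u) = a *: chr_dir G E x u.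
Proof.
by rewrite /chr_dir scaler_sumr; apply: eq_bigr => k _; rewrite mxE scalerA.
Qed.

Lemma geodesic_pair_scale b i (x v : R -> 'rV[R]_n) (a t : R) :
  geodesic_pair (PS b i) x v (a * t) ->
  geodesic_pair (PS b i) (fun s => x (a * s)) (fun s => a *: v (a * s)) t.
Proof.
case=> d1 d2 d3.
have lin (f : R -> 'rV[R]_n) df : is_derive (a * t) (1 : R) f df ->
    is_derive t (1 : R) (fun s => f (a * s)) (a *: df).
  move=> h; have e : 0 + t *: (a : R) = a * t by rewrite add0r mulrC.
  have h' : is_derive (0 + t *: (a : R)) (a : R) f (a *: df) by rewrite e; exact: is_derive_any.
  rewrite (_ : (fun s => f (a * s)) = fun s : R => f (0 + s *: a)); first exact: is_derive_line h'.
  by apply/funext => s; rewrite add0r mulrC.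
split=> //; first exact: lin.
apply: (is_derive_eq (is_derive_scalef a (lin _ _ d3))).
have -> : ts_ch (PS b i) (x (a * t)) (a *: v (a * t)) = a *: ts_ch (PS b i) (x (a * t)) (v (a * t)).
  exact: chr_dirZ.
move: (ts_ch _ _ _) => C; rewrite -scalemxAl -[in RHS]scalemxAr !scalerN; reflexivity.
Qed.

Lemma constant_geodesic b i p (a' b' : \bar R) c : dom i p -> fdom b p -> (a' < 0 < b')%E ->
  geodesic g a' b' c -> c 0 = p -> velocity c i 0 = 0 -> forall t, oitv a' b' t -> c t = p.
Proof.
move=> di hb ab hg c0 v0 t ht; have Px := patch_chart di hb.
pose T := `|t| + 1; have T0 : 0 < T by rewrite ltr_wpDl.
have [gc vc] : geodesic g (- T)%:E T%:E (param i \o cst (chart i p)) /\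
    forall s : R, `|s| < T -> velocity (param i \o cst (chart i p)) i s = 0.
  apply: (@geodesic_of_pair _ _ _ _ _ _ _ phi n3 tw b i (cst (chart i p)) (cst 0)) => s _; split=> //.
    exact: is_derive_cst.
  by apply: (is_derive_eq (is_derive_cst _ _ _)); rewrite mul0mx oppr0.
have e : (param i \o cst (chart i p)) t = p by rewrite /= chartK.
rewrite -[RHS]e.
apply: (@geodesic_unique _ _ _ _ _ _ _ phi n3 tw (maxe a' (- T)%:E) (mine b' T%:E) _ _ _ _ _ _ 0 t i hg gc).
- move=> s; rewrite /oitv /= gt_max lt_min => /andP[/andP[h1 h2] /andP[h3 h4]].
  by rewrite h1 h2 h3 h4.
- by case/andP: ab => h1 h2; rewrite /oitv /= gt_max lt_min h1 h2 !lte_fin T0 oppr_lt0 T0.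
- case/andP: ht => h1 h2; rewrite /oitv /= gt_max lt_min h1 h2 /=.
  by have : oitv (- T)%:E T%:E t by apply/oitv_norm; rewrite ltrDl.
- by rewrite c0.
- by rewrite c0 /= chartK.
- by rewrite v0 vc// normr0.
Qed.

(* The last clauses compare the spinor along [c u] with its first-order
   expansion, t times the Clifford product of u with chi at the zero. *)
Lemma geodesics_from_zero b i p : zero_set phi p -> dom i p -> fdom b p ->
  exists (c : 'rV[R]_n -> R -> M) (T rho : R), [/\ 0 < T, 0 < rho,
    forall u, `|u| <= rho -> [/\ geodesic g (- T)%:E T%:E (c u), c u 0 = p, velocity (c u) i 0 = u &
      forall t : R, `|t| < T -> forall a : R, a != 0 ->
       exists c', [/\ geodesic g (- (`|a|^-1 * T))%:E (`|a|^-1 * T)%:E c', c' 0 = p,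
          velocity c' i 0 = a *: u & c' (a^-1 * t) = c u t] ],
    exists t U, [/\ 0 < `|t| < T, nbhs p U & forall q, U q -> [/\ dom i q, fdom b q &
       exists2 u, `|u| <= rho & c u t = q] ] &
    forall u t, `|u| <= rho -> 0 < `|t| < T ->
      [/\ zero_set phi (c u t) -> cl gamc (u *m ts_th (PS b i) (chart i p)) *m lchi phi b i (chart i p) = 0,
          cl gamc (u *m ts_th (PS b i) (chart i p)) *m lchi phi b i (chart i p) = 0 -> zero_set phi (c u t) &
          current_sq (lchi phi b i (chart i p)) < 0 -> null_at g V (c u t) ->
          mink (u *m ts_th (PS b i) (chart i p)) (u *m ts_th (PS b i) (chart i p)) = 0] ].
Proof.
move=> zp di hb; have Px := patch_chart di hb.
have z0 : ts_phi (PS b i) (chart i p) = 0 by apply/(zero_setP phi di hb).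
have [x [v [T [rho [T0 rho0 fam shoot est]]]]] := @geodesics_near_zero _ _ _ _ _ cc Hs Hc (PS b i) (chart i p) Px z0.
have in_dom u t : `|u| <= rho -> `|t| < T ->
    [/\ dom i (param i (x u t)), fdom b (param i (x u t)) & chart i (param i (x u t)) = x u t].
  move=> hu ht; have [_ _ H] := fam u hu; have [dx _ _] := H t ht; exact: (chart_image_param dx).
exists (fun u => param i \o x u), T, rho; split=> //.
- move=> u hu; have [x0 v0 H] := fam u hu; have [hg hv] := geodesic_of_pair H.
  split=> //; first by rewrite /= x0 chartK.
    by rewrite hv ?normr0// v0.
  (* The geodesic is reparametrised by s -> a s; later this identifies geodesics whose initial
     velocities are proportional. *)
  move=> t ht a a0; have a0' : 0 < `|a| by rewrite normr_gt0.
  have H' s : `|s| < `|a|^-1 * T -> geodesic_pair (PS b i) (fun s => x u (a * s)) (fun s => a *: v u (a * s)) s.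
    move=> hs; apply: geodesic_pair_scale; apply: H.
    by rewrite normrM mulrC -ltr_pdivlMr// mulrC.
  have [hg' hv'] := geodesic_of_pair H'.
  exists (param i \o (fun s => x u (a * s))); split=> //.
  + by rewrite /= mulr0 x0 chartK.
  + by rewrite hv' ?normr0 ?mulr_gt0 ?invr_gt0// mulr0 v0.
  + by rewrite /= mulrA mulfV// mul1r.
- have T2 : 0 < T / 2 < T by rewrite divr_gt0//= ltr_pdivrMr// mulr_natr mulr2n ltrDl.
  have [d d0 Hd] := shoot (T / 2) T2.
  exists (T / 2), (chart_ball b i (chart i p) d); split.
  + by rewrite gtr0_norm//; case/andP: T2.
  + exact: chart_ball_nbhs (chart_ball_center di hb d0).
  move=> q [dq bq hq]; split=> //; have [u hu e] := Hd _ (ltW hq).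
  by exists u => //=; rewrite e chartK.
move=> u t hu ht; have [e1 e2 e3] := est u t hu ht.
have /andP[_ ht2] := ht; have [dq bq eq] := in_dom u t hu ht2.
have zq : zero_set phi (param i (x u t)) <-> lphi phi b i (x u t) = 0.
  by rewrite -{2}eq; exact: zero_setP.
split.
- by move/zq; exact: e1.
- by move=> h; apply/zq; exact: e2.
- by move=> neg nul; apply: e3 => //; have := (null_atP dq bq).1 nul; rewrite eq.
Qed.

Lemma zero_null p : zero_set phi p -> null_at g V p.
Proof.
move=> zp; have [i di] := dom_cover p; have [b hb] := fdom_cover o p.
apply/(null_atP di hb); rewrite ((zero_setP phi di hb).1 zp).
by rewrite -[0](scale0r 0) current_sqZ ?expr0n ?mul0r.
Qed.

Lemma small_multiple (rho : R) (w : 'rV[R]_n) : 0 < rho -> exists2 e : R, e != 0 & `|e *: w| <= rho.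
Proof.
move=> r0; have w1 : 0 < `|w| + 1 by rewrite ltr_wpDl.
exists (rho / (`|w| + 1)); first by rewrite gt_eqF// divr_gt0.
rewrite normrZ gtr0_norm ?divr_gt0// mulrAC ler_pdivrMr// ler_wpM2l ?lerDl//.
exact: ltW.
Qed.

Lemma th_neq0 b i p (u : 'rV[R]_n) : dom i p -> fdom b p -> u != 0 ->
  u *m ts_th (PS b i) (chart i p) != 0.
Proof. by move=> di hb; apply: contra_neq => h; rewrite -(ts_th_unit u di hb) h mul0mx. Qed.

(** * The timelike case *)

Section Timelike.
Hypothesis V_timelike : exists q, timelike_at g V q.

Let sing q : sing_set phi V q <-> null_at g V q.
Proof. by rewrite /sing_set asboolT. Qed.

Let chi_timelike b i p : zero_set phi p -> dom i p -> fdom b p ->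
  current_sq (lchi phi b i (chart i p)) < 0.
Proof.
move=> zp di hb; rewrite lt_neqAle (current_sq_le0 cc Hc Hp n3) andbT.
apply/eqP => chi0; have [q tq] := V_timelike; have [j dj] := dom_cover q.
have := tq j dj; rewrite (null_everywhere zp di hb chi0 dj); rewrite ltxx.
by [].
Qed.

Lemma null_cone_singular p : zero_set phi p -> null_cone g p `<=` sing_set phi V.
Proof.
move=> zp q [->|[a [b [c [ab ng c0 [t ht <-]]]]]]; apply/sing; first exact: zero_null.
have [i di] := dom_cover (c t); have [b' hb] := fdom_cover o (c t).
apply/(null_atP di hb); apply: (null_geodesic_singular n3 tw ng ab _ ht di hb).
by rewrite c0.
Qed.

(** Every point of [U] is reached from p at the same time t by a geodesic of the family. At a zero
    the initial velocity annihilates chi(p), hence is 0; at a singular point it is null. *)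
Lemma timelike_local p : zero_set phi p -> exists2 U : set M, nbhs p U &
  (zero_set phi `&` U = [set p]) /\ (sing_set phi V `&` U = U `&` null_cone g p).
Proof.
move=> zp; have [i di] := dom_cover p; have [b hb] := fdom_cover o p.
have chi_neg := chi_timelike zp di hb.
have [c [T [rho [T0 rho0 fam [t [U [ht hU shoot]]] est]]]] := geodesics_from_zero zp di hb.
have tT : `|t| < T by case/andP: ht.
have const u : `|u| <= rho -> u = 0 -> c u t = p.
  move=> hu u0; have [gu cu vu _] := fam u hu.
  apply: (constant_geodesic di hb _ gu cu); [|by rewrite vu|exact/oitv_norm].
  by rewrite !lte_fin oppr_lt0 T0.
exists U => //; split.
- apply/seteqP; split=> q.
    case=> zq /shoot[dq bq [u hu e]]; rewrite -e in zq *; have [e1 _ _] := est u t hu ht.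
    case: (eqVneq u 0) => [u0|u0]; first by rewrite /= const.
    have lc0 : lchi phi b i (chart i p) != 0.
      by apply/eqP => h; move: chi_neg; rewrite h -[0](scale0r 0) current_sqZ ?expr0n ?mul0r ?ltxx.
    have [_ h _] := annihilator cc Hs Hc Hp n3 (e1 zq) (th_neq0 di hb u0) lc0.
    by rewrite h ltxx in chi_neg.
  by move=> ->; split=> //; exact: nbhs_singleton hU.
apply/seteqP; split=> q; last by move=> [Uq nq]; split=> //; exact: (null_cone_singular zp).
move=> [/sing nq Uq]; split=> //; have [dq bq [u hu e]] := shoot q Uq.
case: (eqVneq u 0) => [u0|u0]; first by left; rewrite -e const.
have [gu cu vu _] := fam u hu; have [_ _ e3] := est u t hu ht.
rewrite -e in nq; right; exists (- T)%:E, T%:E, (c u).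
have ab : (- T%:E < 0 < T%:E)%E by rewrite !lte_fin oppr_lt0 T0.
split=> //; last by exists t => //; apply/oitv_norm.
apply: (null_geodesic_of n3 tw gu (ab : oitv _ _ 0)); exists i; rewrite cu vu; split=> //.
by rewrite (ip_mink _ _ di hb) (e3 chi_neg nq).
Qed.

Lemma zeros_countable : countable (zero_set phi).
Proof.
have [F [cF QF sub]] := @countable_cover M (zero_set phi) (fun A => countable A)
  (@manifold_second_countable R n M) (fun p zp => ltac:(
    have [U hU [e _]] := timelike_local zp; exists [set p], U; split;
    [exact: countable1|exact: hU|by rewrite e])).
apply: sub_countable (subset_card_le sub) _.
by apply: bigcup_countable.
Qed.

End Timelike.

(** * The null case *)

Section Null.
Hypothesis V_null : forall p, ~ zero_set phi p -> null_at g V p.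
Hypothesis nontrivial : exists p, ~ zero_set phi p.

Let all_null p : null_at g V p.
Proof. by have [/zero_null|/V_null] := pselect (zero_set phi p). Qed.

Lemma sing_zero : sing_set phi V = zero_set phi.
Proof.
rewrite /sing_set asboolF// => -[q tq]; have [j dj] := dom_cover q.
by have := tq j dj; rewrite (all_null dj) ltxx.
Qed.

Lemma null_local p : zero_set phi p -> exists (a b : \bar R) c (U : set M),
  [/\ maximal_null_geodesic g a b c, c 0 = p, nbhs p U,
   c @` oitv a b `<=` zero_set phi & zero_set phi `&` U `<=` c @` oitv a b].
Proof.
move=> zp; have [i di] := dom_cover p; have [b hb] := fdom_cover o p.
have chi0 := chi_neq0 nontrivial zp di hb.
have [c [T [rho [T0 rho0 fam [t [U [ht hU shoot]]] est]]]] := geodesics_from_zero zp di hb.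
have ab : (- T%:E < 0 < T%:E)%E by rewrite !lte_fin oppr_lt0 T0.
(* If the current of chi(p) were timelike, a geodesic in a non-null direction would reach points
   where the current of phi is not null. *)
have chi_null : current_sq (lchi phi b i (chart i p)) = 0.
  apply/eqP/negPn/negP => hn.
  have neg : current_sq (lchi phi b i (chart i p)) < 0 by rewrite lt_neqAle hn (current_sq_le0 cc Hc Hp n3).
  have [y [_ yy]] := spacelike_orthogonal n3 (0 : 'rV[R]_n).
  have [e e0 he] := small_multiple (y *m lframe b i (chart i p)) rho0.
  have [_ _ e3] := est _ t he ht; have := e3 neg (@all_null _).
  have -> : e *: (y *m lframe b i (chart i p)) *m ts_th (PS b i) (chart i p) = e *: y.
    rewrite -scalemxAl -mulmxA (frame_coframe (@lframe_orthonormal _ _ _ g o b i) (patch_chart di hb)).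
    by rewrite mulmx1.
  rewrite minkZl minkZr => /eqP; rewrite !mulf_eq0 (negPf e0) (negPf yy).
  by [].
pose w0 := current gamc (rform D) (lchi phi b i (chart i p)).
have w00 : w0 != 0 by exact: (current_neq0 Hp n3 chi0).
(* [w0] spans the kernel of u -> u.chi(p); it is rescaled to an initial velocity of the family. *)
have [e e0 he] := small_multiple (w0 *m lframe b i (chart i p)) rho0.
set w := e *: _ in he.
have wth : w *m ts_th (PS b i) (chart i p) = e *: w0.
  rewrite /w -scalemxAl -mulmxA (frame_coframe (@lframe_orthonormal _ _ _ g o b i) (patch_chart di hb)).
  by rewrite mulmx1.
have wn0 : w != 0.
  apply: contra_neq w00 => h; move: wth; rewrite h mul0mx => /esym/eqP.
  by rewrite scaler_eq0 (negPf e0) => /eqP.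
have [gw cw vw _] := fam w he.
have dcw : dom i (c w 0) by rewrite cw.
have wnul : ip g i (c w 0) (velocity (c w) i 0) (velocity (c w) i 0) = 0.
  rewrite vw cw (ip_mink _ _ di hb); rewrite -[X in mink X X]/(w *m ts_th (PS b i) (chart i p)) wth.
  by rewrite minkZl minkZr -[mink w0 w0]/(current_sq _) chi_null !mulr0.
have vn : velocity (c w) i 0 != 0 by rewrite vw.
have [a' [b' [m [mx m0 uni]]]] := maximal_null_geodesic_exists n3 tw ab gw dcw vn wnul.
have [ab' [gm _] _] := mx.
have zm : c w 0 = p by [].
exists a', b', m, U; split=> //; first by rewrite m0.
- move=> _ [s hs <-]; apply: (zero_along_geodesic n3 tw gm ab' _ hs).
  apply: (@near_radius _ 0 T); first by rewrite subrr normr0.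
  move=> r; rewrite subr0 => hr.
  have [_ <-] := uni _ _ _ ab gw erefl erefl r ((oitv_norm T r).2 hr).
  case: (eqVneq r 0) => [->|r0]; first by rewrite cw.
  have [_ e2 _] := est w r he (ltac:(by rewrite normr_gt0 r0)).
  have cz : cl gamc (e *: w0) = e *: cl gamc w0 by rewrite linearZ.
  apply: e2; rewrite wth cz -scalemxAl (current_annihilates cc Hc Hp n3 chi_null).
  by rewrite scaler0.
move=> q [zq /shoot[dq bq [u hu eq]]]; rewrite -eq in zq *.
have tT : `|t| < T by case/andP: ht.
case: (eqVneq u 0) => [u0|u0].
  exists 0 => //; rewrite m0 cw; have [gu cu vu _] := fam u hu; apply: esym.
  by apply: (constant_geodesic di hb ab gu cu); [rewrite vu|exact/oitv_norm].
have [e1 _ _] := est u t hu ht.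
have [_ _ [l ul]] := annihilator cc Hs Hc Hp n3 (e1 zq) (th_neq0 di hb u0) chi0.
have [gu cu vu scale] := fam u hu.
(* The initial velocity of any other zero near p is a multiple of [w], so that zero is the point of
   the maximal geodesic at time (l/e) t. *)
have uw : u = (l / e) *: w.
  rewrite -(ts_th_unit u di hb) ul -/w0 -(ts_th_unit w di hb) wth -!scalemxAl scalerA.
  by rewrite divfK.
have l0 : l / e != 0 by apply: contra_neq u0 => h; rewrite uw h scale0r.
have [c' [gc' c'0 vc' ec']] := scale t tT (l / e)^-1 (ltac:(by rewrite invr_eq0)).
rewrite invrK in ec'.
have lT : 0 < `|(l / e)^-1|^-1 * T by rewrite mulr_gt0// invr_gt0 normr_gt0 invr_eq0.
have vc'w : velocity c' i 0 = velocity (c w) i 0.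
  by rewrite vc' vw {1}uw scalerA mulVf// scale1r.
have abl : ((- (`|(l / e)^-1|^-1 * T))%:E < 0 < (`|(l / e)^-1|^-1 * T)%:E)%E.
  by rewrite !lte_fin oppr_lt0 lT.
have tl : oitv (- (`|(l / e)^-1|^-1 * T))%:E (`|(l / e)^-1|^-1 * T)%:E (l / e * t).
  by apply/oitv_norm; rewrite normrM normfV invrK ltr_pM2l// normr_gt0.
have c'w : c' 0 = c w 0 by rewrite c'0 cw.
have [in_ab mE] := uni _ _ c' abl gc' c'w vc'w _ tl.
by exists (l / e * t) => //; rewrite -mE ec'.
Qed.

End Null.
End TwistorSpinorZeros.

Theorem proposition2 (R : realType) (n : nat) (M : smooth_manifold R n)
    (g : lorentz_metric M) (o : orientation g) (D : spinor_module R n)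
    (S : spin_structure o D) (phi : spinor_field S) (V : tangent_field M) :
  (3 <= n)%N ->
  connected [set: M] ->
  conformal_killing phi ->
  (exists p, ~ zero_set phi p) ->
  zero_set phi !=set0 ->
  is_dirac_current phi V ->
  ((forall p, ~ zero_set phi p -> null_at g V p) ->
    sing_set phi V = zero_set phi /\
    (exists F : set (set M),
      [/\ countable F,
          forall A, F A -> exists a b c,
            maximal_null_geodesic g a b c /\ A = c @` oitv a b &
          zero_set phi = \bigcup_(A in F) A]) /\
    (forall p, zero_set phi p -> exists a b c (U : set M),
      [/\ maximal_null_geodesic g a b c, c 0 = p, nbhs p U &
          zero_set phi `&` U = (c @` oitv a b) `&` U]))
  /\
  ((exists p, timelike_at g V p) ->
    [/\ countable (zero_set phi),
        forall p, zero_set phi p -> exists2 U : set M, nbhs p U &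
          zero_set phi `&` U = [set p],
        forall p, zero_set phi p -> null_cone g p `<=` sing_set phi V &
        forall p, zero_set phi p -> exists2 U : set M, nbhs p U &
          sing_set phi V `&` U = U `&` null_cone g p]).
Proof.
move=> n3 conn tw nontrivial _ hV; split=> [V_null|V_timelike].
  split; first exact: (sing_zero hV V_null).
  have loc := null_local n3 conn tw hV V_null nontrivial.
  split; last first.
    move=> p zp; have [a [b [c [U [mx c0 hU sub sup]]]]] := loc p zp.
    exists a, b, c, U; split=> //; apply/seteqP; split=> q [hq Uq]; split=> //.
      exact: sup.
    exact: sub.
  (* Inclusion in the zero set is part of the required property, so that the cover becomes an
     equality. *)
  have [F [cF QF cov]] := @countable_cover M (zero_set phi)
    (fun A => A `<=` zero_set phi /\
      exists a b c, maximal_null_geodesic g a b c /\ A = c @` oitv a b)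
    (@manifold_second_countable R n M) (fun p zp =>
      let: ex_intro a (ex_intro b (ex_intro c (ex_intro U (And5 mx _ hU sub sup)))) := loc p zp in
      ex_intro _ (c @` oitv a b) (ex_intro _ U (And3
        (conj sub (ex_intro _ a (ex_intro _ b (ex_intro _ c (conj mx erefl))))) hU sup))).
  exists F; split=> //; first by move=> A /QF[].
  by apply/seteqP; split=> // q [A /QF[sub _] Aq]; exact: sub.
have loc := timelike_local n3 conn tw hV V_timelike.
split.
- exact: (zeros_countable n3 conn tw hV V_timelike).
- by move=> p /loc[U hU [e _]]; exists U.
- by move=> p zp; exact: (null_cone_singular n3 tw hV V_timelike zp).
- by move=> p /loc[U hU [_ e]]; exists U.
Qed.
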